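(* For $n\ge 1$ let $\mathsf{M}_n$ be a rooted planar map chosen uniformly at random among all rooted planar maps with $n$ edges, and let $X_n$ be the number of cut vertices of $\mathsf{M}_n$. Then \[ \frac{X_n}{n} \longrightarrow c \quad\text{in probability as } n\to\infty,\qquad c=\frac{5-\sqrt{17}}{4}\approx 0.2192, \] and moreover $\mathbb{E}\,X_n = c\,n + O(1)$.
   Context: A planar map is a connected planar graph, loops and multiple edges allowed, together with an embedding in the plane (considered up to orientation-preserving homeomorphism). A map is rooted if a vertex (root vertex) and an edge incident to it (root edge) are distinguished; all maps are rooted, and the size of a map is its number of edges. A vertex $v$ is a cut vertex if the edge set can be partitioned into two non-empty classes such that $v$ is the only vertex incident to edges of both classes. *)

(* Defs.v *)
From mathcomp Require Import all_boot all_fingroup.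
From Stdlib Require Import Reals.

Set Implicit Arguments.
Unset Strict Implicit.
Unset Printing Implicit Defensive.

(* A map with n edges has 2n darts (half-edges). *)
Definition dart (n : nat) := 'I_(2 * n).

(* A (labelled) rooted pre-map: (alpha, sigma, root dart).
   alpha : edge involution, sigma : rotation around vertices
   (counterclockwise cyclic order of darts at each vertex). *)
Definition premap (n : nat) := ({perm dart n} * {perm dart n} * dart n)%type.

Definition alpha n (m : premap n) : {perm dart n} := m.1.1.
Definition sigma n (m : premap n) : {perm dart n} := m.1.2.
Definition root  n (m : premap n) : dart n := m.2.

Definition vertices n (m : premap n) : {set {set dart n}} := porbits (sigma m).
Definition faces n (m : premap n) : {set {set dart n}} :=
  porbits (alpha m * sigma m)%g.

Definition map_connected n (m : premap n) : bool :=
  [forall x : dart n, forall y : dart n,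
     connect (fun u v : dart n => (v == alpha m u) || (v == sigma m u)) x y].

(* A rooted planar map with n edges: alpha is a fixed-point-free involution,
   the map is connected, and Euler's formula V - E + F = 2 holds (genus 0). *)
Definition is_rmap n (m : premap n) : bool :=
  [&& [forall x : dart n, alpha m (alpha m x) == x],
      [forall x : dart n, alpha m x != x],
      map_connected m &
      #|vertices m| + #|faces m| == n + 2].

Definition rmap_iso n (m m' : premap n) : bool :=
  [exists phi : {perm dart n},
     [&& [forall x, phi (alpha m x) == alpha m' (phi x)],
         [forall x, phi (sigma m x) == sigma m' (phi x)] &
         phi (root m) == root m']].

Definition rmaps n : {set premap n} := [set m | is_rmap m].

Definition rmap_classes n : {set {set premap n}} :=
  [set [set m' in rmaps n | rmap_iso m m'] | m in rmaps n].

(* An edge-class of darts: a set of darts closed under alpha (a union of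
   edges).  Edge e is incident to vertex w iff some dart of e lies in w. *)
Definition edge_closed n (m : premap n) (A : {set dart n}) : bool :=
  [forall x : dart n, (x \in A) == (alpha m x \in A)].

Definition meets_both n (w A : {set dart n}) : bool :=
  [exists x in w, x \in A] && [exists x in w, x \notin A].

Definition cut_vertex n (m : premap n) (v : {set dart n}) : bool :=
  [exists A : {set dart n},
     [&& edge_closed m A, A != set0, ~: A != set0, meets_both v A &
         [forall w in vertices m, (w != v) ==> ~~ meets_both w A]]].

Definition num_cut_vertices n (m : premap n) : nat :=
  #|[set v in vertices m | cut_vertex m v]|.

(* number of cut vertices of a rooted map (isomorphism class), computed on
   any representative (it is an isomorphism invariant). *)
Definition cls_cut_vertices n (C : {set premap n}) : nat :=
  match [pick m in C] with Some m => num_cut_vertices m | None => 0 end.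

Open Scope R_scope.

Definition prob_dev (n : nat) (c eps : R) : R :=
  INR #|[set C in rmap_classes n |
          Rgt_dec (Rabs (INR (cls_cut_vertices C) / INR n - c)) eps]|
  / INR #|rmap_classes n|.

Definition expect_cut (n : nat) : R :=
  INR (\sum_(C in rmap_classes n) cls_cut_vertices C) / INR #|rmap_classes n|.

Close Scope R_scope.

(* Main.v *)
From HB Require Import structures.
From mathcomp Require Import all_boot all_fingroup zify.
Require Import Defs.
Set Implicit Arguments.
Unset Strict Implicit.
Unset Printing Implicit Defensive.

(* Tutte's root-edge decomposition is turned into a bijection between isomorphism classes of
   rooted planar maps with n edges and trees of type [code]. The code determines the degree of
   the root vertex, the cyclic word [lab] recording which corners of the root vertex are joined
   by the rest of the map, and the number [xo] of cut vertices other than the root vertex.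

   The word is noncrossing, so a block of the root vertex whose darts all precede a given corner
   is contiguous and can be detached. This yields a linear equation for the generating function
   of the corners at which the next contraction creates no cut vertex. The kernel method then
   solves the equations: with z = x (1 - x) / 3, the generating function of the total of [xo]
   is 1 / (1 - x) - M - T, where T is an algebraic function of x with nonnegative coefficients,
   and the coefficients of x ^ j in z are ballot numbers. The singularity is at x = 1 / 2, where
   T' = 2 (sqrt 17 - 3), and this gives the mean up to O(1).

   For the concentration, the sum of the deviations [xo c - c n] over the maps of fixed root
   degree is o(n) times the number of maps, by induction along Tutte's recursion; detaching
   blocks extends this to the maps whose root vertex is a cut vertex. As the root is uniform
   among the darts, the second moment is 2n times the sum of X / deg over the maps rooted at a
   cut vertex, hence is asymptotic to the square of the mean, and Chebyshev's inequality
   applies. *)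

(** * Rotation systems and the genus inequality *)

(** The root is carried by a leg, an extra dart fixed by [al]. The single vertex is then a rooted
    map, and reductions stay on one dart type: consumed darts become fixed points. A vertex is
    deleted by blocking [si] on its darts, so planarity, labels and cut vertices all reduce to
    merging connectivity classes. Whether contracting an edge absorbs a cut vertex depends on how
    the corners of the contracted vertex are linked, not on their number. Hence the word [lab], and
    the series [H] in which [u] marks the darts outside a prefix. The constant is 1/2 - T'(1/2) / 8:
    relative to the number of maps, the coefficients of 1 / (1 - x) grow like n / 2 and those of [T]
    like T'(1/2) n / 8. The coefficients of [T] in x are summable at 3/5, beyond 1/2, so only ballot
    numbers have to be estimated. Squares need no generating function: rerooting expresses the sum
    of X^2 through first moments at root cut vertices, which follow from the mean, because the maps
    of a given degree obtained by expansion come from all maps except those of finitely many smaller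
    degrees. *)

Section Classes.
Variable T : finType.
Implicit Types (e : rel T) (S : {set T}) (u v x y : T).

Definition touches e S u := [exists s in S, connect e u s].
Definition merge e S : rel T := fun u v => e u v || (u \in S) && (v \in S).
Definition ccl e u := [set v | connect e u v].
Definition classes_of e := [set ccl e u | u in T].
Definition ncl e := #|classes_of e|.

Lemma touchesP e S u :
  reflect (exists2 s, s \in S & connect e u s) (touches e S u).
Proof. exact: exists_inP. Qed.

Lemma touches_in e S u : u \in S -> touches e S u.
Proof. by move=> uS; apply/touchesP; exists u. Qed.

Lemma touches_connect e S u v :
  connect_sym e -> connect e u v -> touches e S u = touches e S v.
Proof.
move=> sym uv; apply/touchesP/touchesP => -[s sS c]; exists s => //.
  by rewrite sym (connect_trans _ uv) // sym.
exact: connect_trans uv c.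
Qed.

(** Only the first and the last visit of a path to [S] matter, since all of [S] has become one
    class. *)
Lemma connect_merge e S u v : connect_sym e ->
  connect (merge e S) u v = connect e u v || touches e S u && touches e S v.
Proof.
move=> sym; apply/idP/idP.
  case/connectP => p; elim: p u => [|w p IH] u /=.
    by move=> _ ->; rewrite connect0.
  case/andP=> uw pw lst; case/orP: uw => [euw|/andP[uS wS]].
    have cuw := connect1 euw.
    by rewrite (same_connect sym cuw) (touches_connect S sym cuw); exact: IH.
  rewrite (touches_in e uS) /=.
  case/orP: (IH w pw lst) => [cwv|/andP[_ ->]]; last by rewrite orbT.
  by rewrite -(touches_connect S sym cwv) (touches_in e wS) orbT.
have sub a b : connect e a b -> connect (merge e S) a b.
  by apply: connect_sub => c d ecd; apply: connect1; rewrite /merge ecd.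
case/orP => [/sub //|/andP[/touchesP[s sS us] /touchesP[t tS vt]]].
apply: connect_trans (sub _ _ us) _; apply: connect_trans (_ : connect _ s t) _.
  by apply: connect1; rewrite /merge sS tS orbT.
by apply: sub; rewrite sym.
Qed.

Lemma merge_sym e S : connect_sym e -> connect_sym (merge e S).
Proof. by move=> sym u v; rewrite !connect_merge // sym andbC. Qed.

Lemma eq_ccl e e' : connect e =2 connect e' -> ccl e =1 ccl e'.
Proof. by move=> ee u; apply/setP=> v; rewrite !inE ee. Qed.

Lemma eq_ncl e e' : connect e =2 connect e' -> ncl e = ncl e'.
Proof. by move=> ee; rewrite /ncl /classes_of (eq_imset _ (eq_ccl ee)). Qed.

Lemma eq_connect_sub e e' :
  subrel e (connect e') -> subrel e' (connect e) -> connect e =2 connect e'.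
Proof.
by move=> s1 s2 u v; apply/idP/idP; apply: connect_sub.
Qed.

Lemma eq_ccl_connect e u v : connect_sym e -> (ccl e u == ccl e v) = connect e u v.
Proof.
move=> sym; apply/eqP/idP => [/setP/(_ v)|c]; first by rewrite !inE connect0.
by apply/setP=> w; rewrite !inE (same_connect sym c).
Qed.

Lemma touches2 e x y u :
  touches e [set x; y] u = connect e u x || connect e u y.
Proof.
apply/touchesP/orP => [[s]|]; first by rewrite !inE => /orP[]/eqP->; auto.
by case=> c; [exists x|exists y]; rewrite // !inE eqxx ?orbT.
Qed.

Lemma connect_merge_id e S : connect_sym e ->
  {in S &, forall x y, connect e x y} -> connect (merge e S) =2 connect e.
Proof.
move=> sym cS u v; rewrite connect_merge //; case c: (connect e u v) => //=.
apply: contraFF c => /andP[/touchesP[s sS us] /touchesP[t tS vt]].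
by apply: connect_trans us (connect_trans (cS _ _ sS tS) _); rewrite sym.
Qed.

(** If [x] and [y] are not connected, their two classes fuse and all others survive: both sets of
    classes agree once the two old classes and the joint one are removed. *)
Lemma ncl_merge2 e x y : connect_sym e ->
  ncl e = ncl (merge e [set x; y]) + ~~ connect e x y.
Proof.
move=> sym; case cxy: (connect e x y) => /=.
  rewrite addn0; apply: eq_ncl => u v; rewrite connect_merge_id //.
  move=> a b; rewrite !inE => /orP[]/eqP-> /orP[]/eqP-> //.
  by rewrite sym.
set e' := merge _ _.
have e'E u v : connect e' u v = connect e u v ||
    (connect e u x || connect e u y) && (connect e v x || connect e v y).
  by rewrite connect_merge // !touches2.
have sym' : connect_sym e' by apply: merge_sym.
rewrite /ncl (cardsD1 (ccl e x)) imset_f // (cardsD1 (ccl e y)).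
rewrite in_setD1 imset_f // eq_ccl_connect // sym cxy /=.
rewrite (cardsD1 (ccl e' x) (classes_of e')) imset_f //.
suff -> : classes_of e :\ ccl e x :\ ccl e y = classes_of e' :\ ccl e' x.
  by rewrite addn1.
have key u : ~~ connect e u x -> ~~ connect e u y -> ccl e u = ccl e' u.
  move=> /negbTE nx /negbTE ny; apply/setP=> v; rewrite !inE e'E nx ny /= orbF //.
apply/setP => C; rewrite !in_setD1; apply/idP/idP.
  case/and3P=> Cy Cx /imsetP[u _ CE]; subst C.
  rewrite !eq_ccl_connect // in Cx Cy.
  by rewrite key // imset_f // andbT eq_ccl_connect // e'E !negb_or Cx negb_and !negb_or Cx Cy.
case/andP=> Cx /imsetP[u _ CE]; subst C.
rewrite eq_ccl_connect // e'E connect0 /= andbT !negb_or in Cx.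
case/and3P: Cx => Cx _ Cy.
by rewrite -key // imset_f // !eq_ccl_connect // Cx Cy.
Qed.

Lemma iter_connect (f : T -> T) e (k : nat) x :
  (forall i, i < k -> e (iter i f x) (iter i.+1 f x)) -> connect e x (iter k f x).
Proof.
elim: k => [|k IH] H; first exact: connect0.
apply: connect_trans (IH _) (connect1 (H _ _)) => // i ik; exact/H/ltnW.
Qed.

End Classes.

(** Arithmetic of the induction in [euler_le]. The literal boolean says whether the transposition
    splits a face ([true]) or joins two ([false]); [b] is the possible gain of a component. *)
Lemma euler_arith1 (a s f f' t c : nat) (b : bool) : f' + (~~ true).*2 = f + 1 ->
  a + 1 + s + f' <= t + 2 * (c + b) -> a + s + f <= t + 2 * c.
Proof. by case: b => /=; lia. Qed.

Lemma euler_arith2 (a s f f' t c : nat) : f' + (~~ false).*2 = f + 1 ->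
  a + 1 + s + f' <= t + 2 * (c + ~~ true) -> a + s + f <= t + 2 * c.
Proof. by rewrite /=; lia. Qed.

Lemma euler_arith3 (f f' : nat) (b : bool) : f' + (~~ false).*2 = f + 1 ->
  f + (~~ b).*2 = f' + true -> b.
Proof. by case: b => //=; lia. Qed.

Section Maps.
Variable T : finType.
Implicit Types (al si : {perm T}) (U : {set T}) (x y : T).
Local Open Scope group_scope.

(** [U] is a set of deleted vertices: edges may still be crossed everywhere, but one may not turn
    around a vertex of [U]. The edge ends at a deleted vertex thus stay present and become
    separate. *)
Definition mrel al si U : rel T :=
  fun u v => (v == al u) || (u \notin U) && (v == si u).

Definition sstable si U := forall x, (si x \in U) = (x \in U).

Lemma sstable0 si : sstable si set0.
Proof. by move=> x; rewrite !inE. Qed.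

Lemma sstable_porbit si x : sstable si (porbit si x).
Proof.
move=> y; rewrite -eq_porbit_mem -[RHS]eq_porbit_mem.
by rewrite (porbit_perm si 1 y).
Qed.

Lemma sstable_iter si U : sstable si U -> forall i x, (iter i si x \in U) = (x \in U).
Proof. by move=> st; elim=> //= i IH x; rewrite st. Qed.

Lemma sstableU si U V : sstable si U -> sstable si V -> sstable si (U :|: V).
Proof. by move=> h1 h2 x; rewrite !inE h1 h2. Qed.

Lemma iter_order_perm al x : exists k, iter k al (al x) = x.
Proof.
exists #|porbit al x|.-1; rewrite -iterSr prednK ?iter_porbit //.
by rewrite lt0n card_porbit_neq0.
Qed.

(** A step is undone by going forward around its cycle. The rest of a cycle of [si] stays outside
    [U], because [U] is a union of such cycles. *)
Lemma mrel_sym al si U : sstable si U -> connect_sym (mrel al si U).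
Proof.
move=> st; suff H u v : connect (mrel al si U) u v -> connect (mrel al si U) v u.
  by move=> u v; apply/idP/idP; apply: H.
case/connectP=> p; elim: p u => [|w p IH] u /=; first by move=> _ ->.
case/andP=> uw pw lst; apply: connect_trans (IH w pw lst) _.
case/orP: uw => [/eqP->|/andP[uU /eqP->]].
  have [k kE] := iter_order_perm al u; rewrite -{2}kE.
  by apply: iter_connect => i _; rewrite /mrel /= eqxx.
have [k kE] := iter_order_perm si u; rewrite -{2}kE.
by apply: iter_connect => i _; rewrite /mrel /= eqxx sstable_iter // st uU orbT.
Qed.

Notation cn al si U := (connect (mrel al si U)).

Lemma cn_al al si U x : cn al si U x (al x).
Proof. by apply: connect1; rewrite /mrel eqxx. Qed.

Lemma cn_si al si U x : x \notin U -> cn al si U x (si x).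
Proof. by move=> xU; apply: connect1; rewrite /mrel eqxx xU orbT. Qed.

Lemma cn_porbit al si U x y : sstable si U -> x \notin U -> y \in porbit si x ->
  cn al si U x y.
Proof.
move=> st xU /porbitP[i ->]; rewrite permX; apply: iter_connect => j _.
by rewrite /mrel /= eqxx sstable_iter // xU orbT.
Qed.

Lemma cn0_porbit al si x y : y \in porbit si x -> cn al si set0 x y.
Proof. by apply: cn_porbit; rewrite ?inE //; apply: sstable0. Qed.

Lemma cn_sub0 al si U x y : cn al si U x y -> cn al si set0 x y.
Proof.
apply: connect_sub => u v /orP[/eqP->|/andP[_ /eqP->]]; first exact: cn_al.
by apply: cn_si; rewrite inE.
Qed.

Definition euler al si := #|porbits al| + #|porbits si| + #|porbits (al * si)|.
Definition ncomp al si := ncl (mrel al si set0).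
(** A fixed point of [al] counts once as an orbit and once as a dart, so legs cancel and this reads
    V - E + F = 2 for each component. *)
Definition planar al si := euler al si == #|T| + 2 * ncomp al si.

Lemma porbits1 : #|porbits (1 : {perm T})| = #|T|.
Proof.
rewrite card_imset // => x y /eqP; rewrite eq_porbit_mem porbit.unlock.
by rewrite cycle1 imset_set1 /aperm perm1 inE => /eqP.
Qed.

Lemma connect_fix (e : rel T) x y : (forall z, e x z -> z = x) ->
  connect e x y -> y = x.
Proof.
move=> fx /connectP[p]; elim: p => [|z p IH] /=; first by [].
by case/andP=> /fx -> pz lst; apply: IH.
Qed.

Lemma ncomp1 si : ncomp 1 si = #|porbits si|.
Proof.
rewrite /ncomp /ncl /classes_of /porbits; congr #|pred_of_set _|.
apply: eq_imset => x; apply/setP=> y; rewrite inE; apply/idP/idP; last first.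
  exact: cn0_porbit.
have sym : connect_sym (mrel 1 si set0) by apply/mrel_sym/sstable0.
case/connectP=> p; elim: p x => [|z p IH] x /=; first by move=> _ ->; exact: porbit_id.
case/andP=> xz pz lst; have:= IH z pz lst.
case/orP: xz => [/eqP->|/andP[_ /eqP->]]; first by rewrite perm1.
by rewrite -!eq_porbit_mem (porbit_perm si 1).
Qed.

(* adjoining a transposition to the generators absorbs it in al *)
Lemma cn_mul_tperm al si U (S : {set T}) x y : x \in S -> y \in S ->
  sstable si U ->
  connect (merge (mrel (tperm x y * al) si U) S) =2 connect (merge (mrel al si U) S).
Proof.
move=> xS yS st; apply: eq_connect_sub => u v.
  case/orP=> [/orP[/eqP->|H]|H]; last 1 first.
  - by apply: connect1; rewrite /merge H orbT.
  - rewrite permM; apply: connect_trans (_ : connect _ u (tperm x y u)) _.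
      case: tpermP => [->|->|_ _]; rewrite ?connect0 //.
        by apply: connect1; rewrite /merge xS yS orbT.
      by apply: connect1; rewrite /merge xS yS orbT.
    by apply: connect1; rewrite /merge /mrel eqxx.
  - by apply: connect1; rewrite /merge /mrel H !orbT.
case/orP=> [/orP[/eqP->|H]|H]; last 1 first.
- by apply: connect1; rewrite /merge H orbT.
- have -> : al u = (tperm x y * al) (tperm x y u) by rewrite permM tpermK.
  apply: connect_trans (_ : connect _ u (tperm x y u)) _.
    case: tpermP => [->|->|_ _]; rewrite ?connect0 //.
      by apply: connect1; rewrite /merge xS yS orbT.
    by apply: connect1; rewrite /merge xS yS orbT.
  by apply: connect1; rewrite /merge /mrel eqxx.
- by apply: connect1; rewrite /merge /mrel H !orbT.
Qed.

(** Induction on the number of darts moved by [al]. Splitting [al x] off its cycle adds one orbit of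
    [al], changes the number of faces by one and the number of components by at most one; when a
    face is lost, the components cannot increase. *)
Lemma euler_le al si : euler al si <= #|T| + 2 * ncomp al si.
Proof.
have [n] := ubnP #|[pred x | al x != x]|; elim: n al => // n IH al.
rewrite ltnS => le_n.
case: (pickP [pred x | al x != x]) => [x /= ax|al1]; last first.
  have -> : al = 1 by apply/permP=> x; rewrite perm1; apply/eqP; move: (al1 x) => /= /negbFE.
  by rewrite /euler mul1g ncomp1 porbits1 mul2n -addnn addnA.
set y := al x; set al' := tperm x y * al.
have yx : y != x by [].
have xy : x != y by rewrite eq_sym.
have lt' : #|[pred x | al' x != x]| < n.
  apply: leq_trans le_n; apply: proper_card; apply/properP; split.
    apply/subsetP=> z; rewrite !inE permM; case: tpermP => [-> _|->|_ _ ->] //.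
    by rewrite -/y eqxx.
  by exists y; rewrite !inE ?permM ?tpermR -/y ?eqxx // (inj_eq perm_inj).
have := IH al' lt'; rewrite /euler.
have := porbits_mul_tperm al x y; rewrite -/al' /= xy.
have -> /= : x \in porbit al y by rewrite porbit_sym (mem_porbit al 1).
rewrite addn0 => ->.
have := porbits_mul_tperm (al * si) x y; rewrite /= mulgA -/al' xy /=.
have sym := @mrel_sym al si _ (sstable0 si).
have sym' := @mrel_sym al' si _ (sstable0 si).
have nE : ncomp al si = ncl (merge (mrel al' si set0) [set x; y]).
  rewrite (eq_ncl (cn_mul_tperm al _ _ (sstable0 si))) ?inE ?eqxx ?orbT //.
  rewrite /ncomp (ncl_merge2 x y sym).
  by have -> : connect (mrel al si set0) x y; [exact: cn_al | rewrite addn0].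
have := ncl_merge2 x y sym'; rewrite -nE -/(ncomp al' si) => n'E.
case xy' : (x \in porbit (al * si) y) => /= E1 E2.
  by move: E2; rewrite n'E; exact: euler_arith1 E1.
(* Two faces are joined here, so [x] and [y] lie on a common face of the cut map, and walking round
   this face connects them. *)
have c' : connect (mrel al' si set0) x y.
  have : x \in porbit (al' * si) y.
    have := porbits_mul_tperm (al' * si) x y.
    by rewrite /= mulgA /al' mulgA tperm2 mul1g -/al' xy; exact: euler_arith3 E1.
  rewrite porbit_sym => /porbitP[i ->]; rewrite permX; elim: i => [|i IHi] /=; first exact: connect0.
  apply: connect_trans IHi _; rewrite permM.
  by apply: connect_trans (cn_al _ _ _ _) _; apply: cn_si; rewrite inE.
by move: E2; rewrite n'E c'; exact: euler_arith2 E1.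
Qed.

End Maps.

Notation cn al si U := (connect (mrel al si U)).

(** * Contracting or deleting the root edge *)

Section Orbits.
Variable T : finType.
Implicit Types (s : {perm T}) (A : {set T}) (x y : T).
Local Open Scope group_scope.

Lemma porbit_subset s A x : x \in A -> (forall y, y \in A -> s y \in A) ->
  porbit s x \subset A.
Proof.
move=> xA cl; apply/subsetP=> y /porbitP[i ->]; rewrite permX.
by elim: i => //= i IH; exact: cl.
Qed.

Lemma mem_porbit1 s x : s x \in porbit s x.
Proof. exact: (mem_porbit s 1 x). Qed.

Lemma iter_porbit_inj s x i j : iter i s x = iter j s x ->
  i < #|porbit s x| -> j < #|porbit s x| -> i = j.
Proof.
move=> E ix jx; apply/eqP; rewrite -(nth_uniq x _ _ (uniq_traject_porbit s x)) ?size_traject //.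
by rewrite !nth_traject // E.
Qed.

Lemma card_porbit_period s x k : 0 < k -> iter k s x = x ->
  (forall i j, i < k -> j < k -> iter i s x = iter j s x -> i = j) ->
  #|porbit s x| = k :> nat.
Proof.
move=> k0 kx inj; have le : #|porbit s x| <= k.
  rewrite leqNgt; apply/negP => lt.
  by have := @iter_porbit_inj s x k 0 kx lt (ltn_trans k0 lt) => E; rewrite E in k0.
apply/eqP; rewrite eqn_leq le /= leqNgt; apply/negP=> lt.
by have := inj _ _ lt k0; rewrite iter_porbit => /(_ erefl) /eqP; rewrite (negbTE (card_porbit_neq0 s x)).
Qed.

Lemma porbit_closed s x y : y \in porbit s x -> s y \in porbit s x.
Proof. by rewrite (sstable_porbit s x y). Qed.

Lemma eq_porbit_on s s' x : {in porbit s x, s =1 s'} -> porbit s x = porbit s' x.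
Proof.
move=> ss; have it i : iter i s' x = iter i s x.
  elim: i => //= i ->; rewrite ss // -permX mem_porbit //.
by apply/setP=> y; apply/porbitP/porbitP=> -[i ->]; exists i; rewrite !permX it.
Qed.

Lemma porbits_split s x y : x != y -> x \in porbit s y ->
  #|porbits (tperm x y * s)| = #|porbits s|.+1.
Proof. by move=> ne xy; have := porbits_mul_tperm s x y; rewrite /= xy ne /=; lia. Qed.

Lemma porbits_join s x y : x \notin porbit s y ->
  #|porbits (tperm x y * s)|.+1 = #|porbits s|.
Proof.
move=> xy; have := porbits_mul_tperm s x y; rewrite /= xy /=.
have -> : x != y by apply: contra xy => /eqP->; exact: porbit_id.
by rewrite /=; lia.
Qed.

Lemma porbits_splitr s x y : x != y -> x \in porbit s y ->
  #|porbits (s * tperm x y)| = #|porbits s|.+1.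
Proof.
move=> ne xy; rewrite -porbitsV invMg tpermV porbits_split ?porbitsV //.
by rewrite porbitV.
Qed.

Lemma porbits_joinr s x y : x \notin porbit s y ->
  #|porbits (s * tperm x y)|.+1 = #|porbits s|.
Proof. by move=> xy; rewrite -porbitsV invMg tpermV porbits_join ?porbitsV // porbitV. Qed.

Lemma porbitJ s t x : porbit (s ^ t) (t x) = t @: porbit s x.
Proof.
apply/setP=> y; apply/porbitP/imsetP => [[i ->]|[z /porbitP[i ->] ->]].
  exists ((s ^+ i) x); first exact: mem_porbit.
  by rewrite -conjXg permJ.
by exists i; rewrite -conjXg permJ.
Qed.

Lemma card_porbitsJ s t : #|porbits (s ^ t)| = #|porbits s|.
Proof.
have -> : porbits (s ^ t) = (fun A : {set T} => t @: A) @: porbits s.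
  apply/setP=> A; apply/imsetP/imsetP=> [[x _ ->]|[B /imsetP[x _ ->] ->]].
    exists (porbit s (t^-1 x)); first exact: imset_f.
    by rewrite -porbitJ permKV.
  by exists (t x) => //; rewrite porbitJ.
by rewrite card_imset //; apply: imset_inj; exact: perm_inj.
Qed.

End Orbits.

Lemma ncl_merge3 (T : finType) (e : rel T) r a b : connect_sym e ->
  ncl e = ncl (merge e [set r; a; b]) + ~~ connect e r a
          + ~~ (connect e a b || connect e r b).
Proof.
move=> sym; rewrite (ncl_merge2 r a sym) [ncl (merge e [set r; a])](ncl_merge2 a b (merge_sym _ sym)).
rewrite -addnA [~~ _ + _]addnC addnA; congr (_ + _ + _); last first.
  rewrite connect_merge // !touches2 connect0 orbT /= ![connect e b _]sym.
  by case: (connect e a b); rewrite ?orbT //= orbF.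
apply: eq_ncl; apply: eq_connect_sub => u v.
  case/orP=> [/orP[H|/andP[]]|/andP[]].
  - by apply: connect1; rewrite /merge H.
  - rewrite !inE => uS vS; apply: connect1; rewrite /merge !inE.
    by case/orP: uS => ->; case/orP: vS => ->; rewrite ?orbT.
  rewrite !inE => uS vS; apply: connect1; rewrite /merge !inE.
  by case/orP: uS => ->; case/orP: vS => ->; rewrite ?orbT.
case/orP=> [H|/andP[uS vS]].
  by apply: connect1; rewrite /merge H.
have sym2 : connect_sym (merge (merge e [set r; a]) [set a; b]).
  by do 2!apply: merge_sym.
have toa w : w \in [set r; a; b] -> connect (merge (merge e [set r; a]) [set a; b]) a w.
  rewrite !inE => /orP[/orP[]|] /eqP->; last 1 first.
  - by apply: connect1; rewrite /merge !inE !eqxx !orbT.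
  - by apply: connect1; rewrite /merge !inE !eqxx !orbT.
  - exact: connect0.
by apply: connect_trans (toa _ vS); rewrite sym2 toa.
Qed.

Lemma add3_eq (p q t p' q' t' : nat) : p = p'.+1 -> q = q'.+1 -> t = t' + 2 ->
  p + q + t = p' + q' + t' + 4.
Proof. by move=> -> -> ->; lia. Qed.

Section Steps.
Variable T : finType.
Variables (al si : {perm T}) (r : T).
Local Open Scope group_scope.
Let a := si r.
Let b := al a.

(** [r] is the leg, [a] the dart after it and [b] the other end of the root edge. Cutting that edge
    leaves [a] and [b] as fixed points. *)
Definition ct_al : {perm T} := tperm a b * al.
(** A root loop: the cycle [(r a A b B)] is cut into [(r)], [(a A)] and [(b B)], and [a] and [b]
    become the legs of the two sides. *)
Definition lp_si : {perm T} := si * tperm r a * tperm a b.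
(** The last dart contributed by the far vertex to the contracted one. If [b] is alone at its vertex
    nothing is contributed, and the leg takes this place. *)
Definition ex_last := if si b == b then r else si^-1 b.
(** From [(r a A)] and [(b B)] to [(r B A)], [(a)], [(b)]. The far darts come first, so their number
    alone suffices to undo the contraction. The product of transpositions gives the orbit counts
    directly. *)
Definition ex_si : {perm T} :=
  tperm ex_last b * (tperm r b * (tperm r a * si)).
Let y := ex_last.

(** Fixed points of [al] outside the component of [r] are allowed: they are darts consumed by
    reductions, or the leg of the other side of a loop. *)
Definition good := [/\ involutive al, al r = r &
  forall x, cn al si set0 r x -> x != r -> al x != x].

Hypothesis inv : involutive al.
Hypothesis rleg : al r = r.
Hypothesis ar : a != r.
Hypothesis ab : b != a.

Let alb : al b = a. Proof. by rewrite /b inv. Qed.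
Let br : b != r.
Proof. by rewrite -(inj_eq (@perm_inj _ al)) alb rleg. Qed.

Let alx_a x : (al x == a) = (x == b).
Proof. by rewrite -{1}alb (inj_eq perm_inj). Qed.
Let alx_b x : (al x == b) = (x == a).
Proof. by rewrite /b (inj_eq perm_inj). Qed.

Lemma ct_alE x : ct_al x = if (x == a) || (x == b) then x else al x.
Proof.
rewrite permM; case: tpermP => [->|->|/eqP/negbTE-> /eqP/negbTE->//].
  by rewrite eqxx alb.
by rewrite eqxx orbT.
Qed.

Lemma ct_al_inv : involutive ct_al.
Proof.
move=> x; rewrite !ct_alE; case xab : ((x == a) || (x == b)); first by rewrite xab.
have /norP[xa xb] := negbT xab.
by rewrite alx_a alx_b inv (negbTE xa) (negbTE xb).
Qed.

Lemma card_ct_al : #|porbits ct_al| = #|porbits al|.+1.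
Proof.
apply: porbits_split; first by rewrite eq_sym.
by rewrite -alb mem_porbit1.
Qed.

Section LoopStep.
Hypothesis ins : b \in porbit si r.
Let v0 := porbit si r.

Lemma lp_siE x : lp_si x = if x == r then r else if si x == b then a
                           else if si x == r then b else si x.
Proof.
rewrite !permM; case: (altP (x =P r)) => [->|xr].
  by rewrite -/a tpermR tpermD // eq_sym.
have xa : si x != a by rewrite (inj_eq perm_inj).
case: (altP (si x =P b)) => [->|xb].
  by rewrite (tpermD (x := r)) 1?eq_sym // tpermR.
case: (altP (si x =P r)) => [->|xr2]; first by rewrite tpermL tpermL.
by rewrite !tpermD // eq_sym.
Qed.

Let s1 := si * tperm r a.
Let s1E x : s1 x = if x == r then r else if si x == r then a else si x.
Proof.
rewrite permM; case: (altP (x =P r)) => [->|xr]; first by rewrite tpermR.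
have xa : si x != a by rewrite (inj_eq perm_inj).
case: (altP (si x =P r)) => [->|xr2]; first by rewrite tpermL.
by rewrite tpermD // eq_sym.
Qed.

Let b_s1 : b \in porbit s1 a.
Proof.
suff : b \in r |: porbit s1 a by rewrite !inE (negbTE br).
apply: (subsetP _ _ ins); apply: porbit_subset; first by rewrite !inE eqxx.
move=> x; rewrite !inE => /orP[/eqP->|xs]; first by rewrite -/a porbit_id orbT.
case: (altP (si x =P r)) => //= xr.
move: (porbit_closed xs); rewrite s1E (negbTE xr).
by case: (altP (x =P r)) => // -> _; rewrite porbit_id.
Qed.

Lemma card_lp_si : #|porbits lp_si| = #|porbits si| + 2.
Proof.
rewrite /lp_si porbits_splitr; first last.
- by rewrite porbit_sym.
- by rewrite eq_sym.
rewrite porbits_splitr ?addn2 //; first by rewrite eq_sym.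
by rewrite porbit_sym (mem_porbit si 1).
Qed.

(** Up to conjugation by the transposition of [a] and [b], the faces change only by a split at [r]
    and its successor [a]. *)
Lemma card_lp_face : #|porbits (ct_al * lp_si)| = #|porbits (al * si)|.+1.
Proof.
have -> : ct_al * lp_si = (al * si * tperm r a) ^ tperm a b.
  by rewrite /ct_al /lp_si /conjg tpermV !mulgA.
rewrite card_porbitsJ porbits_splitr //; first by rewrite eq_sym.
have -> : a = (al * si) r by rewrite permM rleg.
by rewrite porbit_sym (mem_porbit (al * si) 1).
Qed.

Lemma euler_lp : euler ct_al lp_si = euler al si + 4.
Proof. by rewrite /euler card_ct_al card_lp_si card_lp_face; lia. Qed.

Lemma lp_v0 : sstable lp_si v0.
Proof.
move=> x; have av : a \in v0 by rewrite (mem_porbit si 1).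
have rv : r \in v0 := porbit_id _ _.
rewrite lp_siE; have st := sstable_porbit si r; rewrite -/v0 in st.
case: (altP (x =P r)) => [->|_]; first by [].
case: (altP (si x =P b)) => [E|_]; first by rewrite -(st x) E av ins.
case: (altP (si x =P r)) => [E|_]; first by rewrite -(st x) E rv ins.
exact: st.
Qed.

Lemma lp_connect U : sstable si U -> r \notin U ->
  connect (mrel al si U) =2 connect (merge (mrel ct_al lp_si U) [set r; a; b]).
Proof.
move=> st rU; apply: eq_connect_sub => u v.
  case/orP=> [/eqP->|/andP[uU /eqP->]].
    case uab : ((u == a) || (u == b)).
      apply: connect1; rewrite /merge !inE -orbA uab orbT /=.
      by case/orP: uab => /eqP->; rewrite ?alb -/b !eqxx ?orbT.
    by apply: connect1; rewrite /merge /mrel ct_alE uab eqxx.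
  case: (altP (u =P r)) => [->|ur].
    by apply: connect1; rewrite /merge !inE !eqxx !orbT.
  have step : connect (merge (mrel ct_al lp_si U) [set r; a; b]) u (lp_si u).
    by apply: connect1; rewrite /merge /mrel uU eqxx !orbT.
  apply: connect_trans step _; rewrite lp_siE (negbTE ur).
  case: (altP (si u =P b)) => [->|_].
    by apply: connect1; rewrite /merge !inE !eqxx !orbT.
  case: (altP (si u =P r)) => [->|_]; last exact: connect0.
  by apply: connect1; rewrite /merge !inE !eqxx !orbT.
have era : cn al si U r a by apply: cn_si.
have eab : cn al si U a b by apply: cn_al.
have sym := mrel_sym al st.
have tor w : w \in [set r; a; b] -> cn al si U r w.
  rewrite !inE => /orP[/orP[]|] /eqP->; [exact: connect0|exact: era|].
  exact: connect_trans era eab.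
case/orP=> [|/andP[uS vS]]; last first.
  by apply: connect_trans (tor _ vS); rewrite sym tor.
case/orP=> [/eqP->|/andP[uU /eqP->]].
  by rewrite ct_alE; case: ifP => _; [exact: connect0|exact: cn_al].
rewrite lp_siE; case: (altP (u =P r)) => [->|ur]; first exact: connect0.
have step : cn al si U u (si u) by apply: cn_si.
case: (altP (si u =P b)) step => [->|_] step.
  by apply: connect_trans step _; rewrite sym; exact: eab.
case: (altP (si u =P r)) step => [->|_] step //.
by apply: connect_trans step (connect_trans era eab).
Qed.

(** The change of [si] takes place inside the root vertex; once that is blocked, only the cut edge
    has to be restored. *)
Lemma lp_connect_root :
  connect (mrel al si v0) =2 connect (merge (mrel ct_al lp_si v0) [set a; b]).
Proof.
have lpE u : u \notin v0 -> lp_si u = si u.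
  move=> uv; have suv : si u \notin v0 by rewrite (sstable_porbit si r).
  rewrite lp_siE; case: (altP (u =P r)) => [E|_].
    by rewrite E porbit_id in uv.
  case: (altP (si u =P b)) => [E|_]; first by rewrite E ins in suv.
  by case: (altP (si u =P r)) => [E|_] //; rewrite E porbit_id in suv.
have sym := mrel_sym al (sstable_porbit si r).
apply: eq_connect_sub => u v.
  case/orP=> [/eqP->|/andP[uU /eqP->]].
    case uab : ((u == a) || (u == b)).
      apply: connect1; rewrite /merge !inE uab /=.
      by case/orP: uab => /eqP->; rewrite ?alb -/b !eqxx ?orbT.
    by apply: connect1; rewrite /merge /mrel ct_alE uab eqxx.
  by apply: connect1; rewrite /merge /mrel uU lpE // eqxx orbT.
case/orP=> [/orP[/eqP->|/andP[uU /eqP->]]|/andP[]].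
- by rewrite ct_alE; case: ifP => _; [exact: connect0|exact: cn_al].
- by rewrite lpE //; exact: cn_si.
have eab : cn al si v0 a b by apply: cn_al.
rewrite !inE => /orP[]/eqP-> /orP[]/eqP->; rewrite ?connect0 //.
by rewrite sym.
Qed.

Lemma lp_isolated U x : cn ct_al lp_si U r x -> x = r.
Proof.
apply: connect_fix => z /orP[/eqP->|/andP[_ /eqP->]].
  by rewrite ct_alE rleg; case: ifP.
by rewrite lp_siE eqxx.
Qed.

(** A Jordan curve argument by counting: the left side of Euler's formula grows by 4, so by
    [euler_le] there must be two new components, which forces the two sides of the loop apart. *)
Lemma lp_planar_sep : planar al si ->
  planar ct_al lp_si /\ ~~ cn ct_al lp_si set0 a b.
Proof.
move=> /eqP pl; have := euler_le ct_al lp_si; rewrite /planar euler_lp pl.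
have sym := mrel_sym ct_al (sstable0 lp_si).
have ncE : ncomp ct_al lp_si = ncomp al si + 1 + ~~ cn ct_al lp_si set0 a b.
  rewrite /ncomp (ncl_merge3 r a b sym) (eq_ncl (lp_connect (sstable0 si) _)) ?inE //.
  case E1 : (connect _ r a); first by move: ar; rewrite (lp_isolated E1) eqxx.
  case E2 : (connect _ r b); first by move: br; rewrite (lp_isolated E2) eqxx.
  by rewrite orbF.
rewrite ncE; case: (cn _ _ _ _ _) => /= le; first by exfalso; lia.
by split=> //; apply/eqP; lia.
Qed.

Lemma lp_planarE : ~~ cn ct_al lp_si set0 a b ->
  planar ct_al lp_si -> planar al si.
Proof.
move=> sep; rewrite /planar euler_lp.
have sym := mrel_sym ct_al (sstable0 lp_si).
have -> : ncomp ct_al lp_si = ncomp al si + 1 + ~~ cn ct_al lp_si set0 a b.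
  rewrite /ncomp (ncl_merge3 r a b sym) (eq_ncl (lp_connect (sstable0 si) _)) ?inE //.
  case E1 : (connect _ r a); first by move: ar; rewrite (lp_isolated E1) eqxx.
  case E2 : (connect _ r b); first by move: br; rewrite (lp_isolated E2) eqxx.
  by rewrite orbF.
by rewrite sep /= => /eqP ?; apply/eqP; lia.
Qed.

Lemma lp_iter_a j k : iter k si r = b -> k < #|v0| -> j.+1 < k ->
  iter j lp_si a = iter j.+1 si r.
Proof.
move=> kb kv; elim: j => // j IH jk.
rewrite iterS IH; last exact: ltnW.
rewrite [RHS]iterS lp_siE; set z := iter j.+1 si r.
case: (altP (z =P r)) => [E|_].
  have := @iter_porbit_inj _ si r j.+1 0; rewrite -/z E => H.
  have E3 : j.+1 = 0%N by apply: H => //; rewrite -/v0; lia.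
  by [].
case: (altP (_ =P b)) => [E|_].
  have := @iter_porbit_inj _ si r j.+2 k; rewrite iterS -/z E kb => H.
  have E3 : j.+2 = k by apply: H => //; rewrite -/v0; lia.
  by exfalso; lia.
case: (altP (_ =P r)) => [E|_] //.
have := @iter_porbit_inj _ si r j.+2 0; rewrite iterS -/z E => H.
have E3 : j.+2 = 0%N by apply: H => //; rewrite -/v0; lia.
  by [].
Qed.

Lemma lp_iter_b j k : iter k si r = b -> k + j < #|v0| ->
  iter j lp_si b = iter (k + j) si r.
Proof.
move=> kb; elim: j => [|j IH] jk; first by rewrite addn0.
have k0 : 0 < k by case: k kb {IH jk} => //= E; move: br; rewrite -E eqxx.
rewrite iterS IH; last by lia.
rewrite addnS [RHS]iterS lp_siE; set z := iter (k + j) si r.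
case: (altP (z =P r)) => [E|_].
  have := @iter_porbit_inj _ si r (k + j) 0; rewrite -/z E => H.
  have E3 : k + j = 0 by apply: H => //; rewrite -/v0; lia.
  by exfalso; lia.
case: (altP (_ =P b)) => [E|_].
  have := @iter_porbit_inj _ si r (k + j).+1 k; rewrite iterS -/z E kb => H.
  have E3 : (k + j).+1 = k by apply: H => //; rewrite -/v0; lia.
  by exfalso; lia.
case: (altP (_ =P r)) => [E|_] //.
have := @iter_porbit_inj _ si r (k + j).+1 0; rewrite iterS -/z E => H.
have E3 : (k + j).+1 = 0 by apply: H => //; rewrite -/v0; lia.
  by exfalso; lia.
Qed.

Lemma lp_wrap_a k : iter k si r = b -> k < #|v0| -> iter k.-1 lp_si a = a.
Proof.
move=> kb kv; case: k kb kv => [|[|k]] kb kv.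
- by move: br; rewrite -kb /= eqxx.
- by move: ab; rewrite -kb /= eqxx.
rewrite /= (@lp_iter_a k k.+2) // -/(iter k.+1 si r) lp_siE.
case: (altP (_ =P r)) => [E|_].
  have := @iter_porbit_inj _ si r k.+1 0; rewrite E => H.
  have E3 : k.+1 = 0%N by apply: H => //; rewrite -/v0; lia.
  by [].
by rewrite -iterS kb eqxx.
Qed.

Lemma lp_wrap_b k : iter k si r = b -> k < #|v0| -> iter (#|v0| - k) lp_si b = b.
Proof.
move=> kb kv; have k0 : 0 < k by case: k kb {kv} => //= E; move: br; rewrite -E eqxx.
case E : (#|v0| - k) => [|j]; first by [].
rewrite iterS (@lp_iter_b j k) //; last by lia.
have vE : iter (k + j).+1 si r = r.
  have <- : #|v0| = (k + j).+1 by lia.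
  exact: iter_porbit.
rewrite lp_siE -[si (iter _ _ _)]iterS vE eqxx.
case: (altP (_ =P r)) => [E2|_].
  have := @iter_porbit_inj _ si r (k + j) 0; rewrite E2 => H.
  have E3 : k + j = 0 by apply: H => //; rewrite -/v0; lia.
  by exfalso; lia.
by rewrite eq_sym (negbTE br).
Qed.

Lemma card_lp_a k : iter k si r = b -> k < #|v0| -> #|porbit lp_si a| = k.-1.
Proof.
move=> kb kv; apply: card_porbit_period.
- case: k kb kv => [|[|k]] kb kv //; first by move: br; rewrite -kb /= eqxx.
  by move: ab; rewrite -kb /= eqxx.
- exact: lp_wrap_a.
move=> i j ik jk; rewrite (lp_iter_a kb kv) ?(lp_iter_a kb kv); try lia.
by move/iter_porbit_inj => H; apply: succn_inj; apply: H; rewrite -/v0; lia.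
Qed.

Lemma card_lp_b k : iter k si r = b -> k < #|v0| -> #|porbit lp_si b| = #|v0| - k.
Proof.
move=> kb kv; apply: card_porbit_period; first by lia.
  exact: lp_wrap_b.
move=> i j ik jk; rewrite (lp_iter_b kb) ?(lp_iter_b kb); try lia.
move/iter_porbit_inj => H; have E3 : k + i = k + j by apply: H; rewrite -/v0; lia.
by lia.
Qed.

Lemma lp_v0E : v0 = r |: (porbit lp_si a :|: porbit lp_si b).
Proof.
have st := lp_v0; apply/eqP; rewrite eqEsubset; apply/andP; split; last first.
  rewrite subUset sub1set porbit_id subUset.
  by rewrite !porbit_subset ?ins ?mem_porbit1 // => x; rewrite st.
apply: porbit_subset; first by rewrite !inE eqxx.
move=> x; rewrite !inE => /or3P[/eqP->|xa|xb].
- by rewrite -/a !porbit_id /= ?orbT.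
- move: (porbit_closed xa); rewrite lp_siE.
  case: (altP (x =P r)) => [->|_]; first by rewrite -/a !porbit_id /= ?orbT.
  case: (altP (_ =P b)) => [->|_]; first by rewrite !porbit_id /= ?orbT.
  by case: (altP (_ =P r)) => //= _ ->.
move: (porbit_closed xb); rewrite lp_siE.
case: (altP (x =P r)) => [->|_]; first by rewrite -/a !porbit_id /= ?orbT.
case: (altP (_ =P b)) => [->|_]; first by rewrite !porbit_id /= ?orbT.
by case: (altP (_ =P r)) => //= _ ->; rewrite !orbT.
Qed.

End LoopStep.

Section ExpandStep.
Hypothesis nins : b \notin porbit si r.
Let v0 := porbit si r.
Let w := porbit si b.

Let rv0 : r \in v0. Proof. exact: porbit_id. Qed.
Let av0 : a \in v0. Proof. by rewrite (mem_porbit si 1). Qed.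
Let bw : b \in w. Proof. exact: porbit_id. Qed.
Let disj x : x \in v0 -> x \in w -> False.
Proof.
rewrite /v0 /w -!eq_porbit_mem => /eqP E1 /eqP E2.
by move: nins; rewrite -eq_porbit_mem -E1 -E2 eqxx.
Qed.
Let yr_spec := (si b == b /\ y = r) \/ (si b != b /\ y \in w /\ si y = b).
Let yr_or : yr_spec.
Proof.
rewrite /yr_spec /y /ex_last; case: (altP eqP) => [_|E]; [by left|right; split=> //].
by split; rewrite ?permKV // /w -porbitV (mem_porbit si^-1 1).
Qed.
Local Lemma yb : y != b.
Proof.
case: yr_or => [[_ ->]|[E [_ H]]]; first by rewrite eq_sym.
by apply: contra E => /eqP yE; rewrite -{1}yE H.
Qed.
Local Lemma ya : y != a.
Proof.
case: yr_or => [[_ ->]|[_ [yw _]]]; first by rewrite eq_sym.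
by apply/eqP=> E; apply: (disj av0); rewrite -E.
Qed.

Local Lemma ra : r != a. Proof. by rewrite eq_sym. Qed.
Local Lemma rb : r != b. Proof. by rewrite eq_sym. Qed.
Local Lemma a_b : a != b. Proof. by rewrite eq_sym. Qed.

(** The order of the tests matters: when [b] is alone at its vertex, [y] is [r], and the leg must go
    to [si a]. *)
Lemma ex_siE x : ex_si x = if x == a then a else if x == b then b
   else if x == y then si a else if x == r then si b else si x.
Proof.
have [ya' yb' ra' rb' a_b'] := And5 ya yb ra rb a_b.
rewrite /ex_si !permM -/y.
case: (altP (x =P a)) => [->|xa].
  by rewrite (tpermD ya ab) (tpermD ra ab) tpermR.
case: (altP (x =P b)) => [->|xb].
  rewrite tpermR; case: yr_or => [[/eqP E ->]|[_ [yw yE]]].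
    by rewrite tpermL (tpermD rb a_b).
  have yr : r != y by apply/eqP=> E; apply: (disj rv0); rewrite E.
  have by' : b != y by rewrite eq_sym.
  have ay' : a != y by rewrite eq_sym.
  by rewrite (tpermD yr by') (tpermD yr ay').
case: (altP (x =P y)) => [->|xy].
  by rewrite tpermL tpermR tpermL.
have yx : y != x by rewrite eq_sym.
have bx : b != x by rewrite eq_sym.
have ax : a != x by rewrite eq_sym.
rewrite (tpermD yx bx).
case: (altP (x =P r)) => [->|xr].
  by rewrite tpermL (tpermD rb a_b).
have rx : r != x by rewrite eq_sym.
by rewrite (tpermD rx bx) (tpermD rx ax).
Qed.

Let s1 := tperm r a * si.
Let s1w : w = porbit s1 b.
Proof.
have [ya' yb' ra' rb' a_b'] := And5 ya yb ra rb a_b.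
apply: eq_porbit_on => x xw; rewrite permM tpermD //.
  by apply/eqP=> E; apply: (disj rv0); rewrite E.
by apply/eqP=> E; apply: (disj av0); rewrite E.
Qed.

Lemma card_ex_si : #|porbits ex_si| = #|porbits si|.+1.
Proof.
have [ya' yb' ra' rb' a_b'] := And5 ya yb ra rb a_b.
have s2 : #|porbits (tperm r b * s1)| = #|porbits si|.
  apply/eqP; rewrite -eqSS; apply/eqP; rewrite porbits_join; last first.
    by rewrite -s1w; apply/negP=> H; apply: (disj rv0).
  rewrite porbits_split //.
  by rewrite porbit_sym (mem_porbit si 1).
rewrite /ex_si porbits_split ?s2 // porbit_sym.
suff E0 : (tperm r b * s1) y = b by rewrite -{1}E0 mem_porbit1.
rewrite !permM; case: yr_or => [[/eqP E ->]|[_ [yw yE]]].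
  by rewrite tpermL (tpermD rb a_b).
have yr : r != y by apply/eqP=> E'; apply: (disj rv0); rewrite E'.
have by' : b != y by rewrite eq_sym.
have ay' : a != y by rewrite eq_sym.
by rewrite (tpermD yr by') (tpermD yr ay').
Qed.

(** The face permutation is precomposed with two transpositions, each splitting a face: the isolated
    darts [a] and [b] now form faces of their own. *)
Lemma card_ex_face : #|porbits (ct_al * ex_si)| = #|porbits (al * si)| + 2.
Proof.
have [ya' yb' ra' rb' a_b'] := And5 ya yb ra rb a_b.
pose phi := al * si.
have phir : phi r = a by rewrite permM rleg.
have phib : phi b = si a by rewrite permM alb.
have phia : phi a = si b by rewrite permM.
have sab : si a != b by apply: contra nins => /eqP<-; exact: (porbit_closed av0).
have aay : a != al y by rewrite eq_sym alx_a.
have p1 : (tperm a r * phi) (al y) = b.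
  rewrite permM; case: yr_or => [[/eqP E ->]|[_ [yw yE]]].
    by rewrite rleg tpermR phia.
  have ray : r != al y.
    apply/eqP=> E; apply: (disj rv0).
    by rewrite -[r]rleg E inv.
  by rewrite (tpermD aay ray) permM inv yE.
have byy : b != al y by rewrite eq_sym alx_b.
have -> : ct_al * ex_si = tperm b (al y) * (tperm a r * phi).
  apply/permP=> x; rewrite permM ct_alE ex_siE [RHS]permM.
  case: (altP (x =P b)) => [->|xb].
    by rewrite orbT (negbTE ab) eqxx tpermL p1.
  case: (altP (x =P a)) => [->|xa] /=.
    have aya : al y != a by rewrite eq_sym.
    by rewrite eqxx (tpermD ab aya) permM tpermL phir.
  rewrite alx_a (negbTE xb) alx_b (negbTE xa).
  have aE z : (al x == z) = (x == al z).
    by apply/eqP/eqP => [<-|->]; rewrite inv.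
  rewrite !aE rleg.
  have ax : a != x by rewrite eq_sym.
  have bx : b != x by rewrite eq_sym.
  case: (altP (x =P al y)) => [->|xy].
    by rewrite tpermR permM tpermD ?phib // eq_sym.
  have ayx : al y != x by rewrite eq_sym.
  rewrite (tpermD bx ayx) permM.
  case: (altP (x =P r)) => [->|xr]; first by rewrite tpermR phia.
  have rx : r != x by rewrite eq_sym.
  by rewrite (tpermD ax rx) permM.
rewrite porbits_split //; last by rewrite -{1}p1 mem_porbit1.
rewrite porbits_split ?addn2 // -phir mem_porbit1 //.
Qed.

Lemma euler_ex : euler ct_al ex_si = euler al si + 4.
Proof.
have [ya' yb' ra' rb' a_b'] := And5 ya yb ra rb a_b.
exact: (add3_eq card_ct_al card_ex_si card_ex_face).
Qed.

Lemma ct_ala : ct_al a = a. Proof. by rewrite ct_alE eqxx. Qed.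
Lemma ct_alb : ct_al b = b. Proof. by rewrite ct_alE eqxx orbT. Qed.
Lemma ex_sia : ex_si a = a. Proof. by rewrite ex_siE eqxx. Qed.
Lemma ex_sib : ex_si b = b. Proof. by rewrite ex_siE (negbTE ab) eqxx. Qed.

Lemma ex_si_off x : x \notin v0 -> x \notin w -> ex_si x = si x.
Proof.
have [ya' yb' ra' rb' a_b'] := And5 ya yb ra rb a_b.
move=> xv xw; rewrite ex_siE.
case: (altP (x =P a)) => [E|_]; first by rewrite E av0 in xv.
case: (altP (x =P b)) => [E|_]; first by rewrite E bw in xw.
case: (altP (x =P r)) => [E|_]; first by rewrite E rv0 in xv.
case: (altP (x =P y)) => [E|_] //.
case: yr_or => [[_ yr]|[_ [yw _]]]; first by rewrite E yr rv0 in xv.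
by rewrite E yw in xw.
Qed.

Lemma ex_vw_stable : sstable ex_si (v0 :|: w).
Proof.
have [ya' yb' ra' rb' a_b'] := And5 ya yb ra rb a_b.
move=> x; have st : sstable si (v0 :|: w) by apply: sstableU; exact: sstable_porbit.
have hav : a \in v0 :|: w by rewrite inE av0.
have hbv : b \in v0 :|: w by rewrite inE bw orbT.
have hrv : r \in v0 :|: w by rewrite inE rv0.
rewrite ex_siE; case: (altP (x =P a)) => [->|_] //; case: (altP (x =P b)) => [->|_] //.
case: (altP (x =P y)) => [->|_].
  rewrite st hav; case: yr_or => [[_ ->]|[_ [yw _]]]; first by rewrite hrv.
  by rewrite inE yw orbT.
by case: (altP (x =P r)) => [->|_]; rewrite st ?hbv ?hrv.
Qed.

Lemma ex_notin U : sstable si U -> r \notin U -> b \notin U ->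
  (forall x, x \in v0 -> x \notin U) /\ (forall x, x \in w -> x \notin U).
Proof.
have [ya' yb' ra' rb' a_b'] := And5 ya yb ra rb a_b.
move=> st rU bU; split=> x /porbitP[i ->];
by rewrite permX sstable_iter.
Qed.

Lemma ex_stable U : sstable si U -> r \notin U -> b \notin U -> sstable ex_si U.
Proof.
have [ya' yb' ra' rb' a_b'] := And5 ya yb ra rb a_b.
move=> st rU bU x; have [vU wU] := ex_notin st rU bU.
case xv : (x \in v0 :|: w).
  have := ex_vw_stable x; rewrite xv => xv'.
  have nU z : z \in v0 :|: w -> z \in U = false.
    by rewrite inE => /orP[/vU|/wU] /negbTE.
  by rewrite !nU.
move: xv; rewrite inE => /norP[xv xw].
by rewrite ex_si_off // st.
Qed.

Let sym0 U : sstable si U -> connect_sym (mrel al si U). Proof. exact: mrel_sym. Qed.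

Let al_step (e : rel T) (U' S : {set T}) s' : a \in S -> b \in S ->
  e = merge (mrel ct_al s' U') S -> forall u, connect e u (al u).
Proof.
have [ya' yb' ra' rb' a_b'] := And5 ya yb ra rb a_b.
move=> aS bS -> u.
case uab : ((u == a) || (u == b)); last first.
  by apply: connect1; rewrite /merge /mrel ct_alE uab eqxx.
apply: connect1; rewrite /merge; case/orP: uab => /eqP->.
  by rewrite aS bS orbT.
by rewrite alb aS bS orbT.
Qed.

(** [U] may be any set of vertices avoiding both ends of the root edge: the empty set serves for
    counting components, a single vertex for its status as a cut vertex. *)
Lemma ex_connect U : sstable si U -> r \notin U -> b \notin U ->
  connect (mrel al si U) =2 connect (merge (mrel ct_al ex_si U) [set r; a; b]).
Proof.
have [ya' yb' ra' rb' a_b'] := And5 ya yb ra rb a_b.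
move=> st rU bU; have [vU wU] := ex_notin st rU bU.
have st' := ex_stable st rU bU.
have aS : a \in [set r; a; b] by rewrite !inE eqxx orbT.
have bS : b \in [set r; a; b] by rewrite !inE eqxx !orbT.
have rS : r \in [set r; a; b] by rewrite !inE eqxx.
have inS u v : u \in [set r; a; b] -> v \in [set r; a; b] ->
    connect (merge (mrel ct_al ex_si U) [set r; a; b]) u v.
  by move=> uS vS; apply: connect1; rewrite /merge uS vS orbT.
have symm := merge_sym [set r; a; b] (mrel_sym ct_al st').
have exs u : u \notin U ->
    connect (merge (mrel ct_al ex_si U) [set r; a; b]) u (ex_si u).
  by move=> uU; apply: connect1; rewrite /merge /mrel uU eqxx !orbT.
have era : cn al si U r a by apply: cn_si.
have eab : cn al si U a b by apply: cn_al.
have toy : connect (merge (mrel ct_al ex_si U) [set r; a; b]) r y.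
  case: yr_or => [[_ ->]|[sb [yw yE]]]; first exact: connect0.
  apply: connect_trans (inS _ _ rS bS) _; rewrite symm.
  suff H z : z \in w -> connect (merge (mrel ct_al ex_si U) [set r; a; b]) b z.
    by rewrite symm; exact: H.
  case/porbitP=> i ->; rewrite permX; elim: i => [|i IH]; first exact: connect0.
  set z' := iter i si b in IH *.
  have zw : z' \in w by rewrite /z' -permX mem_porbit.
  case: (altP (z' =P b)) => [E|zb].
    rewrite iterS -/z' E; apply: connect_trans (inS _ _ bS rS) _.
    have -> : si b = ex_si r; last exact: exs.
    rewrite ex_siE (negbTE ra) (negbTE rb).
    case: (altP (r =P y)) => [E'|_]; last by rewrite eqxx.
    by exfalso; apply: (disj rv0); rewrite E'.
  case: (altP (z' =P y)) => [E|zy].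
    by rewrite iterS -/z' E yE; exact: connect0.
  apply: connect_trans IH _; rewrite iterS -/z'.
  have -> : si z' = ex_si z'; last exact/exs/wU.
  rewrite ex_siE (negbTE zb) (negbTE zy).
  case: (altP (z' =P a)) => [E|_]; first by case: (disj av0); rewrite -E.
  by case: (altP (z' =P r)) => [E|_] //; case: (disj rv0); rewrite -E.
apply: eq_connect_sub => u v.
  case/orP=> [/eqP->|/andP[uU /eqP->]]; first exact: (al_step aS bS).
  case: (altP (u =P r)) => [->|ur]; first exact: inS.
  case: (altP (u =P a)) => [->|ua].
    apply: connect_trans (inS _ _ aS rS) (connect_trans toy _).
    have -> : si a = ex_si y by rewrite ex_siE (negbTE ya) (negbTE yb) eqxx.
    apply: exs; case: yr_or => [[_ ->] //|[_ [yw _]]]; exact: wU.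
  case: (altP (u =P b)) => [->|ub].
    case: yr_or => [[/eqP-> _]|[sb [yw _]]]; first exact: connect0.
    apply: connect_trans (inS _ _ bS rS) _.
    have -> : si b = ex_si r; last exact: exs.
    rewrite ex_siE (negbTE ra) (negbTE rb) eqxx.
    case: (altP (r =P y)) => [E'|_] //.
    by exfalso; apply: (disj rv0); rewrite E'.
  case: (altP (u =P y)) => [E|uy].
    case: yr_or => [[_ yr]|[sb [yw yE]]]; first by rewrite E yr eqxx in ur.
    by rewrite E yE; apply: connect_trans (inS _ _ rS bS); rewrite symm.
  have -> : si u = ex_si u; last exact: exs.
  by rewrite ex_siE (negbTE ua) (negbTE ub) (negbTE uy) (negbTE ur).
have sym := mrel_sym al st.
have tor z : z \in [set r; a; b] -> cn al si U r z.
  rewrite !inE => /orP[/orP[]|] /eqP->; [exact: connect0|exact: era|].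
  exact: connect_trans era eab.
case/orP=> [|/andP[uS vS]]; last first.
  by apply: connect_trans (tor _ vS); rewrite sym tor.
case/orP=> [/eqP->|/andP[uU /eqP->]].
  by rewrite ct_alE; case: ifP => _; [exact: connect0|exact: cn_al].
have su z : z \notin U -> cn al si U z (si z) by move=> zU; apply: cn_si.
rewrite ex_siE; case: (altP (u =P a)) => [->|_]; first exact: connect0.
case: (altP (u =P b)) => [->|_]; first exact: connect0.
case: (altP (u =P y)) => [->|_].
  apply: connect_trans (su _ (vU _ av0)).
  case: yr_or => [[_ ->] //|[sb [yw yE]]].
  apply: connect_trans (su _ (wU _ yw)) _; rewrite yE sym; exact: eab.
case: (altP (u =P r)) => [->|_]; last exact: su.
by apply: connect_trans (connect_trans era eab) (su _ bU).
Qed.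

(** Blocking one end of the root edge amounts to blocking the whole contracted vertex and then
    identifying all darts of the other end, together with the dart of the root edge at the blocked
    end. *)
Let ex_connect_vw (U S : {set T}) : sstable si U -> (U = v0 \/ U = w) ->
  a \in S -> b \in S -> (forall x, x \in v0 :|: w -> (x \in U) || (x \in S)) ->
  (forall u, u \notin U -> u \in v0 :|: w -> si u \in S) ->
  {in S &, forall u v, cn al si U u v} ->
  connect (mrel al si U) =2 connect (merge (mrel ct_al ex_si (v0 :|: w)) S).
Proof.
have [ya' yb' ra' rb' a_b'] := And5 ya yb ra rb a_b.
move=> st UE aS bS cov clS cS.
apply: eq_connect_sub => u v.
  case/orP=> [/eqP->|/andP[uU /eqP->]]; first exact: (al_step aS bS).
  case uvw : (u \in v0 :|: w).
    have uS : u \in S by move: (cov _ uvw); rewrite (negbTE uU).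
    by apply: connect1; rewrite /merge uS clS ?orbT.
  apply: connect1; rewrite /merge /mrel uvw /=; move: uvw; rewrite inE => /norP[xv xw].
  by rewrite ex_si_off // eqxx orbT.
case/orP=> [/orP[/eqP->|/andP[uU /eqP->]]|/andP[uS vS]]; last exact: cS.
  by rewrite ct_alE; case: ifP => _; [exact: connect0|exact: cn_al].
move: uU; rewrite inE => /norP[uv uw]; rewrite ex_si_off //.
by apply: cn_si; case: UE => ->.
Qed.

Lemma ex_connect_w :
  connect (mrel al si w) =2 connect (merge (mrel ct_al ex_si (v0 :|: w)) (b |: v0)).
Proof.
have [ya' yb' ra' rb' a_b'] := And5 ya yb ra rb a_b.
have v0w x : x \in v0 -> x \notin w by move=> xv; apply/negP; exact: disj.
have st := sstable_porbit si b; have st0 := sstable_porbit si r.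
have eab : cn al si w a b by apply: cn_al.
have sym := mrel_sym al st.
have va x : x \in v0 -> cn al si w x a.
  move=> xv; apply: cn_porbit => //; first exact: v0w.
  by move: av0 xv; rewrite /v0 -!eq_porbit_mem => /eqP-> /eqP->.
have ta x : x \in b |: v0 -> cn al si w x a.
  by rewrite !inE => /orP[/eqP->|/va //]; rewrite sym; exact: eab.
apply: ex_connect_vw => //.
- by right.
- by rewrite inE av0 orbT.
- by rewrite inE set11.
- by move=> x; rewrite !inE => /orP[->|->]; rewrite ?orbT.
- move=> u uw; rewrite inE (negbTE uw) orbF => uv.
  by rewrite inE (st0 u) uv orbT.
by move=> u v /ta ua /ta; rewrite sym => va'; exact: connect_trans ua va'.
Qed.

Lemma ex_connect_root :
  connect (mrel al si v0) =2 connect (merge (mrel ct_al ex_si (v0 :|: w)) (a |: w)).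
Proof.
have [ya' yb' ra' rb' a_b'] := And5 ya yb ra rb a_b.
have v0w x : x \in w -> x \notin v0 by move=> xw; apply/negP=> /disj; exact.
have st := sstable_porbit si b; have st0 := sstable_porbit si r.
have eab : cn al si v0 a b by apply: cn_al.
have sym := mrel_sym al st0.
have va x : x \in w -> cn al si v0 x b.
  move=> xv; apply: cn_porbit => //; first exact: v0w.
  by rewrite porbit_sym.
have ta x : x \in a |: w -> cn al si v0 x b.
  by rewrite !inE => /orP[/eqP->|/va //].
apply: ex_connect_vw => //.
- by left.
- by rewrite inE set11.
- by rewrite inE bw orbT.
- by move=> x; rewrite !inE => /orP[->|->]; rewrite ?orbT.
- move=> u uw; rewrite inE (negbTE uw) /= => uv.
  by rewrite inE (st u) uv orbT.
by move=> u v /ta ua /ta; rewrite sym => va'; exact: connect_trans ua va'.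
Qed.

Lemma ex_isolated U x z : x \in [set a; b] -> cn ct_al ex_si U x z -> z = x.
Proof.
have [ya' yb' ra' rb' a_b'] := And5 ya yb ra rb a_b.
move=> xab; apply: connect_fix => u; rewrite /mrel; move: xab.
by rewrite !inE => /orP[]/eqP->; rewrite ?ct_ala ?ct_alb ?ex_sia ?ex_sib => /orP[/eqP|/andP[_ /eqP]].
Qed.

Lemma ex_planar : planar ct_al ex_si = planar al si.
Proof.
have sym := mrel_sym ct_al (sstable0 ex_si).
rewrite /planar euler_ex; have -> : ncomp ct_al ex_si = ncomp al si + 2.
  rewrite /ncomp (ncl_merge3 r a b sym) (eq_ncl (ex_connect (sstable0 si) _ _)) ?inE //.
  case E1 : (connect _ r a).
    have aS : a \in [set a; b] by rewrite !inE eqxx.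
    by rewrite sym in E1; move: ra; rewrite (ex_isolated aS E1) eqxx.
  case E2 : (connect _ a b).
    have aS : a \in [set a; b] by rewrite !inE eqxx.
    by move: ab; rewrite (ex_isolated aS E2) eqxx.
  case E3 : (connect _ r b) => /=; last by lia.
  have bS : b \in [set a; b] by rewrite !inE eqxx orbT.
  by rewrite sym in E3; move: rb; rewrite (ex_isolated bS E3) eqxx.
by apply/eqP/eqP; lia.
Qed.

Let m := #|w|.-1.

Let w_gt0 : 0 < #|w|. Proof. by rewrite lt0n card_porbit_neq0. Qed.
Let v_gt0 : 0 < #|v0|. Proof. by rewrite lt0n card_porbit_neq0. Qed.

Lemma ex_iter_w k : 0 < k -> k <= m -> iter k ex_si r = iter k si b.
Proof.
case: k => // k _; elim: k => [|k IH] km.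
  rewrite /= ex_siE (negbTE ra) (negbTE rb); case: (altP (r =P y)) => [E|_].
    case: yr_or => [[sb _]|[_ [yw _]]]; last by case: (disj rv0); rewrite E.
    move: km; rewrite /m /w.
    have -> : porbit si b = [set b].
      apply/eqP; rewrite eqEsubset sub1set porbit_id andbT porbit_subset ?set11 //.
      by move=> z; rewrite !inE => /eqP->.
    by rewrite cards1.
  by rewrite eqxx.
rewrite iterS IH; last exact: ltnW.
have zw : iter k.+1 si b \in w by rewrite -permX mem_porbit.
have zb : iter k.+1 si b != b.
  apply/eqP=> E; have := @iter_porbit_inj _ si b k.+1 0; rewrite E => H.
  have E3 : k.+1 = 0%N by apply: H => //; rewrite -/w; move: km; rewrite /m; lia.
  by [].
rewrite [RHS]iterS ex_siE (negbTE zb).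
case: (altP (_ =P a)) => [E|_]; first by case: (disj av0); rewrite -E.
case: (altP (_ =P y)) => [E|_].
  have E2 : iter k.+2 si b = b.
    case: yr_or => [[_ yr]|[_ [_ yE]]]; last by rewrite iterS E yE.
    by case: (disj rv0); rewrite -yr -E.
  have := @iter_porbit_inj _ si b k.+2 0; rewrite E2 => H.
  have E3 : k.+2 = 0%N by apply: H => //; rewrite -/w; move: km; rewrite /m; lia.
  by [].
by case: (altP (_ =P r)) => [E|_] //; case: (disj rv0); rewrite -E.
Qed.

Lemma ex_iter_last : iter m ex_si r = y.
Proof.
have wE : iter m.+1 si b = b by rewrite /m prednK // iter_porbit.
case E : m => [|k].
  case: yr_or => [[_ ->]//|[sb _]].
  by move: wE; rewrite E /= => /eqP; rewrite (negbTE sb).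
rewrite ex_iter_w ?E //; case: yr_or => [[/eqP sb _]|[sb [_ yE]]].
  have := @iter_porbit_inj _ si b 1 0; rewrite /= sb => H.
  have E3 : 1%N = 0%N by apply: H => //; rewrite -/w; move: E; rewrite /m; lia.
  by [].
by apply: (@perm_inj _ si); rewrite yE -iterS -E.
Qed.

Lemma ex_iter_v j : 0 < j -> j < #|v0| -> iter (m + j) ex_si r = iter j.+1 si r.
Proof.
case: j => // j _; elim: j => [|j IH] jv.
  rewrite addn1 iterS ex_iter_last ex_siE (negbTE ya) (negbTE yb) eqxx //.
rewrite addnS iterS IH; last exact: ltnW.
set z := iter j.+2 si r.
have zv : z \in v0 by rewrite /z -permX mem_porbit.
have zr : z != r.
  apply/eqP=> E; have := @iter_porbit_inj _ si r j.+2 0; rewrite -/z E => H.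
  have E3 : j.+2 = 0%N by apply: H.
  by [].
have za : z != a.
  apply/eqP=> E; have := @iter_porbit_inj _ si r j.+2 1; rewrite -/z E => H.
  have E3 : j.+2 = 1%N by apply: H => //; exact: ltn_trans jv.
  by [].
rewrite ex_siE (negbTE za) (negbTE zr).
case: (altP (_ =P b)) => [E|_]; first by case: (disj zv); rewrite E.
case: (altP (_ =P y)) => [E|_] //.
case: yr_or => [[_ yr]|[_ [yw _]]]; first by move: zr; rewrite E yr eqxx.
by case: (disj zv); rewrite E.
Qed.

Lemma ex_porbit : porbit ex_si r = (v0 :|: w) :\ a :\ b.
Proof.
apply/eqP; rewrite eqEsubset; apply/andP; split.
  apply: porbit_subset; first by rewrite !inE rb ra rv0.
  move=> z; rewrite !in_setD1 ex_vw_stable => /and3P[zb za ->].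
  rewrite andbT -{1}ex_sib -{1}ex_sia !(inj_eq perm_inj).
  by rewrite zb za.
apply/subsetP=> z; rewrite !in_setD1 => /and3P[zb za]; rewrite inE => /orP[].
  move=> zv; have := zv; rewrite /v0 porbit_traject => /trajectP[[|[|j]] jv zE].
  - by rewrite zE /= porbit_id.
  - by rewrite zE /= -/a eqxx in za.
  by rewrite zE -ex_iter_v //; [rewrite -permX mem_porbit | exact: ltnW].
move=> zv; have := zv; rewrite /w porbit_traject => /trajectP[[|j] jv zE].
  by rewrite zE /= eqxx in zb.
rewrite zE -ex_iter_w //; first by rewrite -permX mem_porbit.
by rewrite /m /w; lia.
Qed.

Lemma card_ex_porbit : #|porbit ex_si r| = m + #|v0|.-1.
Proof.
have disj0 : v0 :&: w = set0.
  by apply/setP=> x; rewrite !inE; apply/negP => /andP[]; exact: disj.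
have h1 : b \in (v0 :|: w) :\ a by rewrite !inE ab bw orbT.
have h2 : a \in (v0 :|: w) by rewrite !inE av0.
rewrite ex_porbit; have := cardsD1 b ((v0 :|: w) :\ a).
have := cardsD1 a (v0 :|: w); rewrite h1 h2 cardsU disj0 cards0 /m.
by move: w_gt0 v_gt0; set p1 := #|w|; set p2 := #|v0|; lia.
Qed.

Lemma ex_vw_cn : connect (mrel ct_al ex_si (v0 :|: w)) =2
  connect (mrel ct_al ex_si (porbit ex_si r)).
Proof.
have [ya' yb' ra' rb' a_b'] := And5 ya yb ra rb a_b.
apply: eq_connect => u z; rewrite /mrel ex_porbit !in_setD1.
case: (altP (u =P a)) => [->|_] /=.
  by rewrite ct_ala ex_sia andbF /= inE av0 /= orbF orbb.
case: (altP (u =P b)) => [->|_] //=.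
by rewrite ct_alb ex_sib inE bw orbT /= orbF orbb.
Qed.

End ExpandStep.
End Steps.

(** * Codes of rooted planar maps *)

(** [Loop] keeps the two sides of a root loop. [Expand c i] keeps the contracted map and the number
    [i] of its root darts that came from the far end of the root edge. *)
Inductive code := Vtx | Loop of code & code | Expand of code & nat.

Lemma code_comparable : comparable code.
Proof. by move=> c d; rewrite /decidable; decide equality; exact: eq_comparable. Qed.
HB.instance Definition _ := hasDecEq.Build code (compareP code_comparable).

Fixpoint csize c := match c with
  | Vtx => 0
  | Loop c1 c2 => (csize c1 + csize c2).+1
  | Expand c1 _ => (csize c1).+1
  end.

Fixpoint deg c := match c with
  | Vtx => 0
  | Loop c1 c2 => (deg c1 + deg c2).+2
  | Expand c1 i => (deg c1 - i).+1
  end.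

Fixpoint valid c := match c with
  | Vtx => true
  | Loop c1 c2 => valid c1 && valid c2
  | Expand c1 i => (i <= deg c1) && valid c1
  end.

(** 0 is the class of the root edge. Whatever is linked to the far vertex is absorbed into it, and
    the shift keeps the other labels away from 0. *)
Definition fold_lab (z : seq nat) x := if x \in z then 0 else x.+1.

(** Only equality of labels has a meaning. For a loop, 0 marks its own two darts and parity keeps
    its two sides apart. *)
Fixpoint lab c : seq nat := match c with
  | Vtx => [::]
  | Loop c1 c2 => 0 :: [seq x.*2.+1 | x <- lab c1]
                   ++ 0 :: [seq x.*2.+2 | x <- lab c2]
  | Expand c1 i =>
      0 :: [seq fold_lab (take i (lab c1)) x | x <- drop i (lab c1)]
  end.

(** No block of the root vertex is exhausted by the first [i] darts. If these are the darts of the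
    far end, then each of them is linked to the near end, so the far end is not a cut vertex. *)
Definition noblk c i := all (mem (drop i (lab c))) (take i (lab c)).

Fixpoint xo c := match c with
  | Vtx => 0
  | Loop c1 c2 => xo c1 + xo c2
  | Expand c1 i => xo c1 + ~~ noblk c1 i
  end.

Lemma size_lab c : size (lab c) = deg c.
Proof.
elim: c => //= [c1 IH1 c2 IH2|c1 IH1 i].
  by rewrite size_cat /= !size_map IH1 IH2 addnS.
by rewrite size_map size_drop IH1.
Qed.

Lemma deg0 c : (deg c == 0) = (c == Vtx).
Proof. by case: c => [|c1 c2|c i]; apply/esym/eqP. Qed.

Definition noncut c := constant (lab c).
Definition xc c := xo c + ~~ noncut c.

Lemma constantPn (s : seq nat) :
  reflect (forall p q, p < size s -> q < size s -> nth 0 s p = nth 0 s q) (constant s).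
Proof.
case: s => [|x s]; first by apply: ReflectT.
apply: (iffP allP) => [H p q|H y].
  suff K k : k < size (x :: s) -> nth 0 (x :: s) k = x by move=> /K-> /K->.
  case: k => // k ks; exact/eqP/H/mem_nth.
case/(nthP 0) => k ks <-; rewrite /= eq_sym; apply/eqP.
exact: (H 0 k.+1).
Qed.

Section Codes.
Variable T : finType.
Implicit Types (al si : {perm T}) (r x y : T) (U V : {set T}).

Fixpoint code_of (f : nat) al si r : code :=
  if f isn't f'.+1 then Vtx else
  if si r == r then Vtx else
  if al (si r) \in porbit si r then
    Loop (code_of f' (ct_al al si r) (lp_si al si r) (si r))
         (code_of f' (ct_al al si r) (lp_si al si r) (al (si r)))
  else Expand (code_of f' (ct_al al si r) (ex_si al si r) r)
              #|porbit si (al (si r))|.-1.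

(** The graph of [code_of] without its fuel, so that invariants can be proved by induction on the
    decomposition. *)
Inductive isCode : code -> {perm T} -> {perm T} -> T -> Prop :=
| isVtx al si r : si r = r -> isCode Vtx al si r
| isLoop c1 c2 al si r : si r != r -> al (si r) \in porbit si r ->
    isCode c1 (ct_al al si r) (lp_si al si r) (si r) ->
    isCode c2 (ct_al al si r) (lp_si al si r) (al (si r)) ->
    isCode (Loop c1 c2) al si r
| isExpand c al si r : si r != r -> al (si r) \notin porbit si r ->
    isCode c (ct_al al si r) (ex_si al si r) r ->
    isCode (Expand c #|porbit si (al (si r))|.-1) al si r.

Lemma isCode_code_of c al si r : isCode c al si r ->
  forall f, csize c <= f -> code_of f al si r = c.
Proof.
elim=> {c al si r} [al si r E|c1 c2 al si r ar ins _ IH1 _ IH2|c al si r ar nins _ IH] [|f] //=.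
- by rewrite E eqxx.
- by move=> le; rewrite (negbTE ar) ins IH1 ?IH2 //; lia.
by move=> le; rewrite (negbTE ar) (negbTE nins) IH.
Qed.

Lemma good_ab al si r : good al si r -> si r != r -> al (si r) != si r.
Proof.
move=> [_ _ H] ar; apply: H => //; exact/cn0_porbit/mem_porbit1.
Qed.

Lemma good_loop al si r : good al si r -> planar al si -> si r != r ->
  al (si r) \in porbit si r ->
  [/\ good (ct_al al si r) (lp_si al si r) (si r),
      good (ct_al al si r) (lp_si al si r) (al (si r)),
      planar (ct_al al si r) (lp_si al si r) &
      ~~ cn (ct_al al si r) (lp_si al si r) set0 (si r) (al (si r))].
Proof.
move=> g pl ar ins; have ab := good_ab g ar; have [inv rl leg] := g.
have [pl' sep] := lp_planar_sep inv rl ar ab ins pl.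
have symm := mrel_sym (ct_al al si r) (sstable0 (lp_si al si r)).
have cninv : involutive (ct_al al si r) by apply: ct_al_inv.
have legs x : cn (ct_al al si r) (lp_si al si r) set0 (si r) x
    || cn (ct_al al si r) (lp_si al si r) set0 (al (si r)) x ->
    cn al si set0 r x.
  rewrite (lp_connect inv rl ar ab (sstable0 si)) ?inE //.
  rewrite connect_merge // => H; apply/orP; right; apply/andP; split.
    by rewrite touches_in // !inE eqxx.
  apply/touchesP; case/orP: H => H; [exists (si r)|exists (al (si r))];
    by rewrite ?inE ?eqxx ?orbT // symm.
have rr x : cn (ct_al al si r) (lp_si al si r) set0 r x -> x = r.
  exact: lp_isolated.
split=> //; split=> //; rewrite ?ct_alE ?eqxx ?orbT // => x cx xr.
  have xb : x != al (si r).
    by apply/eqP=> E; case/negP: sep; rewrite E in cx.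
  rewrite ct_alE // (negbTE xr) (negbTE xb) /=; apply: leg.
    by apply: legs; rewrite cx.
  apply/eqP=> E; rewrite E symm in cx.
  by move: ar; rewrite (rr _ cx) eqxx.
have xb : x != si r.
  by apply/eqP=> E; case/negP: sep; rewrite symm; rewrite E in cx.
rewrite ct_alE // (negbTE xr) (negbTE xb) /=; apply: leg.
  by apply: legs; rewrite cx orbT.
apply/eqP=> E; rewrite E symm in cx.
have := rr _ cx => E2; move: ar.
by rewrite -(inj_eq (@perm_inj _ al)) E2 rl eqxx.
Qed.

Lemma comp_expand0 al si r x : involutive al -> al r = r -> si r != r ->
  al (si r) != si r -> al (si r) \notin porbit si r ->
  cn al si set0 r x = [|| cn (ct_al al si r) (ex_si al si r) set0 r x,
     x == si r | x == al (si r)].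
Proof.
move=> inv rl ar ab nins.
have symm := mrel_sym (ct_al al si r) (sstable0 (ex_si al si r)).
rewrite (ex_connect inv rl ar ab nins (sstable0 si)) ?inE //.
rewrite connect_merge // touches_in ?inE ?eqxx //=.
case c : (connect _ r x) => //=; apply/touchesP/orP => [[s]|[]/eqP->].
- rewrite !inE => /orP[/orP[]|] /eqP-> cs.
  + by rewrite symm c in cs.
  + left; rewrite symm in cs; apply/eqP; apply: (ex_isolated inv rl ar ab nins _ cs).
    by rewrite !inE eqxx.
  right; rewrite symm in cs; apply/eqP; apply: (ex_isolated inv rl ar ab nins _ cs).
  by rewrite !inE eqxx orbT.
- by exists (si r); rewrite ?inE ?eqxx ?orbT.
by exists (al (si r)); rewrite ?inE ?eqxx ?orbT.
Qed.

Lemma comp_expand al si r x : good al si r -> si r != r ->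
  al (si r) \notin porbit si r ->
  cn al si set0 r x = [|| cn (ct_al al si r) (ex_si al si r) set0 r x,
     x == si r | x == al (si r)].
Proof.
move=> g ar nins; have ab := good_ab g ar; have [inv rl leg] := g.
exact: comp_expand0.
Qed.

Lemma good_expand al si r : good al si r -> si r != r ->
  al (si r) \notin porbit si r ->
  good (ct_al al si r) (ex_si al si r) r.
Proof.
move=> g ar nins; have ab := good_ab g ar; have [inv rl leg] := g.
have symm := mrel_sym (ct_al al si r) (sstable0 (ex_si al si r)).
split; first by apply: ct_al_inv.
  rewrite ct_alE // rl; by case: ifP.
move=> x cx xr; have iso z : z \in [set si r; al (si r)] -> x != z.
  move=> zS; apply/eqP=> E; rewrite E symm in cx.
  have E2 := ex_isolated inv rl ar ab nins zS cx.
  by move: xr; rewrite E -E2 eqxx.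
rewrite ct_alE // (negbTE (iso _ _)) ?inE ?eqxx // (negbTE (iso _ _)) ?inE ?eqxx ?orbT //=.
by apply: leg => //; rewrite comp_expand // cx.
Qed.

Definition nmoved al := #|[set x | al x != x]|.

Lemma nmoved_ct al si r : good al si r -> si r != r ->
  nmoved (ct_al al si r) < nmoved al.
Proof.
move=> g ar; have ab := good_ab g ar; have [inv rl leg] := g.
apply: proper_card; apply/properP; split.
  by apply/subsetP => x; rewrite !inE ct_alE //; case: ifP => //; rewrite eqxx.
by exists (si r); rewrite !inE // ct_alE // eqxx eqxx.
Qed.

(** Every reduction lowers the number of darts moved by [al], which therefore suffices as fuel. *)
Lemma isCodeP al si r f : good al si r -> planar al si -> nmoved al <= f ->
  isCode (code_of f al si r) al si r.
Proof.
elim: f al si r => [|f IH] al si r g pl le /=.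
  apply: isVtx; apply/eqP/negPn/negP => ar; have := nmoved_ct g ar; lia.
case: (altP (si r =P r)) => [E|ar]; first exact: isVtx.
have lt : nmoved (ct_al al si r) <= f by have := nmoved_ct g ar; lia.
case: ifP => ins.
  have [g1 g2 pl' _] := good_loop g pl ar ins.
  by apply: isLoop => //; apply: IH.
have ab := good_ab g ar; have [inv rl leg] := g.
apply: isExpand; rewrite ?ins //; apply: IH => //; first by apply: good_expand; rewrite ?ins.
by rewrite ex_planar ?ins.
Qed.

(** Goodness and planarity pass to the reduced maps; carrying them here leaves three bare cases to
    every later induction. *)
Lemma isCode_good_ind (P : code -> {perm T} -> {perm T} -> T -> Prop) :
  (forall al si r, good al si r -> planar al si -> si r = r -> P Vtx al si r) ->
  (forall c1 c2 al si r, good al si r -> planar al si -> si r != r ->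
     al (si r) \in porbit si r ->
     isCode c1 (ct_al al si r) (lp_si al si r) (si r) ->
     isCode c2 (ct_al al si r) (lp_si al si r) (al (si r)) ->
     P c1 (ct_al al si r) (lp_si al si r) (si r) ->
     P c2 (ct_al al si r) (lp_si al si r) (al (si r)) ->
     P (Loop c1 c2) al si r) ->
  (forall c al si r, good al si r -> planar al si -> si r != r ->
     al (si r) \notin porbit si r ->
     isCode c (ct_al al si r) (ex_si al si r) r ->
     P c (ct_al al si r) (ex_si al si r) r ->
     P (Expand c #|porbit si (al (si r))|.-1) al si r) ->
  forall c al si r, isCode c al si r -> good al si r -> planar al si ->
    P c al si r.
Proof.
move=> PV PL PE c al si r; elim=> {c al si r}.
- by move=> al si r E g pl; apply: PV.
- move=> c1 c2 al si r ar ins C1 IH1 C2 IH2 g pl.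
  have [g1 g2 pl' _] := good_loop g pl ar ins.
  by apply: PL => //; [apply: IH1|apply: IH2].
move=> c al si r ar nins C IH g pl.
have ab := good_ab g ar; have [inv rl leg] := g.
apply: PE => //; apply: IH; first exact: good_expand.
by rewrite ex_planar.
Qed.

Lemma fix_porbit si r : si r = r -> porbit si r = [set r].
Proof.
move=> E; apply/eqP; rewrite eqEsubset sub1set porbit_id andbT porbit_subset ?set11 //.
by move=> z; rewrite !inE => /eqP->; rewrite E.
Qed.

Lemma loop_index al si r : al (si r) \in porbit si r ->
  exists2 k, iter k si r = al (si r) & k < #|porbit si r|.
Proof.
by rewrite porbit_traject => /trajectP[k kv kE]; exists k.
Qed.

Lemma isCode_deg c al si r : isCode c al si r -> good al si r -> planar al si ->
  #|porbit si r| = (deg c).+1 /\ valid c.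
Proof.
move: c al si r; apply: isCode_good_ind => [al si r _ _ E|c1 c2 al si r g pl ar ins _ _ [IH1 v1] [IH2 v2]|c al si r g pl ar nins _ [IH v]].
- by rewrite fix_porbit // cards1.
- have ab := good_ab g ar; have [inv rl leg] := g.
  have [k kE kv] := loop_index ins.
  rewrite (card_lp_a inv rl ar ab ins kE kv) in IH1.
  rewrite (card_lp_b inv rl ar ab ins kE kv) in IH2.
  by rewrite /= v1 v2; split=> //; lia.
have ab := good_ab g ar; have [inv rl leg] := g.
rewrite (card_ex_porbit inv rl ar ab nins) in IH.
have w0 : 0 < #|porbit si (al (si r))| by rewrite lt0n card_porbit_neq0.
have v0 : 1 < #|porbit si r|.
  have := subset_leq_card (_ : [set r; si r] \subset porbit si r).
  rewrite cards2 eq_sym ar => -> //.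
  by rewrite subUset !sub1set porbit_id mem_porbit1.
by rewrite /= v andbT; split; lia.
Qed.

Definition comp al si r := [set x | cn al si set0 r x].

Lemma comp_loop0 al si r x : involutive al -> al r = r -> si r != r ->
  al (si r) != si r -> al (si r) \in porbit si r ->
  cn al si set0 r x = [|| x == r, cn (ct_al al si r) (lp_si al si r) set0 (si r) x
    | cn (ct_al al si r) (lp_si al si r) set0 (al (si r)) x].
Proof.
move=> inv rl ar ab ins.
have symm := mrel_sym (ct_al al si r) (sstable0 (lp_si al si r)).
rewrite (lp_connect inv rl ar ab (sstable0 si)) ?inE //.
rewrite connect_merge // touches_in ?inE ?eqxx //=.
apply/orP/or3P => [[c|/touchesP[s]]|].
- by constructor 1; apply/eqP; apply: lp_isolated c.
- rewrite !inE => /orP[/orP[]|] /eqP-> ; rewrite symm => c.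
  + by constructor 1; apply/eqP; apply: lp_isolated c.
  + by constructor 2.
  by constructor 3.
case=> [/eqP->|c|c]; [left; exact: connect0|right|right]; apply/touchesP.
  by exists (si r); rewrite ?inE ?eqxx ?orbT // symm.
by exists (al (si r)); rewrite ?inE ?eqxx ?orbT // symm.
Qed.

Lemma comp_loop al si r x : good al si r -> planar al si -> si r != r ->
  al (si r) \in porbit si r ->
  cn al si set0 r x = [|| x == r, cn (ct_al al si r) (lp_si al si r) set0 (si r) x
    | cn (ct_al al si r) (lp_si al si r) set0 (al (si r)) x].
Proof.
move=> g pl ar ins; have ab := good_ab g ar; have [inv rl leg] := g.
exact: comp_loop0.
Qed.

(** Two darts for each edge, and one for the leg. *)
Lemma isCode_size c al si r : isCode c al si r -> good al si r -> planar al si ->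
  #|comp al si r| = (2 * csize c).+1.
Proof.
move: c al si r; apply: isCode_good_ind => [al si r [_ rl _] _ E|c1 c2 al si r g pl ar ins _ _ IH1 IH2|c al si r g pl ar nins _ IH].
- rewrite muln0 (_ : comp al si r = [set r]) ?cards1 //.
  apply/setP=> x; rewrite !inE; apply/idP/eqP => [|->]; last exact: connect0.
  by apply: connect_fix => z; rewrite /mrel rl E => /orP[/eqP|/andP[_ /eqP]].
- have [g1 g2 pl' sep] := good_loop g pl ar ins.
  have symm := mrel_sym (ct_al al si r) (sstable0 (lp_si al si r)).
  have ab := good_ab g ar; have [inv rl leg] := g.
  have -> : comp al si r = r |: (comp (ct_al al si r) (lp_si al si r) (si r)
      :|: comp (ct_al al si r) (lp_si al si r) (al (si r))).
    by apply/setP=> x; rewrite !inE comp_loop.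
  rewrite cardsU1 cardsU IH1 IH2 disjoint_setI0 ?cards0.
    rewrite !inE; case c1r : (connect _ _ r).
      by rewrite symm in c1r; have := ar; rewrite (lp_isolated inv rl ar ab c1r) eqxx.
    case c2r : (connect _ _ r) => /=; last by lia.
    rewrite symm in c2r; have E := lp_isolated inv rl ar ab c2r.
    by move: ar; rewrite -(inj_eq (@perm_inj _ al)) E rl eqxx.
  rewrite -setI_eq0; apply/eqP/setP=> x; rewrite !inE; apply/negP=> /andP[c1x c2x].
  by move/negP: sep; apply; rewrite symm in c2x; exact: connect_trans c1x c2x.
have symm := mrel_sym (ct_al al si r) (sstable0 (ex_si al si r)).
have ab := good_ab g ar; have [inv rl leg] := g.
have -> : comp al si r = si r |: (al (si r) |: comp (ct_al al si r) (ex_si al si r) r).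
  by apply/setP=> x; rewrite !inE comp_expand // orbC -orbA.
rewrite !cardsU1 IH !inE eq_sym (negbTE ab) /=.
case c1r : (connect _ _ (si r)).
  rewrite symm in c1r; have := ex_isolated inv rl ar ab nins _ c1r.
  by rewrite !inE eqxx => /(_ isT) E; move: ar; rewrite -E eqxx.
case c2r : (connect _ _ (al (si r))) => /=; last by lia.
rewrite symm in c2r; have := ex_isolated inv rl ar ab nins _ c2r.
rewrite !inE eqxx orbT => /(_ isT) E.
by move: ar; rewrite -(inj_eq (@perm_inj _ al)) -E rl eqxx.
Qed.

End Codes.

Lemma fold_lab_eq z x y :
  (fold_lab z x == fold_lab z y) = (x == y) || (x \in z) && (y \in z).
Proof.
rewrite /fold_lab; case: (boolP (x \in z)) => xz; case: (boolP (y \in z)) => yz;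
  rewrite ?eqxx ?orbT ?orbF ?eqSS //=.
  by apply/esym/negbTE; apply: contra yz => /eqP<-.
by apply/esym/negbTE; apply: contra xz => /eqP->.
Qed.

(** * Blocks and cut vertices under contraction of the root edge *)

Section Stats.
Variable T : finType.
Implicit Types (al si : {perm T}) (r x y z : T) (U V : {set T}).

Lemma cn_off al si U V x y : V \subset U ->
  (forall z, z \in U -> z \notin V -> ~~ cn al si set0 x z) ->
  cn al si U x y = cn al si V x y.
Proof.
move=> VU off; apply/idP/idP.
  apply: connect_sub => u v /orP[/eqP->|/andP[uU /eqP->]]; first exact: cn_al.
  by apply: cn_si; apply: contra uU; apply/subsetP.
case/connectP=> p; suff H x' : cn al si set0 x x' -> path (mrel al si V) x' p ->
    y = last x' p -> cn al si U x' y by apply: H; exact: connect0.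
elim: p x' => [|z p IH] x' xx' /=; first by move=> _ ->.
case/andP=> xz pz lst.
have sub : cn al si set0 x' z := cn_sub0 (connect1 xz).
have xz0 := connect_trans xx' sub.
apply: connect_trans (IH z xz0 pz lst); case/orP: xz => [/eqP->|/andP[xV /eqP->]].
  exact: cn_al.
by apply: cn_si; apply: contraL xx' => xU; exact: off.
Qed.

Lemma cn_iso al si U x y : al x = x -> x \in U -> cn al si U x y -> y = x.
Proof.
move=> alx xU; apply: connect_fix => z; rewrite /mrel alx xU orbF.
by move/eqP.
Qed.

Lemma cn_iter al si x k : cn al si set0 x (iter k si x).
Proof. by apply: cn0_porbit; rewrite -permX mem_porbit. Qed.

Definition cutv al si (v : {set T}) := [exists x in v, exists y in v, ~~ cn al si v x y].

(** Restricted to the component of [r], since the permutations also carry the other side of a loop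
    and the consumed darts. *)
Definition nrcut al si r := [set v in porbits si |
  [&& r \notin v, [exists x in v, cn al si set0 r x] & cutv al si v]].

Section ExpandStats.
Variables (c : code) (al si : {perm T}) (r : T).
Hypothesis g : good al si r.
Hypothesis pl : planar al si.
Hypothesis ar : si r != r.
Hypothesis nins : al (si r) \notin porbit si r.
Hypothesis ic : isCode c (ct_al al si r) (ex_si al si r) r.
Local Notation a := (si r).
Local Notation b := (al (si r)).
Local Notation v0 := (porbit si r).
Local Notation w := (porbit si b).
Local Notation m := #|w|.-1.
Local Notation ct := (ct_al al si r).
Local Notation ex := (ex_si al si r).
Local Notation v1 := (porbit ex r).

Hypothesis IH : forall p q, p < deg c -> q < deg c ->
  (nth 0 (lab c) p == nth 0 (lab c) q) =
  cn ct ex v1 (iter p.+1 ex r) (iter q.+1 ex r).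

Let ab := good_ab g ar.
Let inv : involutive al. Proof. by case: g. Qed.
Let rl : al r = r. Proof. by case: g. Qed.
Let g' := good_expand g ar nins.
Let pl' : planar ct ex. Proof. by rewrite ex_planar. Qed.
Let sym1 := mrel_sym ct (sstable_porbit ex r).
Let v1E : v1 = (v0 :|: w) :\ a :\ b := ex_porbit inv rl ar ab nins.
Let vwE : cn ct ex (v0 :|: w) =2 cn ct ex v1 := ex_vw_cn inv rl ar ab nins.

Lemma ex_deg : (deg c).+1 = m + #|v0|.-1.
Proof.
have [<- _] := isCode_deg ic g' pl'.
exact: card_ex_porbit.
Qed.

Lemma ex_card_v0 : 1 < #|v0|.
Proof.
have := subset_leq_card (_ : [set r; a] \subset v0).
rewrite cards2 eq_sym ar => -> //.
by rewrite subUset !sub1set porbit_id mem_porbit1.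
Qed.

Lemma ex_le_deg : m <= deg c.
Proof. by have := ex_deg; have := ex_card_v0; lia. Qed.

Let iterW k : k < m -> iter k.+1 ex r = iter k.+1 si b.
Proof. by move=> km; rewrite (ex_iter_w inv rl ar ab nins). Qed.

Let iterV j : j < deg c - m -> iter (m + j).+1 ex r = iter j.+2 si r.
Proof.
move=> jd; rewrite -addnS (ex_iter_v inv rl ar ab nins) //.
by have := ex_deg; lia.
Qed.

Let iso x z : x \in [set a; b] -> cn ct ex v1 x z -> z = x.
Proof. exact: ex_isolated. Qed.

Let iso_r z : cn ct ex v1 r z -> z = r.
Proof.
apply: cn_iso; last exact: porbit_id.
by have [] := g'.
Qed.

Let av1 z : z \in v1 -> z \notin [set a; b].
Proof. by rewrite v1E !in_setD1 !inE negb_or => /and3P[-> ->]. Qed.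

Let cx_v1 k : iter k ex r \in v1. Proof. by rewrite -permX mem_porbit. Qed.

Let not_iso z s : z \in v1 -> s \in [set a; b] -> cn ct ex v1 z s -> False.
Proof.
move=> zv sS; rewrite sym1 => /(iso sS) E.
by have := av1 zv; rewrite E sS.
Qed.

Let cx_r p : p < deg c -> iter p.+1 ex r != r.
Proof.
move=> pd; apply/eqP=> E; have := @iter_porbit_inj _ ex r p.+1 0 E.
have [-> _] := isCode_deg ic g' pl'.
by rewrite ltnS pd => /(_ isT isT).
Qed.

(** The darts of the far vertex occupy the first [m] places of the contracted root vertex, so being
    linked to one of them means sharing a label with this prefix. *)
Lemma touch_w q : q < deg c ->
  touches (mrel ct ex (v0 :|: w)) (a |: w) (iter q.+1 ex r) =
  (nth 0 (lab c) q \in take m (lab c)).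
Proof.
move=> qd; have zv := cx_v1 q.+1; have le := ex_le_deg.
apply/touchesP/idP => [[s]|].
  rewrite vwE !inE => /orP[/eqP->|sw] cs.
    by case: (not_iso zv _ cs); rewrite !inE eqxx.
  move: sw; rewrite porbit_traject => /trajectP[[|k] km sE]; move: cs; rewrite sE => cs.
    by case: (not_iso zv _ cs); rewrite !inE eqxx orbT.
  have km' : k < m by lia.
  rewrite -iterW // in cs; rewrite -IH // in cs; last exact: leq_trans km' le.
  rewrite (eqP cs) -(nth_take 0 km') mem_nth // size_take size_lab.
  by case: ifP; lia.
case/(nthP 0) => k; rewrite size_take size_lab => km.
have km' : k < m by move: km; case: ifP; lia.
rewrite nth_take // => E; exists (iter k.+1 si b).
  by rewrite inE -permX mem_porbit orbT.
rewrite vwE -iterW // -IH ?E //; exact: leq_trans km' le.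
Qed.

Lemma touch_v q : q < deg c ->
  touches (mrel ct ex (v0 :|: w)) (b |: v0) (iter q.+1 ex r) =
  (nth 0 (lab c) q \in drop m (lab c)).
Proof.
move=> qd; have zv := cx_v1 q.+1; have le := ex_le_deg; have dE := ex_deg.
have v02 := ex_card_v0.
apply/touchesP/idP => [[s]|].
  rewrite vwE !inE => /orP[/eqP->|sw] cs.
    by case: (not_iso zv _ cs); rewrite !inE eqxx orbT.
  move: sw; rewrite porbit_traject => /trajectP[[|[|k]] km sE]; move: cs; rewrite sE => cs.
  - rewrite [iter 0 _ _]/= sym1 in cs; have := iso_r cs => E.
    by have := cx_r qd; rewrite E eqxx.
  - by case: (not_iso zv _ cs); rewrite !inE eqxx.
  have km' : k < deg c - m by lia.
  rewrite -iterV // -IH // in cs; last by lia.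
  rewrite (eqP cs) -nth_drop mem_nth // size_drop size_lab //.
case/(nthP 0) => k; rewrite size_drop size_lab => km.
rewrite nth_drop => E; exists (iter k.+2 si r).
  by rewrite inE -permX mem_porbit orbT.
rewrite vwE -iterV // -IH ?E //; lia.
Qed.

(** With the near end blocked, the far vertex reunites all blocks that it meets; these are exactly
    the labels that [fold_lab] sends to 0. *)
Lemma expand_lab p q : p < deg (Expand c m) -> q < deg (Expand c m) ->
  (nth 0 (lab (Expand c m)) p == nth 0 (lab (Expand c m)) q) =
  cn al si v0 (iter p.+1 si r) (iter q.+1 si r).
Proof.
have symw : connect_sym (mrel ct ex (v0 :|: w)).
  by move=> x y; rewrite !vwE sym1.
have RE x y : cn al si v0 x y = cn ct ex v1 x y ||
   touches (mrel ct ex (v0 :|: w)) (a |: w) x &&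
   touches (mrel ct ex (v0 :|: w)) (a |: w) y.
  by rewrite (ex_connect_root inv rl ar ab nins) connect_merge // vwE.
have ta : touches (mrel ct ex (v0 :|: w)) (a |: w) a.
  by apply: touches_in; rewrite !inE eqxx.
have hd j : j < deg c - m ->
  (0 == nth 0 [seq fold_lab (take m (lab c)) l | l <- drop m (lab c)] j) =
  cn al si v0 a (iter j.+2 si r).
  move=> jd; rewrite (nth_map 0) ?size_drop ?size_lab // nth_drop RE ta andTb.
  rewrite -iterV // touch_w; last by have := ex_le_deg; lia.
  case c1 : (cn _ _ _ a _).
    rewrite sym1 in c1; case: (not_iso (cx_v1 _) _ c1).
    by rewrite !inE eqxx.
  by rewrite /fold_lab; case: ifP.
have symv0 := mrel_sym al (sstable_porbit si r).
rewrite /= !ltnS; case: p q => [|p] [|q] pd qd /=.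
- by rewrite connect0.
- exact: hd.
- by rewrite eq_sym symv0; exact: hd.
rewrite !(nth_map 0) ?size_drop ?size_lab // !nth_drop fold_lab_eq.
have le := ex_le_deg.
by rewrite RE -!iterS -!iterV // !touch_w -?IH //; lia.
Qed.

(** With the far end blocked, the near end gathers [b] and every dart linked to it. A dart of the
    far end escapes exactly if its label does not recur after the prefix. *)
Lemma expand_cutv : cutv al si w = ~~ noblk c m.
Proof.
have symw : connect_sym (mrel ct ex (v0 :|: w)).
  by move=> x y; rewrite !vwE sym1.
have RE x y : cn al si w x y = cn ct ex v1 x y ||
   touches (mrel ct ex (v0 :|: w)) (b |: v0) x &&
   touches (mrel ct ex (v0 :|: w)) (b |: v0) y.
  by rewrite (ex_connect_w inv rl ar ab nins) connect_merge // vwE.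
have tb : touches (mrel ct ex (v0 :|: w)) (b |: v0) b.
  by apply: touches_in; rewrite !inE eqxx.
have le := ex_le_deg.
apply/idP/idP.
  apply: contraL => /allP nb.
  suff tw x : x \in w -> touches (mrel ct ex (v0 :|: w)) (b |: v0) x.
    apply/negP => /exists_inP[x xw /exists_inP[y yw]].
    by rewrite RE !tw // orbT.
  rewrite porbit_traject => /trajectP[[|k] km ->] //.
  have km' : k < m by lia.
  rewrite -iterW // touch_v; last exact: leq_trans km' le.
  apply: nb; rewrite -(nth_take 0 km') mem_nth // size_take size_lab.
  by case: ifP; lia.
case/allPn => x /(nthP 0)[k]; rewrite size_take size_lab => km.
have km' : k < m by move: km; case: ifP; lia.
rewrite nth_take // => <- nb0; have kd := leq_trans km' le.
have nb : nth 0 (lab c) k \notin drop m (lab c) := nb0.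
rewrite -touch_v // in nb.
apply/exists_inP; exists b; first exact: porbit_id.
apply/exists_inP; exists (iter k.+1 si b); first by rewrite -permX mem_porbit.
rewrite RE tb -iterW // (negbTE nb) orbF; apply/negP; rewrite sym1.
by apply: not_iso; rewrite ?cx_v1 // !inE eqxx orbT.
Qed.

Let off_vw z : z \notin v0 -> z \notin w ->
  (forall x, x \in porbit si z -> (x \notin v0) && (x \notin w)) /\
  porbit ex z = porbit si z.
Proof.
move=> zv zw; have H x : x \in porbit si z -> (x \notin v0) && (x \notin w).
  case/porbitP=> i ->.
  by rewrite permX !(sstable_iter (sstable_porbit _ _)) zv zw.
split=> //; apply/esym; apply: eq_porbit_on => x /H /andP[h1 h2].
by rewrite (ex_si_off inv rl ar ab nins).
Qed.

Let cutv_off z : z \notin v0 -> z \notin w ->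
  cutv al si (porbit si z) = cutv ct ex (porbit si z).
Proof.
move=> zv zw; have [H pE] := off_vw zv zw; rewrite /cutv.
have st : sstable ex (porbit si z) by rewrite -pE; exact: sstable_porbit.
have symz := mrel_sym ct st.
have rz : r \notin porbit si z.
  by apply/negP=> /H; rewrite porbit_id.
have bz : b \notin porbit si z.
  by apply/negP=> /H; rewrite porbit_id andbF.
apply: eq_existsb => x; case xz : (x \in porbit si z) => //=.
apply: eq_existsb => y; case yz : (y \in porbit si z) => //=.
rewrite (ex_connect inv rl ar ab nins (sstable_porbit si z)) // connect_merge //.
have tr u : u \in porbit si z -> touches (mrel ct ex (porbit si z)) [set r; a; b] u ->
   cn ct ex (porbit si z) u r.
  move=> /H /andP[uv uw] /touchesP[s]; rewrite !inE => /orP[/orP[]|] /eqP-> //.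
    rewrite symz => cs; have := ex_isolated inv rl ar ab nins _ cs.
    by rewrite !inE eqxx => /(_ isT) E; rewrite E mem_porbit1 in uv.
  rewrite symz => cs; have := ex_isolated inv rl ar ab nins _ cs.
  by rewrite !inE eqxx orbT => /(_ isT) E; rewrite E porbit_id in uw.
congr (~~ _); case cxy : (connect _ x y) => //=.
apply/negbTE/negP => /andP[/(tr _ xz) xr /(tr _ yz)]; rewrite symz => yr.
by rewrite (connect_trans xr yr) in cxy.
Qed.

(** Contraction preserves the status of every vertex off the root edge, since the darts [a] and [b]
    it sets aside are isolated; the far end itself contributes the last term. *)
Lemma expand_nrcut :
  #|nrcut al si r| = #|nrcut ct ex r| + ~~ noblk c m.
Proof.
have symm := mrel_sym ct (sstable0 ex).
have iso0 z : z \in [set a; b] -> ~~ cn ct ex set0 r z.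
  move=> zS; apply/negP; rewrite symm => cz.
  have E := ex_isolated inv rl ar ab nins zS cz.
  move: zS; rewrite -E !inE eq_sym (negbTE ar) /= => /eqP E2.
  by move: ar; rewrite -(inj_eq (@perm_inj _ al)) -E2 rl eqxx.
have wn : w \notin nrcut ct ex r.
  apply/negP; rewrite inE => /andP[/imsetP[z _ wE]] /and3P[_ /exists_inP[x xw rx] _].
  have bE : ex b = b.
    by rewrite (ex_sib inv rl ar ab nins).
  have wE2 : w = [set b].
    have bz : b \in porbit ex z by rewrite -wE porbit_id.
    by rewrite wE -(fix_porbit bE); apply/esym/eqP; rewrite eq_porbit_mem.
  move: xw; rewrite wE2 inE => /eqP xb; have := iso0 b.
  by rewrite -xb rx !inE xb eqxx orbT => /(_ isT).
have -> : nrcut al si r = nrcut ct ex r :|: (if cutv al si w then [set w] else set0).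
  apply/setP=> v; rewrite in_setU; apply/idP/idP.
    rewrite inE => /andP[/imsetP[z _ ->]] /and3P[rz /exists_inP[x xz rx] cz].
    case zw : (z \in w).
      have E : porbit si z = w by apply/eqP; rewrite eq_porbit_mem.
      by move: cz; rewrite E => ->; rewrite inE eqxx orbT.
    have zv : z \notin v0 by rewrite porbit_sym.
    have [H pE] := off_vw zv (negbT zw).
    apply/orP; left; rewrite inE -{1}pE imset_f //= rz /= -cutv_off ?zw // cz andbT.
    apply/exists_inP; exists x => //; move: rx; rewrite comp_expand //.
    case/or3P=> // /eqP E; move: (H _ xz); rewrite E ?mem_porbit1 //.
    by rewrite porbit_id andbF.
  case/orP; last first.
    case: ifP => cw; rewrite inE // => /eqP->.
    rewrite inE imset_f //= cw andbT porbit_sym nins /=.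
    apply/exists_inP; exists b; first exact: porbit_id.
    by rewrite comp_expand // eqxx !orbT.
  rewrite inE => /andP[/imsetP[z _ ->]] /and3P[rz /exists_inP[x xz rx] cz].
  have zvw : z \notin v0 :|: w.
    apply/negP => zvw.
    case zab : (z \in [set a; b]).
      have fixz : ex z = z.
        move: zab; rewrite !inE => /orP[]/eqP->; first by rewrite (ex_sia inv rl ar ab nins).
        by rewrite (ex_sib inv rl ar ab nins).
      move: xz; rewrite fix_porbit // inE => /eqP xE.
      by move: (iso0 _ zab); rewrite -xE rx.
    have : z \in v1 by rewrite v1E !in_setD1 zvw; move: zab; rewrite !inE => /norP[-> ->].
    by rewrite porbit_sym (negbTE rz).
  move: zvw; rewrite inE => /norP[zv zw]; have [H pE] := off_vw zv zw.
  move: rz xz cz; rewrite pE => rz xz cz.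
  rewrite inE imset_f //= rz cutv_off // cz andbT.
  by apply/exists_inP; exists x => //; rewrite comp_expand // rx.
rewrite -expand_cutv; case: ifP => _ /=; last by rewrite setU0 addn0.
by rewrite setUC cardsU1 wn addnC.
Qed.

End ExpandStats.
End Stats.

(** * Blocks and cut vertices under deletion of a root loop *)

Section Stats.
Variable T : finType.
Implicit Types (al si : {perm T}) (r x y z : T) (U V : {set T}).

Section LoopStats.
Variables (c1 c2 : code) (al si : {perm T}) (r : T).
Hypothesis g : good al si r.
Hypothesis pl : planar al si.
Hypothesis ar : si r != r.
Hypothesis ins : al (si r) \in porbit si r.
Local Notation a := (si r).
Local Notation b := (al (si r)).
Local Notation v0 := (porbit si r).
Local Notation ct := (ct_al al si r).
Local Notation lp := (lp_si al si r).
Local Notation va := (porbit lp a).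
Local Notation vb := (porbit lp b).
Hypothesis ic1 : isCode c1 ct lp a.
Hypothesis ic2 : isCode c2 ct lp b.

Hypothesis IH1 : forall p q, p < deg c1 -> q < deg c1 ->
  (nth 0 (lab c1) p == nth 0 (lab c1) q) =
  cn ct lp va (iter p.+1 lp a) (iter q.+1 lp a).
Hypothesis IH2 : forall p q, p < deg c2 -> q < deg c2 ->
  (nth 0 (lab c2) p == nth 0 (lab c2) q) =
  cn ct lp vb (iter p.+1 lp b) (iter q.+1 lp b).

Let ab := good_ab g ar.
Let inv : involutive al. Proof. by case: g. Qed.
Let rl : al r = r. Proof. by case: g. Qed.
Let br : b != r.
Proof. by apply/eqP=> E; move: ar; rewrite -(inj_eq (@perm_inj _ al)) E rl eqxx. Qed.
Let ga : good ct lp a. Proof. by have [] := good_loop g pl ar ins. Qed.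
Let gb : good ct lp b. Proof. by have [] := good_loop g pl ar ins. Qed.
Let pl' : planar ct lp. Proof. by have [] := good_loop g pl ar ins. Qed.
Let sep : ~~ cn ct lp set0 a b. Proof. by have [] := good_loop g pl ar ins. Qed.
Let sym0 := mrel_sym ct (sstable0 lp).
Let v0E : v0 = r |: (va :|: vb) := lp_v0E inv rl ar ab ins.
Let st0 : sstable lp v0 := lp_v0 inv rl ar ab ins.
Let symv := mrel_sym ct st0.

Let iso_r z : cn ct lp set0 r z -> z = r.
Proof. exact: lp_isolated. Qed.

Let not_r z x : x \in [set a; b] -> cn ct lp set0 x z -> z != r.
Proof.
move=> xS cz; apply/eqP=> E; rewrite E sym0 in cz; have := iso_r cz => xr.
by move: xS; rewrite xr !inE ![r == _]eq_sym (negbTE ar) (negbTE br).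
Qed.

Let sepP x : cn ct lp set0 a x -> cn ct lp set0 b x -> False.
Proof.
by move=> ax bx; case/negP: sep; rewrite sym0 in bx; exact: connect_trans ax bx.
Qed.

Lemma lp_degs : iter (deg c1).+2 si r = b /\ #|v0| = deg c1 + deg c2 + 3.
Proof.
have [k kE kv] := loop_index ins.
have [da _] := isCode_deg ic1 ga pl'; have [db _] := isCode_deg ic2 gb pl'.
rewrite (card_lp_a inv rl ar ab ins kE kv) in da.
rewrite (card_lp_b inv rl ar ab ins kE kv) in db.
have E : k = (deg c1).+2 by lia.
by rewrite -E kE; split=> //; lia.
Qed.

Let kE : iter (deg c1).+2 si r = b. Proof. by case: lp_degs. Qed.
Let kv : (deg c1).+2 < #|v0|. Proof. by case: lp_degs => _ ->; lia. Qed.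

Let iterA p : p < deg c1 -> iter p.+2 si r = iter p.+1 lp a.
Proof. by move=> pd; rewrite (lp_iter_a inv rl ar ab ins kE kv). Qed.

Let iterB q : q < deg c2 -> iter (deg c1 + q).+3 si r = iter q.+1 lp b.
Proof.
move=> qd; rewrite (lp_iter_b inv rl ar ab ins kE) ?addSn ?addnS //.
by case: lp_degs => _ ->; lia.
Qed.

Let cA k : cn ct lp set0 a (iter k lp a). Proof. exact: cn_iter. Qed.
Let cB k : cn ct lp set0 b (iter k lp b). Proof. exact: cn_iter. Qed.

Let offA x y : cn ct lp set0 a x -> cn ct lp v0 x y = cn ct lp va x y.
Proof.
move=> ax; apply: cn_off; first by rewrite v0E; apply/subsetP=> z; rewrite !inE => ->; rewrite orbT.
move=> z; rewrite v0E !inE => /or3P[/eqP->|-> //|zb] _; apply/negP => cz.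
  by have := not_r _ (connect_trans ax cz); rewrite eqxx !inE eqxx => /(_ isT).
by apply: (sepP (connect_trans ax cz)); exact: cn0_porbit.
Qed.

Let offB x y : cn ct lp set0 b x -> cn ct lp v0 x y = cn ct lp vb x y.
Proof.
move=> bx; apply: cn_off; first by rewrite v0E; apply/subsetP=> z; rewrite !inE => ->; rewrite !orbT.
move=> z; rewrite v0E !inE => /or3P[/eqP->|za|-> //] _; apply/negP => cz.
  by have := not_r _ (connect_trans bx cz); rewrite eqxx !inE eqxx orbT => /(_ isT).
by apply: (sepP _ (connect_trans bx cz)); exact: cn0_porbit.
Qed.

Let isoab x z : x \in [set a; b] -> cn ct lp v0 x z -> z = x.
Proof.
rewrite !inE => /orP[]/eqP->; apply: cn_iso => //; rewrite ?ct_alE ?eqxx ?orbT //.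
exact: mem_porbit1.
Qed.

Let ne_a p : p < deg c1 -> iter p.+1 lp a != a.
Proof.
move=> pd; apply/eqP=> E; have := @iter_porbit_inj _ lp a p.+1 0 E.
by have [-> _] := isCode_deg ic1 ga pl'; rewrite ltnS pd => /(_ isT isT).
Qed.

Let ne_b p : p < deg c2 -> iter p.+1 lp b != b.
Proof.
move=> pd; apply/eqP=> E; have := @iter_porbit_inj _ lp b p.+1 0 E.
by have [-> _] := isCode_deg ic2 gb pl'; rewrite ltnS pd => /(_ isT isT).
Qed.

Let RE x y : cn al si v0 x y = cn ct lp v0 x y ||
   touches (mrel ct lp v0) [set a; b] x && touches (mrel ct lp v0) [set a; b] y.
Proof. by rewrite (lp_connect_root inv rl ar ab ins) connect_merge. Qed.

Let not_touch z : z != a -> z != b -> touches (mrel ct lp v0) [set a; b] z = false.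
Proof.
move=> za zb; apply/touchesP=> -[s sS]; rewrite symv => /(isoab sS) E.
by move: sS; rewrite -E !inE (negbTE za) (negbTE zb).
Qed.

(** The four kinds of places at the root vertex, with label and dart: the two ends of the loop and
    the darts of either side. Comparing two places becomes a table of sixteen cases. *)
Variant pos_spec (p : nat) : nat -> T -> Prop :=
| PosA : p = 0 -> pos_spec p 0 a
| PosX i : i < deg c1 -> pos_spec p (nth 0 (lab c1) i).*2.+1 (iter i.+1 lp a)
| PosB : pos_spec p 0 b
| PosY j : j < deg c2 -> pos_spec p (nth 0 (lab c2) j).*2.+2 (iter j.+1 lp b).

Lemma posP p : p < deg (Loop c1 c2) ->
  pos_spec p (nth 0 (lab (Loop c1 c2)) p) (iter p.+1 si r).
Proof.
move=> pd; case: p pd => [|p] pd; first exact: PosA.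
have -> : nth 0 (lab (Loop c1 c2)) p.+1 =
   nth 0 ([seq l.*2.+1 | l <- lab c1] ++ 0 :: [seq l.*2.+2 | l <- lab c2]) p by [].
rewrite nth_cat size_map size_lab; case: ltnP => pc.
  by rewrite (nth_map 0) ?size_lab // iterA //; exact: PosX.
case E : (p - deg c1) => [|j].
  have -> : p = deg c1 by lia.
  by rewrite kE; exact: PosB.
have jd : j < deg c2 by move: pd; rewrite /=; lia.
rewrite [nth _ _ _]/= (nth_map 0) ?size_lab //.
have -> : p.+2 = (deg c1 + j).+3 by lia.
by rewrite iterB //; exact: PosY.
Qed.

Lemma loop_lab p q : p < deg (Loop c1 c2) -> q < deg (Loop c1 c2) ->
  (nth 0 (lab (Loop c1 c2)) p == nth 0 (lab (Loop c1 c2)) q) =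
  cn al si v0 (iter p.+1 si r) (iter q.+1 si r).
Proof.
have symm := mrel_sym al (sstable_porbit si r).
have aS : a \in [set a; b] by rewrite !inE eqxx.
have bS : b \in [set a; b] by rewrite !inE eqxx orbT.
have cnab x y : x \in [set a; b] -> y \in [set a; b] -> cn al si v0 x y.
  by move=> xS yS; rewrite RE !touches_in // orbT.
have neX i x : i < deg c1 -> x \in [set a; b] -> x != iter i.+1 lp a.
  move=> id_; rewrite !inE => /orP[]/eqP->; first by rewrite eq_sym ne_a.
  by apply/eqP=> E; apply: (sepP (cA i.+1)); rewrite -E connect0.
have neY i x : i < deg c2 -> x \in [set a; b] -> x != iter i.+1 lp b.
  move=> id_; rewrite !inE => /orP[]/eqP->; last by rewrite eq_sym ne_b.
  by apply/eqP=> E; apply: (sepP _ (cB i.+1)); rewrite -E connect0.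
have cnS x y : x \in [set a; b] -> y != a -> y != b -> ~~ cn al si v0 x y.
  move=> xS ya yb; rewrite RE [touches _ _ y]not_touch // andbF orbF.
  apply/negP => /(isoab xS) E; move: xS.
  by rewrite -E !inE (negbTE ya) (negbTE yb).
have cnX i x : i < deg c1 -> x \in [set a; b] -> ~~ cn al si v0 x (iter i.+1 lp a).
  by move=> id_ xS; apply: cnS => //; rewrite eq_sym neX.
have cnY i x : i < deg c2 -> x \in [set a; b] -> ~~ cn al si v0 x (iter i.+1 lp b).
  by move=> id_ xS; apply: cnS => //; rewrite eq_sym neY.
have cnXX i y : i < deg c1 -> cn al si v0 (iter i.+1 lp a) y = cn ct lp va (iter i.+1 lp a) y.
  move=> id_; rewrite RE not_touch ?orbF; first exact/offA/cA.
    by rewrite eq_sym neX.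
  by rewrite eq_sym neX.
have cnYY i y : i < deg c2 -> cn al si v0 (iter i.+1 lp b) y = cn ct lp vb (iter i.+1 lp b) y.
  move=> id_; rewrite RE not_touch ?orbF; first exact/offB/cB.
    by rewrite eq_sym neY.
  by rewrite eq_sym neY.
have cnXY i j : i < deg c1 -> j < deg c2 ->
    ~~ cn al si v0 (iter i.+1 lp a) (iter j.+1 lp b).
  move=> id_ jd; rewrite cnXX //; apply/negP=> /cn_sub0 H.
  exact: sepP (connect_trans (cA _) H) (cB _).
have aX i : i < deg c1 -> cn al si v0 a (iter i.+1 lp a) = false.
  by move=> id_; apply/negbTE/cnX.
have bX i : i < deg c1 -> cn al si v0 b (iter i.+1 lp a) = false.
  by move=> id_; apply/negbTE/cnX.
have aY i : i < deg c2 -> cn al si v0 a (iter i.+1 lp b) = false.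
  by move=> id_; apply/negbTE/cnY.
have bY i : i < deg c2 -> cn al si v0 b (iter i.+1 lp b) = false.
  by move=> id_; apply/negbTE/cnY.
move=> pd qd; case: (posP pd) => [_|i id_||i id_]; case: (posP qd) => [_|j jd||j jd];
  rewrite ?(cnab a a aS aS) ?(cnab a b aS bS) ?(cnab b a bS aS) ?(cnab b b bS bS) ?aX ?bX ?aY ?bY //;
  rewrite ?[cn al si v0 _ a]symm ?[cn al si v0 _ b]symm ?aX ?bX ?aY ?bY //.
- rewrite cnXX // -IH1 // eqSS; apply/eqP/eqP => [E|->//].
  by rewrite -[LHS]doubleK E doubleK.
- rewrite (negbTE (cnXY _ _ _ _)) //; apply/eqP=> E.
  by have := congr1 odd E; rewrite /= !odd_double.
- rewrite symm (negbTE (cnXY _ _ _ _)) //; apply/eqP=> E.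
  by have := congr1 odd E; rewrite /= !odd_double.
rewrite cnYY // -IH2 // !eqSS; apply/eqP/eqP => [E|->//].
by rewrite -[LHS]doubleK E doubleK.
Qed.

Let lp_off x : x \notin v0 -> lp x = si x.
Proof.
move=> uv; have suv : si x \notin v0 by rewrite (sstable_porbit si r).
rewrite lp_siE //; case: (altP (x =P r)) => [E|_]; first by rewrite E porbit_id in uv.
case: (altP (si x =P b)) => [E|_]; first by rewrite E ins in suv.
by case: (altP (si x =P r)) => [E|_] //; rewrite E porbit_id in suv.
Qed.

Let off_v z : z \notin v0 ->
  (forall x, x \in porbit si z -> x \notin v0) /\ porbit lp z = porbit si z.
Proof.
move=> zv; have H x : x \in porbit si z -> x \notin v0.
  by case/porbitP=> i ->; rewrite permX (sstable_iter (sstable_porbit _ _)).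
by split=> //; apply/esym; apply: eq_porbit_on => x /H /lp_off.
Qed.

Let cutv_off z d : d \in [set a; b] -> z \notin v0 -> cn ct lp set0 d z ->
  cutv al si (porbit si z) = cutv ct lp (porbit si z).
Proof.
move=> dS zv dz; have [H pE] := off_v zv; rewrite /cutv.
have st : sstable lp (porbit si z) by rewrite -pE; exact: sstable_porbit.
have symz := mrel_sym ct st.
have rz : r \notin porbit si z by apply/negP=> /H; rewrite porbit_id.
have az : a \notin porbit si z by apply/negP=> /H; rewrite mem_porbit1.
have bz : b \notin porbit si z by apply/negP=> /H; rewrite ins.
apply: eq_existsb => x; case xz : (x \in porbit si z) => //=.
apply: eq_existsb => y; case yz : (y \in porbit si z) => //=.
rewrite (lp_connect inv rl ar ab (sstable_porbit si z)) // connect_merge //.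
have conn u : u \in porbit si z -> cn ct lp set0 d u.
  by rewrite -pE => uz; apply: connect_trans dz _; exact: cn0_porbit.
have tr u : u \in porbit si z -> touches (mrel ct lp (porbit si z)) [set r; a; b] u ->
   cn ct lp (porbit si z) u d.
  move=> /conn du /touchesP[s sS us].
  have ds := connect_trans du (cn_sub0 us).
  have sr := not_r dS ds; suff -> : d = s by [].
  move: sS dS ds; rewrite !inE (negbTE sr) /= => /orP[]/eqP-> /orP[]/eqP-> //.
    by rewrite sym0 (negbTE sep).
  by rewrite (negbTE sep).
congr (~~ _); case cxy : (connect _ x y) => //=.
apply/negbTE/negP => /andP[/(tr _ xz) xr /(tr _ yz)]; rewrite symz => yr.
by rewrite (connect_trans xr yr) in cxy.
Qed.

(** Every vertex other than the root lies on exactly one side of the loop, and the other side cannot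
    be reached from it without the root vertex. *)
Lemma loop_nrcut : #|nrcut al si r| = #|nrcut ct lp a| + #|nrcut ct lp b|.
Proof.
have aS : a \in [set a; b] by rewrite !inE eqxx.
have bS : b \in [set a; b] by rewrite !inE eqxx orbT.
have -> : nrcut al si r = nrcut ct lp a :|: nrcut ct lp b.
  apply/setP=> v; rewrite in_setU; apply/idP/idP.
    rewrite inE => /andP[/imsetP[z _ ->]] /and3P[rz /exists_inP[x xz rx] cz].
    have zv : z \notin v0 by rewrite porbit_sym.
    have [H pE] := off_v zv; move: rx; rewrite comp_loop //.
    have az : a \notin porbit si z by apply/negP=> /H; rewrite mem_porbit1.
    have bz : b \notin porbit si z by apply/negP=> /H; rewrite ins.
    have xz' : z \in porbit lp x by rewrite porbit_sym pE.
    case/or3P=> [/eqP E|ax|bx]; first by move: xz; rewrite E (negbTE rz).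
      have dz := connect_trans ax (cn0_porbit ct xz').
      apply/orP; left; rewrite inE -{1}pE imset_f //= az -(cutv_off aS) // cz andbT.
      by apply/exists_inP; exists x.
    have dz := connect_trans bx (cn0_porbit ct xz').
    apply/orP; right; rewrite inE -{1}pE imset_f //= bz -(cutv_off bS) // cz andbT.
    by apply/exists_inP; exists x.
  have back d : d \in [set a; b] -> v \in nrcut ct lp d -> v \in nrcut al si r.
    move=> dS; rewrite inE => /andP[/imsetP[z _ ->]] /and3P[rz /exists_inP[x xz rx] cz].
    have xz' : z \in porbit lp x by rewrite porbit_sym.
    have dz := connect_trans rx (cn0_porbit ct xz').
    have zv : z \notin v0.
      rewrite v0E !inE; apply/negP => /or3P[/eqP zr|za|zb].
      - by have := not_r dS dz; rewrite zr eqxx.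
      - move: dS rz dz; rewrite !inE => /orP[]/eqP->; first by rewrite porbit_sym za.
        by move=> _; exact: sepP (cn0_porbit ct za).
      move: dS rz dz; rewrite !inE => /orP[]/eqP->; last by rewrite porbit_sym zb.
      by move=> _ az; exact: sepP az (cn0_porbit ct zb).
    have [H pE] := off_v zv; move: rz xz cz; rewrite pE => rz xz cz.
    rewrite inE imset_f //= (cutv_off dS zv dz) cz andbT.
    apply/andP; split; first by apply/negP=> /H; rewrite porbit_id.
    apply/exists_inP; exists x => //; rewrite comp_loop //.
    by move: dS rx; rewrite !inE => /orP[]/eqP-> ->; rewrite ?orbT.
  by case/orP; apply: back.
rewrite cardsU disjoint_setI0 ?cards0 ?subn0 // -setI_eq0; apply/eqP/setP=> v; rewrite !inE.
apply/negP=> /andP[/andP[/imsetP[z _ vE] /and3P[_ /exists_inP[x xv ax] _]]].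
case/andP=> _ /and3P[_ /exists_inP[y yv by_] _].
apply: (sepP ax); apply: connect_trans by_ _; apply: cn0_porbit.
by move: xv yv; rewrite vE -!eq_porbit_mem => /eqP-> /eqP->.
Qed.

End LoopStats.

(** The shift by one skips the leg: place 0 of the word is the dart after it. *)
Lemma isCode_lab c al si r : isCode c al si r -> good al si r -> planar al si ->
  forall p q, p < deg c -> q < deg c ->
  (nth 0 (lab c) p == nth 0 (lab c) q) =
  cn al si (porbit si r) (iter p.+1 si r) (iter q.+1 si r).
Proof.
move: c al si r; apply: isCode_good_ind => [al si r _ _ _ //|c1 c2 al si r g pl ar ins i1 i2 IH1 IH2|c al si r g pl ar nins i1 IH].
  exact: loop_lab.
exact: expand_lab.
Qed.

Lemma isCode_xo c al si r : isCode c al si r -> good al si r -> planar al si ->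
  #|nrcut al si r| = xo c.
Proof.
move: c al si r; apply: isCode_good_ind => [al si r [_ rl _] _ E|c1 c2 al si r g pl ar ins i1 i2 IH1 IH2|c al si r g pl ar nins i1 IH].
- apply/eqP; rewrite cards_eq0 -subset0; apply/subsetP=> v.
  rewrite inE => /andP[_ /and3P[rv /exists_inP[x xv rx] _]].
  suff xr : x = r by rewrite -xr xv in rv.
  move: rx; apply: connect_fix => z; rewrite /mrel rl E.
  by case/orP=> [/eqP|/andP[_ /eqP]].
- by rewrite loop_nrcut // IH1 IH2.
rewrite (@expand_nrcut T c) ?IH //.
have [] := good_expand g ar nins => inv' rl' leg'.
have ab := good_ab g ar; have [inv rl leg] := g.
by apply: isCode_lab; [|exact: good_expand|rewrite ex_planar].
Qed.

End Stats.

(** * Codes are complete isomorphism invariants *)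

(** An isomorphism of the component of [r] onto its image; the values of [f] elsewhere are
    arbitrary. *)
Definition morph_on (T T' : finType) (f : T -> T') (al si : {perm T}) (r : T)
    (al' si' : {perm T'}) :=
  [/\ {in comp al si r &, injective f},
      {in comp al si r, forall x, f (al x) = al' (f x)} &
      {in comp al si r, forall x, f (si x) = si' (f x)}].

Section Comp.
Variable T : finType.
Implicit Types (al si : {perm T}) (r x : T).

Lemma comp_al al si r x : x \in comp al si r -> al x \in comp al si r.
Proof. by rewrite !inE => /connect_trans; apply; apply: cn_al. Qed.
Lemma comp_si al si r x : x \in comp al si r -> si x \in comp al si r.
Proof. by rewrite !inE => /connect_trans; apply; apply: cn_si; rewrite inE. Qed.
Lemma comp_r al si r : r \in comp al si r.
Proof. by rewrite inE connect0. Qed.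
Lemma comp_porbit al si r x y : x \in comp al si r -> y \in porbit si x ->
  y \in comp al si r.
Proof. by rewrite !inE => /connect_trans c yx; apply: c; exact: cn0_porbit. Qed.

Lemma comp_min al si r (A : {set T}) : r \in A ->
  {in A, forall x, (al x \in A) && (si x \in A)} -> comp al si r \subset A.
Proof.
move=> rA cl; apply/subsetP=> x; rewrite inE => /connectP[p].
elim: p r rA => [|y p IH] z zA /=; first by move=> _ ->.
case/andP=> zy py lst; apply: (IH y) => //.
by have /andP[] := cl z zA; case/orP: zy => [/eqP->|/andP[_ /eqP->]].
Qed.
End Comp.

Section Morph.
Variables (T T' : finType).
Implicit Types (f : T -> T') (r : T).

Lemma morph_iter f (al si : {perm T}) r (al' si' : {perm T'}) : morph_on f al si r al' si' ->
  {in comp al si r, forall x i, f (iter i si x) = iter i si' (f x)}.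
Proof.
move=> [_ _ H] x xc; elim=> //= i IH; rewrite H ?IH //.
by apply: comp_porbit xc _; rewrite -permX mem_porbit.
Qed.

Lemma morph_comp f (al si : {perm T}) r (al' si' : {perm T'}) :
  morph_on f al si r al' si' ->
  {in comp al si r, forall x, f x \in comp al' si' (f r)}.
Proof.
move=> [_ Mal Msi] x; rewrite inE => /connectP[p].
suff H u : u \in comp al si r -> f u \in comp al' si' (f r) ->
    path (mrel al si set0) u p -> x = last u p -> f x \in comp al' si' (f r).
  by apply: H; exact: comp_r.
elim: p u => [|z p IH] u uc fu /=; first by move=> _ ->.
case/andP=> uz pz lst; apply: (IH z _ _ pz lst); case/orP: uz => [|/andP[_]] /eqP->.
- exact: comp_al.
- exact: comp_si.
- by rewrite Mal // comp_al.
by rewrite Msi // comp_si.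
Qed.

Lemma morph_mem_porbit f (al si : {perm T}) r (al' si' : {perm T'}) : morph_on f al si r al' si' ->
  {in comp al si r &, forall x y, (f y \in porbit si' (f x)) = (y \in porbit si x)}.
Proof.
move=> M x y xc yc; have [inj _ _] := M; apply/porbitP/porbitP=> -[i E]; exists i.
  apply: inj => //; last by rewrite permX (morph_iter M) // -permX.
  by apply: comp_porbit xc _; rewrite mem_porbit.
by rewrite E permX (morph_iter M) // permX.
Qed.

Lemma morph_card_porbit f (al si : {perm T}) r (al' si' : {perm T'}) : morph_on f al si r al' si' ->
  {in comp al si r, forall x, #|porbit si' (f x)| = #|porbit si x|}.
Proof.
move=> M x xc; have [inj _ _] := M.
have -> : porbit si' (f x) = f @: porbit si x.
  apply/setP=> y; apply/porbitP/imsetP => [[i ->]|[z /porbitP[i ->] ->]].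
    exists (iter i si x); first by rewrite -permX mem_porbit.
    by rewrite permX (morph_iter M).
  by exists i; rewrite !permX (morph_iter M).
rewrite card_in_imset // => y z yp zp; apply: inj.
  exact: comp_porbit xc yp.
exact: comp_porbit xc zp.
Qed.

(** The reductions are built from [r], [al] and [si] alone, so a morphism of a map is also a
    morphism of its reduced maps. *)
Lemma isCode_morph c (al si : {perm T}) r : isCode c al si r -> good al si r -> planar al si ->
  forall f (al' si' : {perm T'}), involutive al' -> morph_on f al si r al' si' ->
  isCode c al' si' (f r).
Proof.
move: c al si r; apply: isCode_good_ind => [al si r g pl E|c1 c2 al si r g pl ar ins i1 i2 IH1 IH2|c al si r g pl ar nins i1 IH] f al' si' inv' M;
  have [inj Mal Msi] := M; have rc := comp_r al si r.
- by apply: isVtx; rewrite -Msi // E.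
- have [inv rl leg] := g; have ab := good_ab g ar.
  have ac := comp_si rc; have bc := comp_al ac.
  have aE := Msi _ rc; have bE := Mal _ ac; rewrite aE in bE.
  have rl' : al' (f r) = f r by rewrite -Mal // rl.
  have ar' : si' (f r) != f r by rewrite -aE (inj_in_eq inj).
  have ab' : al' (si' (f r)) != si' (f r) by rewrite -bE -aE (inj_in_eq inj).
  have ins' : al' (si' (f r)) \in porbit si' (f r).
    by rewrite -bE (morph_mem_porbit M).
  have fct x : x \in comp al si r -> f (ct_al al si r x) = ct_al al' si' (f r) (f x).
    move=> xc; rewrite !ct_alE // -bE -aE !(inj_in_eq inj) //.
    by case: ifP => // _; exact: Mal.
  have flp x : x \in comp al si r -> f (lp_si al si r x) = lp_si al' si' (f r) (f x).
    move=> xc; have sx := comp_si xc.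
    rewrite !lp_siE // -bE -aE -Msi // !(inj_in_eq inj) //.
    by do !case: ifP => // _.
  have sub d : d \in [set si r; al (si r)] ->
     morph_on f (ct_al al si r) (lp_si al si r) d (ct_al al' si' (f r)) (lp_si al' si' (f r)).
    move=> dS; have cs x : x \in comp (ct_al al si r) (lp_si al si r) d -> x \in comp al si r.
      rewrite !inE => cx; rewrite comp_loop //; move: dS cx; rewrite !inE => /orP[]/eqP-> ->; by rewrite ?orbT.
    split=> [x y /cs xc /cs yc|x /cs xc|x /cs xc]; [exact: inj|exact: fct|exact: flp].
  have inv1 : involutive (ct_al al' si' (f r)) by apply: ct_al_inv.
  apply: isLoop => //.
    by rewrite -aE; apply: IH1 => //; apply: sub; rewrite !inE eqxx.
  by rewrite -bE; apply: IH2 => //; apply: sub; rewrite !inE eqxx orbT.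
have [inv rl leg] := g; have ab := good_ab g ar.
have ac := comp_si rc; have bc := comp_al ac.
have aE := Msi _ rc; have bE := Mal _ ac; rewrite aE in bE.
have rl' : al' (f r) = f r by rewrite -Mal // rl.
have ar' : si' (f r) != f r by rewrite -aE (inj_in_eq inj).
have ab' : al' (si' (f r)) != si' (f r) by rewrite -bE -aE (inj_in_eq inj).
have nins' : al' (si' (f r)) \notin porbit si' (f r).
  by rewrite -bE (morph_mem_porbit M).
have sbc := comp_si bc.
have yc : ex_last al si r \in comp al si r.
  rewrite /ex_last; case: ifP => // _.
  by apply: comp_porbit bc _; rewrite -porbitV mem_porbit1.
have yE : f (ex_last al si r) = ex_last al' si' (f r).
  rewrite /ex_last -bE -(Msi _ bc) (inj_in_eq inj) //; case: ifP => // _.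
  apply: (@perm_inj _ si'); rewrite permKV -Msi ?permKV //.
  by apply: comp_porbit bc _; rewrite -porbitV mem_porbit1.
have fct x : x \in comp al si r -> f (ct_al al si r x) = ct_al al' si' (f r) (f x).
  move=> xc; rewrite !ct_alE // -bE -aE !(inj_in_eq inj) //.
  by case: ifP => // _; exact: Mal.
have fex x : x \in comp al si r -> f (ex_si al si r x) = ex_si al' si' (f r) (f x).
  move=> xc; rewrite !ex_siE // -yE -bE -aE -!Msi // !(inj_in_eq inj) //.
  by do !case: ifP => // _.
rewrite -(morph_card_porbit M) // bE; apply: isExpand => //; apply: IH.
  exact: ct_al_inv.
have cs x : x \in comp (ct_al al si r) (ex_si al si r) r -> x \in comp al si r.
  by rewrite !inE => cx; rewrite comp_expand // cx.
by split=> [x y /cs xc /cs yc'|x /cs xc|x /cs xc]; [exact: inj|exact: fct|exact: fex].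
Qed.

(** The isomorphism is assembled from those of the reduced maps, extended to the darts of the root
    edge. It respects [si] because [si] can be recovered from [lp_si], respectively from [ex_si] and
    the place of [ex_last]. *)
Lemma isCode_iso c (al si : {perm T}) r : isCode c al si r -> good al si r -> planar al si ->
  forall (al' si' : {perm T'}) (r' : T'), isCode c al' si' r' -> good al' si' r' -> planar al' si' ->
  exists f, f r = r' /\ morph_on f al si r al' si'.
Proof.
move: c al si r; apply: isCode_good_ind => [al si r g pl E|c1 c2 al si r g pl ar ins i1 i2 IH1 IH2|c al si r g pl ar nins i1 IH] al' si' r' ic' g' pl'.
- have E' : si' r' = r' by inversion ic'.
  exists (fun=> r'); have [_ rl _] := g; have [_ rl' _] := g'.
  have c1 x : x \in comp al si r -> x = r.
    rewrite inE; apply: connect_fix => z; rewrite /mrel rl E.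
    by case/orP=> [/eqP|/andP[_ /eqP]].
  by split=> //; split=> [x y /c1-> /c1->|x|x].
- have [ar' [ins' [i1' i2']]] : si' r' != r' /\ al' (si' r') \in porbit si' r' /\
      isCode c1 (ct_al al' si' r') (lp_si al' si' r') (si' r') /\
      isCode c2 (ct_al al' si' r') (lp_si al' si' r') (al' (si' r')).
    by inversion ic'.
  have [ga gb pl1 sep] := good_loop g pl ar ins.
  have [ga' gb' pl1' sep'] := good_loop g' pl' ar' ins'.
  have [f1 [f1a M1]] := IH1 _ _ _ i1' ga' pl1'.
  have [f2 [f2b M2]] := IH2 _ _ _ i2' gb' pl1'.
  have [inv rl leg] := g; have ab := good_ab g ar.
  have [inv' rl' leg'] := g'; have ab' := good_ab g' ar'.
  set a := si r in f1a M1 f2b M2 ga gb sep ar ab ins *.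
  set b := al a in f1a M1 f2b M2 gb sep ab ins *.
  set a' := si' r' in f1a M1 f2b M2 ga' gb' sep' ar' ab' ins' *.
  set b' := al' a' in f1a M1 f2b M2 gb' sep' ab' ins' *.
  set ct := ct_al al si r in M1 M2 ga gb pl1 sep *.
  set lp := lp_si al si r in M1 M2 ga gb pl1 sep *.
  set ct' := ct_al al' si' r' in M1 M2 ga' gb' pl1' sep' *.
  set lp' := lp_si al' si' r' in M1 M2 ga' gb' pl1' sep' *.
  have symm := mrel_sym ct (sstable0 lp); have symm' := mrel_sym ct' (sstable0 lp').
  have isor x : cn ct lp set0 r x -> x = r by apply: lp_isolated.
  have isor' x : cn ct' lp' set0 r' x -> x = r' by apply: lp_isolated.
  have br : b != r by apply/eqP=> E; move: ar; rewrite -(inj_eq (@perm_inj _ al)) -/b E rl eqxx.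
  have br' : b' != r' by apply/eqP=> E; move: ar'; rewrite -(inj_eq (@perm_inj _ al')) -/b' E rl' eqxx.
  have Ar x : x \in comp ct lp a -> x != r.
    by rewrite inE => c; apply/eqP=> E; rewrite E symm in c; move: ar; rewrite (isor _ c) eqxx.
  have Br x : x \in comp ct lp b -> x != r.
    by rewrite inE => c; apply/eqP=> E; rewrite E symm in c; move: br; rewrite (isor _ c) eqxx.
  have Ar' x : x \in comp ct' lp' a' -> x != r'.
    by rewrite inE => c; apply/eqP=> E; rewrite E symm' in c; move: ar'; rewrite (isor' _ c) eqxx.
  have Br' x : x \in comp ct' lp' b' -> x != r'.
    by rewrite inE => c; apply/eqP=> E; rewrite E symm' in c; move: br'; rewrite (isor' _ c) eqxx.
  have AB x : x \in comp ct lp a -> x \in comp ct lp b -> False.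
    rewrite !inE => c; rewrite symm => d; case/negP: sep; exact: connect_trans c d.
  have AB' x : x \in comp ct' lp' a' -> x \in comp ct' lp' b' -> False.
    rewrite !inE => c; rewrite symm' => d; case/negP: sep'; exact: connect_trans c d.
  have f1c x : x \in comp ct lp a -> f1 x \in comp ct' lp' a'.
    by rewrite -f1a; exact: morph_comp.
  have f2c x : x \in comp ct lp b -> f2 x \in comp ct' lp' b'.
    by rewrite -f2b; exact: morph_comp.
  have cE x : (x \in comp al si r) = [|| x == r, x \in comp ct lp a | x \in comp ct lp b].
    by rewrite !inE comp_loop.
  pose F x := if x == r then r' else if x \in comp ct lp a then f1 x else f2 x.
  have FA x : x \in comp ct lp a -> F x = f1 x.
    by move=> xA; rewrite /F xA (negbTE (Ar x xA)).
  have FB x : x \in comp ct lp b -> F x = f2 x.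
    move=> xB; rewrite /F (negbTE (Br x xB)).
    by case: ifP => // xA; case: (AB x).
  have Fr : F r = r' by rewrite /F eqxx.
  have Fa : F a = a' by rewrite FA ?comp_r.
  have Fb : F b = b' by rewrite FB ?comp_r.
  have [inj1 al1 si1] := M1; have [inj2 al2 si2] := M2.
  have Finj : {in comp al si r &, injective F}.
    move=> x y; rewrite !cE => /or3P[/eqP->|xA|xB] /or3P[/eqP->|yA|yB] //;
      rewrite ?Fr ?(FA _ xA) ?(FA _ yA) ?(FB _ xB) ?(FB _ yB) => E.
    - by have := Ar' _ (f1c _ yA); rewrite -E eqxx.
    - by have := Br' _ (f2c _ yB); rewrite -E eqxx.
    - by have := Ar' _ (f1c _ xA); rewrite E eqxx.
    - exact: inj1.
    - by case: (AB' (f1 x)); [exact: f1c|rewrite E; exact: f2c].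
    - by have := Br' _ (f2c _ xB); rewrite E eqxx.
    - by case: (AB' (f1 y)); [exact: f1c|rewrite -E; exact: f2c].
    exact: inj2.
  have ac : a \in comp al si r by rewrite cE comp_r orbT.
  have bc : b \in comp al si r by rewrite cE comp_r !orbT.
  have rc : r \in comp al si r by rewrite cE eqxx.
  have Fct x : x \in comp al si r -> x != r -> F (ct x) = ct' (F x).
    rewrite cE => /or3P[/eqP->|xA|xB]; rewrite ?eqxx // => _.
      by rewrite (FA _ xA) FA ?comp_al // al1.
    by rewrite (FB _ xB) FB ?comp_al // al2.
  have Flp x : x \in comp al si r -> x != r -> F (lp x) = lp' (F x).
    rewrite cE => /or3P[/eqP->|xA|xB]; rewrite ?eqxx // => _.
      by rewrite (FA _ xA) FA ?comp_si // si1.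
    by rewrite (FB _ xB) FB ?comp_si // si2.
  exists F; split=> //; split=> // x xc.
    case: (altP (x =P r)) => [->|xr]; first by rewrite rl Fr rl'.
    have := Fct x xc xr; rewrite !ct_alE // -/a -/b -/a' -/b' -Fa -Fb !(inj_in_eq Finj) //.
    case: (altP (x =P a)) => [->|xa] /=; first by rewrite -/b Fa Fb.
    case: (altP (x =P b)) => [->|xb] //=; rewrite Fb /b inv Fa /b' inv' //.
  case: (altP (x =P r)) => [->|xr]; first by rewrite Fr.
  have sic := comp_si xc.
  have lpc : lp x \in comp al si r.
    move: xc; rewrite !cE => /or3P[/eqP E|xA|xB]; first by rewrite E eqxx in xr.
      by rewrite (comp_si xA) orbT.
    by rewrite (comp_si xB) !orbT.
  have siE y : y != r -> si y = if lp y == a then b else if lp y == b then r else lp y.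
    move=> yr; rewrite lp_siE // (negbTE yr) -/a -/b.
    have sya : si y != a by rewrite (inj_eq perm_inj).
    case: (altP (si y =P b)) => [->|sb]; first by rewrite eqxx.
    case: (altP (si y =P r)) => [->|sr]; first by rewrite (negbTE ab) eqxx.
    by rewrite (negbTE sya) (negbTE sb).
  have siE' y : y != r' -> si' y = if lp' y == a' then b' else if lp' y == b' then r' else lp' y.
    move=> yr; rewrite lp_siE // (negbTE yr) -/a' -/b'.
    have sya : si' y != a' by rewrite (inj_eq perm_inj).
    case: (altP (si' y =P b')) => [->|sb]; first by rewrite eqxx.
    case: (altP (si' y =P r')) => [->|sr]; first by rewrite (negbTE ab') eqxx.
    by rewrite (negbTE sya) (negbTE sb).
  rewrite siE // siE'; last by rewrite -Fr (inj_in_eq Finj).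
  rewrite -(Flp x xc xr) -Fa -Fb -Fr !(inj_in_eq Finj) //.
  by do !case: ifP => // _.
(* The orbit size is replaced by a variable so that inverting [isCode] yields an equation between
   the orbit sizes of the two maps. *)
have [m mE] : exists m, m = #|porbit si (al (si r))|.-1 by exists #|porbit si (al (si r))|.-1.
rewrite -mE in ic'.
have [ar' [nins' [i1' mE']]] : si' r' != r' /\ al' (si' r') \notin porbit si' r' /\
    isCode c (ct_al al' si' r') (ex_si al' si' r') r' /\ m = #|porbit si' (al' (si' r'))|.-1.
  by inversion ic'.
have [inv rl leg] := g; have ab := good_ab g ar.
have [inv' rl' leg'] := g'; have ab' := good_ab g' ar'.
have g1 := good_expand g ar nins; have g1' := good_expand g' ar' nins'.
have [|f [fr M]] := IH _ _ _ i1' g1'; first by rewrite ex_planar.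
have pl1 : planar (ct_al al si r) (ex_si al si r) by rewrite ex_planar.
have [inj Mal Msi] := M.
(* The dart where the far end stops is the [m]-th after the leg; as [m] is common to both maps, [f]
   sends one such dart to the other. *)
have lastE : ex_last al si r = iter m (ex_si al si r) r by rewrite mE ex_iter_last.
have lastE' : ex_last al' si' r' = iter m (ex_si al' si' r') r' by rewrite mE' ex_iter_last.
have fy : f (ex_last al si r) = ex_last al' si' r'.
  by rewrite lastE lastE' (morph_iter M) ?comp_r // fr.
set a := si r in ar ab nins *; set b := al a in ab nins *.
set a' := si' r' in ar' ab' nins' *; set b' := al' a' in ab' nins' *.
set ct := ct_al al si r in g1 M pl1 i1 inj Mal Msi *.
set ex := ex_si al si r in g1 M pl1 i1 inj Mal Msi lastE *.
set ct' := ct_al al' si' r' in g1' M Mal i1' *.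
set ex' := ex_si al' si' r' in g1' M Msi i1' lastE' *.
set y := ex_last al si r in fy lastE.
set y' := ex_last al' si' r' in fy lastE'.
have symm := mrel_sym ct (sstable0 ex); have symm' := mrel_sym ct' (sstable0 ex').
have na x : x \in comp ct ex r -> (x != a) && (x != b).
  rewrite inE symm => cx; have H z : z \in [set a; b] -> x != z.
    move=> zS; apply/eqP=> E; rewrite E in cx.
    have E2 := ex_isolated inv rl ar ab nins zS cx.
    move: zS; rewrite -E2 !inE => /orP[]/eqP E3; first by move: ar; rewrite -E3 eqxx.
    by move: ar; rewrite -(inj_eq (@perm_inj _ al)) -/b -E3 rl eqxx.
  by rewrite !H // !inE eqxx ?orbT.
have na' x : x \in comp ct' ex' r' -> (x != a') && (x != b').
  rewrite inE symm' => cx; have H z : z \in [set a'; b'] -> x != z.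
    move=> zS; apply/eqP=> E; rewrite E in cx.
    have E2 := ex_isolated inv' rl' ar' ab' nins' zS cx.
    move: zS; rewrite -E2 !inE => /orP[]/eqP E3; first by move: ar'; rewrite -E3 eqxx.
    by move: ar'; rewrite -(inj_eq (@perm_inj _ al')) -/b' -E3 rl' eqxx.
  by rewrite !H // !inE eqxx ?orbT.
have fc x : x \in comp ct ex r -> f x \in comp ct' ex' r'.
  by rewrite -fr; exact: morph_comp.
have cE x : (x \in comp al si r) = [|| x \in comp ct ex r, x == a | x == b].
  by rewrite !inE comp_expand.
pose F x := if x == a then a' else if x == b then b' else f x.
have Fa : F a = a' by rewrite /F eqxx.
have Fb : F b = b' by rewrite /F (negbTE ab) eqxx.
have Fc x : x \in comp ct ex r -> F x = f x.
  by move=> /na/andP[xa xb]; rewrite /F (negbTE xa) (negbTE xb).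
have yc : y \in comp ct ex r.
  by rewrite lastE; apply: comp_porbit (comp_r _ _ _) _; rewrite -permX mem_porbit.
have rc1 := comp_r ct ex r.
have Finj : {in comp al si r &, injective F}.
  move=> u v; rewrite !cE => /or3P[uc|/eqP->|/eqP->] /or3P[vc|/eqP->|/eqP->] //;
    rewrite ?Fa ?Fb ?(Fc _ uc) ?(Fc _ vc) => E.
  - exact: inj.
  - by have := na' _ (fc _ uc); rewrite E eqxx.
  - by have := na' _ (fc _ uc); rewrite E eqxx andbF.
  - by have := na' _ (fc _ vc); rewrite -E eqxx.
  - by move: ab'; rewrite E eqxx.
  - by have := na' _ (fc _ vc); rewrite -E eqxx andbF.
  by move: ab'; rewrite E eqxx.
have exE := ex_siE inv rl ar ab nins; rewrite -/ex -/a -/b -/y in exE.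
have exE' := ex_siE inv' rl' ar' ab' nins'; rewrite -/ex' -/a' -/b' -/y' in exE'.
have yr : (y == r) = (y' == r') by rewrite -fy -fr (inj_in_eq inj).
have lastP := fun z => erefl (ex_last al si z).
have sby : (si b == b) = (y == r).
  rewrite /y /ex_last -/a -/b; case: ifP => [|sb]; first by rewrite eqxx.
  apply/esym/eqP=> E; move: nins; rewrite -E -porbitV.
  by rewrite porbit_sym mem_porbit1.
have sby' : (si' b' == b') = (y' == r').
  rewrite /y' /ex_last -/a' -/b'; case: ifP => [|sb]; first by rewrite eqxx.
  apply/esym/eqP=> E; move: nins'; rewrite -E -porbitV.
  by rewrite porbit_sym mem_porbit1.
have siy : y != r -> si y = b.
  by rewrite -sby /y /ex_last -/a -/b => /negbTE->; rewrite permKV.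
have siy' : y' != r' -> si' y' = b'.
  by rewrite -sby' /y' /ex_last -/a' -/b' => /negbTE->; rewrite permKV.
exists F; split; first by rewrite Fc.
split=> // x; rewrite cE.
  case/or3P=> [xc|/eqP->|/eqP->]; last 1 first.
  - by rewrite {1}/b inv Fa Fb /b' inv'.
  - have := Mal x xc; have /andP[xa xb] := na x xc.
    have /andP[fa fb] := na' _ (fc x xc).
    rewrite /ct /ct' !ct_alE // -/a -/b -/a' -/b' (negbTE xa) (negbTE xb) (negbTE fa) (negbTE fb) /=.
    rewrite (Fc x xc) => <-; rewrite Fc //.
    by have := comp_al xc; rewrite /ct ct_alE // -/a -/b (negbTE xa) (negbTE xb).
  by rewrite -/b Fa Fb.
case/or3P=> [xc|/eqP->|/eqP->].
- have /andP[xa xb] := na x xc; have /andP[fa fb] := na' _ (fc x xc).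
  rewrite (Fc x xc); case: (altP (x =P r)) => [->|xr]; first by rewrite fr -/a Fa.
  case: (altP (x =P y)) => [E|xy].
    have yr' : y != r by rewrite -E.
    by rewrite E siy // fy siy' -?yr // Fb.
  have fxy : f x != y' by rewrite -fy (inj_in_eq inj).
  have fxr : f x != r' by rewrite -fr (inj_in_eq inj).
  have exx : ex x = si x by rewrite exE (negbTE xa) (negbTE xb) (negbTE xy) (negbTE xr).
  have exx' : ex' (f x) = si' (f x).
    by rewrite exE' (negbTE fa) (negbTE fb) (negbTE fxy) (negbTE fxr).
  by rewrite -exx -exx' Fc ?Msi // comp_si.
- have exy : ex y = si a.
    by have /andP[ya yb] := na y yc; rewrite exE (negbTE ya) (negbTE yb) eqxx.
  have exy' : ex' y' = si' a'.
    have := na' _ (fc y yc); rewrite fy => /andP[ya yb].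
    by rewrite exE' (negbTE ya) (negbTE yb) eqxx.
  by rewrite Fa -exy -exy' Fc ?comp_si // Msi // fy.
rewrite Fb; case E : (y == r).
  have E' := E; rewrite yr in E'.
  by have := sby; have := sby'; rewrite E E' => /eqP-> /eqP->.
have E' := E; rewrite yr in E'.
have exr : ex r = si b.
  have /andP[ya yb] := na r rc1.
  by rewrite exE (negbTE ya) (negbTE yb) eq_sym E eqxx.
have exr' : ex' r' = si' b'.
  have := na' _ (fc r rc1); rewrite fr => /andP[ya yb].
  by rewrite exE' (negbTE ya) (negbTE yb) eq_sym E' eqxx.
by rewrite -exr -exr' Fc ?comp_si // Msi // fr.
Qed.

End Morph.

(** * Every code is realised *)

Lemma ltn_add_pred m v : 1 < v -> m < m + v.-1.
Proof. by case: v => [|[|v]] //= _; rewrite addnS ltnS leq_addr. Qed.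

Section Realize.
Variable T : finType.
Implicit Types (al si : {perm T}) (r a b x y z : T) (D : {set T}).

(** These two undo [ex_si] and [lp_si] by the same transpositions in reverse order. Here [y] is to
    be the last dart given to the far end. *)
Definition unex_si si r a b y : {perm T} :=
  (tperm r a * (tperm r b * (tperm y b * si)))%g.
Definition unlp_si si r a b : {perm T} := (si * tperm a b * tperm r a)%g.

Lemma unex_siE si r a b y x : a != b -> r != a -> r != b -> si a = a -> si b = b ->
  y != a -> y != b ->
  unex_si si r a b y x = if x == r then a else if x == a then si y
    else if x == b then (if y == r then b else si r)
    else if x == y then b else si x.
Proof.
move=> ab ra rb sa sb ya yb; rewrite /unex_si !permM.
have ba : b != a by rewrite eq_sym.
case: (altP (x =P r)) => [->|xr].
  by rewrite tpermL (tpermD (z := a)) // (tpermD (z := a)).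
have rx : r != x by rewrite eq_sym.
case: (altP (x =P a)) => [->|xa].
  by rewrite tpermR tpermL tpermR.
have ax : a != x by rewrite eq_sym.
rewrite (tpermD rx ax); case: (altP (x =P b)) => [->|xb].
  rewrite tpermR; case: (altP (y =P r)) => [->|yr].
    by rewrite tpermL sb.
  by rewrite tpermD // eq_sym.
have bx : b != x by rewrite eq_sym.
rewrite (tpermD rx bx); case: (altP (x =P y)) => [->|xy].
  by rewrite tpermL.
by rewrite tpermD // eq_sym.
Qed.

Lemma eq_cn_on al si al' si' r : {in comp al si r, forall x, al x = al' x /\ si x = si' x} ->
  comp al' si' r = comp al si r.
Proof.
move=> H; apply/eqP; rewrite eqEsubset; apply/andP; split.
  apply: comp_min; first exact: comp_r.
  by move=> x xc; have [<- <-] := H x xc; rewrite comp_al ?comp_si.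
apply/subsetP=> x; rewrite inE => /connectP[p].
suff K u : u \in comp al si r -> u \in comp al' si' r -> path (mrel al si set0) u p ->
  x = last u p -> x \in comp al' si' r by apply: K; exact: comp_r.
elim: p u => [|v p IH] u uc uc' /=; first by move=> _ ->.
have [e1 e2] := H u uc.
by case/andP=> /orP[|/andP[_]]/eqP->; apply: IH; rewrite ?comp_al ?comp_si // ?e1 ?e2 ?comp_al ?comp_si.
Qed.

(** Nothing changes off [r] and [D]. This allows the two sides of a loop to be built one after the
    other on disjoint sets of darts. *)
Definition realizes c al0 si0 r D al si :=
  [/\ involutive al, {in ~: (r |: D), forall x, al x = al0 x /\ si x = si0 x},
      (al r = r /\ {in D, forall x, al x != x}),
      isCode c al si r & (comp al si r = r |: D /\ planar al si)].

Lemma realizes_good c al0 si0 r D al si : realizes c al0 si0 r D al si -> good al si r.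
Proof.
move=> [inv _ [rl leg] _ [cE _]]; split=> // x cx xr; apply: leg.
have : x \in comp al si r by rewrite inE.
by rewrite cE !inE (negbTE xr).
Qed.

(** Two darts of [D] become the root edge, and the others are handed to the recursive calls. The
    reductions of the resulting map are then equal, as permutations, to the maps supplied by
    induction. *)
Lemma realize c : valid c -> forall al0 si0 r D, involutive al0 -> planar al0 si0 ->
  #|D| = 2 * csize c -> r \notin D ->
  {in r |: D, forall x, al0 x = x /\ si0 x = x} ->
  exists al si, realizes c al0 si0 r D al si.
Proof.
elim: c => [_|c1 IH1 c2 IH2 /andP[v1 v2]|c IH i /andP[id_ v]] al0 si0 r D inv0 pl0 cD rD iso.
- have D0 : D = set0 by apply/eqP; rewrite -cards_eq0 cD.
  have [rl rs] : al0 r = r /\ si0 r = r by apply: iso; rewrite !inE eqxx.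
  exists al0, si0; split=> //.
  + by split=> // x; rewrite D0 inE.
  + exact: isVtx.
  split=> //; rewrite D0 setU0; apply/eqP; rewrite eqEsubset sub1set comp_r andbT.
  by apply: comp_min; [rewrite inE|move=> x; rewrite !inE => /eqP->; rewrite rl rs eqxx].
- have [a aD] : exists a, a \in D.
    by apply/set0Pn; rewrite -cards_eq0 cD /=; lia.
  have cDa : #|D :\ a| = (2 * (csize c1 + csize c2)).+1.
    by have := cardsD1 a D; rewrite aD cD /=; lia.
  have [b bDa] : exists b, b \in D :\ a.
    by apply/set0Pn; rewrite -cards_eq0 cDa.
  have cDb : #|D :\ a :\ b| = 2 * (csize c1 + csize c2).
    by have := cardsD1 b (D :\ a); rewrite bDa cDa /=; lia.
  have [D1 sD1 cD1] : exists2 D1 : {set T}, D1 \subset D :\ a :\ b & #|D1| = 2 * csize c1.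
    pose s := take (2 * csize c1) (enum (D :\ a :\ b)).
    have us : uniq s by rewrite take_uniq ?enum_uniq.
    exists [set x in s]; last first.
      rewrite cardsE (card_uniqP us) size_take_min -cardE cDb.
      by apply/minn_idPl; rewrite mulnDr leq_addr.
    by apply/subsetP=> x; rewrite inE => /mem_take; rewrite mem_enum.
  pose D2 := (D :\ a :\ b) :\: D1.
  have cD2 : #|D2| = 2 * csize c2.
    by rewrite cardsD (setIidPr sD1) cD1 cDb mulnDr addKn.
  have DE x : x \in D = [|| x == a, x == b, x \in D1 | x \in D2].
    rewrite !inE; move/subsetP: sD1 => /(_ x); rewrite !inE.
    case: (altP (x =P a)) => [->|xa] /=; first by rewrite aD.
    case: (altP (x =P b)) => [->|xb] /=.
      by move: bDa; rewrite inE => /andP[_ ->].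
    by case: (x \in D1) => //= H; rewrite H.
  have ab : a != b by move: bDa; rewrite !inE eq_sym => /andP[].
  have aD1 : a \notin D1 by apply/negP=> /(subsetP sD1); rewrite !inE eqxx andbF.
  have bD1 : b \notin D1 by apply/negP=> /(subsetP sD1); rewrite !inE eqxx.
  have aD2 : a \notin D2 by rewrite !inE eqxx /= !andbF.
  have bD2 : b \notin D2 by rewrite !inE eqxx /= !andbF.
  have rD1 : r \notin D1 by apply: contra rD => h; rewrite DE h !orbT.
  have rD2 : r \notin D2 by apply: contra rD => h; rewrite DE h !orbT.
  have ra : r != a by apply: contra rD => /eqP->.
  have rb : r != b by apply: contra rD => /eqP->; rewrite DE eqxx orbT.
  have [al1 [si1 R1]] : exists al si, realizes c1 al0 si0 a D1 al si.
    apply: IH1 => // x; rewrite !inE => h; apply: iso; rewrite !inE DE.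
    by case/orP: h => ->; rewrite ?orbT.
  have [inv1 off1 [leg1 nf1] ic1 [cp1 pl1]] := R1.
  have same1 x : x \in [set r; b] :|: D2 -> al1 x = x /\ si1 x = x.
    move=> h; have xo : x \notin a |: D1.
      rewrite !inE; apply/negP; move: h; rewrite !inE.
      case/orP=> [/orP[]/eqP->|/andP[xD1 /andP[xb /andP[xa _]]]].
      - by rewrite (negbTE ra) (negbTE rD1).
      - by rewrite eq_sym (negbTE ab) (negbTE bD1).
      by rewrite (negbTE xa) (negbTE xD1).
    have [-> ->] : al1 x = al0 x /\ si1 x = si0 x by apply: off1; rewrite inE.
    apply: iso; rewrite !inE DE; move: h; rewrite in_setU !in_set2.
    by case/orP=> [/orP[->|->]|->]; rewrite ?orbT.
  have [al2 [si2 R2]] : exists al si, realizes c2 al1 si1 b D2 al si.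
    apply: IH2 => // x h; apply: same1; move: h; rewrite in_setU1 in_setU in_set2.
    by case/orP=> ->; rewrite ?orbT.
  have [inv2 off2 [leg2 nf2] ic2 [cp2 pl2]] := R2.
  have same2 x : x \in r |: (a |: D1) -> al2 x = al1 x /\ si2 x = si1 x.
    move=> h; apply: off2; rewrite !inE; apply/negP; move: h; rewrite !inE.
    case/or3P=> [/eqP->|/eqP->|xD1].
    - by rewrite (negbTE rb) (negbTE rD) /= !andbF.
    - by rewrite (negbTE ab) eqxx /= !andbF.
    by rewrite xD1 orbF => /eqP E; move: bD1; rewrite -E xD1.
  have [rl2 rs2] : al2 r = r /\ si2 r = r.
    have [-> ->] := same2 r (setU11 _ _); apply: same1.
    by rewrite !inE eqxx.
  have g1 := realizes_good R1; have g2 := realizes_good R2.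
  have cpa : comp al2 si2 a = a |: D1.
    rewrite -cp1; apply: eq_cn_on => x; rewrite cp1 => h.
    by have [-> ->] : al2 x = al1 x /\ si2 x = si1 x by apply: same2; rewrite inE h orbT.
  have ic1' : isCode c1 al2 si2 a.
    apply: (isCode_morph ic1 g1 pl1 (f := id)) => //; split=> // x; rewrite cp1 => h.
      by have [->] : al2 x = al1 x /\ si2 x = si1 x by apply: same2; rewrite inE h orbT.
    by have [_ ->] : al2 x = al1 x /\ si2 x = si1 x by apply: same2; rewrite inE h orbT.
  have la2 : al2 a = a.
    by have [-> _] : al2 a = al1 a /\ si2 a = si1 a by apply: same2; rewrite !inE eqxx orbT.
  pose al : {perm T} := (tperm a b * al2)%g; pose si := unlp_si si2 r a b.
  have siE x : si x = let z := si2 x in if z == a then b else if z == b then r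
       else if z == r then a else z.
    rewrite /si /unlp_si !permM /=; case: (tpermP a b (si2 x)) => [->|->|/eqP na /eqP nb].
    - by rewrite eqxx tpermD // eq_sym.
    - by rewrite eq_sym (negbTE ab) eqxx tpermR.
    rewrite (negbTE na) (negbTE nb).
    case: (altP (si2 x =P r)) => [->|nr]; first by rewrite tpermL.
    by rewrite tpermD // eq_sym.
  have alE x : al x = if x == a then b else if x == b then a else al2 x.
    rewrite /al permM; case: tpermP => [->|->|/eqP na /eqP nb].
    - by rewrite eqxx leg2.
    - by rewrite eq_sym (negbTE ab) eqxx la2.
    by rewrite (negbTE na) (negbTE nb).
  have sir : si r = a by rewrite siE /= rs2 (negbTE ra) (negbTE rb) eqxx.
  have ala : al a = b by rewrite alE eqxx.
  have alb : al b = a by rewrite alE eq_sym (negbTE ab) eqxx.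
  have inv : involutive al.
    move=> x; rewrite [al x]alE; case: (altP (x =P a)) => [->|xa] //.
    case: (altP (x =P b)) => [->|xb] //.
    have ea : (al2 x == a) = (x == a) by rewrite -{1}la2 (inj_eq perm_inj).
    have eb : (al2 x == b) = (x == b) by rewrite -{1}leg2 (inj_eq perm_inj).
    rewrite alE ea eb (negbTE xa) (negbTE xb).
    exact: inv2.
  have rl : al r = r by rewrite alE (negbTE ra) (negbTE rb).
  have ctE : ct_al al si r = al2.
    by rewrite /ct_al sir ala /al tpermKg.
  have lpE : lp_si al si r = si2.
    by rewrite /lp_si sir ala /si /unlp_si -!mulgA (mulgA (tperm r a)) tperm2 mul1g tperm2 mulg1.
  have not_in x : x \in a |: D1 -> x != b /\ x != r.
    rewrite !inE => /orP[/eqP->|xD1]; first by split=> //; rewrite eq_sym.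
    split; first by apply: contra bD1 => /eqP<-.
    by apply: contra rD1 => /eqP<-.
  (* Starting at [a], [si] follows the cycle of [si2], and at the dart where [si2] would return to
     [a] it goes to [b] instead. *)
  have ins : al (si r) \in porbit si r.
    rewrite sir ala; apply/negPn/negP => nb.
    have ap : a \in porbit si r by rewrite -sir mem_porbit1.
    have it j : iter j si2 a \in porbit si r /\ iter j si2 a \in a |: D1.
      elim: j => [|j [IHp IHc]]; first by rewrite !inE eqxx.
      have nc : iter j.+1 si2 a \in a |: D1.
        by move: IHc; rewrite -cpa; exact: comp_si.
      split=> //; have := porbit_closed IHp; rewrite siE /= -iterS.
      have [n1 n2] := not_in _ nc; rewrite (negbTE n1) (negbTE n2).
      by case: ifP => // /eqP ->.
    case/negP: nb; have [k kE] := iter_order_perm si2 a; have kE' : iter k.+1 si2 a = a by rewrite iterSr.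
    have := porbit_closed (it k).1; rewrite siE /=.
    by rewrite -[si2 (iter _ _ _)]iterS kE' eqxx.
  have ar' : si r != r by rewrite sir eq_sym.
  have ab' : al (si r) != si r by rewrite sir ala eq_sym.
  have cp : comp al si r = r |: D.
    apply/setP=> x; rewrite inE comp_loop0 // ctE lpE sir ala.
    have -> : cn al2 si2 set0 a x = (x \in a |: D1) by rewrite -cpa inE.
    have -> : cn al2 si2 set0 b x = (x \in b |: D2) by rewrite -cp2 inE.
    rewrite !in_setU1 DE.
    by case: (x == r); case: (x == a); case: (x == b); case: (x \in D1); case: (x \in D2).
  exists al, si; split=> //.
  + move=> x; rewrite in_setC in_setU1 negb_or DE => /andP[xr /norP[xa /norP[xb /norP[xD1 xD2]]]].
    have [e1 e2] : al1 x = al0 x /\ si1 x = si0 x.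
      by apply: off1; rewrite in_setC in_setU1 negb_or xa xD1.
    have [e3 e4] : al2 x = al1 x /\ si2 x = si1 x.
      by apply: off2; rewrite in_setC in_setU1 negb_or xb xD2.
    rewrite alE (negbTE xa) (negbTE xb) e3 e1; split=> //; rewrite siE /= e4 e2.
    have hx : x \notin r |: D by rewrite in_setU1 DE !negb_or xr xa xb xD1.
    have f0 z : z \in r |: D -> si0 x != z.
      move=> zD; have [_ sz] := iso z zD; rewrite -sz (inj_eq perm_inj).
      by apply/eqP=> E; rewrite E zD in hx.
    by rewrite !(negbTE (f0 _ _)) // in_setU1 ?DE !eqxx ?orbT.
  + split=> // x; rewrite DE alE; case: (altP (x =P a)) => [-> _|xa]; first by rewrite eq_sym.
    case: (altP (x =P b)) => [->|xb] //= /orP[xD1|xD2]; last exact: nf2.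
    have [-> _] : al2 x = al1 x /\ si2 x = si1 x by apply: same2; rewrite !inE xD1 !orbT.
    exact: nf1.
  + by apply: isLoop; rewrite ?ctE ?lpE // ?sir ?ala.
  split=> //; apply: (@lp_planarE _ al si r) => //; rewrite ?ctE ?lpE //.
  rewrite sir ala; apply/negP=> c.
  have : b \in comp al2 si2 a by rewrite inE.
  by rewrite cpa !inE eq_sym (negbTE ab) (negbTE bD1).
have [a aD] : exists a, a \in D.
  by apply/set0Pn; rewrite -cards_eq0 cD /=; lia.
have cDa : #|D :\ a| = (2 * csize c).+1.
  by have := cardsD1 a D; rewrite aD cD /=; lia.
have [b bDa] : exists b, b \in D :\ a.
  by apply/set0Pn; rewrite -cards_eq0 cDa.
have cDb : #|D :\ a :\ b| = 2 * csize c.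
  by have := cardsD1 b (D :\ a); rewrite bDa cDa /=; lia.
set D1 := D :\ a :\ b in cDb.
have ab : a != b by move: bDa; rewrite !inE eq_sym => /andP[].
have DE x : x \in D = [|| x == a, x == b | x \in D1].
  rewrite !inE; case: (altP (x =P a)) => [->|xa] /=; first by rewrite aD.
  case: (altP (x =P b)) => [->|xb] //=.
  by move: bDa; rewrite inE => /andP[_ ->].
have aD1 : a \notin D1 by rewrite !inE eqxx andbF.
have bD1 : b \notin D1 by rewrite !inE eqxx.
have ra : r != a by apply: contra rD => /eqP->.
have rb : r != b by apply: contra rD => /eqP->; rewrite DE eqxx orbT.
have rD1 : r \notin D1 by apply: contra rD => h; rewrite DE h !orbT.
have [al1 [si1 R1]] : exists al si, realizes c al0 si0 r D1 al si.
  apply: IH => // x; rewrite in_setU1 => h; apply: iso; rewrite in_setU1 DE.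
  by case/orP: h => ->; rewrite ?orbT.
have [inv1 off1 [rl1 nf1] ic1 [cp1 pl1]] := R1.
have g1 := realizes_good R1.
have fx x : x \in [set a; b] -> al1 x = x /\ si1 x = x.
  move=> h; have [-> ->] : al1 x = al0 x /\ si1 x = si0 x.
    apply: off1; rewrite in_setC in_setU1; move: h; rewrite in_set2 => /orP[]/eqP->.
      by rewrite negb_or eq_sym ra.
    by rewrite negb_or eq_sym rb.
  by apply: iso; rewrite in_setU1 DE; move: h; rewrite in_set2 => /orP[]->; rewrite ?orbT.
have [la1 sa1] : al1 a = a /\ si1 a = a by apply: fx; rewrite !inE eqxx.
have [lb1 sb1] : al1 b = b /\ si1 b = b by apply: fx; rewrite !inE eqxx orbT.
have [dE _] := isCode_deg ic1 g1 pl1.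
set N := #|porbit si1 r| in dE.
have iN : i < N by rewrite dE ltnS.
have N0 : 0 < N by rewrite dE.
pose y := iter i si1 r.
have yc : y \in comp al1 si1 r.
  by rewrite /y; apply: comp_porbit (comp_r _ _ _) _; rewrite -permX mem_porbit.
have nac z : z \in comp al1 si1 r -> (z != a) && (z != b).
  rewrite cp1 !inE => /orP[/eqP->|/andP[-> /andP[-> _]]] //.
  by rewrite ra rb.
have /andP[ya yb] := nac y yc.
pose al : {perm T} := (tperm a b * al1)%g; pose si := unex_si si1 r a b y.
have siE := fun x => @unex_siE si1 r a b y x ab ra rb sa1 sb1 ya yb.
rewrite -/si in siE.
have alE x : al x = if x == a then b else if x == b then a else al1 x.
  rewrite /al permM; case: tpermP => [->|->|/eqP na /eqP nb].
  - by rewrite eqxx.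
  - by rewrite eq_sym (negbTE ab) eqxx.
  by rewrite (negbTE na) (negbTE nb).
have ba : b != a by rewrite eq_sym.
have sir : si r = a by rewrite siE eqxx.
have ala : al a = b by rewrite alE eqxx.
have alb : al b = a by rewrite alE (negbTE ba) eqxx.
have inv : involutive al.
  move=> x; rewrite [al x]alE; case: (altP (x =P a)) => [->|xa] //.
  case: (altP (x =P b)) => [->|xb] //.
  have ea : (al1 x == a) = (x == a) by rewrite -{1}la1 (inj_eq perm_inj).
    have eb : (al1 x == b) = (x == b) by rewrite -{1}lb1 (inj_eq perm_inj).
    rewrite alE ea eb (negbTE xa) (negbTE xb).
  exact: inv1.
have rl : al r = r by rewrite alE (negbTE ra) (negbTE rb).
have ctE : ct_al al si r = al1 by rewrite /ct_al sir ala /al tpermKg.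
have yr0 : (y == r) = (i == 0).
  apply/eqP/eqP => [E|i0]; last by rewrite /y i0.
  exact: (@iter_porbit_inj _ si1 r i 0 E).
have sib : si b = if y == r then b else si1 r.
  by rewrite siE eq_sym (negbTE rb) (negbTE ba) eqxx.
have siy : y != r -> si y = b.
  by move=> yr; rewrite siE (negbTE yr) (negbTE ya) (negbTE yb) eqxx.
have lastE : ex_last al si r = y.
  rewrite /ex_last sir ala sib; case: (altP (y =P r)) => [->|yr]; first by rewrite eqxx.
  have /andP[_ n] : (si1 r != a) && (si1 r != b).
    by apply: nac; apply: comp_si; exact: comp_r.
  by rewrite (negbTE n) -(siy yr) permK.
have exE : ex_si al si r = si1.
  by rewrite /ex_si lastE sir ala /si /unex_si !tpermKg.
have nins : al (si r) \notin porbit si r.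
  (* [A] holds [r], [a] and the darts after place [i] of the contracted vertex. It is closed under
     [si], contains [r] and misses [b]. *)
  rewrite sir ala; pose A := [set r; a] :|: [set iter j si1 r | j : 'I_N & i < j].
  have rA : r \in A by rewrite !inE eqxx.
  have aA : a \in A by rewrite !inE eqxx orbT.
  have nxt j : i <= j -> j < N -> iter j.+1 si1 r \in A.
    move=> ij jN; case: (ltnP j.+1 N) => [jN'|jN'].
      rewrite in_setU; apply/orP; right; apply/imsetP; exists (Ordinal jN') => //.
      by rewrite inE /= ltnS.
    have -> : j.+1 = N by apply/eqP; rewrite eqn_leq jN jN'.
    by rewrite iter_porbit.
  have sub : porbit si r \subset A.
    apply: porbit_subset => // z; rewrite in_setU in_set2.
    case/orP=> [/orP[]/eqP->|/imsetP[j]]; first by rewrite sir.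
      rewrite siE eq_sym (negbTE ra) eqxx; exact: nxt.
    rewrite inE => ij ->; have jN := ltn_ord j.
    have zc : iter j si1 r \in comp al1 si1 r.
      by apply: comp_porbit (comp_r _ _ _) _; rewrite -permX mem_porbit.
    have /andP[za zb] := nac _ zc.
    rewrite siE (negbTE za) (negbTE zb); case: ifP => [_|zr]; first exact: aA.
    case: ifP => [/eqP E|_]; last by apply: nxt => //; exact: ltnW.
    have E2 : j = i :> nat.
      exact: (@iter_porbit_inj _ si1 r j i E).
    by move: ij; rewrite E2 ltnn.
  apply/negP => /(subsetP sub); rewrite in_setU in_set2 eq_sym (negbTE rb) (negbTE ba) /=.
  case/imsetP=> j _ E; have zc : iter j si1 r \in comp al1 si1 r.
    by apply: comp_porbit (comp_r _ _ _) _; rewrite -permX mem_porbit.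
  by have := nac _ zc; rewrite -E eqxx andbF.
have ar' : si r != r by rewrite sir eq_sym.
have ab' : al (si r) != si r by rewrite sir ala.
have cp : comp al si r = r |: D.
  apply/setP=> x; rewrite inE comp_expand0 // ctE exE sir ala.
  have := congr1 (fun A : {set T} => x \in A) cp1.
  rewrite inE in_setU1 => ->; rewrite in_setU1 DE.
  by case: (x == r); case: (x == a); case: (x == b); case: (x \in D1).
have iE : i = #|porbit si (al (si r))|.-1.
  have e1 := ex_iter_last inv rl ar' ab' nins; rewrite exE lastE in e1.
  have e2 := card_ex_porbit inv rl ar' ab' nins; rewrite exE -/N in e2.
  have v2 : 1 < #|porbit si r|.
    have := subset_leq_card (_ : [set r; si r] \subset porbit si r).
    rewrite cards2 eq_sym ar' => -> //.
    by rewrite subUset !sub1set porbit_id mem_porbit1.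
  apply: (@iter_porbit_inj _ si1 r); rewrite -/N ?e1 //.
  by rewrite e2; exact: ltn_add_pred.
exists al, si; split=> //.
+ move=> x; rewrite in_setC in_setU1 negb_or DE => /andP[xr /norP[xa /norP[xb xD1]]].
  have [e1 e2] : al1 x = al0 x /\ si1 x = si0 x.
    by apply: off1; rewrite in_setC in_setU1 negb_or xr xD1.
  rewrite alE (negbTE xa) (negbTE xb) e1; split=> //.
  rewrite siE (negbTE xr) (negbTE xa) (negbTE xb) e2.
  case: ifP => // /eqP E; move: yc; rewrite -E cp1 in_setU1.
  by rewrite (negbTE xr) (negbTE xD1).
+ split=> // x; rewrite DE alE; case: (altP (x =P a)) => [-> _|xa]; first by rewrite eq_sym.
  by case: (altP (x =P b)) => [->|xb] //=; exact: nf1.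
+ by rewrite iE; apply: isExpand; rewrite ?ctE ?exE.
by split=> //; rewrite -(ex_planar inv rl ar' ab' nins) ctE exE.
Qed.

End Realize.

(** * The list of codes of a given size *)

Definition loops_of (A B : seq code) := [seq Loop c1 c2 | c1 <- A, c2 <- B].
Definition expands_of (A : seq code) :=
  flatten [seq [seq Expand c i | i <- iota 0 (deg c).+1] | c <- A].

Definition codes_step (F : nat -> seq code) n :=
  flatten [seq loops_of (F k) (F (n - k)) | k <- iota 0 n.+1] ++ expands_of (F n).
Arguments codes_step : simpl never.

Fixpoint codes_fuel f n : seq code := match n, f with
  | 0, _ => [:: Vtx]
  | n'.+1, f'.+1 => codes_step (codes_fuel f') n'
  | _, 0 => [::]
  end.
Definition codes n := codes_fuel n n.

Lemma eq_codes_step F G n : (forall k, k <= n -> F k = G k) ->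
  codes_step F n = codes_step G n.
Proof.
move=> FG; rewrite /codes_step FG //; congr (flatten _ ++ _).
apply/eq_in_map => i; rewrite mem_iota add0n => /andP[_ ik].
by rewrite !FG //; lia.
Qed.

Lemma codes_fuelE f n : n <= f -> codes_fuel f n = codes n.
Proof.
suff H g h k : k <= g -> k <= h -> codes_fuel g k = codes_fuel h k.
  by move=> nf; apply: H.
elim: g h k => [|g IH] [|h] [|k] //= kg kh.
by apply: eq_codes_step => i ik; apply: IH; lia.
Qed.

Lemma codesS n : codes n.+1 =
  flatten [seq loops_of (codes k) (codes (n - k)) | k <- iota 0 n.+1]
  ++ expands_of (codes n).
Proof.
rewrite {1}/codes [codes_fuel _ _]/=.
by apply: (@eq_codes_step _ codes) => i ik; exact: codes_fuelE.
Qed.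

Lemma mem_codes0 c : (c \in codes 0) = valid c && (csize c == 0).
Proof.
rewrite [codes 0]/= inE; case: c => [|c1 c2|c i] /=; first by rewrite eqxx.
  by rewrite andbF; apply/eqP.
by rewrite andbF; apply/eqP.
Qed.

Lemma mem_codes n c : (c \in codes n) = valid c && (csize c == n).
Proof.
elim: n {-2}n (leqnn n) c => [|N IH] [|n] nN c.
- exact: mem_codes0.
- by [].
- exact: mem_codes0.
rewrite codesS mem_cat; apply/orP/andP.
  case=> [/flatten_mapP[k]|/flatten_mapP[c']].
    rewrite mem_iota add0n => /andP[_ kn] /allpairsP[[c1 c2] [/= h1 h2 ->]].
    rewrite !IH in h1 h2; try lia.
    case/andP: h1 => v1 /eqP s1; case/andP: h2 => v2 /eqP s2.
    by rewrite /= v1 v2 s1 s2; split=> //; apply/eqP; lia.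
  rewrite IH; last by lia.
  case/andP=> v /eqP s /mapP[i]; rewrite mem_iota => /andP[_ id_] ->.
  by rewrite /= v s eqxx; split=> //; rewrite andbT; lia.
case: c => [|c1 c2|c i] [v /eqP s] //; rewrite /= in v s.
  case/andP: v => v1 v2; left; apply/flatten_mapP; exists (csize c1).
    by rewrite mem_iota; lia.
  have n1 : csize c1 <= N by lia.
  have n2 : n - csize c1 <= N by lia.
  have h1 : c1 \in codes (csize c1) by rewrite (IH _ n1) v1 eqxx.
  have h2 : c2 \in codes (n - csize c1).
    by rewrite (IH _ n2) v2 /=; apply/eqP; lia.
  by apply/allpairsP; exists (c1, c2).
case/andP: v => id_ v; right; apply/flatten_mapP; exists c.
  have n1 : n <= N by lia.
  by rewrite (IH _ n1) v /=; apply/eqP; lia.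
by apply/mapP; exists i => //; rewrite mem_iota; lia.
Qed.

(** [g] reads the index off an element, which makes the pieces disjoint. *)
Lemma uniq_flatten_map (I T : eqType) (s : seq I) (F : I -> seq T) (g : T -> I) :
  uniq s -> (forall i, i \in s -> uniq (F i)) ->
  (forall i x, i \in s -> x \in F i -> g x = i) -> uniq (flatten [seq F i | i <- s]).
Proof.
elim: s => //= i s IH /andP[is_ us] uF gF; rewrite cat_uniq uF ?mem_head //=.
rewrite IH ?andbT //; first last.
- by move=> j x js; apply: gF; rewrite inE js orbT.
- by move=> j js; apply: uF; rewrite inE js orbT.
apply/hasPn => x /flatten_mapP[j js xj]; apply: contra is_ => /= xi.
by rewrite -(gF i x) ?mem_head // (gF j x) // inE js orbT.
Qed.

Lemma uniq_codes n : uniq (codes n).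
Proof.
elim: n {-2}n (leqnn n) => [|N IH] [|n] nN //.
rewrite codesS cat_uniq; apply/and3P; split.
- apply: (@uniq_flatten_map _ _ _ _ (fun c => if c is Loop c1 _ then csize c1 else 0)).
  + exact: iota_uniq.
  + move=> k; rewrite mem_iota => /andP[_ kn]; apply: allpairs_uniq.
    * by apply: IH; lia.
    * by apply: IH; lia.
    by move=> [a b] [c d] _ _ /= [-> ->].
  move=> k c; rewrite mem_iota => /andP[_ kn] /allpairsP[[c1 c2] [/= h1 h2 ->]].
  by move: h1; rewrite mem_codes => /andP[_ /eqP].
- apply/hasPn => c /flatten_mapP[c' _ /mapP[i _ ->]].
  by apply/negP => /flatten_mapP[k _ /allpairsP[[c1 c2] [_ _]]].
apply: (@uniq_flatten_map _ _ _ _ (fun c => if c is Expand c1 _ then c1 else Vtx)).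
- by apply: IH; lia.
- by move=> c _; rewrite map_inj_uniq ?iota_uniq // => i j [].
by move=> c c' _ /mapP[i _ ->].
Qed.

(** * Rooted maps and their codes *)

Lemma cn1 (Y : finType) (s : {perm Y}) (x y : Y) : cn 1%g s set0 x y = (y \in porbit s x).
Proof.
apply/idP/idP; last exact: cn0_porbit.
case/connectP=> p; elim: p x => [|z p IH] x /=; first by move=> _ ->; exact: porbit_id.
case/andP=> xz pz lst; have:= IH z pz lst.
case/orP: xz => [/eqP->|/andP[_ /eqP->]]; first by rewrite perm1.
by rewrite -!eq_porbit_mem (porbit_perm s 1).
Qed.

Lemma ncomp_connected (Y : finType) (al s : {perm Y}) (y0 : Y) :
  (forall u v, cn al s set0 u v) -> ncomp al s = 1.
Proof.
move=> c; rewrite /ncomp /ncl; suff -> : classes_of (mrel al s set0) = [set setT].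
  by rewrite cards1.
have cT u : ccl (mrel al s set0) u = setT by apply/setP=> v; rewrite !inE c.
apply/setP=> A; rewrite inE; apply/imsetP/eqP => [[u _ ->]|->]; first exact: cT.
by exists y0; rewrite ?cT.
Qed.

Section Lift.
Variable X : finType.
Implicit Types (s t : {perm X}) (x y rho : X) (v : {set X}).

Lemma omap_inj s : injective (omap s).
Proof. by move=> [x|] [y|] //= [/perm_inj ->]. Qed.
Definition optp s : {perm option X} := perm (@omap_inj s).

Lemma optp_none s : optp s None = None. Proof. by rewrite permE. Qed.
Lemma optp_some s x : optp s (Some x) = Some (s x). Proof. by rewrite permE. Qed.

Lemma optpM s t : (optp (s * t) = optp s * optp t)%g.
Proof.
by apply/permP=> -[x|]; rewrite permM ?optp_none // !optp_some permM.
Qed.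

Lemma optp1 : optp 1 = 1%g.
Proof. by apply/permP=> -[x|]; rewrite perm1 ?optp_none // optp_some perm1. Qed.

Lemma optp_iter s x i : iter i (optp s) (Some x) = Some (iter i s x).
Proof. by elim: i => //= i ->; rewrite optp_some. Qed.

Lemma optp_porbit s x : porbit (optp s) (Some x) = Some @: porbit s x.
Proof.
apply/setP=> z; apply/porbitP/imsetP => [[i ->]|[y /porbitP[i ->] ->]].
  by exists ((s ^+ i)%g x); rewrite ?mem_porbit // !permX optp_iter.
by exists i; rewrite !permX optp_iter.
Qed.

Lemma optp_porbit_none s : porbit (optp s) None = [set None].
Proof. by apply: fix_porbit; exact: optp_none. Qed.

Lemma card_porbits_optp s : #|porbits (optp s)| = #|porbits s|.+1.
Proof.
have -> : porbits (optp s) = [set None] |: (fun A : {set X} => Some @: A) @: porbits s.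
  apply/setP=> A; rewrite in_setU1; apply/imsetP/orP.
    case=> -[x|] _ ->; [right|left; by rewrite optp_porbit_none].
    by rewrite optp_porbit; apply/imset_f/imset_f.
  case=> [/eqP->|/imsetP[B /imsetP[x _ ->] ->]].
    by exists None => //; rewrite optp_porbit_none.
  by exists (Some x) => //; rewrite optp_porbit.
rewrite cardsU1 card_imset; last by apply: imset_inj => x y [].
case: (boolP (_ \in _)) => // /imsetP[B _ /setP/(_ None)].
rewrite inE eqxx => /esym/imsetP[x _] //.
Qed.

Lemma unlift (s : {perm option X}) : s None = None -> exists t, s = optp t.
Proof.
move=> sN; have sS x : s (Some x) != None by rewrite -sN (inj_eq perm_inj).
pose f x := odflt x (s (Some x)).
have fE x : s (Some x) = Some (f x) by rewrite /f; case: (s (Some x)) (sS x).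
have fi : injective f.
  move=> x y E; have : s (Some x) = s (Some y) by rewrite !fE E.
  by move/perm_inj => [].
exists (perm fi); apply/permP=> -[x|]; last by rewrite sN optp_none.
by rewrite optp_some permE fE.
Qed.

Variable rho : X.
(** The leg [None] is inserted in the corner just before the dart [rho]. *)
Definition legp s : {perm option X} := (optp s * tperm None (Some rho))%g.
Definition leg_set v : {set option X} :=
  [set u | if u is Some x then x \in v else rho \in v].

Lemma legp_none s : legp s None = Some rho.
Proof. by rewrite permM optp_none tpermL. Qed.
Lemma legp_some s x : legp s (Some x) = if s x == rho then None else Some (s x).
Proof.
rewrite permM optp_some; case: (altP (s x =P rho)) => [->|ne].
  by rewrite tpermR.
rewrite tpermD //; apply/eqP=> -[E]; by rewrite E eqxx in ne.
Qed.

Lemma card_legp s : #|porbits (legp s)| = #|porbits s|.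
Proof.
apply/eqP; rewrite -eqSS -card_porbits_optp; apply/eqP; apply: porbits_joinr.
by rewrite optp_porbit; apply/imsetP=> -[].
Qed.

(** Walks are projected by sending the leg to [rho], which shares its vertex; in the other direction
    a step into [rho] takes a detour through the leg. *)
Lemma leg_cn (al s : {perm X}) v x y : sstable s v ->
  cn (optp al) (legp s) (leg_set v) (Some x) (Some y) = cn al s v x y.
Proof.
move=> st; apply/idP/idP.
  pose g (u : option X) := odflt rho u.
  suff H u w : cn (optp al) (legp s) (leg_set v) u w -> cn al s v (g u) (g w) by move/H.
  case/connectP=> p; elim: p u => [|z p IH] u /=; first by move=> _ ->; exact: connect0.
  case/andP=> uz pz lst; apply: connect_trans (IH z pz lst).
  case: u uz => [u|]; case/orP => [/eqP->|/andP[uv /eqP->]].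
  - by rewrite optp_some; exact: cn_al.
  - rewrite legp_some; rewrite inE in uv.
    have su := cn_si al s uv; case: (altP (s u =P rho)) su => [->|_] su; exact: su.
  - by rewrite optp_none; exact: connect0.
  by rewrite legp_none; exact: connect0.
case/connectP=> p; elim: p x => [|z p IH] u /=; first by move=> _ ->; exact: connect0.
case/andP=> uz pz lst; apply: connect_trans (IH z pz lst).
case/orP: uz => [/eqP->|/andP[uv /eqP->]].
  by rewrite -optp_some; exact: cn_al.
have uU : Some u \notin leg_set v by rewrite inE.
have su := cn_si (optp al) (legp s) uU; rewrite legp_some in su.
case: (altP (s u =P rho)) su => [E|_] su //; rewrite E.
apply: connect_trans su _; rewrite -(legp_none s); apply: cn_si.
by rewrite inE -E st.
Qed.

Lemma leg_porbit s x : porbit (legp s) (Some x) = leg_set (porbit s x).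
Proof.
have L0 : leg_set set0 = set0 by apply/setP=> -[z|]; rewrite !inE.
have H y : (Some y \in porbit (legp s) (Some x)) = (y \in porbit s x).
  rewrite -!cn1 -optp1 -L0 leg_cn //; exact: sstable0.
apply/setP=> -[y|]; rewrite ?inE ?H //.
rewrite -H -[RHS]eq_porbit_mem -[LHS]eq_porbit_mem.
by rewrite -(legp_none s) (porbit_perm (legp s) 1 None).
Qed.

Lemma leg_set_inj : injective leg_set.
Proof.
move=> u v /setP E; apply/setP=> x; by have := E (Some x); rewrite !inE.
Qed.

Lemma porbits_leg s : porbits (legp s) = leg_set @: porbits s.
Proof.
apply/setP=> A; apply/imsetP/imsetP => [[[x|] _ ->]|[B /imsetP[x _ ->] ->]].
- by exists (porbit s x); rewrite ?imset_f ?leg_porbit.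
- exists (porbit s rho); rewrite ?imset_f // -leg_porbit -(legp_none s).
  by rewrite (porbit_perm (legp s) 1 None).
by exists (Some x); rewrite ?leg_porbit.
Qed.

End Lift.

Section Bridge.
Variable n : nat.
Implicit Types (m : premap n).

Definition legal m : {perm option (dart n)} := optp (alpha m).
Definition legsi m : {perm option (dart n)} := legp (root m) (sigma m).
Definition map_code m : code := code_of (2 * n) (legal m) (legsi m) None.

Lemma card_odart : #|{: option (dart n)}| = (2 * n).+1.
Proof. by rewrite card_option card_ord. Qed.

Lemma rmapP m : reflect
  [/\ involutive (alpha m), forall x, alpha m x != x,
      forall x y, cn (alpha m) (sigma m) set0 x y &
      #|porbits (sigma m)| + #|porbits (alpha m * sigma m)%g| = n + 2]
  (m \in rmaps n).
Proof.
rewrite inE; apply: (iffP and4P).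
  case=> /forallP inv /forallP ff /forallP c /eqP e; split=> //.
    by move=> x; apply/eqP.
  move=> x y; have /forallP/(_ y) := c x; rewrite /map_connected.
  by apply: connect_sub => u v H; apply: connect1; rewrite /mrel in_set0.
case=> inv ff c e; split; [|exact/forallP| |exact/eqP].
  by apply/forallP=> x; apply/eqP.
apply/forallP=> x; apply/forallP=> y; have := c x y.
by apply: connect_sub => u v; rewrite /mrel in_set0 => H; apply: connect1.
Qed.

Lemma card_invol (X : finType) (al : {perm X}) : involutive al ->
  (forall x, al x != x) -> #|X| = 2 * #|porbits al|.
Proof.
move=> inv ff; have orb x : porbit al x = [set x; al x].
  apply/eqP; rewrite eqEsubset; apply/andP; split.
    apply: porbit_subset; first by rewrite !inE eqxx.
    by move=> y; rewrite !inE => /orP[]/eqP->; rewrite ?inv eqxx ?orbT.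
  by rewrite subUset !sub1set porbit_id mem_porbit1.
have part : partition (porbits al) [set: X].
  apply/and3P; split.
  - apply/eqP/setP=> x; rewrite inE; apply/bigcupP; exists (porbit al x).
      exact: imset_f.
    exact: porbit_id.
  - apply/trivIsetP => A B /imsetP[x _ ->] /imsetP[y _ ->] ne.
    rewrite -setI_eq0; apply/set0Pn => -[z]; rewrite inE -!eq_porbit_mem.
    by case/andP=> /eqP e1 /eqP e2; rewrite -e1 -e2 eqxx in ne.
  apply/negP=> /imsetP[x _] /setP/(_ x); rewrite inE porbit_id //.
rewrite -cardsT (card_uniform_partition _ part (n := 2)) 1?mulnC // => A /imsetP[x _ ->].
by rewrite orb cards2 eq_sym ff.
Qed.

Lemma leg_connect m x y : cn (legal m) (legsi m) set0 (Some x) (Some y) =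
  cn (alpha m) (sigma m) set0 x y.
Proof.
rewrite -(leg_cn (root m) (alpha m) x y (sstable0 (sigma m))).
by have -> : leg_set (root m) set0 = set0 by apply/setP=> -[z|]; rewrite !inE.
Qed.

Lemma leg_connect_none m : cn (legal m) (legsi m) set0 None (Some (root m)).
Proof. by rewrite -{1}(legp_none (root m) (sigma m)); apply: cn_si; rewrite inE. Qed.

Lemma legal_inv m : involutive (alpha m) -> involutive (legal m).
Proof. by move=> inv [x|]; rewrite ?optp_none // !optp_some inv. Qed.

Lemma good_leg m : involutive (alpha m) -> (forall x, alpha m x != x) ->
  good (legal m) (legsi m) None.
Proof.
move=> inv ff; split; [exact: legal_inv|exact: optp_none|].
move=> [x|] //= _ _; rewrite optp_some; apply: contra (ff x) => /eqP[E].
by rewrite E.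
Qed.

Lemma leg_comp m : (forall x y, cn (alpha m) (sigma m) set0 x y) <->
  comp (legal m) (legsi m) None = setT.
Proof.
have symm := mrel_sym (legal m) (sstable0 (legsi m)).
split=> [c|/setP c x y].
  apply/setP=> -[x|]; rewrite !inE ?connect0 //.
  by apply: connect_trans (leg_connect_none m) _; rewrite leg_connect.
have := c (Some x); have := c (Some y); rewrite !inE -leg_connect => cy cx.
by rewrite symm in cx; exact: connect_trans cx cy.
Qed.

(** The leg adds one dart and one orbit of [al] and leaves the numbers of vertices and faces as they
    were. *)
Lemma planar_leg m : involutive (alpha m) -> (forall x, alpha m x != x) ->
  (forall x y, cn (alpha m) (sigma m) set0 x y) ->
  planar (legal m) (legsi m) =
  (#|porbits (sigma m)| + #|porbits (alpha m * sigma m)%g| == n + 2).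
Proof.
move=> inv ff c; have symm := mrel_sym (legal m) (sstable0 (legsi m)).
have nc : ncomp (legal m) (legsi m) = 1.
  have H w : cn (legal m) (legsi m) set0 None w.
    by have [/(_ c)/setP/(_ w)] := leg_comp m; rewrite !inE.
  apply: (ncomp_connected None) => u v.
  by apply: connect_trans (H v); rewrite symm.
have cA := card_invol inv ff; rewrite card_ord in cA.
have fE : (legal m * legsi m = legp (root m) (alpha m * sigma m))%g.
  by rewrite /legp optpM mulgA.
rewrite /planar /euler nc fE !card_legp card_porbits_optp card_odart.
move: #|porbits (alpha m)| #|porbits (sigma m)| #|porbits (alpha m * sigma m)%g| cA => p q t cA.
by apply/eqP/eqP; lia.
Qed.

Lemma nmoved_le m : involutive (alpha m) -> nmoved (legal m) <= 2 * n.
Proof.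
move=> inv; rewrite -ltnS -card_odart; apply: proper_card; apply/properP.
by split; [exact/subsetP|exists None; rewrite // inE optp_none eqxx].
Qed.

Lemma map_codeP m : m \in rmaps n ->
  [/\ good (legal m) (legsi m) None, planar (legal m) (legsi m) &
      isCode (map_code m) (legal m) (legsi m) None].
Proof.
case/rmapP=> inv ff c e; have g := good_leg inv ff.
have pl : planar (legal m) (legsi m) by rewrite planar_leg // e.
by split=> //; apply: isCodeP => //; exact: nmoved_le.
Qed.

Lemma mem_map_code m : m \in rmaps n -> map_code m \in codes n.
Proof.
move=> mR; have [g pl ic] := map_codeP mR; rewrite mem_codes.
have [_ ->] := isCode_deg ic g pl; have := isCode_size ic g pl.
case/rmapP: mR => _ _ c _; have [/(_ c) -> _] := leg_comp m.
rewrite cardsT card_odart /= => -[E]; apply/eqP; lia.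
Qed.

Lemma isCode_map_code m c : isCode c (legal m) (legsi m) None -> csize c <= 2 * n ->
  map_code m = c.
Proof. by move=> ic le; exact: isCode_code_of ic _ le. Qed.

Lemma map_code_iso m m' : m \in rmaps n -> m' \in rmaps n ->
  rmap_iso m m' = (map_code m == map_code m').
Proof.
move=> mR mR'; have [g pl ic] := map_codeP mR; have [g' pl' ic'] := map_codeP mR'.
apply/existsP/eqP => [[phi /and3P[/forallP ha /forallP hs /eqP hr]]|E].
  have M : morph_on (omap phi) (legal m) (legsi m) None (legal m') (legsi m').
    split; first by move=> x y _ _; exact: omap_inj.
      by move=> [x|] _; rewrite ?optp_none // !optp_some /= (eqP (ha x)).
    move=> [x|] _; last by rewrite !legp_none /= hr.
    rewrite !legp_some -(eqP (hs x)) -hr (inj_eq perm_inj).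
    by case: ifP.
  have [inv' _ _] := g'.
  have ic2 := isCode_morph ic g pl inv' M.
  apply/esym; apply: isCode_map_code ic2 _.
  by have := mem_map_code mR; rewrite mem_codes => /andP[_ /eqP->]; lia.
rewrite -E in ic'; have [f [f0 [inj fa fs]]] := isCode_iso ic g pl ic' g' pl'.
have cT x : x \in comp (legal m) (legsi m) None.
  by case/rmapP: (mR) => _ _ c _; have [/(_ c) -> _] := leg_comp m; rewrite inE.
have fi : injective f by move=> x y; apply: inj.
have fS x : f (Some x) != None by rewrite -f0 (inj_eq fi).
pose g0 x := odflt x (f (Some x)).
have gE x : f (Some x) = Some (g0 x) by rewrite /g0; case: (f (Some x)) (fS x).
have gi : injective g0.
  move=> x y e; have : f (Some x) = f (Some y) by rewrite !gE e.
  by move/fi => [].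
have hr : g0 (root m) = root m'.
  by have := fs None (cT _); rewrite legp_none gE f0 legp_none => -[].
exists (perm gi); apply/and3P; split; rewrite ?permE ?hr //.
  apply/forallP=> x; rewrite !permE; have := fa (Some x) (cT _).
  by rewrite optp_some !gE optp_some => -[->].
apply/forallP=> x; rewrite !permE; have := fs (Some x) (cT _).
rewrite legp_some gE legp_some; case: (altP (sigma m x =P root m)) => [->|_].
  by rewrite f0 hr; case: ifP => // /eqP->.
by rewrite gE; case: ifP => // _ [->].
Qed.

(** The code is realised on all darts but [None], starting from the planar map in which every dart
    is isolated. As n > 0 the leg is not alone at its vertex, and the dart after it is the root. *)
Lemma map_code_surj c : 0 < n -> c \in codes n ->
  exists2 m, m \in rmaps n & map_code m = c.
Proof.
move=> n0; rewrite mem_codes => /andP[v /eqP sc].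
have pl1 : planar (1%g : {perm option (dart n)}) 1%g.
  by apply/eqP; rewrite /euler mul1g ncomp1 !porbits1; lia.
have [|||||al [si R]] := @realize (option (dart n)) c v 1%g 1%g None [set~ None].
- by move=> x; rewrite !perm1.
- exact: pl1.
- by rewrite cardsC1 card_odart sc.
- by rewrite !inE eqxx.
- by move=> x _; rewrite !perm1.
have g := realizes_good R; case: R => inv _ [alN leg] ic [cp pl].
have siN : si None != None.
  apply/eqP=> E; have [dg _] := isCode_deg ic g pl.
  move: dg; rewrite fix_porbit // cards1 => -[/esym/eqP]; rewrite deg0 => /eqP cV.
  by move: sc n0; rewrite cV /= => <-.
have [rho rE] : exists rho, si None = Some rho by case: (si None) siN => // x; exists x.
have [al' alE] := unlift alN.
have [|si' siE] := @unlift _ (si * tperm None (Some rho))%g.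
  by rewrite permM rE tpermR.
pose m : premap n := (al', si', rho).
have mal : legal m = al by rewrite alE.
have msi : legsi m = si by rewrite /legsi /legp -siE -mulgA tperm2 mulg1.
have inv' : involutive al'.
  by move=> x; have := inv (Some x); rewrite alE !optp_some => -[].
have ff x : al' x != x.
  have := leg (Some x); rewrite !inE alE optp_some => /(_ isT).
  by apply: contra => /eqP->.
have cT : comp (legal m) (legsi m) None = setT.
  by rewrite mal msi cp; apply/setP=> x; rewrite !inE; case: (x == None).
have cc : forall x y, cn (alpha m) (sigma m) set0 x y by apply/leg_comp.
have mR : m \in rmaps n.
  by apply/rmapP; split=> //; apply/eqP; rewrite -planar_leg // mal msi.
exists m => //; apply: isCode_map_code; first by rewrite mal msi.
by rewrite sc; lia.
Qed.

End Bridge.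

(** * Cut vertices of maps, and the number of labellings of a map *)

Section CutBridge.
Variable n : nat.
Implicit Types (m : premap n).

(** A walk that never turns at [v] cannot leave its class of a separating edge partition.
    Conversely, the darts reached from [x] by such walks form one class. *)
Lemma cut_vertexE m v : v \in vertices m ->
  cut_vertex m v = cutv (alpha m) (sigma m) v.
Proof.
case/imsetP=> d _ vE; have st : sstable (sigma m) v by rewrite vE; exact: sstable_porbit.
have symm := mrel_sym (alpha m) st.
apply/existsP/exists_inP.
  case=> A /and5P[/forallP ec A0 AC /andP[/exists_inP[x xv xA] /exists_inP[y yv yA]] /forall_inP oth].
  exists x => //; apply/exists_inP; exists y => //; apply: contra yA => /connectP[p].
  elim: p x xA {xv} => [|z p IH] x xA /=; first by move=> _ ->.
  case/andP=> xz; apply: IH; case/orP: xz => [/eqP->|/andP[xv /eqP->]].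
    by rewrite -(eqP (ec x)).
  have w : porbit (sigma m) x \in vertices m by apply: imset_f.
  have ne : porbit (sigma m) x != v by apply: contra xv => /eqP<-; exact: porbit_id.
  have := oth _ w; rewrite ne /= /meets_both => /nandP[/exists_inP H|/exists_inP H].
    by case: H; exists x; rewrite // porbit_id.
  by apply/negPn/negP => nA; case: H; exists (sigma m x) => //; exact: mem_porbit1.
case=> x xv /exists_inP[y yv nc].
exists [set z | cn (alpha m) (sigma m) v x z]; apply/and5P; split.
- apply/forallP=> z; rewrite !inE; apply/eqP; apply/idP/idP => c.
    exact: connect_trans c (cn_al _ _ _ _).
  by apply: connect_trans c _; rewrite symm; exact: cn_al.
- by apply/set0Pn; exists x; rewrite inE connect0.
- by apply/set0Pn; exists y; rewrite !inE.
- apply/andP; split; apply/exists_inP; [exists x|exists y] => //; rewrite !inE ?connect0 //.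
apply/forall_inP=> w /imsetP[u _ ->]; apply/implyP => ne.
apply/negP => /andP[/exists_inP[p pw]] + /exists_inP[q qw]; rewrite !inE => cp /negP; apply.
apply: connect_trans cp _; apply: cn_porbit => //.
  apply: contra ne => pv; apply/eqP; move: pv pw; rewrite vE -!eq_porbit_mem.
  by move=> /eqP e1 /eqP e2; rewrite -e1 -e2.
by move: pw qw; rewrite -!eq_porbit_mem => /eqP-> /eqP->.
Qed.

Lemma root_deg m : m \in rmaps n -> #|porbit (sigma m) (root m)| = deg (map_code m).
Proof.
move=> mR; have [g pl ic] := map_codeP mR; have [+ _] := isCode_deg ic g pl.
have -> : porbit (legsi m) None = None |: Some @: porbit (sigma m) (root m).
  have -> : porbit (legsi m) None = leg_set (root m) (porbit (sigma m) (root m)).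
    rewrite -leg_porbit -(legp_none (root m) (sigma m)).
    by rewrite (porbit_perm (legsi m) 1 None).
  apply/setP=> -[x|]; rewrite !inE ?porbit_id // mem_imset // => u v []; exact.
rewrite cardsU1 card_imset; last by move=> u v [].
by case: imsetP => [[]|] // _ [].
Qed.

Lemma root_cut m : m \in rmaps n ->
  cutv (alpha m) (sigma m) (porbit (sigma m) (root m)) = ~~ noncut (map_code m).
Proof.
move=> mR; have [g pl ic] := map_codeP mR; have [dE _] := isCode_deg ic g pl.
have L := isCode_lab ic g pl.
have vE : porbit (legsi m) None = leg_set (root m) (porbit (sigma m) (root m)).
  rewrite -leg_porbit -(legp_none (root m) (sigma m)).
  by rewrite (porbit_perm (legsi m) 1 None).
have pos x : x \in porbit (sigma m) (root m) ->
    exists2 p, p < deg (map_code m) & iter p.+1 (legsi m) None = Some x.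
  move=> xv; have : Some x \in porbit (legsi m) None by rewrite vE inE.
  rewrite porbit_traject => /trajectP[[|p] pd E] //.
  by exists p; rewrite -?E //; move: pd; rewrite dE.
have cE x y : cn (legal m) (legsi m) (porbit (legsi m) None) (Some x) (Some y) =
    cn (alpha m) (sigma m) (porbit (sigma m) (root m)) x y.
  by rewrite vE leg_cn //; exact: sstable_porbit.
apply/exists_inP/idP => [[x xv /exists_inP[y yv]]|].
  apply: contra => /constantPn H; have [p pd pE] := pos x xv; have [q qd qE] := pos y yv.
  by rewrite -cE -pE -qE -L //; apply/eqP; apply: H; rewrite size_lab.
move=> nn; apply/exists_inP; apply: contraR nn => H; apply/constantPn => p q; rewrite size_lab => pd qd; apply/eqP.
rewrite L //; have inv k : k < deg (map_code m) ->
    exists2 x, x \in porbit (sigma m) (root m) & iter k.+1 (legsi m) None = Some x.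
  move=> kd; have : iter k.+1 (legsi m) None \in porbit (legsi m) None.
    by rewrite -permX mem_porbit.
  case E : (iter k.+1 (legsi m) None) => [x|].
    by rewrite vE inE => xv; exists x.
  have := @iter_porbit_inj _ (legsi m) None k.+1 0 E; rewrite dE ltnS => H2.
  by have := H2 kd isT.
have [x xv ->] := inv p pd; have [y yv ->] := inv q qd; rewrite cE.
apply/negPn/negP => nc; case/negP: H; apply/exists_inP; exists x => //.
by apply/exists_inP; exists y => //; apply/negP.
Qed.

Lemma num_cut_map m : m \in rmaps n -> num_cut_vertices m = xc (map_code m).
Proof.
move=> mR; have [g pl ic] := map_codeP mR.
set v0 := porbit (sigma m) (root m).
have v0v : v0 \in vertices m by apply: imset_f.
rewrite /num_cut_vertices /xc -root_cut // -(isCode_xo ic g pl) -/v0.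
have -> : [set v in vertices m | cut_vertex m v] =
    [set v in porbits (sigma m) | cutv (alpha m) (sigma m) v].
  by apply/setP=> v; rewrite !inE; apply: andb_id2l => vm; exact: cut_vertexE.
rewrite (cardsD1 v0) inE [v0 \in _]v0v /= addnC; congr (_ + _).
have -> : nrcut (legal m) (legsi m) None = leg_set (root m) @:
    ([set v in porbits (sigma m) | cutv (alpha m) (sigma m) v] :\ v0).
  have cutE (v : {set dart n}) : root m \notin v -> v \in porbits (sigma m) ->
      cutv (legal m) (legsi m) (leg_set (root m) v) = cutv (alpha m) (sigma m) v.
    move=> rv /imsetP[d _ vE]; have st : sstable (sigma m) v by rewrite vE; exact: sstable_porbit.
    apply/exists_inP/exists_inP => [[[x|] xv /exists_inP[[y|] yv]]|[x xv /exists_inP[y yv nc]]];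
      rewrite ?inE ?(negbTE rv) // in xv yv *.
      rewrite leg_cn // => nc; exists x => //; by apply/exists_inP; exists y.
    exists (Some x); rewrite ?inE //; apply/exists_inP; exists (Some y); rewrite ?inE //.
    by rewrite leg_cn.
  have rE (v : {set dart n}) : v \in porbits (sigma m) -> (root m \in v) = (v == v0).
    by case/imsetP=> d _ ->; rewrite -eq_porbit_mem eq_sym.
  apply/setP=> U; rewrite inE porbits_leg; apply/andP/imsetP.
    case=> /imsetP[v vP ->] /and3P[]; rewrite inE => rv _; rewrite cutE // => cv.
    by exists v => //; rewrite !inE -rE // rv vP.
  case=> v; rewrite !inE => /and3P[]; move=> vv0 vP cv ->.
  have rv : root m \notin v by rewrite rE.
  split; first exact: imset_f.
  rewrite cutE // cv inE rv andbT /=; case/imsetP: (vP) => d _ vE.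
  apply/exists_inP; exists (Some d); first by rewrite inE vE porbit_id.
  case/rmapP: mR => _ _ c _; have [/(_ c)/setP/(_ (Some d)) + _] := leg_comp m.
  by rewrite !inE.
by rewrite card_imset //; exact: leg_set_inj.
Qed.

Lemma cut_root m : m \in rmaps n ->
  cut_vertex m (porbit (sigma m) (root m)) = ~~ noncut (map_code m).
Proof. by move=> mR; rewrite cut_vertexE ?root_cut //; apply: imset_f. Qed.

Definition conj_map m (phi : {perm dart n}) : premap n :=
  ((alpha m ^ phi)%g, (sigma m ^ phi)%g, phi (root m)).

Lemma rmap_isoP m m' :
  reflect (exists phi, m' = conj_map m phi) (rmap_iso m m').
Proof.
apply: (iffP existsP) => [[phi /and3P[/forallP ha /forallP hs /eqP hr]]|[phi ->]]; exists phi.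
  case: m' ha hs hr => [[al' si'] r'] ha hs hr; congr (_, _, _); last exact: esym hr.
    by apply/permP=> x; rewrite -(permKV phi x) permJ (eqP (ha _)).
  by apply/permP=> x; rewrite -(permKV phi x) permJ (eqP (hs _)).
by apply/and3P; split=> //; apply/forallP=> x; rewrite permJ.
Qed.

Lemma conj_map_rmaps m phi : m \in rmaps n -> conj_map m phi \in rmaps n.
Proof.
case/rmapP=> inv ff c e; apply/rmapP; split.
- by move=> x; rewrite -(permKV phi x) !permJ inv.
- by move=> x; rewrite -(permKV phi x) permJ (inj_eq perm_inj).
- move=> x y; rewrite -(permKV phi x) -(permKV phi y).
  have := c ((phi^-1)%g x) ((phi^-1)%g y).
  case/connectP=> p; elim: p ((phi^-1)%g x) => [|z p IH] u /=; first by move=> _ ->; exact: connect0.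
  case/andP=> uz pz lst; apply: connect_trans (IH z pz lst).
  case/orP: uz => [/eqP->|/andP[_ /eqP->]].
    by rewrite -permJ; exact: cn_al.
  by rewrite -permJ; apply: cn_si; rewrite inE.
by rewrite -conjMg !card_porbitsJ.
Qed.

(** Rooted maps have no automorphisms: two relabellings agreeing at the root agree on its component,
    which is everything. *)
Lemma conj_map_inj m : m \in rmaps n -> injective (conj_map m).
Proof.
case/rmapP=> inv ff c e phi psi [Ea Es Er]; apply/permP => x.
have : x \in comp (alpha m) (sigma m) (root m) by rewrite inE.
have sub : comp (alpha m) (sigma m) (root m) \subset [set x | phi x == psi x].
  apply: comp_min; first by rewrite inE Er.
  move=> z; rewrite !inE => /eqP z1; apply/andP; split.
    by rewrite -(permJ (alpha m) phi) Ea z1 permJ.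
  by rewrite -(permJ (sigma m) phi) Es z1 permJ.
by move/(subsetP sub); rewrite inE => /eqP.
Qed.

(** Relabelling acts freely, so all isomorphism classes have the same number of labelled maps.
    Averages over classes are thus averages over labelled maps, where the root can be moved. *)
Lemma card_fiber c : 0 < n -> c \in codes n ->
  #|[set m in rmaps n | map_code m == c]| = (2 * n)`!.
Proof.
move=> n0 cC; have [m mR mc] := map_code_surj n0 cC.
have -> : [set m' in rmaps n | map_code m' == c] = conj_map m @: setT.
  apply/setP=> m'; rewrite in_set; apply/andP/imsetP => [[m'R /eqP E]|[phi _ ->]].
    have : rmap_iso m m' by rewrite map_code_iso // mc E.
    by case/rmap_isoP => phi ->; exists phi; rewrite ?inE.
  have pR := conj_map_rmaps phi mR; split=> //.
  by rewrite -mc eq_sym -map_code_iso //; apply/rmap_isoP; exists phi.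
rewrite card_imset; last exact: conj_map_inj.
rewrite cardsT; have := card_perm [set: dart n]; rewrite cardsT card_ord => <-.
by rewrite -cardsT; apply: eq_card => s; rewrite inE; apply/esym/subsetP=> x; rewrite inE.
Qed.

Definition fiber c := [set m in rmaps n | map_code m == c].

Lemma classesE : 0 < n -> perm_eq (enum (rmap_classes n)) [seq fiber c | c <- codes n].
Proof.
move=> n0; have finj : {in codes n &, injective fiber}.
  move=> c d cC dC E; have [m mR mc] := map_code_surj n0 cC.
  have : m \in fiber c by rewrite inE mR mc eqxx.
  by rewrite E inE mc => /andP[_ /eqP].
apply: uniq_perm; first exact: enum_uniq.
  by rewrite map_inj_in_uniq ?uniq_codes.
have cE m : m \in rmaps n -> [set m' in rmaps n | rmap_iso m m'] = fiber (map_code m).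
  move=> mR; apply/setP=> m'; rewrite in_set [in RHS]inE; case m'R : (m' \in rmaps n) => //=.
  by rewrite map_code_iso // eq_sym.
move=> C; rewrite mem_enum; apply/imsetP/mapP => [[m mR ->]|[c cC ->]].
  by exists (map_code m); rewrite ?mem_map_code ?cE.
by have [m mR mc] := map_code_surj n0 cC; exists m; rewrite ?cE ?mc.
Qed.

Lemma cls_fiber c : 0 < n -> c \in codes n -> cls_cut_vertices (fiber c) = xc c.
Proof.
move=> n0 cC; rewrite /cls_cut_vertices; case: pickP => [m|].
  by rewrite inE => /andP[mR /eqP <-]; exact: num_cut_map.
have [m mR mc] := map_code_surj n0 cC; move/(_ m).
by rewrite inE mR mc eqxx.
Qed.

Lemma card_classes : 0 < n -> #|rmap_classes n| = size (codes n).
Proof. by move=> n0; rewrite cardE (perm_size (classesE n0)) size_map. Qed.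

Lemma card_classes_pred (P : pred nat) : 0 < n ->
  #|[set C in rmap_classes n | P (cls_cut_vertices C)]| = count (fun c => P (xc c)) (codes n).
Proof.
move=> n0; rewrite cardE.
have -> : size (enum [set C in rmap_classes n | P (cls_cut_vertices C)]) =
    count (fun C => P (cls_cut_vertices C)) (enum (rmap_classes n)).
  rewrite -size_filter; apply/perm_size/uniq_perm.
  - exact: enum_uniq.
  - by apply: filter_uniq; exact: enum_uniq.
  by move=> C; rewrite mem_enum inE mem_filter mem_enum andbC.
rewrite (seq.permP (classesE n0)) count_map; apply: eq_in_count => c cC /=.
by rewrite cls_fiber.
Qed.

Lemma sum_classes : 0 < n ->
  \sum_(C in rmap_classes n) cls_cut_vertices C = \sum_(c <- codes n) xc c.
Proof.
move=> n0; rewrite -big_enum (perm_big _ (classesE n0)) big_map.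
by rewrite big_seq [RHS]big_seq; apply: eq_bigr => c; exact: cls_fiber.
Qed.

End CutBridge.

(** * The word of the root vertex *)

Lemma nth_lab_Loop c1 c2 p : nth 0 (lab (Loop c1 c2)) p =
  if p is p'.+1 then
    if p' < deg c1 then (nth 0 (lab c1) p').*2.+1
    else if p' - deg c1 is q.+1 then
      if q < deg c2 then (nth 0 (lab c2) q).*2.+2 else 0
    else 0
  else 0.
Proof.
case: p => [|p] //=; rewrite nth_cat size_map size_lab; case: ifP => h.
  by rewrite (nth_map 0) ?size_lab.
case: (p - deg c1) => [|q] //=; case: ifP => hq.
  by rewrite (nth_map 0) ?size_lab.
by rewrite nth_default // size_map size_lab leqNgt hq.
Qed.

Lemma nth_lab_Expand c i p : p < deg (Expand c i) -> nth 0 (lab (Expand c i)) p =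
  if p is p'.+1 then fold_lab (take i (lab c)) (nth 0 (lab c) (i + p')) else 0.
Proof.
case: p => [|p] //= h; rewrite (nth_map 0) ?nth_drop // size_drop size_lab; lia.
Qed.

Lemma double_odd_even a b : a.*2.+1 = b.*2.+2 -> False.
Proof. by move/(congr1 odd); rewrite /= !odd_double. Qed.

Lemma mem_take_nth (s : seq nat) i x : i <= size s ->
  reflect (exists2 k, k < i & nth 0 s k = x) (x \in take i s).
Proof.
move=> h; apply: (iffP (nthP 0)) => [[k]|[k ki <-]].
  by rewrite size_takel // => ki <-; exists k => //; rewrite nth_take.
by exists k; rewrite ?size_takel ?nth_take.
Qed.

Lemma mem_drop_nth (s : seq nat) i x :
  reflect (exists2 k, i <= k < size s & nth 0 s k = x) (x \in drop i s).
Proof.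
apply: (iffP (nthP 0)) => [[k]|[k /andP[ki ks] <-]].
  by rewrite size_drop nth_drop => ki <-; exists (i + k) => //; rewrite leq_addr -ltn_subRL.
exists (k - i); first by rewrite size_drop ltn_subRL subnKC.
by rewrite nth_drop subnKC.
Qed.

Definition noncrossing (s : seq nat) := forall p q r t, p < q -> q < r -> r < t -> t < size s ->
  nth 0 s p = nth 0 s r -> nth 0 s q = nth 0 s t -> nth 0 s p = nth 0 s q.

(** This is how planarity enters the counting. A crossing in an expanded word lifts to a crossing in
    the word of the contracted map, some place below [i] with the same old label standing in for a
    place labelled 0. *)
Lemma lab_noncrossing c : valid c -> noncrossing (lab c).
Proof.
elim: c => [|c1 IH1 c2 IH2|c IH i] // vc p q r t pq qr rt.
  case/andP: vc => v1 v2; rewrite size_lab /= => td; rewrite !nth_lab_Loop.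
  case: p pq => [|p] pq; case: q qr pq => [|q] qr pq //; case: r rt qr => [|r] rt qr //; case: t td rt => [|t] td rt //.
    do 3 (case: ifP => ?; try done); case er : (r - deg c1) => [|r'];
    case eq : (q - deg c1) => [|q']; case et : (t - deg c1) => [|t'] //;
    try lia; by do ?(case: ifP => ?; try done); lia.
  have pq' : p < q by []. have qr' : q < r by []. have rt' : r < t by [].
  case: (ltnP t (deg c1)) => t1.
    have r1 := ltn_trans rt' t1; have q1 := ltn_trans qr' r1; have p1 := ltn_trans pq' q1.
    rewrite r1 q1 p1 => /succn_inj/double_inj h1 /succn_inj/double_inj h2.
    by rewrite (IH1 v1 p q r t) // size_lab.
  case: (ltnP r (deg c1)) => r1.
    rewrite (ltn_trans qr' r1) (ltn_trans pq' (ltn_trans qr' r1)); case: (t - deg c1) => [|t'] //; case: ifP => // _ h1 h2; case: (double_odd_even h2).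
  case: (ltnP q (deg c1)) => q1.
    rewrite (ltn_trans pq' q1); case: (r - deg c1) => [|r'] //; case: ifP => // _ h1; case: (double_odd_even h1).
  case: (ltnP p (deg c1)) => p1.
    by case: (r - deg c1) => [|r'] //; case: ifP => // _ h1; case: (double_odd_even h1).
  have -> : q - deg c1 = (q - deg c1).-1.+1 by lia.
  have -> : r - deg c1 = (r - deg c1).-1.+1 by lia.
  have -> : t - deg c1 = (t - deg c1).-1.+1 by lia.
  have -> : (t - deg c1).-1 < deg c2 by lia.
  have -> : (r - deg c1).-1 < deg c2 by lia.
  have -> : (q - deg c1).-1 < deg c2 by lia.
  case ep : (p - deg c1) => [|p'] //; have -> : p' < deg c2 by lia.
  move=> /succn_inj/succn_inj/double_inj h1 /succn_inj/succn_inj/double_inj h2.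
  by rewrite (IH2 v2 p' (q - deg c1).-1 (r - deg c1).-1 (t - deg c1).-1) ?size_lab //; lia.
case/andP: vc => id_ v; rewrite size_lab => td.
have {}IH := IH v; rewrite !nth_lab_Expand; try lia.
have tE := @mem_take_nth (lab c) i; rewrite size_lab in tE.
case: q pq qr => [|q] pq qr //; case: r qr rt => [|r] qr rt //; case: t rt td => [|t] rt td //.
have sz : i + t < size (lab c) by rewrite size_lab; move: td => /=; lia.
set z := take i (lab c) in tE *.
have zero x : (0 == fold_lab z x) = (x \in z) by rewrite /fold_lab; case: (x \in z).
have key k : k < i + q -> nth 0 (lab c) k = nth 0 (lab c) (i + r) ->
    nth 0 (lab c) (i + q) = nth 0 (lab c) (i + t) -> nth 0 (lab c) k = nth 0 (lab c) (i + q).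
  by move=> kq; apply: IH; lia.
have inz x k : nth 0 (lab c) k = x -> k < i -> x \in z by move=> kx ki; apply/tE => //; exists k.
have rq : nth 0 (lab c) (i + r) \in z -> fold_lab z (nth 0 (lab c) (i + q)) = fold_lab z (nth 0 (lab c) (i + t)) ->
    nth 0 (lab c) (i + q) \in z.
  case/(tE _ id_) => k ki kr /eqP; rewrite fold_lab_eq => /orP[/eqP E2|/andP[]//].
  by apply: (inz _ k) => //; apply: key => //; lia.
case: p pq => [|p] pq.
  move=> /eqP; rewrite zero => rz E2; apply/eqP; rewrite zero; exact: rq.
move=> /eqP; rewrite fold_lab_eq => /orP[/eqP E1|/andP[pz rz]] E2; apply/eqP; rewrite fold_lab_eq; last first.
  by rewrite pz rq ?orbT.
move/eqP: E2; rewrite fold_lab_eq => /orP[/eqP E2|/andP[qz _]].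
  by rewrite (IH (i + p) (i + q) (i + r) (i + t)) ?eqxx //; lia.
have [k ki kq] := tE _ id_ qz.
suff : nth 0 (lab c) (i + p) \in z by move=> pz; rewrite pz qz orbT.
apply: (inz _ k) => //.
apply: (IH k (i + p) (i + q) (i + r)) => //; lia.
Qed.

(** * Inserting a map at a corner of the root vertex *)

(** Two maps joined at their root vertices, the darts of [c] first. The root edge of [c] remains the
    root edge, so the recursion follows the decomposition of [c]. *)
Fixpoint cat c d := match c with
  | Vtx => d
  | Loop c1 c2 => Loop c1 (cat c2 d)
  | Expand c1 i => Expand (cat c1 d) i
  end.

(** [d] is placed after the first [j] darts of [c]. Working on codes avoids surgery on permutations;
    labels and sizes are all that is wanted of the result. *)
Fixpoint ins c j d := match j, c with
  | 0, _ => cat d c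
  | _, Vtx => d
  | j'.+1, Loop c1 c2 =>
      if j' <= deg c1 then Loop (ins c1 j' d) c2 else Loop c1 (ins c2 (j' - (deg c1).+1) d)
  | j'.+1, Expand c1 i => Expand (ins c1 (i + j') d) i
  end.

Fixpoint spl c k := match k, c with
  | 0, _ => (Vtx, c)
  | _, Vtx => (Vtx, Vtx)
  | k'.+1, Loop c1 c2 => let p := spl c2 (k' - (deg c1).+1) in (Loop c1 p.1, p.2)
  | k'.+1, Expand c1 i => let p := spl c1 (i + k') in (Expand p.1 i, p.2)
  end.

(** The inverse of [ins]: it takes the [k] darts from place [j] away and returns what remains, then
    what was detached. The values are meaningful when these darts form a union of blocks. *)
Fixpoint det c j k := match j, c with
  | 0, _ => ((spl c k).2, (spl c k).1)
  | _, Vtx => (Vtx, Vtx)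
  | j'.+1, Loop c1 c2 =>
      if j' + k <= deg c1 then let p := det c1 j' k in (Loop p.1 c2, p.2)
      else let p := det c2 (j' - (deg c1).+1) k in (Loop c1 p.1, p.2)
  | j'.+1, Expand c1 i => let p := det c1 (i + j') k in (Expand p.1 i, p.2)
  end.

Lemma csize_cat c d : csize (cat c d) = csize c + csize d.
Proof. by elim: c => //= [c1 _ c2 ->|c1 -> i]; lia. Qed.

Lemma deg_cat c d : valid c -> deg (cat c d) = deg c + deg d.
Proof.
elim: c => //= [c1 _ c2 IH /andP[_ v]|c1 IH i /andP[h v]]; rewrite IH //; lia.
Qed.

Lemma valid_cat c d : valid c -> valid d -> valid (cat c d).
Proof.
move=> vc vd; elim: c vc => //= [c1 _ c2 IH /andP[-> v]|c1 IH i /andP[h v]]; rewrite IH //.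
by rewrite deg_cat //; lia.
Qed.

Lemma csize_ins c j d : csize (ins c j d) = csize c + csize d.
Proof.
elim: c j => [|c1 IH1 c2 IH2|c IH i] [|j] //=; rewrite ?csize_cat /= ?IH; try lia.
by case: ifP => _ /=; rewrite ?IH1 ?IH2; lia.
Qed.

Lemma deg_ins c j d : valid c -> valid d -> j <= deg c -> deg (ins c j d) = deg c + deg d.
Proof.
move=> vc vd; elim: c vc j => [|c1 IH1 c2 IH2|c IH i] vc [|j] //= jc; rewrite ?deg_cat //=; try lia.
  by case/andP: vc => v1 v2; case: ifP => h /=; rewrite ?IH1 ?IH2 //; lia.
by case/andP: vc => id_ v; rewrite IH //; lia.
Qed.

Lemma valid_ins c j d : valid c -> valid d -> j <= deg c -> valid (ins c j d).
Proof.
move=> vc vd; elim: c vc j => [|c1 IH1 c2 IH2|c IH i] vc [|j] //= jc.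
- exact: valid_cat.
- exact: valid_cat.
- case/andP: vc => v1 v2; case: ifP => h /=; first by rewrite IH1 // v2.
  by apply/andP; split=> //; apply: IH2 => //; lia.
- exact: valid_cat.
case/andP: vc => id_ v; rewrite IH ?deg_ins //; lia.
Qed.

Lemma spl_cat c d : valid c -> spl (cat c d) (deg c) = (c, d).
Proof.
elim: c => [|c1 _ c2 IH /andP[_ v]|c IH i /andP[h v]] /=; first by case: d.
  by rewrite (_ : _ - _ = deg c2) ?IH //; lia.
by rewrite (_ : _ + _ = deg c) ?IH //; lia.
Qed.

Lemma ins0 c d : ins c 0 d = cat d c. Proof. by case: c. Qed.

Lemma det0 c k : det c 0 k = ((spl c k).2, (spl c k).1). Proof. by case: c. Qed.

Lemma det_ins c j d : valid c -> valid d -> j <= deg c -> det (ins c j d) j (deg d) = (c, d).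
Proof.
move=> vc vd; elim: c vc j => [|c1 IH1 c2 IH2|c IH i] vc [|j] jc; rewrite ?det0 ?ins0 ?spl_cat //=.
- case/andP: vc => v1 v2; case: (leqP j (deg c1)) => h /=.
    by rewrite deg_ins // leq_add2r h IH1.
  by rewrite ifN ?IH2 //; rewrite /= in jc; lia.
by case/andP: vc => id_ v; rewrite IH //; rewrite /= in jc; lia.
Qed.

Definition closed_at c j k := forall p q, j <= p < j + k -> q < deg c -> ~~ (j <= q < j + k) ->
  nth 0 (lab c) p <> nth 0 (lab c) q.

Lemma nth_Loop1 c1 c2 p : p < deg c1 ->
  nth 0 (lab (Loop c1 c2)) p.+1 = (nth 0 (lab c1) p).*2.+1.
Proof. by move=> h; rewrite nth_lab_Loop h. Qed.

Lemma nth_Loop0 c1 c2 : nth 0 (lab (Loop c1 c2)) (deg c1).+1 = 0.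
Proof. by rewrite nth_lab_Loop ltnn subnn. Qed.

Lemma nth_Loop2 c1 c2 p : p < deg c2 ->
  nth 0 (lab (Loop c1 c2)) (p + (deg c1).+2) = (nth 0 (lab c2) p).*2.+2.
Proof.
move=> h; rewrite addnS nth_lab_Loop ifN; last by lia.
by rewrite (_ : p + (deg c1).+1 - deg c1 = p.+1) ?h //; lia.
Qed.

(** A window that starts with the root dart has label 0, so it also captures whatever is linked to
    the far end; in the contracted map it becomes a prefix that includes the [i] far darts. Any
    other window is merely shifted. *)
Lemma closed_Expand c i j k : valid (Expand c i) -> j + k <= (deg c - i).+1 ->
  closed_at (Expand c i) j k -> 0 < k ->
  if j is j'.+1 then closed_at c (i + j') k else closed_at c 0 (i + k.-1).
Proof.
move=> /andP[id_ v] jk cl k0.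
have E p q : i <= p < deg c -> i <= q < deg c -> nth 0 (lab c) p = nth 0 (lab c) q ->
    nth 0 (lab (Expand c i)) (p - i).+1 = nth 0 (lab (Expand c i)) (q - i).+1.
  move=> /andP[ip pd] /andP[iq qd] e; rewrite !nth_lab_Expand /=; try lia.
  by rewrite !subnKC // e.
have Z p q : p < i -> i <= q < deg c -> nth 0 (lab c) p = nth 0 (lab c) q ->
    nth 0 (lab (Expand c i)) (q - i).+1 = 0.
  move=> pi /andP[iq qd] e; rewrite nth_lab_Expand /=; last by lia.
  rewrite subnKC // /fold_lab ifT //; apply/mem_take_nth; first by rewrite size_lab.
  by exists p.
case: j jk cl => [|j] jk cl p q pj qd nq e.
  have iq : i <= q by lia.
  case: (ltnP p i) => pi.
    by apply: (cl 0 (q - i).+1); rewrite ?(Z p q) ?iq //=; lia.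
  by apply: (cl (p - i).+1 (q - i).+1); rewrite /=; try lia; apply: E => //; lia.
have ip : i <= p by lia.
case: (ltnP q i) => qi.
  by apply: (cl (p - i).+1 0); rewrite ?(Z q p) //=; lia.
by apply: (cl (p - i).+1 (q - i).+1); rewrite /=; try lia; apply: E => //; lia.
Qed.

Lemma spl_closed c k : valid c -> k <= deg c -> closed_at c 0 k ->
  let p := spl c k in [/\ valid p.1, valid p.2, deg p.1 = k & cat p.1 p.2 = c].
Proof.
elim: c k => [|c1 _ c2 IH|c IH i] [|k] vc kc cl //.
  case/andP: (vc) => v1 v2.
  (* The two ends of the loop share the label 0 and the first one is in the window, hence so is the
     second. *)
  have dk : deg c1 < k.
    rewrite ltnNge; apply/negP => h.
    by apply: (cl 0 (deg c1).+1); rewrite ?nth_Loop0 //=; lia.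
  rewrite /= in kc; have kc2 : k - (deg c1).+1 <= deg c2 by lia.
  have [|w1 w2 dE cE] := IH (k - (deg c1).+1) v2 kc2.
    move=> p q pk qd nq e; apply: (cl (p + (deg c1).+2) (q + (deg c1).+2)); rewrite /=; try lia.
    by rewrite !nth_Loop2 ?e //; lia.
  split; rewrite /= ?cE ?dE //; first by apply/andP.
  by lia.
case/andP: (vc) => id_ v; rewrite /= in kc.
have ik : i + k <= deg c by lia.
have cl' : closed_at c 0 (i + k) by apply: (@closed_Expand c i 0 k.+1).
have [w1 w2 dE cE] := IH (i + k) v ik cl'.
split; rewrite /= ?cE ?dE //; first by rewrite leq_addr.
lia.
Qed.

Lemma spl_det c k : valid c -> k <= deg c -> closed_at c 0 k -> let p := det c 0 k in
  [/\ valid p.1, valid p.2, deg p.1 = deg c - k, deg p.2 = k & ins p.1 0 p.2 = c].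
Proof.
move=> vc kc cl; have [] := spl_closed vc kc cl.
rewrite det0; case: (spl c k) => d e /= vd ve dE <-; rewrite deg_cat // dE addKn.
by rewrite ins0; split.
Qed.

(** A window not starting at 0 misses the first end of a root loop, hence also the second, so it
    lies within one side and the induction applies there. Windows starting at 0 are left to
    [spl]. *)
Lemma det_closed c j k : valid c -> 0 < k -> j + k <= deg c -> closed_at c j k -> let p := det c j k in
  [/\ valid p.1, valid p.2, deg p.1 = deg c - k, deg p.2 = k & ins p.1 j p.2 = c].
Proof.
move=> vc k0; elim: c vc j => [|c1 IH1 c2 IH2|c IH i] vc [|j] jk cl; try exact: spl_det.
- by rewrite /= in jk; lia.
- case/andP: (vc) => v1 v2; rewrite /= in jk *.
  have dj : ~~ (j <= deg c1 < j + k).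
    by apply/negP => h; apply: (cl (deg c1).+1 0); rewrite ?nth_Loop0 //=; lia.
  case: ifP => h.
    have [|w1 w2 d1 d2 cE] := IH1 v1 j h.
      move=> p q pk qd nq e; have h1 : p < deg c1 by lia.
      by apply: (cl p.+1 q.+1); rewrite ?nth_Loop1 ?e //=; lia.
    split; rewrite /= ?d1 ?cE //; first by apply/andP.
      by lia.
    by rewrite ifT //; lia.
  have jk2 : j - (deg c1).+1 + k <= deg c2 by lia.
  have [|w1 w2 d1 d2 cE] := IH2 v2 (j - (deg c1).+1) jk2.
    move=> p q pk qd nq e; apply: (cl (p + (deg c1).+2) (q + (deg c1).+2)); rewrite /=; try lia.
    by rewrite !nth_Loop2 ?e //; lia.
  split; rewrite /= ?d1 ?cE //; first by apply/andP.
    by lia.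
  by rewrite ifN //; lia.
case/andP: (vc) => id_ v; rewrite /= in jk.
have jk2 : i + j + k <= deg c by lia.
have [|w1 w2 d1 d2 cE] := IH v (i + j) jk2; first by apply: (@closed_Expand c i j.+1 k) => //; lia.
split; rewrite /= ?d1 ?cE //; first by rewrite w1 andbT; lia.
lia.
Qed.

(** The inserted word up to injective renaming of each part into disjoint label sets; only equality
    of labels is compared later. *)
Definition glue (s t : seq nat) j w := exists f g : nat -> nat,
  [/\ {in s &, injective f}, {in t &, injective g},
      forall x y, x \in s -> y \in t -> f x <> g y &
      w = map f (take j s) ++ map g t ++ map f (drop j s)].

Definition loop_labels (u v : seq nat) := 0 :: [seq x.*2.+1 | x <- u] ++ 0 :: [seq x.*2.+2 | x <- v].
Definition expand_labels (s : seq nat) i := 0 :: [seq fold_lab (take i s) x | x <- drop i s].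

Lemma mem_loop_labels u v x : x \in loop_labels u v ->
  [\/ x = 0, exists2 y, y \in u & x = y.*2.+1 | exists2 y, y \in v & x = y.*2.+2].
Proof.
rewrite /loop_labels inE mem_cat inE => /or3P[/eqP->|/mapP[y yu ->]|/orP[/eqP->|/mapP[y yv ->]]].
- exact: Or31.
- by apply: Or32; exists y.
- exact: Or31.
by apply: Or33; exists y.
Qed.

(** Renames by [f] the labels from the first side of a loop and leaves the others alone; [even_part]
    does this for the second side. *)
Definition odd_part f x := if x is 0 then 0 else if odd x then (f x./2).*2.+1 else x.
Definition even_part f x := if x is 0 then 0 else if odd x then x else (f (x./2.-1)).*2.+2.

Arguments odd_part : simpl never.
Arguments even_part : simpl never.

Lemma odd_partE f : (odd_part f 0 = 0) * ((forall x, odd_part f x.*2.+1 = (f x).*2.+1)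
  * (forall x, odd_part f x.*2.+2 = x.*2.+2)).
Proof.
split=> //; split=> x; rewrite /odd_part /= odd_double //=.
by rewrite uphalf_double.
Qed.

Lemma even_partE f : (even_part f 0 = 0) * ((forall x, even_part f x.*2.+1 = x.*2.+1)
  * (forall x, even_part f x.*2.+2 = (f x).*2.+2)).
Proof.
split=> //; split=> x; rewrite /even_part /= odd_double //=.
by rewrite doubleK.
Qed.

Lemma odd_part_inj u v f : {in u &, injective f} -> {in loop_labels u v &, injective (odd_part f)}.
Proof.
move=> fi x y /mem_loop_labels[->|[x' xu ->]|[x' xv ->]] /mem_loop_labels[->|[y' yu ->]|[y' yv ->]];
  rewrite !odd_partE // => E; try lia.
by rewrite (fi x' y') //; lia.
Qed.

Lemma even_part_inj u v f : {in v &, injective f} -> {in loop_labels u v &, injective (even_part f)}.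
Proof.
move=> fi x y /mem_loop_labels[->|[x' xu ->]|[x' xv ->]] /mem_loop_labels[->|[y' yu ->]|[y' yv ->]];
  rewrite !even_partE // => E; try lia.
by rewrite (fi x' y') //; lia.
Qed.

Lemma map_odd_part f u : map (odd_part f) [seq x.*2.+1 | x <- u] = [seq x.*2.+1 | x <- map f u].
Proof. by rewrite -!map_comp; apply: eq_map => x /=; rewrite odd_partE. Qed.
Lemma map_odd_part_even f u : map (odd_part f) [seq x.*2.+2 | x <- u] = [seq x.*2.+2 | x <- u].
Proof. by rewrite -!map_comp; apply: eq_map => x /=; rewrite odd_partE. Qed.
Lemma map_even_part f u : map (even_part f) [seq x.*2.+2 | x <- u] = [seq x.*2.+2 | x <- map f u].
Proof. by rewrite -!map_comp; apply: eq_map => x /=; rewrite even_partE. Qed.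
Lemma map_even_part_odd f u : map (even_part f) [seq x.*2.+1 | x <- u] = [seq x.*2.+1 | x <- u].
Proof. by rewrite -!map_comp; apply: eq_map => x /=; rewrite even_partE. Qed.

Lemma glue_loop_cat s t u w : glue s t 0 w -> glue s (loop_labels u t) 0 (loop_labels u w).
Proof.
case=> f [g [fi gi fg ->]]; rewrite take0 drop0 /=.
exists (fun x => (f x).*2.+2), (even_part g); split.
- by move=> x y xs ys /= E; apply: fi => //; lia.
- exact: even_part_inj.
- move=> x y xs /mem_loop_labels[->|[z zu ->]|[z zt ->]]; rewrite even_partE; try lia.
  by have := fg x z xs zt; lia.
rewrite take0 drop0 /loop_labels /= !map_cat /= !map_even_part map_even_part_odd even_partE.
by rewrite -catA -!map_comp.
Qed.

Lemma glue_loop1 s t u j w : j <= size s -> glue s t j w ->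
  glue (loop_labels s u) t j.+1 (loop_labels w u).
Proof.
move=> js [f [g [fi gi fg ->]]].
exists (odd_part f), (fun y => (g y).*2.+1); split.
- exact: odd_part_inj.
- by move=> x y xs ys /= E; apply: gi => //; lia.
- move=> x y /mem_loop_labels[->|[z zu ->]|[z zt ->]] yt; rewrite odd_partE; try lia.
  by have := fg z y zu yt; lia.
rewrite /loop_labels /= take_cat drop_cat size_map; case: (ltnP j (size s)) => h.
  rewrite !map_cat /= map_odd_part_even -map_take -map_drop !map_odd_part odd_partE.
  by rewrite -!catA -!map_comp.
have -> : j = size s by lia.
rewrite subnn take0 drop0 take_size drop_size cats0 /= !map_cat /= cats0 map_odd_part map_odd_part_even odd_partE.
by rewrite -!catA -!map_comp.
Qed.

Lemma glue_loop2 s t u j w : j <= size s -> glue s t j w ->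
  glue (loop_labels u s) t (j + (size u).+2) (loop_labels u w).
Proof.
move=> js [f [g [fi gi fg ->]]].
exists (even_part f), (fun y => (g y).*2.+2); split.
- exact: even_part_inj.
- by move=> x y xs ys /= E; apply: gi => //; lia.
- move=> x y /mem_loop_labels[->|[z zu ->]|[z zt ->]] yt; rewrite even_partE; try lia.
  by have := fg z y zt yt; lia.
rewrite /loop_labels addnS /= take_cat drop_cat size_map; do 2 (rewrite ifN; last by lia).
have -> : j + (size u).+1 - size u = j.+1 by lia.
rewrite /= !map_cat /= -map_take -map_drop !map_even_part map_even_part_odd even_partE.
by rewrite -!catA -!map_comp.
Qed.

Definition succ_part f x := if x is y.+1 then (f y).+1 else 0.

Lemma fold_lab_map (f : nat -> nat) (s z : seq nat) (x : nat) : {in s &, injective f} -> {subset z <= s} -> x \in s ->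
  fold_lab (map f z) (f x) = succ_part f (fold_lab z x).
Proof.
move=> fi zs xs; rewrite /fold_lab; case: (boolP (x \in z)) => xz.
  by rewrite map_f.
by rewrite ifN //; apply: contra xz => /mapP[y yz E]; rewrite (fi x y) //; exact: zs.
Qed.

Lemma mem_expand_labels s i x : x \in expand_labels s i -> x = 0 \/ exists2 y, y \in s & x = y.+1.
Proof.
rewrite inE => /orP[/eqP->|/mapP[y /mem_drop ys ->]]; first by left.
by rewrite /fold_lab; case: ifP => _; [left|right; exists y].
Qed.

Lemma succ_part_inj s i f : {in s &, injective f} -> {in expand_labels s i &, injective (succ_part f)}.
Proof.
move=> fi x y /mem_expand_labels[->|[x' xs ->]] /mem_expand_labels[->|[y' ys ->]] //= [E].
by rewrite (fi x' y').
Qed.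

Lemma glue_expand_cat s t i w : i <= size t -> glue s t 0 w ->
  glue s (expand_labels t i) 0 (expand_labels w i).
Proof.
move=> it [f [g [fi gi fg ->]]]; rewrite take0 drop0 /=.
exists (fun x => (f x).+1), (succ_part g); split.
- by move=> x y xs ys /= [E]; apply: fi.
- exact: succ_part_inj.
- by move=> x y xs /mem_expand_labels[->|[z zt ->]] //= [E]; case: (fg x z).
rewrite take0 drop0 /expand_labels /= take_cat drop_cat !size_map.
have tl : (if i < size t then take i (map g t) else map g t ++ take (i - size t) (map f s)) = map g (take i t).
  case: ltnP => h; first by rewrite map_take.
  have -> : i = size t by lia.
  by rewrite subnn take0 cats0 take_size.
have dl : (if i < size t then drop i (map g t) ++ map f s else drop (i - size t) (map f s)) = map g (drop i t) ++ map f s.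
  case: ltnP => h; first by rewrite map_drop.
  have -> : i = size t by lia.
  by rewrite subnn drop0 drop_size.
rewrite tl dl map_cat -!map_comp; congr (_ :: _ ++ _); apply/eq_in_map => x xs /=.
  by apply: (@fold_lab_map _ t) => //; [exact: mem_take|exact: mem_drop xs].
rewrite /fold_lab ifN //; apply/mapP => -[y /mem_take yt E]; exact: (fg x y).
Qed.

Lemma glue_expand s t i j w : i + j <= size s -> glue s t (i + j) w ->
  glue (expand_labels s i) t j.+1 (expand_labels w i).
Proof.
move=> ijs [f [g [fi gi fg ->]]].
exists (succ_part f), (fun y => (g y).+1); split.
- exact: succ_part_inj.
- by move=> x y xs ys /= [E]; apply: gi.
- by move=> x y /mem_expand_labels[->|[z zt ->]] yt //= [E]; case: (fg z y).
have sz : size (map f (take (i + j) s)) = i + j by rewrite size_map size_takel.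
have tl : take i (map f (take (i + j) s) ++ map g t ++ map f (drop (i + j) s)) = map f (take i s).
  rewrite take_cat sz -map_take take_takel ?leq_addr //; case: ltnP => // h.
  have -> : j = 0 by lia.
  by rewrite addn0 subnn take0 cats0.
have dl : drop i (map f (take (i + j) s) ++ map g t ++ map f (drop (i + j) s)) =
    map f (take j (drop i s)) ++ map g t ++ map f (drop j (drop i s)).
  rewrite drop_cat sz -map_drop take_drop addnC drop_drop; case: ltnP => // h.
  have -> : j = 0 by lia.
  by rewrite add0n subnn !drop0 [drop i (take i s)]drop_oversize // size_take; case: ifP => // h2; lia.
rewrite /expand_labels tl dl /= !map_cat -map_take -map_drop -!map_comp.
have sub : {subset take i s <= s} by move=> x; exact: mem_take.
congr (_ :: _ ++ _ ++ _); apply/eq_in_map => x xs /=.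
- by apply: (@fold_lab_map _ s) => //; exact: mem_drop (mem_take xs).
- rewrite /fold_lab ifN //; apply/mapP => -[y /mem_take yt E]; exact: (fg y x).
by apply: (@fold_lab_map _ s) => //; exact: mem_drop (mem_drop xs).
Qed.

Lemma lab_cat c d : valid c -> glue (lab d) (lab c) 0 (lab (cat c d)).
Proof.
elim: c => [|c1 _ c2 IH /andP[_ v]|c IH i /andP[id_ v]].
- by exists id, id; split; rewrite ?take0 ?drop0 //= map_id.
- exact: glue_loop_cat (IH v).
by apply: glue_expand_cat (IH v); rewrite size_lab.
Qed.

Lemma lab_ins c j d : valid c -> valid d -> j <= deg c -> glue (lab c) (lab d) j (lab (ins c j d)).
Proof.
move=> vc vd; elim: c vc j => [|c1 IH1 c2 IH2|c IH i] vc [|j] jc; rewrite ?ins0; try exact: lab_cat.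
- by [].
- case/andP: vc => v1 v2; rewrite /= in jc *; case: ifP => h.
    by apply: glue_loop1 (IH1 v1 j h); rewrite size_lab.
  have jd : j - (deg c1).+1 <= deg c2 by lia.
  have := @glue_loop2 (lab c2) (lab d) (lab c1) (j - (deg c1).+1) _ _ (IH2 v2 _ jd).
  rewrite !size_lab => /(_ jd); rewrite (_ : _ + _ = j.+1) //; lia.
case/andP: vc => id_ v; rewrite /= in jc *.
by apply: glue_expand; [rewrite size_lab; lia|apply: IH => //; lia].
Qed.

(** The two parts share no label, so no block of one can be continued by the other and the condition
    splits. *)
Lemma noblk_ins c j e m : valid c -> valid e -> j <= deg c -> m <= deg e ->
  noblk (ins c j e) (j + m) = noblk c j && noblk e m.
Proof.
move=> vc ve jc me; have [f [g [fi gi fg E]]] := lab_ins vc ve jc.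
rewrite /noblk E.
have sA : size (map f (take j (lab c))) = j by rewrite size_map size_takel // size_lab.
have tE : take (j + m) (map f (take j (lab c)) ++ map g (lab e) ++ map f (drop j (lab c))) =
    map f (take j (lab c)) ++ map g (take m (lab e)).
  by rewrite -{1}sA takeD take_size_cat // drop_size_cat // takel_cat ?map_take // size_map size_lab.
have dE : drop (j + m) (map f (take j (lab c)) ++ map g (lab e) ++ map f (drop j (lab c))) =
    map g (drop m (lab e)) ++ map f (drop j (lab c)).
  rewrite -{1}sA addnC -drop_drop drop_size_cat // drop_cat size_map size_lab !map_drop; case: ltnP => h //.
  have -> : m = deg e by lia.
  by rewrite subnn drop0 -!map_drop -size_lab drop_size.
rewrite tE dE all_cat !all_map; congr (_ && _); apply: eq_in_all => x xs /=; rewrite mem_cat.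
  have xc := mem_take xs.
  have -> : (f x \in map g (drop m (lab e))) = false.
    by apply/negP => /mapP[y /mem_drop ye]; exact: fg.
  apply/mapP/idP => [[y yd E2]|h] //; last by exists x.
  by rewrite (fi x y) //; exact: mem_drop yd.
have xe := mem_take xs.
have -> : (g x \in map f (drop j (lab c))) = false.
  by apply/negP => /mapP[y /mem_drop ye] /esym; exact: fg.
rewrite orbF; apply/mapP/idP => [[y yd E2]|h] //; last by exists x.
by rewrite (gi x y) //; exact: mem_drop yd.
Qed.

Lemma noblk_deg e : 0 < deg e -> noblk e (deg e) = false.
Proof. by rewrite /noblk -size_lab drop_size take_size; case: (lab e). Qed.

(** With a single dart outside the prefix, every label of the prefix must be the label of that
    dart. *)
Lemma noblk_pred e : 0 < deg e -> noblk e (deg e).-1 = noncut e.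
Proof.
move=> e0; have dE : drop (deg e).-1 (lab e) = [:: nth 0 (lab e) (deg e).-1].
  rewrite (drop_nth 0) ?prednK ?size_lab ?prednK //.
  by rewrite -{2}size_lab drop_size.
rewrite /noblk dE; apply/allP/constantPn => [H p q|H x].
  have K k : k < size (lab e) -> nth 0 (lab e) k = nth 0 (lab e) (deg e).-1.
    rewrite size_lab => ke; case: (eqVneq k (deg e).-1) => [->//|nk].
    have : nth 0 (lab e) k \in take (deg e).-1 (lab e).
      by apply/mem_take_nth; [rewrite size_lab; lia|exists k => //; lia].
    by move/H; rewrite /= mem_seq1 => /eqP.
  by move=> /K-> /K->.
case/mem_take_nth => [|k ke <-]; first by rewrite size_lab; lia.
by rewrite /= mem_seq1; apply/eqP/H; rewrite size_lab; lia.
Qed.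

Lemma noblkS c i : noblk c i.+1 -> noblk c i.
Proof.
move/allP => H; apply/allP => x xs.
have xt : x \in take i.+1 (lab c) by rewrite -addn1 takeD mem_cat xs.
have := H x xt; rewrite /= -add1n -drop_drop; exact: mem_drop.
Qed.

(** * Open prefixes of the root word and detachable blocks *)

Definition open_prefixes n : seq (code * nat) :=
  flatten [seq [seq (c, i) | i <- iota 0 (deg c).+1 & noblk c i] | c <- codes n].

Lemma mem_pre n p : (p \in open_prefixes n) =
  [&& valid p.1, csize p.1 == n, p.2 <= deg p.1 & noblk p.1 p.2].
Proof.
case: p => c i /=; apply/flatten_mapP/and4P.
  case=> c'; rewrite mem_codes => /andP[v s] /mapP[j].
  rewrite mem_filter mem_iota => /andP[nb ji] [-> ->].
  by split=> //; lia.
case=> v s id_ nb; exists c; first by rewrite mem_codes v s.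
by apply/mapP; exists i => //; rewrite mem_filter nb mem_iota.
Qed.

Lemma uniq_pre n : uniq (open_prefixes n).
Proof.
apply: (@uniq_flatten_map _ _ _ _ fst); first exact: uniq_codes.
  by move=> c _; rewrite map_inj_uniq ?filter_uniq ?iota_uniq // => i j [].
by move=> c p _ /mapP[i _ ->].
Qed.

Definition blocks n := [seq e <- codes n | noncut e && (0 < deg e)].
(** The prefix takes in all darts of the new block except the last, which keeps the block open. *)
Definition glue_pre e (q : code * nat) := (ins q.1 q.2 e, q.2 + (deg e).-1).
Definition glued n :=
  flatten [seq [seq glue_pre e q | e <- blocks a, q <- open_prefixes (n - a)] | a <- iota 0 n.+1].

(** The block of the first dart outside the prefix begins at the first occurrence of its label and,
    when this is its last dart, ends there. *)
Definition unglue (p : code * nat) :=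
  let j := index (nth 0 (lab p.1) p.2) (lab p.1) in
  let d := det p.1 j (p.2.+1 - j) in (d.2, (d.1, j)).

Lemma noblk_ins_le c j e i : valid c -> valid e -> j <= deg c -> i <= j ->
  noblk (ins c j e) i = noblk c i.
Proof.
move=> vc ve jc ij; have [f [g [fi gi fg E]]] := lab_ins vc ve jc.
have sA : size (map f (take j (lab c))) = j by rewrite size_map size_takel // size_lab.
have sub : {subset take i (lab c) <= lab c} by move=> x; exact: mem_take.
have tE : take i (lab (ins c j e)) = map f (take i (lab c)).
  by rewrite E takel_cat ?sA // -map_take take_takel.
have dE x : x \in lab c -> (f x \in drop i (lab (ins c j e))) = (x \in drop i (lab c)).
  move=> xc; have dK : drop i (lab c) = drop i (take j (lab c)) ++ drop j (lab c).
    rewrite -{1}(cat_take_drop j (lab c)) drop_cat size_takel ?size_lab //; case: ltnP => // ji.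
    have -> : j = i by apply/eqP; rewrite eqn_leq ji ij.
    by rewrite subnn drop0 [drop i (take i _)]drop_oversize // size_take_min geq_minl.
  have -> : drop i (lab (ins c j e)) =
      map f (drop i (take j (lab c))) ++ map g (lab e) ++ map f (drop j (lab c)).
    rewrite E drop_cat sA; case: ltnP => ji; first by rewrite !map_drop.
    have -> : j = i by apply/eqP; rewrite eqn_leq ji ij.
    by rewrite subnn drop0 [drop i (take i _)]drop_oversize // size_take_min geq_minl.
  have fK A : {subset A <= lab c} -> (f x \in map f A) = (x \in A).
    move=> Ac; apply/mapP/idP => [[y yA h]|h]; last by exists x.
    by rewrite (fi x y) // Ac.
  rewrite dK !mem_cat !fK.
  - have -> : (f x \in map g (lab e)) = false by apply/negP => /mapP[y ye]; exact: fg.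
    by [].
  - by move=> y /mem_drop.
  by move=> y /mem_drop/mem_take.
rewrite /noblk tE all_map; apply: eq_in_all => x xs /=; apply: dE; exact: sub.
Qed.

Lemma xo_cat c d : valid c -> valid d -> xo (cat c d) = xo c + xo d.
Proof.
move=> vc vd; elim: c vc => //= [c1 _ c2 IH /andP[_ v]|c IH i /andP[id_ v]]; rewrite IH ?addnA //.
have := noblk_ins vd v (leq0n _) id_; rewrite ins0 add0n => ->.
by rewrite /noblk take0 addnAC.
Qed.

(** The two maps share only the root vertex, which [xo] leaves out, and no other vertex changes its
    status. *)
Lemma xo_ins c j d : valid c -> valid d -> j <= deg c -> xo (ins c j d) = xo c + xo d.
Proof.
move=> vc vd; elim: c vc j => [|c1 IH1 c2 IH2|c IH i] vc [|j] jc; try by rewrite ins0 xo_cat // addnC.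
- by [].
- case/andP: vc => v1 v2; rewrite /= in jc *; case: ifP => h /=.
    by rewrite IH1 // addnAC.
  by rewrite IH2 ?addnA //; lia.
case/andP: vc => id_ v; rewrite /= in jc *; have ij : i + j <= deg c by lia.
by rewrite IH // noblk_ins_le ?leq_addr // addnAC.
Qed.

Lemma glue_preK n a e q : e \in blocks a -> q \in open_prefixes n -> unglue (glue_pre e q) = (e, q).
Proof.
rewrite mem_filter mem_codes mem_pre; case: q => c j /= /andP[/andP[nc e0] /andP[ve _]] /and4P[vc _ jd nb].
rewrite /unglue /glue_pre /=; have [f [g [fi gi fg E]]] := lab_ins vc ve jd.
have sA : size (map f (take j (lab c))) = j by rewrite size_map size_takel // size_lab.
suff -> : index (nth 0 (lab (ins c j e)) (j + (deg e).-1)) (lab (ins c j e)) = j.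
  by rewrite -addnS prednK // addKn det_ins.
have -> : nth 0 (lab (ins c j e)) (j + (deg e).-1) = g (nth 0 (lab e) 0).
  rewrite E nth_cat sA ltnNge leq_addr /= addKn nth_cat size_map size_lab prednK // leqnn.
  rewrite (nth_map 0) ?size_lab ?prednK //; congr g.
  by move/constantPn: nc; apply; rewrite size_lab ?prednK.
have e0' : nth 0 (lab e) 0 \in lab e by rewrite mem_nth // size_lab.
rewrite E index_cat sA ifN; last first.
  by apply/mapP => -[x /mem_take xc] /esym; exact: fg.
case: (lab e) (size_lab e) e0 => [|y s] /= se; first by rewrite -se.
by rewrite eqxx addn0.
Qed.

Lemma unglueK c i : valid c -> i < deg c -> noblk c i -> ~~ noblk c i.+1 ->
  let d := unglue (c, i) in [/\ d.1 \in blocks (csize d.1), d.2 \in open_prefixes (csize d.2.1),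
    csize d.1 + csize d.2.1 = csize c & glue_pre d.1 d.2 = (c, i)].
Proof.
move=> vc ic nb nnb; rewrite /unglue /=; set l := nth 0 (lab c) i; set j := index l (lab c).
have ls : l \in lab c by rewrite mem_nth // size_lab.
have jl : nth 0 (lab c) j = l by rewrite nth_index.
have jmin q : q < j -> nth 0 (lab c) q <> l.
  by move=> qj E; have := before_find 0 qj; rewrite /= E eqxx.
have ji : j <= i by rewrite leqNgt; apply/negP => /jmin.
have dropi : drop i (lab c) = l :: drop i.+1 (lab c) by rewrite (drop_nth 0) ?size_lab.
have nl : l \notin drop i.+1 (lab c).
  apply: contra nnb => ld; apply/allP => x xt; rewrite /=.
  have: x \in drop i (lab c).
    move: xt; rewrite -addn1 takeD mem_cat dropi /= take0 mem_seq1.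
    by move=> /orP[/(allP nb)|/eqP->]; rewrite /= ?dropi // mem_head.
  by rewrite dropi inE => /orP[/eqP->|].
(* A different label strictly between [j] and [i] would recur after [i], because the prefix is open,
   and would then cross the block. *)
have blk p : j <= p <= i -> nth 0 (lab c) p = l.
  move=> /andP[jp pi]; case: (eqVneq p j) => [->//|pj]; case: (eqVneq p i) => [->//|pi'].
  apply/eqP/negPn/negP => npl.
  have : nth 0 (lab c) p \in drop i (lab c).
    apply: (allP nb); apply/mem_take_nth; first by rewrite size_lab ltnW.
    by exists p => //; rewrite ltn_neqAle pi'.
  case/mem_drop_nth => t; rewrite size_lab => /andP[it td] tp.
  have ti : i < t by rewrite ltn_neqAle it andbT; apply: contra npl => /eqP it'; rewrite -tp -it'.
  case/eqP: npl; rewrite -jl; apply/esym; apply: (@lab_noncrossing c vc j p i t); rewrite ?size_lab //.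
  - by rewrite ltn_neqAle eq_sym pj.
  by rewrite ltn_neqAle pi'.
have cl : closed_at c j (i.+1 - j).
  move=> p q pj qd nq; rewrite blk; last by lia.
  case: (ltnP q j) => qj; first by move/esym; exact: jmin.
  move=> E; case/negP: nl; rewrite E; apply/mem_drop_nth; exists q => //; rewrite size_lab; lia.
have k0 : 0 < i.+1 - j by lia.
have jk : j + (i.+1 - j) <= deg c by lia.
have [v1 v2 d1 d2 cE] := det_closed vc k0 jk cl.
set d := det _ _ _ in v1 v2 d1 d2 cE *.
have e0 : 0 < deg d.2 by rewrite d2.
have jd1 : j <= deg d.1 by lia.
have := @noblk_ins d.1 j d.2 (deg d.2).-1 v1 v2 jd1 (leq_pred _).
rewrite cE noblk_pred // (_ : j + _ = i); last by lia.
rewrite nb => /esym/andP[nb1 nc].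
split.
- by rewrite mem_filter nc e0 mem_codes v2 /=.
- by rewrite mem_pre v1 eqxx jd1 nb1.
- by rewrite -[in RHS]cE csize_ins addnC.
by rewrite /glue_pre /= cE d2 subSn //= subnKC.
Qed.

Lemma glue_pre_mem n a e q : a <= n -> e \in blocks a -> q \in open_prefixes (n - a) ->
  [/\ glue_pre e q \in open_prefixes n, (glue_pre e q).2 < deg (glue_pre e q).1 &
      ~~ noblk (glue_pre e q).1 (glue_pre e q).2.+1].
Proof.
move=> an; rewrite mem_filter mem_codes !mem_pre; case: q => c j /=.
move=> /andP[/andP[nc e0] /andP[ve /eqP se]] /and4P[vc /eqP sc jd nb].
have dE := deg_ins vc ve jd; rewrite valid_ins // csize_ins sc se subnK // eqxx dE -addnS.
rewrite prednK // !noblk_ins ?leq_pred // nb noblk_pred // nc noblk_deg //=; split=> //.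
  by rewrite leq_add // leq_pred.
by rewrite leq_add2r.
Qed.

(* Moving the first dart of the suffix into the prefix either keeps every prefix block alive,
   or closes a block of the root vertex, which by planarity is then contiguous and detachable. *)
Lemma pre_step n : perm_eq [seq p <- open_prefixes n | p.2 < deg p.1]
  ([seq (p.1, p.2.-1) | p <- open_prefixes n & 0 < p.2] ++ glued n).
Proof.
apply: uniq_perm.
- exact/filter_uniq/uniq_pre.
- rewrite cat_uniq; apply/and3P; split.
  + rewrite map_inj_in_uniq ?filter_uniq ?uniq_pre // => -[c i] [d j].
    rewrite !mem_filter /= => /andP[i0 _] /andP[j0 _] [-> ij].
    by rewrite -(prednK i0) -(prednK j0) ij.
  + apply/hasPn => p /flatten_mapP[a]; rewrite mem_iota add0n ltnS => /andP[_ an] /allpairsP[[e q] [/= eb qp ->]].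
    have [_ _ nn] := glue_pre_mem an eb qp; apply: contra nn => /mapP[[c i] + ->].
    rewrite mem_filter mem_pre /= => /andP[i0 /and4P[_ _ _ nb]].
    by rewrite /= prednK.
  apply: (@uniq_flatten_map _ _ _ _ (fun p => csize (unglue p).1)); first exact: iota_uniq.
    move=> a _; apply: allpairs_uniq; rewrite ?uniq_pre ?filter_uniq ?uniq_codes //.
    move=> x y /allpairsP[[e q] [/= h1 h2 ->]] /allpairsP[[e' q'] [/= h3 h4 ->]] /= E.
    by rewrite -(glue_preK h1 h2) -(glue_preK h3 h4) E.
  move=> a p _ /allpairsP[[e q] [eb qp ->]]; rewrite (glue_preK eb qp) /=.
  by move: eb; rewrite /= mem_filter mem_codes => /and3P[_ _ /eqP].
move=> [c i]; rewrite mem_filter mem_cat mem_pre /=; apply/andP/orP.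
  case=> ic /and4P[vc /eqP sc id_ nb]; case: (boolP (noblk c i.+1)) => nb1.
    left; apply/mapP; exists (c, i.+1) => //.
    by rewrite mem_filter mem_pre /= vc sc eqxx ic nb1.
  right; have [eb qp sz E] := unglueK vc ic nb nb1.
  apply/flatten_mapP; exists (csize (unglue (c, i)).1); first by rewrite mem_iota -sc -sz /= ltnS leq_addr.
  apply/allpairsP; exists (unglue (c, i)); split=> //.
  by rewrite -sc -sz addKn.
case=> [/mapP[[d j]]|/flatten_mapP[a]].
  rewrite mem_filter mem_pre /= => /andP[j0 /and4P[vd sd jd nb]] [-> ->].
  by rewrite vd sd noblkS ?prednK // (leq_trans (leq_pred j)).
rewrite mem_iota add0n ltnS => /andP[_ an] /allpairsP[[e q] [/= eb qp E]].
by have [] := glue_pre_mem an eb qp; rewrite -E mem_pre /=.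
Qed.

From Stdlib Require Import Reals Lra Psatz Ranalysis5.
From Coquelicot Require Import Coquelicot.
Import Defs.
Local Notation iota := seq.iota.

(** * Sums of reals *)

HB.instance Definition _ := Monoid.isComLaw.Build R 0%R Rplus
  (fun x y z => esym (Rplus_assoc x y z)) Rplus_comm Rplus_0_l.
HB.instance Definition _ := Monoid.isComLaw.Build R 1%R Rmult
  (fun x y z => esym (Rmult_assoc x y z)) Rmult_comm Rmult_1_l.
HB.instance Definition _ := Monoid.isMulLaw.Build R 0%R Rmult Rmult_0_l Rmult_0_r.
HB.instance Definition _ := Monoid.isAddLaw.Build R Rmult Rplus
  Rmult_plus_distr_r Rmult_plus_distr_l.

Notation "\rsum_ ( i <- r | P ) F" := (\big[Rplus/0%R]_(i <- r | P%B) F%R)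
  (at level 41, F at level 41, i, r at level 50) : R_scope.
Notation "\rsum_ ( i <- r ) F" := (\big[Rplus/0%R]_(i <- r) F%R)
  (at level 41, F at level 41, i, r at level 50) : R_scope.
Notation "\rsum_ ( i 'in' A ) F" := (\big[Rplus/0%R]_(i in A) F%R)
  (at level 41, F at level 41, i, A at level 50) : R_scope.

Open Scope R_scope.

Lemma iter_Rplus k a : iter k (Rplus a) 0 = INR k * a.
Proof. by elim: k => [|k IH]; rewrite ?S_INR /= ?IH; lra. Qed.

Section RSum.
Variables (I : Type).
Implicit Types (s : seq I) (P : pred I) (F G : I -> R).

Lemma rsum_ge0 s P F : (forall i, P i -> 0 <= F i) -> 0 <= \rsum_(i <- s | P i) F i.
Proof. by move=> F0; elim/big_ind: _ => //; [lra|move=> x y; lra]. Qed.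

Lemma rsum_le s P F G : (forall i, P i -> F i <= G i) ->
  \rsum_(i <- s | P i) F i <= \rsum_(i <- s | P i) G i.
Proof. by move=> FG; elim/big_ind2: _ => //; [lra|move=> *; lra]. Qed.

Lemma rsum_mull s P F a : \rsum_(i <- s | P i) (a * F i) = a * \rsum_(i <- s | P i) F i.
Proof. by rewrite big_distrr. Qed.

Lemma rsum_mulr s P F a : \rsum_(i <- s | P i) (F i * a) = (\rsum_(i <- s | P i) F i) * a.
Proof. by rewrite big_distrl. Qed.

Lemma rsumD s P F G : \rsum_(i <- s | P i) (F i + G i) =
  \rsum_(i <- s | P i) F i + \rsum_(i <- s | P i) G i.
Proof. by rewrite big_split. Qed.

Lemma rsumN s P F : \rsum_(i <- s | P i) (- F i) = - \rsum_(i <- s | P i) F i.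
Proof.
rewrite (eq_bigr (fun i => -1 * F i)); last by move=> i _; lra.
by rewrite rsum_mull; lra.
Qed.

Lemma rsumB s P F G : \rsum_(i <- s | P i) (F i - G i) =
  \rsum_(i <- s | P i) F i - \rsum_(i <- s | P i) G i.
Proof. by rewrite rsumD rsumN. Qed.

Lemma INR_sum s P (f : I -> nat) :
  INR (\sum_(i <- s | P i) f i)%nat = \rsum_(i <- s | P i) INR (f i).
Proof. by elim/big_ind2: _ => //= m x n y <- <-; rewrite plus_INR. Qed.

Lemma rsum_abs s P F : Rabs (\rsum_(i <- s | P i) F i) <= \rsum_(i <- s | P i) Rabs (F i).
Proof.
elim/big_ind2: _ => [|x y u v h1 h2|i _]; rewrite ?Rabs_R0; try lra.
by apply: Rle_trans (Rabs_triang _ _) _; lra.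
Qed.

Lemma rsum_const s P a : \rsum_(i <- s | P i) a = INR (count P s) * a.
Proof.
elim: s => [|x s IH]; first by rewrite big_nil /= Rmult_0_l.
have -> : count P (x :: s) = (P x + count P s)%nat by [].
rewrite big_cons IH plus_INR; case: (P x); rewrite [INR (nat_of_bool _)]/=; lra.
Qed.
End RSum.

(** * Labelled maps and rerooting *)

Section Reroot.
Variable n : nat.
Implicit Types (m : premap n).
Open Scope R_scope.

Lemma sum_rmaps (F : code -> R) : (0 < n)%nat ->
  \rsum_(m in rmaps n) F (map_code m) = INR (2 * n)`! * \rsum_(c <- codes n) F c.
Proof.
move=> n0; rewrite -rsum_mull.
transitivity (\rsum_(m in rmaps n) \rsum_(c <- codes n | c == map_code m) F c).
  apply: eq_bigr => m mR; rewrite -big_filter filter_pred1_uniq ?uniq_codes //.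
    by rewrite big_seq1.
  exact: mem_map_code.
rewrite (exchange_big_dep predT) //= big_seq [RHS]big_seq; apply: eq_bigr => c cC.
rewrite big_const -(card_fiber n0 cC).
rewrite (eq_card (B := [set m in rmaps n | map_code m == c])); last first.
  by move=> m; rewrite [RHS]inE [LHS]unfold_in eq_sym.
exact: iter_Rplus.
Qed.

(* Rerooting: the root of a uniform map is uniform among its darts, so a cut vertex of
   degree d is the root vertex with probability d / 2n. *)
Lemma rerooting (f : nat -> R) : (0 < n)%nat ->
  \rsum_(c <- codes n) (f (xc c) * INR (xc c)) =
  INR (2 * n) * \rsum_(c <- codes n) (f (xc c) * (INR (~~ noncut c) / INR (deg c))).
Proof.
move=> n0; have fac : INR (2 * n)`! <> 0.
  by apply: not_0_INR; apply/eqP; rewrite -lt0n fact_gt0.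
apply: (Rmult_eq_reg_l (INR (2 * n)`!)) => //.
rewrite -(sum_rmaps (fun c => f (xc c) * INR (xc c))) // -Rmult_assoc.
rewrite [_ * INR (2 * n)]Rmult_comm Rmult_assoc.
rewrite -(sum_rmaps (fun c => f (xc c) * (INR (~~ noncut c) / INR (deg c)))) //.
(* Each cut vertex shares the weight 1 equally among its darts, so summing [ph] over all darts
   counts cut vertices. *)
pose ph m d := INR (cut_vertex m (porbit (sigma m) d)) / INR #|porbit (sigma m) d|.
have XE m : INR (num_cut_vertices m) = \big[Rplus/0]_(d : dart n) ph m d.
  rewrite /num_cut_vertices -sum1_card INR_sum.
  rewrite (partition_big (porbit (sigma m)) (mem (vertices m))) /=; last by move=> d _; exact: imset_f.
  rewrite (eq_bigl (fun v => (v \in vertices m) && cut_vertex m v)); last by move=> v; rewrite inE.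
  rewrite big_mkcondr; apply: eq_bigr => v /imsetP[d _ ->].
  rewrite (eq_bigr (fun=> ph m d)); last by move=> e /eqP E; rewrite /ph E.
  rewrite big_const (eq_card (B := porbit (sigma m) d)); last first.
    by move=> e; rewrite [LHS]eq_porbit_mem.
  rewrite iter_Rplus /ph; have : INR #|porbit (sigma m) d| <> 0.
    by apply: not_0_INR; apply/eqP; exact: card_porbit_neq0.
  by case: cut_vertex => /= h; field.
transitivity (\rsum_(m in rmaps n) \big[Rplus/0]_(d : dart n) (f (num_cut_vertices m) * ph m d)).
  by apply: eq_bigr => m mR; rewrite -num_cut_map // rsum_mull XE.
transitivity (INR (2 * n) * \rsum_(m in rmaps n) (f (num_cut_vertices m) * ph m (root m))); last first.
  congr (_ * _); apply: eq_bigr => m mR; rewrite -num_cut_map //.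
  by rewrite /ph cut_root // root_deg.
(* Being a map does not depend on the choice of the root, so the dart [d] and the root can exchange
   roles, which yields the factor 2n. *)
pose Q (p : {perm dart n} * {perm dart n}) (r : dart n) : bool := ((p, r) : premap n) \in rmaps n.
have QE p r r' : Q p r = Q p r' by rewrite /Q !inE.
have E (G : premap n -> R) : \rsum_(m in rmaps n) G m =
    \big[Rplus/0]_p \big[Rplus/0]_(r | Q p r) G (p, r).
  rewrite pair_big_dep /=; apply: eq_big => [[p r]|[p r] _] //.
rewrite !E -rsum_mull; apply: eq_bigr => p _.
rewrite exchange_big /= -rsum_mull.
rewrite big_mkcond [RHS]big_mkcond /=.
have [r0 _] : exists r0 : dart n, true.
  have h : (0 < 2 * n)%nat by rewrite muln_gt0.
  by exists (Ordinal h).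
apply: eq_bigr => d _.
rewrite (eq_bigl (fun=> Q p d)); last by move=> r; exact: QE.
case: (Q p d); last by rewrite big_pred0.
rewrite (eq_bigr (fun=> f (num_cut_vertices ((p, d) : premap n)) * ph (p, d) d)) //.
by rewrite big_const card_ord iter_Rplus.
Qed.

End Reroot.

(** * Recurrences *)

Lemma rsum_iota (f : nat -> R) n : \rsum_(k <- iota 0 n.+1) f k = sum_f_R0 f n.
Proof.
elim: n => [|n IH]; first by rewrite big_seq1.
by rewrite -[n.+2]addn1 iotaD big_cat big_seq1 IH.
Qed.

Lemma sum_f_R0_rsum (I : Type) (s : seq I) (F : nat -> I -> R) n :
  sum_f_R0 (fun k => \rsum_(i <- s) F k i) n = \rsum_(i <- s) sum_f_R0 (fun k => F k i) n.
Proof. by elim: n => [|n IH] //=; rewrite IH -rsumD. Qed.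

Lemma rsum_codesS n (F : code -> R) : \rsum_(c <- codes n.+1) F c =
  sum_f_R0 (fun k => \rsum_(c1 <- codes k) \rsum_(c2 <- codes (n - k)) F (Loop c1 c2)) n +
  \rsum_(c <- codes n) sum_f_R0 (fun i => F (Expand c i)) (deg c).
Proof.
rewrite codesS big_cat big_flatten big_map -rsum_iota; congr (_ + _).
  by apply: eq_bigr => k _; rewrite big_allpairs_dep.
rewrite big_flatten big_map; apply: eq_bigr => c _.
by rewrite big_map -rsum_iota.
Qed.

Lemma rsum_pre n (F : code -> nat -> R) : \rsum_(p <- open_prefixes n) F p.1 p.2 =
  \rsum_(c <- codes n) sum_f_R0 (fun i => (if noblk c i then F c i else 0)) (deg c).
Proof.
rewrite big_flatten big_map; apply: eq_bigr => c _.
by rewrite big_map big_filter big_mkcond -rsum_iota.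
Qed.

Lemma rsum_glued n (F : code * nat -> R) : \rsum_(p <- glued n) F p =
  sum_f_R0 (fun a => \rsum_(e <- blocks a) \rsum_(q <- open_prefixes (n - a)) F (glue_pre e q)) n.
Proof.
rewrite big_flatten big_map -rsum_iota; apply: eq_bigr => a _.
by rewrite big_allpairs_dep.
Qed.

Lemma conv_rsum (I J : Type) (s : nat -> seq I) (t : nat -> seq J) (F : I -> R) (G : J -> R) (n : nat) :
  sum_f_R0 (fun k => \rsum_(i <- s k) \rsum_(j <- t (n - k)%nat) (F i * G j)) n =
  PS_mult (fun k => \rsum_(i <- s k) F i) (fun k => \rsum_(j <- t k) G j) n.
Proof.
apply: sum_eq => k _; rewrite -rsum_mulr; apply: eq_bigr => i _.
by rewrite rsum_mull.
Qed.

Lemma PS_mult_comm a b n : PS_mult a b n = PS_mult b a n.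
Proof.
rewrite /PS_mult -!rsum_iota -[iota 0 n.+1]/(index_iota 0 n.+1) big_nat_rev big_nat [RHS]big_nat.
apply: eq_bigr => k /= kn; rewrite !minusE add0n subSS subKn; [lra|exact: kn].
Qed.

Lemma sum_pow_rev u d : u <> 1 ->
  sum_f_R0 (fun i => u ^ (d - i).+1) d = u * (1 - u * u ^ d) / (1 - u).
Proof.
move=> u1; have -> : sum_f_R0 (fun i => u ^ (d - i).+1) d = u * sum_f_R0 (fun i => u ^ i) d.
  rewrite -!rsum_iota -rsum_mull -[iota 0 d.+1]/(index_iota 0 d.+1) big_nat_rev big_nat [RHS]big_nat.
  by apply: eq_bigr => k /= kn; rewrite add0n subSS subKn.
rewrite tech3 // -[u ^ S d]/(u * u ^ d); field; lra.
Qed.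

Definition Mn n := INR (size (codes n)).
Definition Wn u n := \rsum_(c <- codes n) u ^ deg c.
Definition Pn u n := \rsum_(c <- codes n) (INR (xo c) * u ^ deg c).
(** [u] marks the darts outside the prefix. One more than their number is the root degree after
    expanding at this prefix. *)
Definition Hn u n := \rsum_(p <- open_prefixes n) u ^ (deg p.1 - p.2).
Definition Sn n := INR (size (blocks n)).

Lemma Wn1 n : Wn 1 n = Mn n.
Proof.
rewrite /Wn (eq_bigr (fun=> 1)) => [|c _]; last by rewrite pow1.
by rewrite rsum_const count_predT Rmult_1_r.
Qed.

Lemma Wn0 u : Wn u 0 = 1. Proof. by rewrite /Wn big_seq1. Qed.
Lemma Pn0 u : Pn u 0 = 0. Proof. by rewrite /Pn big_seq1 /=; lra. Qed.

(** Tutte's recursion. The expansions of [c] have every degree from 1 to one more than that of [c],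
    and the geometric sum produces the divisor 1 - u. *)
Lemma Wn_rec u n : u <> 1 ->
  Wn u n.+1 = u ^ 2 * PS_mult (Wn u) (Wn u) n + u * (Wn 1 n - u * Wn u n) / (1 - u).
Proof.
move=> u1; rewrite /Wn rsum_codesS; congr (_ + _).
  rewrite -conv_rsum scal_sum; apply: sum_eq => k _.
  rewrite -rsum_mulr; apply: eq_bigr => c1 _; rewrite -rsum_mulr; apply: eq_bigr => c2 _.
  rewrite -[deg (Loop c1 c2)]/((deg c1 + deg c2).+2) /= pow_add; lra.
rewrite (eq_bigr (fun c => u / (1 - u) * (1 ^ deg c - u * u ^ deg c))); last first.
  move=> c _; rewrite pow1.
  by transitivity (u * (1 - u * u ^ deg c) / (1 - u)); [exact: sum_pow_rev|field; lra].
by rewrite rsum_mull rsumB rsum_mull; field; lra.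
Qed.

(** The new cut vertex is counted as one minus [noblk]: all prefixes together give the divided
    difference of [Wn], and the open ones are subtracted as [Hn]. *)
Lemma Pn_rec u n : u <> 1 ->
  Pn u n.+1 = 2 * u ^ 2 * PS_mult (Pn u) (Wn u) n + u * (Pn 1 n - u * Pn u n) / (1 - u)
    + u * ((Wn 1 n - u * Wn u n) / (1 - u) - Hn u n).
Proof.
move=> u1; rewrite {1}/Pn rsum_codesS Rplus_assoc; congr (_ + _).
  have -> : 2 * u ^ 2 * PS_mult (Pn u) (Wn u) n =
      u ^ 2 * (PS_mult (Pn u) (Wn u) n + PS_mult (Wn u) (Pn u) n).
    by rewrite [PS_mult (Wn u) _ n]PS_mult_comm; lra.
  rewrite -!conv_rsum -plus_sum scal_sum; apply: sum_eq => k _.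
  rewrite -rsumD -rsum_mulr; apply: eq_bigr => c1 _; rewrite -rsumD -rsum_mulr; apply: eq_bigr => c2 _.
  by rewrite -[deg (Loop c1 c2)]/((deg c1 + deg c2).+2) -[xo (Loop c1 c2)]/(xo c1 + xo c2)%nat plus_INR /= pow_add; lra.
rewrite /Hn (@rsum_pre n (fun c i => u ^ (deg c - i))).
rewrite (eq_bigr (fun c => u / (1 - u) * (INR (xo c) * 1 ^ deg c - u * (INR (xo c) * u ^ deg c))
   + (u / (1 - u) * (1 ^ deg c - u * u ^ deg c)
   - u * sum_f_R0 (fun i => (if noblk c i then u ^ (deg c - i) else 0)) (deg c)))).
  rewrite rsumD rsumB !rsum_mull !rsumB !rsum_mull /Pn /Wn; field; lra.
move=> c _.
have -> : u / (1 - u) * (1 ^ deg c - u * u ^ deg c) = sum_f_R0 (fun i => u ^ (deg c - i).+1) (deg c).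
  by rewrite sum_pow_rev // pow1; field; lra.
have -> : u / (1 - u) * (INR (xo c) * 1 ^ deg c - u * (INR (xo c) * u ^ deg c)) =
    INR (xo c) * sum_f_R0 (fun i => u ^ (deg c - i).+1) (deg c).
  by rewrite sum_pow_rev // pow1; field; lra.
rewrite !scal_sum -minus_sum -plus_sum; apply: sum_eq => i _.
rewrite -[xo (Expand c i)]/(xo c + ~~ noblk c i)%nat -[deg (Expand c i)]/((deg c - i).+1) plus_INR.
by case: (noblk c i) => /=; lra.
Qed.

Lemma noblk_degE c : noblk c (deg c) = (c == Vtx).
Proof.
rewrite -deg0; case: posnP => [|d0]; last by rewrite noblk_deg.
by case: c.
Qed.

(** Only the single vertex has an open prefix of full length. All other open prefixes are decomposed
    by [pre_step], which lowers the exponent by one; the empty prefix is always open and accounts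
    for - [Wn]. *)
Lemma Hn_rec u n : Hn u n = INR (n == 0%nat) + u * (Hn u n - Wn u n) + u * PS_mult Sn (Hn u) n.
Proof.
have H1 : \rsum_(p <- open_prefixes n | (p.2 < deg p.1)%nat) u ^ (deg p.1 - p.2) = Hn u n - INR (n == 0%nat).
  rewrite /Hn [in RHS](bigID (fun p => (p.2 < deg p.1)%nat)) /=.
  suff -> : \rsum_(i <- open_prefixes n | ~~ (i.2 < deg i.1)%nat) u ^ (deg i.1 - i.2) = INR (n == 0%nat) by lra.
  rewrite big_seq_cond (eq_bigl (fun p => (p \in open_prefixes n) && (p == (Vtx, 0%nat)))); last first.
    move=> [c i]; rewrite mem_pre /= xpair_eqE; apply/andP/andP.
      case=> /and4P[vc sc id_ nb]; rewrite -leqNgt => di.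
      have iE : i = deg c by apply/eqP; rewrite eqn_leq id_ di.
      have cV : c = Vtx by apply/eqP; rewrite -noblk_degE -iE.
      by split; [rewrite vc sc id_ nb | rewrite iE cV eqxx].
    by case=> h /andP[cV i0]; split=> //; rewrite (eqP cV).
  rewrite -big_seq_cond -big_filter.
  case: eqP => [->|n0].
    rewrite filter_pred1_uniq ?uniq_pre //; last by rewrite mem_pre.
    by rewrite big_seq1.
  rewrite (eq_in_filter (a2 := pred0)) ?filter_pred0 ?big_nil // => p; rewrite mem_pre => /and4P[_ /eqP s _ _].
  by apply/eqP => E; rewrite E /= in s; case: n0.
have H2 : \rsum_(p <- open_prefixes n | (0 < p.2)%nat) u ^ (deg p.1 - p.2) = Hn u n - Wn u n.
  rewrite /Hn [in RHS](bigID (fun p => (0 < p.2)%nat)) /=.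
  suff -> : \rsum_(i <- open_prefixes n | ~~ (0 < i.2)%nat) u ^ (deg i.1 - i.2) = Wn u n by lra.
  rewrite big_mkcond (@rsum_pre n (fun c i => if ~~ (0 < i)%nat then u ^ (deg c - i) else 0)).
  apply: eq_bigr => c _; case: (deg c) => [|d]; first by rewrite /= /noblk take0.
  rewrite decomp_sum /=; last exact/ltP.
  rewrite /noblk take0 /= (sum_eq _ (fun=> 0)); first by rewrite sum_cte; lra.
  by move=> i _; case: ifP.
have := perm_big _ (pre_step n) (x := 0) (op := Rplus) (P := predT) (F := fun p => u ^ (deg p.1 - p.2)).
rewrite big_cat big_map !big_filter H1 rsum_glued /= => E.
suff : Hn u n - INR (n == 0%nat) = u * (Hn u n - Wn u n) + u * PS_mult Sn (Hn u) n by lra.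
rewrite E; congr (_ + _).
  rewrite -H2 -rsum_mull big_seq_cond [RHS]big_seq_cond; apply: eq_bigr => -[c i] /=.
  rewrite mem_pre /= => /andP[/and4P[_ _ id_ _] i0].
  by rewrite -[u * _]/(u ^ (deg c - i).+1) -subSn // -subSS prednK.
rewrite scal_sum; apply: sum_eq => a _.
have -> : Sn a * Hn u (n - a) * u = \rsum_(e <- blocks a) (Hn u (n - a) * u).
  by rewrite rsum_const count_predT /Sn; lra.
rewrite big_seq [RHS]big_seq; apply: eq_bigr => e; rewrite mem_filter mem_codes => /andP[/andP[nc e0] /andP[ve _]].
rewrite /Hn -rsum_mulr big_seq [RHS]big_seq; apply: eq_bigr => -[c i]; rewrite mem_pre /= => /and4P[vc _ id_ nb].
rewrite deg_ins // -{1}(prednK e0) -addSnnS subnDr subSn //=; lra.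
Qed.

(** * Generating functions *)

Lemma PS_mult_pow (a b : nat -> R) z n :
  PS_mult a b n * z ^ n = PS_mult (fun k => a k * z ^ k) (fun k => b k * z ^ k) n.
Proof.
rewrite Rmult_comm scal_sum; apply: sum_eq => k kn.
have -> : z ^ n = z ^ k * z ^ (n - k) by rewrite -pow_add; congr (_ ^ _); apply/esym/subnKC/leP.
rewrite minusE; ring.
Qed.

Lemma PS_mult_ge0 a b n : (forall k, 0 <= a k) -> (forall k, 0 <= b k) -> 0 <= PS_mult a b n.
Proof. by move=> a0 b0; apply: cond_pos_sum => k; apply: Rmult_le_pos. Qed.

Lemma sum_PS_mult_le a b N : (forall k, 0 <= a k) -> (forall k, 0 <= b k) ->
  sum_f_R0 (PS_mult a b) N <= sum_f_R0 a N * sum_f_R0 b N.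
Proof.
move=> a0 b0; case: N => [|N]; first exact: Rle_refl.
rewrite cauchy_finite; last by apply/ltP.
rewrite -[X in X <= _]Rplus_0_r; apply: Rplus_le_compat_l; apply: cond_pos_sum => k.
by apply: cond_pos_sum => l; apply: Rmult_le_pos.
Qed.

Lemma Wn_ge0 u n : 0 <= u -> 0 <= Wn u n.
Proof. by move=> u0; apply: rsum_ge0 => c _; apply: pow_le. Qed.

Lemma Mn_ge0 n : 0 <= Mn n. Proof. exact: pos_INR. Qed.

(** At u = 2 and z = 1/32 the recursion bounds the next partial sum by 1 + A^2 / 8 + A / 8, where A
    is the current one, and this preserves A <= 2. *)
Lemma sum_W2_le N : sum_f_R0 (fun n => Wn 2 n * (/ 32) ^ n) N <= 2.
Proof.
elim: N => [|N IH]; first by rewrite /= Wn0; lra.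
rewrite decomp_sum; last exact/ltP.
rewrite Wn0 /=; set a := fun n => Wn 2 n * (/ 32) ^ n in IH.
have a0 k : 0 <= a k by apply: Rmult_le_pos; [apply: Wn_ge0; lra|apply: pow_le; lra].
have : sum_f_R0 (fun i => Wn 2 i.+1 * (/ 32 * (/ 32) ^ i)) N <=
    sum_f_R0 (fun i => / 8 * PS_mult a a i + / 8 * a i) N.
  apply: sum_Rle => i _; rewrite Wn_rec; last by lra.
  rewrite -PS_mult_pow /a Wn1; have := Mn_ge0 i; have : 0 <= (/ 32) ^ i by apply: pow_le; lra.
  move: (PS_mult _ _ _) (Wn 2 i) (Mn i) (_ ^ i) => x y m p p0 m0.
  have -> : (2 ^ 2 * x + 2 * (m - 2 * y) / (1 - 2)) * (/ 32 * p) = / 8 * (x * p) + / 8 * (y * p) - / 16 * (m * p) by field.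
  have := Rmult_le_pos _ _ m0 p0; lra.
have -> : sum_f_R0 (fun i => / 8 * PS_mult a a i + / 8 * a i) N =
    / 8 * sum_f_R0 (PS_mult a a) N + / 8 * sum_f_R0 a N.
  by rewrite plus_sum !scal_sum; congr (_ + _); apply: sum_eq => i _; lra.
have := @sum_PS_mult_le a a N a0 a0; have := cond_pos_sum a N a0.
move: IH; set A := sum_f_R0 a N; move=> *; nra.
Qed.

Lemma sum_term_le (a : nat -> R) n : (forall k, 0 <= a k) -> a n <= sum_f_R0 a n.
Proof.
move=> a0; case: n => [|n] /=; first exact: Rle_refl.
by have := cond_pos_sum a n a0; lra.
Qed.

Lemma W2_le n : Wn 2 n <= 2 * 32 ^ n.
Proof.
have a0 k : 0 <= Wn 2 k * (/ 32) ^ k by apply: Rmult_le_pos; [apply: Wn_ge0; lra|apply: pow_le; lra].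
have := Rle_trans _ _ _ (sum_term_le n a0) (sum_W2_le n).
have p0 : 0 < 32 ^ n by apply: pow_lt; lra.
rewrite pow_inv => h; apply: (Rmult_le_reg_r (/ 32 ^ n)); first exact: Rinv_0_lt_compat.
by rewrite [2 * _ * _]Rmult_assoc Rinv_r; lra.
Qed.

Lemma bernoulli_pow x n : 0 < x -> 1 + INR n * x <= (1 + x) ^ n.
Proof. exact: Rfunctions.poly. Qed.

(** The ratio 64 is twice the growth rate 32 found for [Wn] at u = 2, which leaves room for a factor
    n. *)
Lemma disk_bounded a K z : (forall n, Rabs (a n) <= K * 64 ^ n) -> 0 < z < / 64 ->
  Rbar_lt (Rabs z) (CV_radius a).
Proof.
move=> aK zd; rewrite Rabs_pos_eq; last by lra.
apply: (@Rbar_lt_le_trans _ (/ 64)); first by rewrite /=; lra.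
have [ub _] := CV_radius_bounded a; apply: ub; exists K => n.
rewrite Rabs_mult pow_inv Rabs_inv [Rabs (64 ^ n)]Rabs_pos_eq; last by apply: pow_le; lra.
apply: (Rmult_le_reg_r (64 ^ n)); first by apply: pow_lt; lra.
by rewrite Rmult_assoc Rinv_l ?Rmult_1_r //; apply: pow_nonzero; lra.
Qed.

Lemma xo_le c : (xo c <= csize c)%nat.
Proof.
elim: c => //= [c1 h1 c2 h2|c h i]; first by apply: leqW; exact: leq_add.
by rewrite -addn1 leq_add // leq_b1.
Qed.

(** As 3/2 times 4/3 is 2, the linear factor is paid for by (3/2)^d. *)
Lemma pow_deg_le u d : 0 <= u <= 4 / 3 -> (INR d + 1) * u ^ d <= 2 * 2 ^ d.
Proof.
move=> u01; have ud : u ^ d <= (4 / 3) ^ d by apply: pow_incr; lra.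
have -> : 2 ^ d = (1 + / 2) ^ d * (4 / 3) ^ d by rewrite -Rpow_mult_distr; congr (_ ^ _); lra.
have d0 := pos_INR d; have y0 : 0 < (4 / 3) ^ d by apply: pow_lt; lra.
have b : 1 + INR d * / 2 <= (1 + / 2) ^ d by apply: bernoulli_pow; lra.
have h1 : (INR d + 1) * u ^ d <= (INR d + 1) * (4 / 3) ^ d by apply: Rmult_le_compat_l; lra.
have h2 : (INR d + 1) * (4 / 3) ^ d <= 2 * (1 + / 2) ^ d * (4 / 3) ^ d by apply: Rmult_le_compat_r; lra.
lra.
Qed.

Lemma Wn_le u n : 0 <= u <= 2 -> Wn u n <= Wn 2 n.
Proof. by move=> u2; apply: rsum_le => c _; apply: pow_incr. Qed.

Lemma Mn_le n : Mn n <= Wn 2 n.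
Proof. by rewrite -Wn1; apply: Wn_le; lra. Qed.

Lemma pow32_64 n : 32 ^ n <= 64 ^ n. Proof. by apply: pow_incr; lra. Qed.

Lemma Wn_bnd u : 0 <= u <= 2 -> forall n, Rabs (Wn u n) <= 2 * 64 ^ n.
Proof.
move=> u2 n; rewrite Rabs_pos_eq; last by apply: Wn_ge0; lra.
by have := Wn_le n u2; have := W2_le n; have := pow32_64 n; lra.
Qed.

Lemma Pn_bnd u : 0 <= u <= 2 -> forall n, Rabs (Pn u n) <= 2 * 64 ^ n.
Proof.
move=> u2 n; have u0 d : 0 <= u ^ d by apply: pow_le; lra.
rewrite Rabs_pos_eq; last by apply: rsum_ge0 => c _; apply: Rmult_le_pos => //; exact: pos_INR.
have h : Pn u n <= INR n * Wn u n.
  rewrite /Pn /Wn -rsum_mull big_seq [X in _ <= X]big_seq; apply: rsum_le => c.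
  rewrite mem_codes => /andP[_ /eqP <-]; apply: Rmult_le_compat_r => //.
  by apply/le_INR/leP; exact: xo_le.
have h2 := Wn_le n u2; have h3 := W2_le n; have n0 := pos_INR n; have h4 := Wn_ge0 n (proj1 u2).
have b : 1 + INR n * 1 <= (1 + 1) ^ n by apply: bernoulli_pow; lra.
have -> : 64 ^ n = (1 + 1) ^ n * 32 ^ n by rewrite -Rpow_mult_distr; congr (_ ^ _); lra.
have p0 : 0 < 32 ^ n by apply: pow_lt; lra.
have h5 : INR n * Wn u n <= INR n * (2 * 32 ^ n) by apply: Rmult_le_compat_l; lra.
have h6 : INR n * (2 * 32 ^ n) <= (1 + 1) ^ n * (2 * 32 ^ n) by apply: Rmult_le_compat_r; lra.
lra.
Qed.

Lemma Hn_ge0 u n : 0 <= u -> 0 <= Hn u n.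
Proof. by move=> u0; apply: rsum_ge0 => p _; apply: pow_le. Qed.

Lemma Hn_le u n : 0 <= u <= 4 / 3 -> Hn u n <= 2 * Wn 2 n.
Proof.
move=> u1; rewrite /Hn (@rsum_pre n (fun c i => u ^ (deg c - i))) /Wn -rsum_mull.
apply: rsum_le => c _; pose v := Rmax u 1.
have v1 : 1 <= v by exact: Rmax_r.
have v43 : 0 <= v <= 4 / 3 by rewrite /v /Rmax; case: Rle_dec; lra.
apply: Rle_trans (pow_deg_le (deg c) v43).
rewrite -S_INR Rmult_comm -sum_cte; apply: sum_Rle => i _.
have vd : u ^ (deg c - i) <= v ^ deg c.
  apply: (@Rle_trans _ (v ^ (deg c - i))); first by apply: pow_incr; split; [lra|exact: Rmax_l].
  by apply: Rle_pow => //; apply/leP/leq_subr.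
case: ifP => // _; apply: pow_le; lra.
Qed.

Lemma Hn_bnd u : 0 <= u <= 4 / 3 -> forall n, Rabs (Hn u n) <= 4 * 64 ^ n.
Proof.
move=> u1 n; rewrite Rabs_pos_eq; last by apply: Hn_ge0; lra.
by have := Hn_le n u1; have := W2_le n; have := pow32_64 n; lra.
Qed.

Lemma Sn_le n : Sn n <= Mn n.
Proof. by apply/le_INR/leP; rewrite size_filter; exact: count_size. Qed.

Lemma Sn_ge0 n : 0 <= Sn n. Proof. exact: pos_INR. Qed.

Lemma Sn_bnd n : Rabs (Sn n) <= 2 * 64 ^ n.
Proof.
rewrite Rabs_pos_eq; last exact: Sn_ge0.
by have := Sn_le n; have := Mn_le n; have := W2_le n; have := pow32_64 n; lra.
Qed.

Lemma gf_rec a b z : Rbar_lt (Rabs z) (CV_radius a) -> (forall n, a n.+1 = b n) ->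
  PSeries a z = a 0%nat + z * PSeries b z.
Proof.
move=> az ab; rewrite PSeries_decr_1; last exact: CV_radius_inside.
by congr (_ + _ * _); apply: PSeries_ext => n; rewrite -ab.
Qed.

Lemma gf_lin c f g z : ex_pseries f z -> ex_pseries g z ->
  ex_pseries (fun n => c * f n + g n) z /\
  PSeries (fun n => c * f n + g n) z = c * PSeries f z + PSeries g z.
Proof.
move=> ef eg; have ec : ex_pseries (PS_scal c f) z.
  by apply: ex_pseries_scal => //; exact: Rmult_comm.
split; first exact: (ex_pseries_plus _ _ _ ec eg).
by rewrite -PSeries_scal -PSeries_plus.
Qed.

Lemma gf_scal c f z : ex_pseries f z ->
  ex_pseries (fun n => c * f n) z /\ PSeries (fun n => c * f n) z = c * PSeries f z.
Proof.
move=> ef; split; last by rewrite -PSeries_scal.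
by apply: (@ex_pseries_scal _ _ c f z) => //; exact: Rmult_comm.
Qed.

Section GF.
Variable z : R.
Hypothesis zd : 0 < z < / 64.
Variable u : R.
Hypothesis ud : 0 <= u <= 4 / 3.
Hypothesis u1 : u <> 1.

Let M := PSeries Mn z.
Let W := PSeries (Wn u) z.
Let P := PSeries (Pn u) z.
Let P1 := PSeries (Pn 1) z.
Let H := PSeries (Hn u) z.
Let S := PSeries Sn z.

Let dW : Rbar_lt (Rabs z) (CV_radius (Wn u)).
Proof. by apply: (disk_bounded (K := 2)) => //; apply: Wn_bnd; lra. Qed.
Let dM : Rbar_lt (Rabs z) (CV_radius (Wn 1)).
Proof. by apply: (disk_bounded (K := 2)) => //; apply: Wn_bnd; lra. Qed.
Let dP : Rbar_lt (Rabs z) (CV_radius (Pn u)).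
Proof. by apply: (disk_bounded (K := 2)) => //; apply: Pn_bnd; lra. Qed.
Let dP1 : Rbar_lt (Rabs z) (CV_radius (Pn 1)).
Proof. by apply: (disk_bounded (K := 2)) => //; apply: Pn_bnd; lra. Qed.
Let dH : Rbar_lt (Rabs z) (CV_radius (Hn u)).
Proof. by apply: (disk_bounded (K := 4)) => //; apply: Hn_bnd. Qed.
Let dS : Rbar_lt (Rabs z) (CV_radius Sn).
Proof. by apply: (disk_bounded (K := 2)) => //; exact: Sn_bnd. Qed.

Let ME : PSeries (Wn 1) z = M.
Proof. by apply: PSeries_ext => n; exact: Wn1. Qed.

Let h1u : 1 - u <> 0. Proof. by lra. Qed.

Lemma gf_W : (1 - u) * W = (1 - u) + z * u ^ 2 * (1 - u) * W ^ 2 + z * u * (M - u * W).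
Proof.
have [e1 E1] := gf_lin (- u) (CV_radius_inside _ _ dW) (CV_radius_inside _ _ dM).
have [e2 E2] := gf_scal (u ^ 2) (ex_pseries_mult _ _ _ dW dW).
have [e3 E3] := gf_lin (u / (1 - u)) e1 e2.
rewrite {1}/W (gf_rec dW (b := fun n => u / (1 - u) * (- u * Wn u n + Wn 1 n) + u ^ 2 * PS_mult (Wn u) (Wn u) n)); last first.
  by move=> n; rewrite Wn_rec //; field.
rewrite Wn0 E3 E1 E2 ME PSeries_mult // -/W; field; exact: h1u.
Qed.

Lemma gf_P : (1 - u) * P = 2 * z * u ^ 2 * (1 - u) * P * W + z * u * (P1 - u * P)
  + z * u * ((M - u * W) - (1 - u) * H).
Proof.
have [e1 E1] := gf_lin (- u) (CV_radius_inside _ _ dW) (CV_radius_inside _ _ dM).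
have [e2 E2] := gf_lin (- u) (CV_radius_inside _ _ dP) (CV_radius_inside _ _ dP1).
have [e3 E3] := gf_scal (2 * u ^ 2) (ex_pseries_mult _ _ _ dP dW).
have [e4 E4] := gf_lin (- u) (CV_radius_inside _ _ dH) e3.
have [e5 E5] := gf_lin (u / (1 - u)) e1 e4.
have [e6 E6] := gf_lin (u / (1 - u)) e2 e5.
rewrite {1}/P (gf_rec dP (b := fun n => u / (1 - u) * (- u * Pn u n + Pn 1 n) +
   (u / (1 - u) * (- u * Wn u n + Wn 1 n) + (- u * Hn u n + 2 * u ^ 2 * PS_mult (Pn u) (Wn u) n)))); last first.
  by move=> n; rewrite Pn_rec //; field.
rewrite Pn0 E6 E2 E5 E1 E4 E3 ME PSeries_mult // -/W -/P -/P1 -/H; field; exact: h1u.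
Qed.

Lemma gf_H : H = 1 + u * (H - W) + u * S * H.
Proof.
have [e1 E1] := gf_lin (- 1) (CV_radius_inside _ _ dW) (CV_radius_inside _ _ dH).
have [e2 E2] := gf_lin 1 e1 (ex_pseries_mult _ _ _ dS dH).
have [e3 E3] := gf_scal u e2.
have dd : Rbar_lt (Rabs z) (CV_radius (fun n => INR (n == 0%nat))).
  apply: (disk_bounded (K := 1)) => // n.
  have : 1 <= 64 ^ n by apply: pow_R1_Rle; lra.
  by case: n => [|n]; rewrite ?Rabs_R1 ?Rabs_R0 /=; lra.
have [e4 E4] := gf_lin 1 (CV_radius_inside _ _ dd) e3.
rewrite {1}/H (PSeries_ext _ (fun n => 1 * INR (n == 0%nat) +
    u * (1 * (- 1 * Wn u n + Hn u n) + PS_mult Sn (Hn u) n))); last first.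
  by move=> n; rewrite {1}Hn_rec; ring.
rewrite E4 E3 E2 E1 PSeries_mult // (gf_rec dd (b := fun=> 0)) // PSeries_const_0 -/W -/H -/S /=; ring.
Qed.
End GF.

(** * The kernel method *)

(** Gives a Lipschitz bound for [W] in [u], hence the continuity required by the intermediate value
    theorem. *)
Lemma pow_Lip u u' d : 0 <= u <= 4 / 3 -> 0 <= u' <= 4 / 3 ->
  Rabs (u ^ d - u' ^ d) <= Rabs (u - u') * (INR d * (4 / 3) ^ d).
Proof.
move=> h h'; elim: d => [|d IH]; first by rewrite /= Rminus_diag Rabs_R0; have := Rabs_pos (u - u'); lra.
have -> : u ^ d.+1 - u' ^ d.+1 = u * (u ^ d - u' ^ d) + (u - u') * u' ^ d by rewrite /=; ring.
apply: Rle_trans (Rabs_triang _ _) _; rewrite !Rabs_mult S_INR [Rabs u]Rabs_pos_eq; last by lra.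
rewrite [Rabs (u' ^ d)]Rabs_pos_eq; last by apply: pow_le; lra.
have p : u' ^ d <= (4 / 3) ^ d by apply: pow_incr.
have p0 : 0 <= u' ^ d by apply: pow_le; lra.
have a0 := Rabs_pos (u - u'); have b0 := Rabs_pos (u ^ d - u' ^ d).
rewrite -[(4 / 3) ^ d.+1]/(4 / 3 * (4 / 3) ^ d); have n0 := pos_INR d.
have h1 : u * Rabs (u ^ d - u' ^ d) <= 4 / 3 * (Rabs (u - u') * (INR d * (4 / 3) ^ d)).
  by apply: Rmult_le_compat; lra.
have h2 : Rabs (u - u') * u' ^ d <= Rabs (u - u') * (4 / 3 * (4 / 3) ^ d).
  by apply: Rmult_le_compat_l => //; lra.
lra.
Qed.

Lemma Wn_Lip u u' n : 0 <= u <= 4 / 3 -> 0 <= u' <= 4 / 3 ->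
  Rabs (Wn u n - Wn u' n) <= Rabs (u - u') * (2 * Wn 2 n).
Proof.
move=> h h'; rewrite /Wn -rsumB; apply: Rle_trans (rsum_abs _ _ _) _.
rewrite -!rsum_mull; apply: rsum_le => c _; apply: Rle_trans (pow_Lip _ h h') _.
apply: Rmult_le_compat_l; first exact: Rabs_pos.
have /(pow_deg_le (deg c)) : 0 <= 4 / 3 <= 4 / 3 by lra.
have : 0 <= (4 / 3) ^ deg c by apply: pow_le; lra.
lra.
Qed.

Lemma PSeries_ge0 a z : (forall n, 0 <= a n) -> 0 <= z -> ex_pseries a z -> 0 <= PSeries a z.
Proof.
move=> a0 z0 ea; rewrite -(PSeries_const_0 z); apply: Series_le; last exact/ex_pseries_R.
by move=> n; rewrite Rmult_0_l; split; [lra|apply: Rmult_le_pos => //; exact: pow_le].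
Qed.

Lemma Sn1_gt0 : 1 <= Sn 1.
Proof.
rewrite -[1]/(INR 1); apply/le_INR/leP.
have : Expand Vtx 0 \in blocks 1 by rewrite mem_filter mem_codes.
by case: (blocks 1).
Qed.

Section Kernel.
Variable z : R.
Hypothesis zd : 0 < z < / 64.
Let W u := PSeries (Wn u) z.
Let M := PSeries Mn z.
Let s := PSeries Sn z.

Let exW u : 0 <= u <= 2 -> ex_pseries (Wn u) z.
Proof. by move=> h; apply: CV_radius_inside; apply: (disk_bounded (K := 2)) => //; exact: Wn_bnd. Qed.

Lemma W_Lip u u' : 0 <= u <= 4 / 3 -> 0 <= u' <= 4 / 3 ->
  Rabs (W u - W u') <= Rabs (u - u') * (2 * W 2).
Proof.
move=> h h'; have e1 := exW (u := u) ltac:(lra); have e2 := exW (u := u') ltac:(lra).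
have e3 := exW (u := 2) ltac:(lra).
rewrite /W -PSeries_minus // -PSeries_scal -PSeries_scal.
have le n : 0 <= Rabs (PS_minus (Wn u) (Wn u') n * z ^ n) <=
    PS_scal (Rabs (u - u')) (PS_scal 2 (Wn 2)) n * z ^ n.
  split; first exact: Rabs_pos.
  rewrite Rabs_mult [Rabs (z ^ n)]Rabs_pos_eq; last by apply: pow_le; lra.
  by apply: Rmult_le_compat_r; [apply: pow_le; lra|exact: Wn_Lip].
have ex : ex_series (fun n => PS_scal (Rabs (u - u')) (PS_scal 2 (Wn 2)) n * z ^ n).
  apply/ex_pseries_R; apply: ex_pseries_scal; first exact: Rmult_comm.
  by apply: ex_pseries_scal => //; exact: Rmult_comm.
apply: Rle_trans (Series_Rabs _ _) (Series_le _ _ le ex).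
apply: (ex_series_le (V := R_CompleteNormedModule) _ _ _ ex) => n.
by rewrite /norm /= /abs /= Rabs_Rabsolu; have [] := le n.
Qed.

Let W2_2 : W 2 <= 4.
Proof.
have e3 := exW (u := 2) ltac:(lra).
have -> : 4 = Series (fun n => 2 * (/ 2) ^ n).
  by rewrite Series_scal_l Series_geom ?Rabs_pos_eq; lra.
apply: Series_le; last first.
  apply: (ex_series_scal (V := R_NormedModule)); apply: ex_series_geom; rewrite Rabs_pos_eq; lra.
move=> n; have p : 0 <= z ^ n by apply: pow_le; lra.
split; first by apply: Rmult_le_pos => //; apply: Wn_ge0; lra.
have -> : 2 * (/ 2) ^ n = (2 * 32 ^ n) * (/ 64) ^ n.
  by rewrite Rmult_assoc -Rpow_mult_distr; congr (_ * _ ^ _); lra.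
apply: Rmult_le_compat => //; [by apply: Wn_ge0; lra|exact: W2_le|apply: pow_incr; lra].
Qed.

Let W_le u : 0 <= u <= 4 / 3 -> W u <= 4.
Proof.
move=> h; apply: Rle_trans W2_2; apply: Series_le; last by apply/ex_pseries_R/exW; lra.
move=> n; have p : 0 <= z ^ n by apply: pow_le; lra.
split; first by apply: Rmult_le_pos => //; apply: Wn_ge0; lra.
by apply: Rmult_le_compat_r => //; apply: Wn_le; lra.
Qed.

(** The equation for [W] is quadratic in [W]. [kern] is minus its derivative with respect to [W],
    and also the factor of [P] in the linear equation for [P]; [disc] is the discriminant. *)
Let kern u := (1 - u) * (1 - 2 * z * u ^ 2 * W u) + z * u ^ 2.
Let disc u := (1 - u + z * u ^ 2) ^ 2 - 4 * z * u ^ 2 * (1 - u) * ((1 - u) + z * u * M).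

Let kern_sq u : 0 <= u <= 4 / 3 -> kern u ^ 2 = disc u.
Proof.
move=> h; case: (Req_dec u 1) => [->|u1]; first by rewrite /kern /disc; ring.
have E := gf_W zd h u1; rewrite -/(W u) -/M in E.
have E0 : z * u ^ 2 * (1 - u) * W u ^ 2 - (1 - u + z * u ^ 2) * W u + ((1 - u) + z * u * M) = 0 by lra.
rewrite /kern /disc.
have -> : ((1 - u) * (1 - 2 * z * u ^ 2 * W u) + z * u ^ 2) ^ 2 =
  (1 - u + z * u ^ 2) ^ 2 - 4 * z * u ^ 2 * (1 - u) * ((1 - u) + z * u * M) +
  4 * z * u ^ 2 * (1 - u) * (z * u ^ 2 * (1 - u) * W u ^ 2 - (1 - u + z * u ^ 2) * W u + ((1 - u) + z * u * M)).
  by ring.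
by rewrite E0; ring.
Qed.

Let W_cont u : 1 <= u <= 11 / 10 -> continuity_pt W u.
Proof.
move=> hu eps eps0; have L0 : 0 < 8 by lra.
exists (Rmin (/ 10) (eps / 16)); split; first by apply: Rmin_pos; lra.
move=> u' [_]; rewrite /= /R_dist => d.
have d1 := Rlt_le_trans _ _ _ d (Rmin_l _ _); have d2 := Rlt_le_trans _ _ _ d (Rmin_r _ _).
have [h1 h2] := Rabs_def2 _ _ d1.
apply: Rle_lt_trans (@W_Lip u' u _ _) _; try lra.
have : Rabs (u' - u) * (2 * W 2) <= Rabs (u' - u) * 8.
  by apply: Rmult_le_compat_l; [exact: Rabs_pos|lra].
lra.
Qed.

(** [kern] equals z > 0 at u = 1, while at 11/10 the bound W <= 4 makes it negative. *)
Lemma kernel_root : exists U, 1 < U < 11 / 10 /\ kern U = 0.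
Proof.
have cont u : 1 <= u <= 11 / 10 -> continuity_pt (fun u => - kern u) u.
  move=> hu; apply: continuity_pt_opp; apply: continuity_pt_plus; last by reg.
  apply: continuity_pt_mult; first by reg.
  apply: continuity_pt_minus; first by reg.
  by apply: continuity_pt_mult; [reg|exact: W_cont].
have k1 : - kern 1 < 0 by rewrite /kern; lra.
have k2 : 0 < - kern (11 / 10).
  have w := @W_le (11 / 10) ltac:(lra).
  have : z * W (11 / 10) <= z * 4 by apply: Rmult_le_compat_l; lra.
  by rewrite /kern; lra.
have [U [hU kU]] := IVT_interv (fun u => - kern u) 1 (11 / 10) cont ltac:(lra) k1 k2.
exists U; split; last by lra.
by split; case: hU => h1 h2; [case: h1 => // E; rewrite -E in kU; lra|case: h2 => // E; rewrite E in kU; lra].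
Qed.

(** The quadratic method: [disc] is a square near [U] and vanishes there, so [U] is an interior
    minimum and [disc] and its derivative both vanish. These two equations express z and M through v
    = U - 1. *)
Lemma kernel_param : exists v, [/\ 0 < v < / 10, z * (1 + v) ^ 2 = v - 2 * v ^ 2,
  (1 - 2 * v) * W (1 + v) = 1, M * (1 - 2 * v) ^ 2 = (1 + v) * (1 - 3 * v) & kern (1 + v) = 0].
Proof.
have [U [hU kU]] := kernel_root.
have dU : disc U = 0 by rewrite -kern_sq ?kU; [ring|lra].
pose d' := 2 * (1 - U + z * U ^ 2) * (- 1 + 2 * z * U)
   - 4 * z * (2 * U * (1 - U) - U ^ 2) * ((1 - U) + z * U * M) - 4 * z * U ^ 2 * (1 - U) * (- 1 + z * M).
have der : derivable_pt_lim disc U d'.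
  apply/is_derive_Reals; rewrite /disc; auto_derive => //; rewrite /d'; ring.
have dU' : d' = 0.
  pose pr : derivable_pt disc U := exist _ d' der.
  rewrite -(deriv_minimum disc 1 (11 / 10) U pr) //; try lra.
  move=> x x1 x2; rewrite dU -kern_sq; [nra|lra].
exists (U - 1); pose v := U - 1; have UE : U = 1 + v by rewrite /v; ring.
rewrite -/v -UE; pose Z := z * U ^ 2; pose Q := z * U * M - v.
have Z0 : 0 < Z by apply: Rmult_lt_0_compat; [lra|apply: pow_lt; lra].
have v0 : 0 < v < / 10 by rewrite /v; lra.
have e1 : (Z - v) ^ 2 + 4 * Z * v * Q = 0 by rewrite -dU /disc /Z /Q UE; ring.
have e2 : U * d' = 2 * (Z - v) * (2 * Z - U) + 4 * Z * (2 * v + U) * Q + 4 * Z * v * (Q - 1).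
  by rewrite /d' /Z /Q UE; ring.
(* Eliminating [Q] from [e1] and [e2] leaves this product, whose first factor is positive. *)
have e3 : (Z + v) * (Z - v + 2 * v ^ 2) = 0.
  have -> : (Z + v) * (Z - v + 2 * v ^ 2) = - (v * (2 * (Z - v) * (2 * Z - U) + 4 * Z * (2 * v + U) * Q +
      4 * Z * v * (Q - 1)) - (3 * v + U) * ((Z - v) ^ 2 + 4 * Z * v * Q)) by rewrite UE; ring.
  by rewrite -e2 e1 dU'; ring.
have ZE : Z = v - 2 * v ^ 2 by case: (Rmult_integral _ _ e3); lra.
have v2 : 1 - 2 * v <> 0 by lra.
have QE : (1 - 2 * v) * Q = - v ^ 2.
  apply: (Rmult_eq_reg_l (4 * v ^ 2)); last by nra.
  rewrite ZE in e1; have -> : 4 * v ^ 2 * ((1 - 2 * v) * Q) = 4 * (v - 2 * v ^ 2) * v * Q by ring.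
  have E4 : 4 * (v - 2 * v ^ 2) * v * Q = - (v - 2 * v ^ 2 - v) ^ 2 by lra.
  rewrite E4; ring.
split=> //.
  have k0 : - v * (1 - 2 * Z * W U) + Z = 0 by rewrite -kU /kern /Z UE; ring.
  apply: (Rmult_eq_reg_l (2 * v ^ 2)); last by nra.
  rewrite ZE in k0; have -> : 2 * v ^ 2 * ((1 - 2 * v) * W U) = 2 * v * (v - 2 * v ^ 2) * W U by ring.
  lra.
apply: (Rmult_eq_reg_l (z * U)); last by nra.
have -> : z * U * (M * (1 - 2 * v) ^ 2) = (1 - 2 * v) * ((1 - 2 * v) * Q) + v * (1 - 2 * v) ^ 2 by rewrite /Q; ring.
rewrite QE; apply: (Rmult_eq_reg_l U); last by lra.
have -> : U * (z * U * (U * (1 - 3 * v))) = Z * (U * (1 - 3 * v)) by rewrite /Z; ring.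
rewrite ZE UE; ring.
Qed.

Let s_gt0 : 0 < s.
Proof.
have ds : Rbar_lt (Rabs z) (CV_radius Sn) by apply: (disk_bounded (K := 2)) => //; exact: Sn_bnd.
have ds1 : Rbar_lt (Rabs z) (CV_radius (PS_decr_1 Sn)) by rewrite CV_radius_decr_1.
have ds2 : Rbar_lt (Rabs z) (CV_radius (PS_decr_1 (PS_decr_1 Sn))) by rewrite !CV_radius_decr_1.
rewrite /s PSeries_decr_1; last exact: CV_radius_inside.
rewrite PSeries_decr_1; last exact: CV_radius_inside.
have p : 0 <= PSeries (PS_decr_1 (PS_decr_1 Sn)) z.
  by apply: PSeries_ge0; [move=> n; exact: Sn_ge0|lra|exact: CV_radius_inside].
have := Sn_ge0 0; have := Sn1_gt0; rewrite /PS_decr_1 in p *.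
have : 0 <= z * PSeries (fun n => Sn n.+2) z by apply: Rmult_le_pos => //; lra.
move=> h1 h2 h3; have : 0 < z * (Sn 1 + z * PSeries (fun n => Sn n.+2) z) by apply: Rmult_lt_0_compat; lra.
lra.
Qed.

(** A second kernel: at u = 1 / (1 + s) the factor of [H] in its equation vanishes, so u W(u) = 1,
    and the equation for [W] becomes one for [s]. *)
Let s_eq : s ^ 2 = z * (s - 1 + M).
Proof.
pose u := / (1 + s); have us : u * (1 + s) = 1 by rewrite /u; field; lra.
have u0 : 0 < u by apply: Rinv_0_lt_compat; lra.
have ud : 0 <= u <= 4 / 3 by nra.
have u1 : u <> 1 by move=> E; rewrite E in us; lra.
have EH := gf_H zd ud; have EW := gf_W zd ud u1; rewrite -/(W u) -/M -/s in EH EW.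
have uW : u * W u = 1.
  have : PSeries (Hn u) z * (u * (1 + s) - 1) = u * W u - 1 by lra.
  by rewrite us; lra.
have WE : W u = 1 + s by apply: (Rmult_eq_reg_l u); lra.
rewrite WE in EW; have uE : 1 - u = u * s by lra.
rewrite uE us in EW.
have E2 : u * (s * (1 + s)) = u * (s + z * s + z * (M - 1)).
  rewrite (_ : u * (s * (1 + s)) = u * s * (1 + s)); last by ring.
  rewrite EW (_ : z * u ^ 2 * (u * s) * (1 + s) ^ 2 = z * u * s * (u * (1 + s)) ^ 2); last by ring.
  rewrite us; ring.
have := Rmult_eq_reg_l _ _ _ E2 (Rgt_not_eq _ _ u0); lra.
Qed.

(** At u = U the unknown [P] drops out of its equation, leaving the total as U W(U) - M - T with T =
    v H(U). The value of H comes from its own equation, and eliminating [s] gives the quadratic for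
    T. *)
Lemma gf_solution : exists x T, [/\ 0 < x < / 3, z = x * (1 - x) / 3,
  M = (3 - 4 * x) / (3 * (1 - x) ^ 2), PSeries (Pn 1) z = / (1 - x) - M - T &
  0 < T <= x / (1 - x) /\ x * (1 - x) * T ^ 2 - (1 - x) * (3 - x) * T + x = 0].
Proof.
have [v [v0 zE WE ME kE]] := kernel_param.
pose U := 1 + v; have Ud : 0 <= U <= 4 / 3 by rewrite /U; lra.
have U1 : U <> 1 by rewrite /U; lra.
have EP := gf_P zd Ud U1; have EH := gf_H zd Ud; rewrite -/U in zE WE kE ME.
rewrite -/(W U) -/M -/s in EP EH.
set P := PSeries (Pn U) z in EP; set H := PSeries (Hn U) z in EP EH; set P1 := PSeries (Pn 1) z in EP *.
(* This choice turns the relation between z and v into z = x (1 - x) / 3, which is easy to invert as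
   a power series. *)
pose x := 3 * v / (1 + v); have vx : v = x / (3 - x) by rewrite /x; field; lra.
have x0 : 0 < x < / 3.
  split; first by apply: Rmult_lt_0_compat; [lra|apply: Rinv_0_lt_compat; lra].
  by apply: (Rmult_lt_reg_r (1 + v)); [lra|rewrite /x /Rdiv Rmult_assoc Rinv_l; lra].
have zx : z = x * (1 - x) / 3.
  apply: (Rmult_eq_reg_r (U ^ 2)); last by apply: pow_nonzero; rewrite /U; lra.
  by rewrite zE /x /U; field; lra.
have Mx : M = (3 - 4 * x) / (3 * (1 - x) ^ 2).
  apply: (Rmult_eq_reg_r ((1 - 2 * v) ^ 2)); last by apply: pow_nonzero; lra.
  by rewrite ME /U vx; field; lra.
have WU : W U = / (1 - 2 * v) by apply: (Rmult_eq_reg_l (1 - 2 * v)); [rewrite WE Rinv_r; lra|lra].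
have UW : U * W U = / (1 - x) by rewrite WU /U vx; field; lra.
have P1E : P1 = U * W U - M - v * H.
  have : z * U * (P1 + M - U * W U - (1 - U) * H) = 0.
    have -> : 0 = kern U * P by rewrite kE; ring.
    by rewrite /kern; lra.
  have zU : z * U <> 0 by rewrite /U; nra.
  case/Rmult_integral => // E; have -> : v = U - 1 by rewrite /U; ring.
  lra.
have R0 : 0 < / (1 - x) - 1.
  have -> : / (1 - x) - 1 = x / (1 - x) by field; lra.
  by apply: Rmult_lt_0_compat; [lra|apply: Rinv_0_lt_compat; lra].
have HE : H * (v + s + v * s) = / (1 - x) - 1 by rewrite -UW /U; rewrite /U in EH; lra.
have vs : 0 < v * s by apply: Rmult_lt_0_compat; lra.
have H0 : 0 < H.
  apply: (Rmult_lt_reg_r (v + s + v * s)); first by lra.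
  by rewrite HE Rmult_0_l.
exists x, (v * H); split=> //; first by rewrite P1E UW; ring.
have T0 : 0 < v * H by apply: Rmult_lt_0_compat; lra.
have xR : / (1 - x) - 1 = x / (1 - x) by field; lra.
split.
  split=> //; rewrite -xR -HE; have := Rmult_lt_0_compat _ _ H0 s_gt0; have := Rmult_lt_0_compat _ _ H0 vs; lra.
set T := v * H in T0 *.
(* Linear in [s]; multiplied by suitable powers of T, the quadratic equation [E2] of [s] then
   becomes an equation in x and T only. *)
have E1 : 3 * s * (1 - x) * T = x * (x - (1 - x) * T).
  have HE2 : T * (1 - x) * (v + s + v * s) = v * x.
    have -> : T * (1 - x) * (v + s + v * s) = v * (1 - x) * (H * (v + s + v * s)) by rewrite /T; ring.
    by rewrite HE; field; lra.
  have HE3 : (3 - x) * (T * (1 - x) * (v + s + v * s)) = T * (1 - x) * (x + 3 * s) by rewrite vx; field; lra.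
  have HE4 : (3 - x) * (v * x) = x ^ 2 by rewrite vx; field; lra.
  rewrite HE2 HE4 in HE3; lra.
have E2 : 9 * (1 - x) * s ^ 2 = 3 * x * (1 - x) ^ 2 * s + x ^ 2 * (2 - 3 * x).
  by rewrite s_eq zx Mx; field; lra.
have E3 : (3 * s * (1 - x) * T) ^ 2 = x * (1 - x) ^ 2 * T * (3 * s * (1 - x) * T) + x ^ 2 * (2 - 3 * x) * (1 - x) * T ^ 2.
  have -> : (3 * s * (1 - x) * T) ^ 2 = 9 * (1 - x) * s ^ 2 * ((1 - x) * T ^ 2) by ring.
  by rewrite E2; ring.
rewrite E1 in E3; apply: (Rmult_eq_reg_l (x ^ 3)); last by apply: pow_nonzero; lra.
have -> : x ^ 3 * (x * (1 - x) * T ^ 2 - (1 - x) * (3 - x) * T + x) = (x * (x - (1 - x) * T)) ^ 2 -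
  (x * (1 - x) ^ 2 * T * (x * (x - (1 - x) * T)) + x ^ 2 * (2 - 3 * x) * (1 - x) * T ^ 2) by ring.
by rewrite E3; ring.
Qed.
End Kernel.

(** * Coefficient extraction *)

(** A growth condition that holds for all series at hand, survives linear combinations and the
    removal of the first coefficient, and ensures convergence below 1/64. *)
Definition sum_bounded (a : nat -> R) := forall z, 0 < z < / 64 -> exists K, forall n, Rabs (a n) * z ^ n <= K.

Lemma sum_bounded_disk a z : sum_bounded a -> 0 < z < / 64 -> Rbar_lt (Rabs z) (CV_radius a).
Proof.
move=> ba zd; pose y := (z + / 64) / 2; have yd : 0 < y < / 64 by rewrite /y; lra.
have [K Kn] := ba y yd; rewrite Rabs_pos_eq; last by lra.
apply: (@Rbar_lt_le_trans _ y); first by rewrite /= /y; lra.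
have [ub _] := CV_radius_bounded a; apply: ub; exists K => n.
by rewrite Rabs_mult [Rabs (y ^ n)]Rabs_pos_eq //; apply: pow_le; lra.
Qed.

Lemma bounded_64 a K : (forall n, Rabs (a n) <= K * 64 ^ n) -> sum_bounded a.
Proof.
move=> aK z zd; exists K => n; have p : 0 <= z ^ n by apply: pow_le; lra.
have K0 : 0 <= K by have := aK 0%nat; rewrite /= Rmult_1_r; have := Rabs_pos (a 0%nat); lra.
have : Rabs (a n) * z ^ n <= K * 64 ^ n * z ^ n by apply: Rmult_le_compat_r.
rewrite Rmult_assoc -Rpow_mult_distr; have : (64 * z) ^ n <= 1 ^ n by apply: pow_incr; lra.
rewrite pow1 => h; have := Rmult_le_compat_l K _ _ K0 h; lra.
Qed.

(** The constant term vanishes by continuity at 0; then z is divided out and the argument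
    repeated. *)
Lemma gf_zero d : sum_bounded d -> (forall z, 0 < z < / 64 -> PSeries d z = 0) -> forall n, d n = 0.
Proof.
have d0 e : sum_bounded e -> (forall z, 0 < z < / 64 -> PSeries e z = 0) -> e 0%nat = 0.
  move=> be ez; apply: cond_eq => eps eps0; rewrite Rminus_0_r.
  have r0 : Rbar_lt (Rabs 0) (CV_radius e).
    have h : 0 < / 128 < / 64 by lra.
    have := sum_bounded_disk be h; rewrite Rabs_R0; apply: Rbar_le_lt_trans; rewrite /=; exact: Rabs_pos.
  have [a [a0 ha]] := PSeries_continuity e 0 r0 _ eps0.
  pose z := Rmin (a / 2) (/ 128); have z0 : 0 < z by apply: Rmin_pos; lra.
  have za : z <= a / 2 by exact: Rmin_l.
  have zb : z <= / 128 by exact: Rmin_r.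
  have := ha z; rewrite /= /R_dist ez; last by lra.
  rewrite PSeries_0 Rminus_0_l Rabs_Ropp => H; apply: H; split.
    by split => //; lra.
  by rewrite Rminus_0_r Rabs_pos_eq; lra.
move=> bd dz n; elim: n d bd dz => [|n IH] d bd dz; first exact: d0.
apply: (IH (PS_decr_1 d)).
  move=> z zd; have [K Kn] := bd z zd; exists (K / z) => m; rewrite /PS_decr_1.
  apply: (Rmult_le_reg_r z); first by lra.
  have := Kn m.+1; rewrite -[z ^ m.+1]/(z * z ^ m); rewrite /Rdiv (Rmult_assoc K) Rinv_l; lra.
move=> z zd; have := dz z zd; rewrite PSeries_decr_1; last by apply/CV_radius_inside/sum_bounded_disk.
rewrite d0 // Rplus_0_l => /Rmult_integral[]; lra.
Qed.

(* The coefficients of the powers of the small root x of z = x (1 - x) / 3. *)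
Definition tri n j : R := if (j <= n)%nat then
   (if n is n'.+1 then 3 ^ n * (INR 'C(2 * n - j.+1, n') - INR 'C(2 * n - j.+1, n)) else 1) else 0.

Lemma tri0 n : tri n 0 = INR (n == 0%nat).
Proof.
case: n => [|n] //; rewrite /tri /=.
have -> : (2 * n.+1 - 1 = n.*2.+1)%nat by rewrite mul2n doubleS subn1.
suff -> : 'C(n.*2.+1, n) = 'C(n.*2.+1, n.+1) by ring.
have nn : (n <= n.*2.+1)%nat by apply: leqW; rewrite -addnn leq_addr.
by rewrite -(bin_sub nn) -addnn -addnS addKn.
Qed.

Lemma tri_gt n j : (n < j)%nat -> tri n j = 0.
Proof. by rewrite /tri ltnNge => /negbTE ->. Qed.

Lemma tri_diag n : tri n n = 3 ^ n.
Proof.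
case: n => [|n]; rewrite /tri // leqnn mul2n -addnn subnS addnK /= binn bin_small //=; ring.
Qed.

(** Pascal's rule, matching x ^ (j + 2) = x ^ (j + 1) - 3 z x ^ j. *)
Lemma tri_rec n j : tri n.+1 j.+1 = tri n.+1 j.+2 + 3 * tri n j.
Proof.
case: (ltngtP n j) => nj; first by rewrite !tri_gt ?ltnS //; [ring|exact: ltnW].
  case: n nj => [|n] // nj; rewrite /tri !ltnS ?nj ?(ltnW nj).
  have E : (2 * n.+2 - j.+2 = (2 * n.+1 - j.+1).+1)%nat.
    rewrite -subSn; last by rewrite mul2n -addnn addSn ltnS (leq_trans (_ : j <= n)%nat) // leq_addr.
    by rewrite mulnS mul2n !add2n !subSS.
  have jn : (j <= n)%nat by []. 
  rewrite jn (subnS (2 * n.+2) j.+2) E /= !binS !plus_INR; ring.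
by rewrite nj !tri_diag tri_gt //=; ring.
Qed.

Lemma bin_le_exp n k : ('C(n, k) <= expn 2 n)%nat.
Proof.
elim: n k => [|n IH] [|k] //; first by rewrite bin0 expn_gt0.
by rewrite binS expnS mul2n -addnn leq_add.
Qed.

Lemma tri_bounded n j : Rabs (tri n j) <= 12 ^ n.
Proof.
have p0 : 0 < 3 ^ n by apply: pow_lt; lra.
have p12 : 0 <= 12 ^ n by apply: pow_le; lra.
rewrite /tri; case: ifP => _; last by rewrite Rabs_R0.
case: n p0 p12 => [|n] p0 p12; first by rewrite Rabs_R1 /=; lra.
rewrite Rabs_mult [Rabs (3 ^ _)]Rabs_pos_eq; last by lra.
have -> : 12 ^ n.+1 = 3 ^ n.+1 * 4 ^ n.+1 by rewrite -Rpow_mult_distr; congr (_ ^ _); lra.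
apply: Rmult_le_compat_l; first by lra.
have le k : INR 'C(2 * n.+1 - j.+1, k) <= 4 ^ n.+1.
  have -> : 4 ^ n.+1 = INR (expn 2 (2 * n.+1)).
    rewrite expnM; elim: n.+1 => [|m IH] //; rewrite expnS mult_INR -IH /=; ring.
  apply/le_INR/leP; apply: leq_trans (bin_le_exp _ _) _.
  by rewrite leq_pexp2l // leq_subr.
have := le n; have := le n.+1; have := pos_INR 'C(2 * n.+1 - j.+1, n); have := pos_INR 'C(2 * n.+1 - j.+1, n.+1).
by move=> *; apply: Rabs_le; lra.
Qed.

Section Tri.
Variables (z x : R).
Hypothesis zd : 0 < z < / 64.
Hypothesis xd : 0 < x < / 3.
Hypothesis zx : z = x * (1 - x) / 3.
Let B j := PSeries (fun n => tri n j) z.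

Let disk j : Rbar_lt (Rabs z) (CV_radius (fun n => tri n j)).
Proof.
apply: (disk_bounded (K := 1)) => // n; rewrite Rmult_1_l; apply: Rle_trans (tri_bounded _ _) _.
by apply: pow_incr; lra.
Qed.

Let B0 : B 0 = 1.
Proof.
rewrite /B (gf_rec (disk 0) (b := fun=> 0)); last by move=> n; rewrite tri0.
by rewrite PSeries_const_0 tri0 /=; ring.
Qed.

Let B_rec j : B j.+1 = B j.+2 + 3 * z * B j.
Proof.
have [e E] := gf_lin 3 (CV_radius_inside _ _ (disk j)) (CV_radius_inside _ _ (disk j.+2)).
have tri01 k : tri 0 k.+1 = 0 by rewrite tri_gt.
rewrite {1}/B PSeries_decr_1; last exact: CV_radius_inside.
rewrite [B j.+2]/B [in RHS]PSeries_decr_1; last exact: CV_radius_inside.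
rewrite !tri01 !Rplus_0_l -/(B _).
have d2 : Rbar_lt (Rabs z) (CV_radius (PS_decr_1 (fun n => tri n j.+2))) by rewrite CV_radius_decr_1.
have [e2 E2] := gf_lin 3 (CV_radius_inside _ _ (disk j)) (CV_radius_inside _ _ d2).
rewrite (PSeries_ext (PS_decr_1 (fun n => tri n j.+1)) (fun n => 3 * tri n j + PS_decr_1 (fun n => tri n j.+2) n)); last first.
  by move=> n; rewrite /PS_decr_1 tri_rec; ring.
rewrite E2 -/(B j); ring.
Qed.

Let B_small j : Rabs (B j) <= 2 * (24 * z) ^ j.
Proof.
have z0 : 0 <= (24 * z) ^ j by apply: pow_le; lra.
have le n : 0 <= Rabs (tri n j * z ^ n) <= (24 * z) ^ j * (/ 2) ^ n.
  have p0 : 0 <= z ^ n by apply: pow_le; lra.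
  have h0 : 0 <= (/ 2) ^ n by apply: pow_le; lra.
  split; first exact: Rabs_pos.
  case: (ltnP n j) => nj; first by rewrite tri_gt // Rmult_0_l Rabs_R0; exact: Rmult_le_pos.
  rewrite Rabs_mult [Rabs (z ^ n)]Rabs_pos_eq //.
  apply: (@Rle_trans _ (12 ^ n * z ^ n)); first by apply: Rmult_le_compat_r => //; exact: tri_bounded.
  have -> : 12 ^ n * z ^ n = (24 * z) ^ n * (/ 2) ^ n by rewrite -!Rpow_mult_distr; congr (_ ^ _); lra.
  apply: Rmult_le_compat_r => //.
  have -> : (24 * z) ^ n = (24 * z) ^ j * (24 * z) ^ (n - j) by rewrite -pow_add -[Nat.add _ _]/(j + (n - j))%nat subnKC.
  rewrite -[X in _ <= X]Rmult_1_r; apply: Rmult_le_compat_l => //.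
  by rewrite -(pow1 (n - j)); apply: pow_incr; lra.
have ex : ex_series (fun n => (24 * z) ^ j * (/ 2) ^ n).
  apply: (ex_series_scal (V := R_NormedModule)); apply: ex_series_geom; rewrite Rabs_pos_eq; lra.
have exa : ex_series (fun n => Rabs (tri n j * z ^ n)).
  apply: (ex_series_le (V := R_CompleteNormedModule) _ _ _ ex) => n.
  by rewrite /norm /= /abs /= Rabs_Rabsolu; have [] := le n.
apply: Rle_trans (Series_Rabs _ exa) _; apply: Rle_trans (Series_le _ _ le ex) _.
by rewrite Series_scal_l Series_geom ?Rabs_pos_eq; lra.
Qed.

Lemma geom_squeeze a K : (forall j, Rabs a <= K * (/ 2) ^ j) -> a = 0.
Proof.
move=> h; have lim : is_lim_seq (fun j => K * (/ 2) ^ j) 0.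
  rewrite (_ : Finite 0 = Rbar_mult K 0); last by rewrite /= Rmult_0_r.
  by apply: is_lim_seq_scal_l; apply: is_lim_seq_geom; rewrite Rabs_pos_eq; lra.
have := is_lim_seq_le _ _ _ _ h (is_lim_seq_const (Rabs a)) lim => /= a0.
by apply: Rabs_eq_0; apply: Rle_antisym => //; exact: Rabs_pos.
Qed.

(** The recursion in j has the characteristic roots x and 1 - x. The component along 1 - x is zero,
    because [B j] is at most 2 (24 z)^j and 24 z <= (1 - x) / 2 for x < 1/16. *)
Lemma gf_tri j : B j = x ^ j.
Proof.
have x16 : x < / 16 by nra.
pose F j := B j.+1 - x * B j.
have Frec k : F k = (1 - x) ^ k * F 0%nat.
  elim: k => [|k IH]; first by rewrite /=; ring.
  have -> : F k.+1 = (1 - x) * F k by have r := B_rec k; rewrite zx in r; rewrite /F; lra.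
  by rewrite IH /=; ring.
have F0 : F 0%nat = 0.
  apply: (@geom_squeeze _ 4) => k; have p : 0 < (1 - x) ^ k by apply: pow_lt; lra.
  apply: (Rmult_le_reg_l ((1 - x) ^ k)) => //.
  have -> : (1 - x) ^ k * Rabs (F 0%nat) = Rabs (F k) by rewrite (Frec k) Rabs_mult [Rabs ((1 - x) ^ k)]Rabs_pos_eq //; lra.
  have q : (24 * z) ^ k <= ((1 - x) * / 2) ^ k by apply: pow_incr; split; [lra|rewrite zx; nra].
  have -> : (1 - x) ^ k * (4 * (/ 2) ^ k) = 4 * ((1 - x) * / 2) ^ k by rewrite Rpow_mult_distr; ring.
  have b1 := B_small k; have b2 := B_small k.+1; rewrite -[_ ^ k.+1]/((24 * z) * (24 * z) ^ k) in b2.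
  have q0 : 0 <= (24 * z) ^ k by apply: pow_le; lra.
  have h : Rabs (F k) <= Rabs (B k.+1) + x * Rabs (B k).
    apply: Rle_trans (Rabs_triang _ _) _; rewrite Rabs_Ropp Rabs_mult [Rabs x]Rabs_pos_eq; lra.
  have h2 : x * Rabs (B k) <= 1 * (2 * (24 * z) ^ k) by apply: Rmult_le_compat => //; try lra; exact: Rabs_pos.
  have h3 : 2 * (24 * z * (24 * z) ^ k) <= 2 * (1 * (24 * z) ^ k).
    by apply: Rmult_le_compat_l; [lra|apply: Rmult_le_compat_r; lra].
  lra.
elim: j => [|j IH]; first by rewrite B0.
by have := Frec j; rewrite F0 Rmult_0_r /F IH /=; lra.
Qed.
End Tri.

Lemma sum_le_PSeries a x N : (forall n, 0 <= a n) -> 0 <= x -> ex_pseries a x ->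
  sum_f_R0 (fun n => a n * x ^ n) N <= PSeries a x.
Proof.
move=> a0 x0 /ex_pseries_R/Series_correct/is_series_Reals h.
apply: sum_incr => [|n]; first exact: h.
by apply: Rmult_le_pos => //; exact: pow_le.
Qed.

Lemma is_series_lim a l : is_series a l <-> is_lim_seq (sum_f_R0 a) l.
Proof.
split=> h; last by have : is_lim_seq (sum_n a) l by apply: is_lim_seq_ext h => n; rewrite sum_n_Reals.
have h' : is_lim_seq (sum_n a) l := h.
by apply: is_lim_seq_ext h' => n; rewrite sum_n_Reals.
Qed.

(** By triangularity, the partial sums in both orders coincide. They are bounded by the sum of [r],
    and in the limit they dominate any finite number of columns. *)
Lemma tonelli (a : nat -> nat -> R) r : (forall n j, 0 <= a n j) ->
  (forall n j, (n < j)%nat -> a n j = 0) -> (forall j, is_series (fun n => a n j) (r j)) -> ex_series r ->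
  is_series (fun n => sum_f_R0 (a n) n) (Series r).
Proof.
move=> a0 az ar er.
have r0 j : 0 <= r j.
  rewrite -(is_series_unique _ _ (ar j)) -[0](Rmult_0_l (Series (fun n => a n j))) -Series_scal_l.
  apply: Series_le; last by exists (r j); exact: ar.
  by move=> n; rewrite Rmult_0_l; split; [lra|exact: a0].
have row N n : (n <= N)%nat -> sum_f_R0 (a n) n = sum_f_R0 (a n) N.
  elim: N => [|N IH]; first by case: n.
  rewrite leq_eqVlt => /orP[/eqP->//|nN] /=; rewrite -IH // az //; ring.
have SE N : sum_f_R0 (fun n => sum_f_R0 (a n) n) N = sum_f_R0 (fun j => sum_f_R0 (fun n => a n j) N) N.
  rewrite (sum_eq _ (fun n => sum_f_R0 (a n) N)); last by move=> n /leP nN; exact: row.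
  rewrite -!rsum_iota; under eq_bigr do rewrite -rsum_iota.
  by rewrite exchange_big /=; apply: eq_bigr => j _; rewrite rsum_iota.
have col j N : sum_f_R0 (fun n => a n j) N <= r j.
  apply: sum_incr; last by move=> n; exact: a0.
  by apply/is_series_Reals; exact: ar.
have ub N : sum_f_R0 (fun n => sum_f_R0 (a n) n) N <= Series r.
  rewrite SE; apply: (@Rle_trans _ (sum_f_R0 r N)); first by apply: sum_Rle => j _; exact: col.
  apply: sum_incr => //; apply/is_series_Reals; exact: Series_correct.
have incr N : sum_f_R0 (fun n => sum_f_R0 (a n) n) N <= sum_f_R0 (fun n => sum_f_R0 (a n) n) N.+1.
  by rewrite /=; have := cond_pos_sum (a N.+1) N (a0 N.+1); have := a0 N.+1 N.+1; lra.
have [l hl] := ex_finite_lim_seq_incr _ _ incr ub.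
have leS := is_lim_seq_incr_compare _ _ hl incr.
have lE : l = Series r.
  apply: Rle_antisym; first exact: (is_lim_seq_le _ _ _ _ ub hl (is_lim_seq_const _)).
  suff h J : sum_f_R0 r J <= l.
    have lim := proj1 (is_series_lim _ _) (Series_correct _ er).
    exact: (is_lim_seq_le _ _ _ _ h lim (is_lim_seq_const _)).
  have lim : is_lim_seq (fun N => sum_f_R0 (fun j => sum_f_R0 (fun n => a n j) N) J) (sum_f_R0 r J).
    elim: J => [|J IH] /=; first exact/is_series_lim.
    by apply: is_lim_seq_plus' => //; exact/is_series_lim.
  have le N : sum_f_R0 (fun j => sum_f_R0 (fun n => a n j) N) J <= l.
    apply: Rle_trans (leS (N + J)%nat); rewrite SE.
    apply: (@Rle_trans _ (sum_f_R0 (fun j => sum_f_R0 (fun n => a n j) (N + J)) J)).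
      apply: sum_Rle => j _; elim: (J) => [|k IH]; rewrite ?addn0 ?addnS; first lra.
      by apply: Rle_trans IH _; rewrite /=; have := a0 (N + k).+1 j; lra.
    pose b j := sum_f_R0 (fun n => a n j) (N + J).
    have b0 j : 0 <= b j by apply: cond_pos_sum.
    have mb k : sum_f_R0 b J <= sum_f_R0 b (k + J).
      elim: k => [|k IH]; first by rewrite add0n; lra.
      by apply: Rle_trans IH _; rewrite addSn /=; have := b0 (k + J).+1; lra.
    exact: mb.
  exact: (is_lim_seq_le _ _ _ _ le lim (is_lim_seq_const _)).
by rewrite -lE; exact/is_series_lim.
Qed.

(** The form of the ballot numbers without subtraction, from which their sign and their asymptotics
    are read off. *)
Lemma tri_closed n j : (0 < j)%nat -> (j <= n)%nat ->
  (2 * INR n - INR j) * tri n j = 3 ^ n * INR j * INR 'C(2 * n - j, n).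
Proof.
case: n => [|n] j0 jn; first by case: j jn j0.
rewrite /tri jn subnS; set N := (2 * n.+1 - j)%nat.
have N0 : (0 < N)%nat by rewrite subn_gt0 mul2n -addnn (leq_ltn_trans jn) // -addn1 leq_add.
have NE : INR N = 2 * INR n.+1 - INR j.
  have : (N + j = 2 * n.+1)%nat by rewrite subnK // mul2n -addnn (leq_trans jn) // leq_addr.
  by move/(congr1 INR); rewrite plus_INR mult_INR [INR 2]/=; lra.
have h1 : INR N * INR 'C(N.-1, n) = INR n.+1 * INR 'C(N, n.+1).
  by rewrite -!mult_INR; congr INR; exact: mul_bin_diag.
have h2 : INR N * INR 'C(N.-1, n.+1) = (INR N - INR n.+1) * INR 'C(N, n.+1).
  rewrite -minus_INR; last by apply/leP; rewrite /N mul2n -addnn -addnBA // leq_addr.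
  by rewrite -!mult_INR; congr INR; exact: mul_bin_down.
rewrite -NE -Rmult_assoc [INR N * _]Rmult_comm Rmult_assoc Rmult_minus_distr_l h1 h2 NE.
by move: (INR n.+1) (INR j) (INR 'C(_, _)) (3 ^ _) => *; ring.
Qed.

Lemma tri_ge0 n j : 0 <= tri n j.
Proof.
case: (leqP j n) => nj; last by rewrite tri_gt //; lra.
case: (posnP j) => [->|j0]; first by rewrite tri0; exact: pos_INR.
have c := tri_closed j0 nj; have p : 0 <= 3 ^ n by apply: pow_le; lra.
have jn : INR j <= INR n by apply/le_INR/leP.
have j1 : 1 <= INR j by rewrite -[1]/(INR 1); apply/le_INR/leP.
apply: (Rmult_le_reg_l (2 * INR n - INR j)); first by lra.
rewrite Rmult_0_r c; apply: Rmult_le_pos; [apply: Rmult_le_pos => //; lra|exact: pos_INR].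
Qed.

Section Shift.
Variables (z x : R).
Hypothesis zd : 0 < z < / 64.
Hypothesis xd : 0 < x < / 3.
Hypothesis zx : z = x * (1 - x) / 3.

Lemma disk_tri j : Rbar_lt (Rabs z) (CV_radius (fun n => tri n j)).
Proof.
apply: (disk_bounded (K := 1)) => // n; rewrite Rmult_1_l; apply: Rle_trans (tri_bounded _ _) _.
by apply: pow_incr; lra.
Qed.

Lemma gf_tri1 : ex_pseries (fun n => tri n.+1 1) z /\ PSeries (fun n => tri n.+1 1) z = 3 / (1 - x).
Proof.
have d : Rbar_lt (Rabs z) (CV_radius (PS_decr_1 (fun n => tri n 1))) by rewrite CV_radius_decr_1; exact: disk_tri.
split; first exact: CV_radius_inside.
have := gf_tri zd xd zx 1; rewrite PSeries_decr_1; last by apply: CV_radius_inside; exact: disk_tri.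
rewrite tri_gt // Rplus_0_l pow_1 /PS_decr_1 => E; apply: (Rmult_eq_reg_l z); last lra.
by rewrite E {1}zx; field; lra.
Qed.

Lemma gf_tri2 : ex_pseries (fun n => tri n.+2 2) z /\ PSeries (fun n => tri n.+2 2) z = 9 / (1 - x) ^ 2.
Proof.
have d : Rbar_lt (Rabs z) (CV_radius (PS_decr_1 (fun n => tri n 2))) by rewrite CV_radius_decr_1; exact: disk_tri.
have d2 : Rbar_lt (Rabs z) (CV_radius (PS_decr_1 (PS_decr_1 (fun n => tri n 2)))) by rewrite !CV_radius_decr_1; exact: disk_tri.
split; first exact: CV_radius_inside.
have := gf_tri zd xd zx 2; rewrite PSeries_decr_1; last by apply: CV_radius_inside; exact: disk_tri.
rewrite PSeries_decr_1; last exact: CV_radius_inside.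
rewrite {2}/PS_decr_1 !tri_gt // !Rplus_0_l /PS_decr_1 => E; apply: (Rmult_eq_reg_l (z * z)); last nra.
by rewrite Rmult_assoc E {1 2}zx; field; lra.
Qed.
End Shift.

Lemma sum_bounded_lin c a b : sum_bounded a -> sum_bounded b -> sum_bounded (fun n => c * a n + b n).
Proof.
move=> ba bb z zd; have [K hK] := ba z zd; have [L hL] := bb z zd; exists (Rabs c * K + L) => n.
have p : 0 <= z ^ n by apply: pow_le; lra.
apply: (@Rle_trans _ (Rabs c * (Rabs (a n) * z ^ n) + Rabs (b n) * z ^ n)).
  rewrite -Rmult_assoc -Rabs_mult -Rmult_plus_distr_r.
  by apply: Rmult_le_compat_r => //; exact: Rabs_triang.
by apply: Rplus_le_compat => //; apply: Rmult_le_compat_l => //; exact: Rabs_pos.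
Qed.

Lemma sum_bounded_tri k j : sum_bounded (fun n => tri (k + n) j).
Proof.
apply: (@bounded_64 _ (12 ^ k)) => n; apply: Rle_trans (tri_bounded _ _) _.
rewrite -[(k + n)%nat]/(Nat.add k n) pow_add; apply: Rmult_le_compat_l; first by apply: pow_le; lra.
by apply: pow_incr; lra.
Qed.

Lemma sum_bounded_M : sum_bounded Mn.
Proof.
apply: (@bounded_64 _ 2) => n; rewrite -Wn1; apply: Wn_bnd; lra.
Qed.

(** M in powers of 1 / (1 - x); by [gf_tri1] and [gf_tri2] these are series of shifted ballot
    numbers. *)
Lemma Mn_tri n : Mn n = (12 * tri n.+1 1 - tri n.+2 2) / 27.
Proof.
pose f k := - (4 / 9) * tri k.+1 1 + (/ 27 * tri k.+2 2 + Mn k).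
have bf : sum_bounded f.
  apply: sum_bounded_lin; first exact: (sum_bounded_tri 1 1).
  by apply: sum_bounded_lin; [exact: (sum_bounded_tri 2 2)|exact: sum_bounded_M].
have f0 k : f k = 0.
  apply: (gf_zero bf) => z zd; have [x [T [xd zx ME _ _]]] := gf_solution zd.
  have [e1 E1] := gf_tri1 zd xd zx; have [e2 E2] := gf_tri2 zd xd zx.
  have e3 : ex_pseries Mn z by apply: CV_radius_inside; exact: sum_bounded_disk sum_bounded_M zd.
  have [e4 E4] := gf_lin (/ 27) e2 e3; have [e5 E5] := gf_lin (- (4 / 9)) e1 e4.
  by rewrite E5 E4 E1 E2 ME; field; lra.
by have := f0 n; rewrite /f; lra.
Qed.

(* The coefficients of 1 + 2 T, where T is the small root of
   x (1 - x) T ^ 2 - (1 - x) (3 - x) T + x = 0; they are visibly nonnegative. *)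
Definition hstep n (h : nat -> R) := ((if n is 0 then 3 else 4) + PS_mult h h n) / 6.
Fixpoint hs n : seq R := if n is n'.+1 then rcons (hs n') (hstep n' (nth 0 (hs n'))) else [:: 1].
Definition hn n := nth 0 (hs n) n.

Lemma size_hs n : size (hs n) = n.+1.
Proof. by elim: n => //= n IH; rewrite size_rcons IH. Qed.

Lemma nth_hs n k : (k <= n)%nat -> nth 0 (hs n) k = hn k.
Proof.
elim: n => [|n IH]; first by case: k.
by rewrite leq_eqVlt => /orP[/eqP->//|kn]; rewrite /= nth_rcons size_hs kn IH.
Qed.

(** Completing the square in 3 T = x / (1 - x) + x T + x T^2 gives h = 1 + (x / 6) (3 + 4 x / (1 -
    x) + h^2) for h = 1 + 2 T. *)
Lemma hnS n : hn n.+1 = hstep n hn.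
Proof.
rewrite {1}/hn /= nth_rcons size_hs ltnn eqxx; congr ((_ + _) / _).
by apply: sum_eq => k /leP kn; rewrite !nth_hs // minusE leq_subr.
Qed.

Lemma hn_ge0 n : 0 <= hn n.
Proof.
elim/ltn_ind: n => -[|n] IH; first by rewrite /hn /=; lra.
rewrite hnS /hstep; suff : 0 <= PS_mult hn hn n by case: (n) => *; lra.
rewrite /PS_mult -rsum_iota big_seq; apply: rsum_ge0 => k; rewrite mem_iota add0n => kn.
by apply: Rmult_le_pos; apply: IH => //; rewrite ltnS minusE leq_subr.
Qed.

(** At x = 3/5 the explicit terms sum to at most 9, so the next partial sum is at most 1 + 9/10 +
    25/10, below 5. The margin between 3/5 and the critical value 1/2 makes all moments at 1/2
    finite. *)
Lemma sum_hn_le N : sum_f_R0 (fun n => hn n * (3 / 5) ^ n) N <= 5.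
Proof.
set a := fun n => hn n * (3 / 5) ^ n.
have a0 k : 0 <= a k by apply: Rmult_le_pos; [exact: hn_ge0|apply: pow_le; lra].
elim: N => [|N IH]; first by rewrite /= /a /hn /=; lra.
rewrite decomp_sum; last exact/ltP.
have -> : sum_f_R0 (fun i => a i.+1) N =
    / 10 * sum_f_R0 (fun n => (if n is 0 then 3 else 4) * (3 / 5) ^ n) N + / 10 * sum_f_R0 (PS_mult a a) N.
  rewrite !scal_sum -plus_sum; apply: sum_eq => k _.
  by rewrite -PS_mult_pow {1}/a hnS /hstep /=; field.
have p9 : sum_f_R0 (fun n => (if n is 0 then 3 else 4) * (3 / 5) ^ n) N = 9 - 10 * (3 / 5) ^ N.+1.
  by elim: (N) => [|k E] /=; [field|rewrite E /=; field].
have r0 : 0 <= (3 / 5) ^ N.+1 by apply: pow_le; lra.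
have m := @sum_PS_mult_le a a N a0 a0; have S0 := cond_pos_sum a N a0.
have m2 : sum_f_R0 a N * sum_f_R0 a N <= 5 * 5 by apply: Rmult_le_compat.
by rewrite p9 {1}/a /hn /=; rewrite /= in r0; lra.
Qed.

Lemma hn_le n : hn n * (3 / 5) ^ n <= 5.
Proof.
have a0 k : 0 <= hn k * (3 / 5) ^ k by apply: Rmult_le_pos; [exact: hn_ge0|apply: pow_le; lra].
exact: Rle_trans (sum_term_le n a0) (sum_hn_le n).
Qed.

Lemma disk_hn x : 0 <= x < 3 / 5 -> Rbar_lt (Rabs x) (CV_radius hn).
Proof.
move=> xd; apply: (@Rbar_lt_le_trans _ (3 / 5)); first by rewrite /= Rabs_pos_eq; lra.
have [ub _] := CV_radius_bounded hn; apply: ub; exists 5 => n.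
rewrite Rabs_pos_eq; first exact: hn_le.
by apply: Rmult_le_pos; [exact: hn_ge0|apply: pow_le; lra].
Qed.

Definition tau n := (hn n - INR (n == 0%nat)) / 2.

Lemma tau0 : tau 0 = 0. Proof. by rewrite /tau /hn /=; field. Qed.

Lemma tau_ge0 n : 0 <= tau n.
Proof.
case: n => [|n]; first by rewrite tau0; lra.
by rewrite /tau /=; have := hn_ge0 n.+1; lra.
Qed.

Lemma tau_le n : tau n * (3 / 5) ^ n <= 5 / 2.
Proof.
have := hn_le n; have : 0 <= INR (n == 0%nat) * (3 / 5) ^ n.
  by apply: Rmult_le_pos; [exact: pos_INR|apply: pow_le; lra].
by rewrite /tau; lra.
Qed.

Lemma disk_tau x : 0 <= x < 3 / 5 -> Rbar_lt (Rabs x) (CV_radius tau).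
Proof.
move=> xd; apply: (@Rbar_lt_le_trans _ (3 / 5)); first by rewrite /= Rabs_pos_eq; lra.
have [ub _] := CV_radius_bounded tau; apply: ub; exists (5 / 2) => n.
rewrite Rabs_pos_eq; first exact: tau_le.
by apply: Rmult_le_pos; [exact: tau_ge0|apply: pow_le; lra].
Qed.

Lemma gf_tau x : 0 <= x < 3 / 5 -> 0 <= PSeries tau x <= 2 /\
  x * (1 - x) * PSeries tau x ^ 2 - (1 - x) * (3 - x) * PSeries tau x + x = 0.
Proof.
move=> xd; have dh := disk_hn xd; have dt := disk_tau xd; have et := CV_radius_inside _ _ dt.
have eh := CV_radius_inside _ _ dh.
have ec : ex_pseries (fun n => if n is 0 then 3 else 4) x /\
    PSeries (fun n => if n is 0 then 3 else 4) x = 3 + 4 * x / (1 - x).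
  have eg : ex_pseries (fun=> 1) x.
    apply/ex_pseries_R; apply: ex_series_ext (ex_series_geom x _); last by rewrite Rabs_pos_eq; lra.
    by move=> n; rewrite Rmult_1_l.
  have d1 : Rbar_lt (Rabs x) (CV_radius (fun n => if n is 0 then 3 else 4)).
    apply: (@Rbar_lt_le_trans _ 1); first by rewrite /= Rabs_pos_eq; lra.
    have [ub _] := CV_radius_bounded (fun n => if n is 0 then 3 else 4); apply: ub; exists 4 => n.
    by rewrite pow1 Rmult_1_r Rabs_pos_eq; case: n => *; lra.
  split; first exact: CV_radius_inside.
  rewrite (gf_rec d1 (b := fun=> 4)) //.
  have -> : PSeries (fun=> 4) x = 4 * Series (fun n => x ^ n) by rewrite -Series_scal_l.
  by rewrite Series_geom ?Rabs_pos_eq; try lra; field; lra.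
case: ec => ec Ec.
have em := ex_pseries_mult _ _ _ dh dh.
have [e1 E1] := gf_lin 1 ec em; have [e2 E2] := gf_scal (/ 6) e1.
have HE : PSeries hn x = 1 + x * (/ 6 * (3 + 4 * x / (1 - x) + PSeries hn x ^ 2)).
  rewrite {1}(gf_rec dh (b := fun n => / 6 * (1 * (if n is 0 then 3 else 4) + PS_mult hn hn n))); last first.
    by move=> n; rewrite hnS /hstep; field.
  by rewrite E2 E1 Ec PSeries_mult //; congr (_ + _ * (_ * _)); ring.
have hE : PSeries hn x = 1 + 2 * PSeries tau x.
  have d1 : Rbar_lt (Rabs x) (CV_radius (fun n => INR (n == 0%nat))).
    apply: (@Rbar_lt_le_trans _ 1); first by rewrite /= Rabs_pos_eq; lra.
    have [ub _] := CV_radius_bounded (fun n => INR (n == 0%nat)); apply: ub; exists 1 => n.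
    by rewrite pow1 Rmult_1_r Rabs_pos_eq; case: n => *; rewrite /=; lra.
  have dd : PSeries (fun n => INR (n == 0%nat)) x = 1.
    by rewrite (gf_rec d1 (b := fun=> 0)) // PSeries_const_0 /=; ring.
  have [_ E3] := gf_lin 2 et (CV_radius_inside _ _ d1).
  rewrite dd in E3; rewrite Rplus_comm -E3; apply: PSeries_ext => n; rewrite /tau; field.
have t0 : 0 <= PSeries tau x by apply: PSeries_ge0 => //; [exact: tau_ge0|lra].
have h5 : PSeries hn x <= 5.
  apply: (is_lim_seq_le (sum_f_R0 (fun n => hn n * x ^ n)) (fun=> 5) (PSeries hn x) 5).
  - move=> n; apply: Rle_trans (sum_hn_le n); apply: sum_Rle => k _.
    by apply: Rmult_le_compat_l; [exact: hn_ge0|apply: pow_incr; lra].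
  - by apply/is_series_lim/Series_correct/ex_pseries_R.
  exact: is_lim_seq_const.
split; first by lra.
move: HE; rewrite hE; set t := PSeries tau x => HE.
have : (1 + 2 * t) * (6 * (1 - x)) = (1 + x * (/ 6 * (3 + 4 * x / (1 - x) + (1 + 2 * t) ^ 2))) * (6 * (1 - x)) by rewrite -HE.
have -> : (1 + x * (/ 6 * (3 + 4 * x / (1 - x) + (1 + 2 * t) ^ 2))) * (6 * (1 - x)) =
  6 * (1 - x) + x * (3 * (1 - x) + 4 * x + (1 - x) * (1 + 2 * t) ^ 2) by field; lra.
lra.
Qed.

(** * Asymptotics of the mean *)

(** The coefficient of z^n in T(x(z)): [tau] expands T in x, and [tri] expands the powers of x in
    z. *)
Definition Tn n := sum_f_R0 (fun j => tau j * tri n j) n.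

Lemma gf_Tn z x : 0 < z < / 64 -> 0 < x < / 3 -> z = x * (1 - x) / 3 ->
  is_series (fun n => Tn n * z ^ n) (PSeries tau x).
Proof.
move=> zd xd zx; have z0 n : 0 <= z ^ n by apply: pow_le; lra.
have et : ex_pseries tau x by apply: CV_radius_inside; apply: disk_tau; lra.
have := @tonelli (fun n j => tau j * tri n j * z ^ n) (fun j => tau j * x ^ j).
rewrite -/(PSeries tau x) => H.
apply: is_series_ext (H _ _ _ _) => [n|n j|n j nj|j|]; last exact/ex_pseries_R.
- by rewrite /Tn [RHS]Rmult_comm scal_sum.
- by apply: Rmult_le_pos => //; apply: Rmult_le_pos; [exact: tau_ge0|exact: tri_ge0].
- by rewrite tri_gt //; ring.
rewrite -(gf_tri zd xd zx j).
apply: (is_series_ext (fun n => scal (tau j) (tri n j * z ^ n))) => [n|].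
  by rewrite /scal /= /mult /= Rmult_assoc.
apply: (is_series_scal_l (tau j)); apply: Series_correct.
by apply/ex_pseries_R/CV_radius_inside/disk_tri.
Qed.

Lemma sum_bounded_Tn : sum_bounded Tn.
Proof.
move=> z zd; have [x [T [xd zx _ _ _]]] := gf_solution zd.
have Tn0 n : 0 <= Tn n.
  by apply: cond_pos_sum => j; apply: Rmult_le_pos; [exact: tau_ge0|exact: tri_ge0].
have h := gf_Tn zd xd zx; exists (PSeries tau x) => n.
rewrite Rabs_pos_eq // -(is_series_unique _ _ h).
have t0 k : 0 <= Tn k * z ^ k by apply: Rmult_le_pos => //; apply: pow_le; lra.
apply: Rle_trans (sum_term_le n t0) _; apply: sum_le_PSeries => //; first lra.
by apply/ex_pseries_R; exists (PSeries tau x).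
Qed.

(** The coefficients of 1 / (1 - x) - M - T, compared by [gf_zero]. *)
Lemma Pn1_formula n : Pn 1 n = tri n.+1 1 / 3 - Mn n - Tn n.
Proof.
pose f k := - / 3 * tri k.+1 1 + (1 * Mn k + (1 * Tn k + Pn 1 k)).
have bP : sum_bounded (Pn 1) by apply: (@bounded_64 _ 2) => k; apply: Pn_bnd; lra.
have bf : sum_bounded f.
  apply: sum_bounded_lin; first exact: (sum_bounded_tri 1 1).
  apply: sum_bounded_lin; first exact: sum_bounded_M.
  by apply: sum_bounded_lin => //; exact: sum_bounded_Tn.
have f0 k : f k = 0.
  apply: (gf_zero bf) => z zd; have [x [T [xd zx ME PE [T0 TE]]]] := gf_solution zd.
  have [e1 E1] := gf_tri1 zd xd zx.
  have e2 : ex_pseries Mn z by apply: CV_radius_inside; exact: sum_bounded_disk sum_bounded_M zd.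
  have e3 : ex_pseries Tn z by apply: CV_radius_inside; exact: sum_bounded_disk sum_bounded_Tn zd.
  have e4 : ex_pseries (Pn 1) z by apply: CV_radius_inside; exact: sum_bounded_disk bP zd.
  have [e5 E5] := gf_lin 1 e3 e4; have [e6 E6] := gf_lin 1 e2 e5; have [e7 E7] := gf_lin (- / 3) e1 e6.
  have xd' : 0 <= x < 3 / 5 by lra.
  have [t2 tE] := gf_tau xd'.
  rewrite E7 E6 E5 E1 PE [PSeries Tn z](is_series_unique _ _ (gf_Tn zd xd zx)).
  suff -> : PSeries tau x = T by field; lra.
  (* Two distinct roots would satisfy x (t + T) = 3 - x, impossible for t <= 2, T <= 1/2 and x <
     1/3. *)
  have T1 : T <= / 2.
    apply: Rle_trans (proj2 T0) _; apply: (Rmult_le_reg_r (1 - x)); first lra.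
    by rewrite /Rdiv Rmult_assoc Rinv_l; lra.
  set t := PSeries tau x in t2 tE *.
  have : (t - T) * ((1 - x) * (x * (t + T) - (3 - x))) = 0 by lra.
  by case/Rmult_integral => [|/Rmult_integral[]]; nra.
by have := f0 n; rewrite /f; lra.
Qed.

(** The common scale: the coefficients of 1 / (1 - x) and of M are rational multiples of it. It is
    the coefficient of z^n in 1 / sqrt (1 - 12 z). *)
Definition An n := 3 ^ n * INR 'C(2 * n, n).

Lemma An_gt0 n : 0 < An n.
Proof.
apply: Rmult_lt_0_compat; first by apply: pow_lt; lra.
by apply/lt_0_INR/ltP; rewrite bin_gt0 mul2n -addnn leq_addr.
Qed.

Lemma tri1_An n : tri n.+1 1 = 3 * An n / INR n.+1.
Proof.
have c := @tri_closed n.+1 1 isT isT; have n0 := pos_INR n.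
have E : INR n.+1 * INR 'C(2 * n.+1 - 1, n.+1) = (2 * INR n + 1) * INR 'C(2 * n, n).
  have -> : (2 * n.+1 - 1 = (2 * n).+1)%nat by rewrite mulnS add2n subn1.
  have -> : 2 * INR n + 1 = INR (2 * n).+1 by rewrite S_INR mult_INR.
  by rewrite -!mult_INR; congr INR; apply/esym; exact: (mul_bin_diag (2 * n).+1 n).
rewrite S_INR in c E *; apply: (Rmult_eq_reg_l ((2 * INR n + 1) * (INR n + 1))); last by nra.
have -> : (2 * INR n + 1) * (INR n + 1) * (3 * An n / (INR n + 1)) = 3 * 3 ^ n * ((2 * INR n + 1) * INR 'C(2 * n, n)).
  by rewrite /An; field; lra.
have -> : (2 * INR n + 1) * (INR n + 1) * tri n.+1 1 = (INR n + 1) * ((2 * (INR n + 1) - INR 1) * tri n.+1 1).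
  by rewrite [INR 1]/=; ring.
by rewrite c -E [INR 1]/= -[3 ^ n.+1]/(3 * 3 ^ n); ring.
Qed.

Lemma tri2_An n : tri n.+2 2 = 18 * (2 * INR n + 1) * An n / (INR n.+1 * INR n.+2).
Proof.
have c := @tri_closed n.+2 2 isT isT; have n0 := pos_INR n.
have E1 : INR n.+2 * INR 'C(2 * n.+2 - 2, n.+2) = (2 * INR n + 2) * INR 'C((2 * n).+1, n.+1).
  have -> : (2 * n.+2 - 2 = (2 * n).+2)%nat by rewrite !mulnS !add2n subn2.
  have -> : 2 * INR n + 2 = INR (2 * n).+2 by rewrite !S_INR mult_INR /=; ring.
  by rewrite -!mult_INR; congr INR; apply/esym; exact: (mul_bin_diag (2 * n).+2 n.+1).
have E2 : INR n.+1 * INR 'C((2 * n).+1, n.+1) = (2 * INR n + 1) * INR 'C(2 * n, n).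
  have -> : 2 * INR n + 1 = INR (2 * n).+1 by rewrite S_INR mult_INR.
  by rewrite -!mult_INR; congr INR; apply/esym; exact: (mul_bin_diag (2 * n).+1 n).
rewrite -[3 ^ n.+2]/(3 * (3 * 3 ^ n)) in c; rewrite /An; rewrite !S_INR in c E1 E2 *.
rewrite [INR 0]/= in c; set C1 := INR 'C(2 * n.+2 - 2, n.+2) in c E1.
set C2 := INR 'C((2 * n).+1, n.+1) in E1 E2; set C3 := INR 'C(2 * n, n) in E2 *.
have c1 : C1 = (2 * INR n + 2) * C2 / (INR n + 1 + 1) by rewrite -E1; field; lra.
have c2 : C2 = (2 * INR n + 1) * C3 / (INR n + 1) by rewrite -E2; field; lra.
have c3 : tri n.+2 2 = 3 * (3 * 3 ^ n) * (0 + 1 + 1) * C1 / (2 * (INR n + 1 + 1) - (0 + 1 + 1)).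
  by rewrite -c; field; lra.
by rewrite c3 c1 c2; field; lra.
Qed.

(** Tutte's formula for the number of rooted planar maps. *)
Lemma Mn_An n : Mn n = 2 * An n / (INR n.+1 * INR n.+2).
Proof.
by rewrite Mn_tri tri1_An tri2_An !S_INR; have := pos_INR n; move=> *; field; lra.
Qed.

Lemma Mn_gt0 n : 0 < Mn n.
Proof.
rewrite Mn_An; have := An_gt0 n => a0; have n0 := pos_INR n; rewrite !S_INR.
by apply: Rmult_lt_0_compat; [lra|apply: Rinv_0_lt_compat; nra].
Qed.

(** Passing from j to j + 1 multiplies the binomial by (n - j) / (2n - j), which lies between (1 - j
    / n) / 2 and 1/2. *)
Lemma bin_ratio n j : (j <= n)%nat -> (0 < n)%nat ->
  (/ 2) ^ j * (1 - INR j ^ 2 / (2 * INR n)) * INR 'C(2 * n, n) <= INR 'C(2 * n - j, n)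
  <= (/ 2) ^ j * INR 'C(2 * n, n).
Proof.
move=> + n0; have N0 : 0 < INR n by apply/lt_0_INR/ltP.
elim: j => [_|j IH jn]; first by rewrite subn0 /=; split; [apply: Req_le; field|]; lra.
have [lo hi] := IH (ltnW jn).
have jR : INR j + 1 <= INR n by rewrite -S_INR; apply/le_INR/leP.
have j0 := pos_INR j.
have rec : (2 * INR n - INR j) * INR 'C(2 * n - j.+1, n) = (INR n - INR j) * INR 'C(2 * n - j, n).
  have n2j : (n <= 2 * n - j)%nat by rewrite mul2n -addnn -addnBA ?leq_addr // ltnW.
  have -> : 2 * INR n - INR j = INR (2 * n - j).
    by rewrite minus_INR ?mult_INR //; apply/leP; rewrite mul2n -addnn (leq_trans (ltnW jn)) // leq_addr.
  have -> : INR n - INR j = INR (2 * n - j - n).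
    rewrite -minus_INR; last by apply/leP/ltnW.
    by congr INR; rewrite minusE subnAC mul2n -addnn addnK.
  by rewrite -!mult_INR subnS; congr INR; exact: mul_bin_down.
set X := INR 'C(2 * n, n) in lo hi *; set Y := INR 'C(2 * n - j, n) in lo hi rec.
set Z := INR 'C(2 * n - j.+1, n) in rec *.
have X0 : 0 <= X by exact: pos_INR. have Y0 : 0 <= Y by exact: pos_INR. have Z0 : 0 <= Z by exact: pos_INR.
have ZE : Z = (INR n - INR j) / (2 * INR n - INR j) * Y.
  by apply: (Rmult_eq_reg_l (2 * INR n - INR j)); [rewrite rec; field; lra|lra].
have f1 : (INR n - INR j) / (2 * INR n - INR j) <= / 2.
  by apply: (Rmult_le_reg_r (2 * INR n - INR j)); [lra|rewrite /Rdiv Rmult_assoc Rinv_l; lra].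
have f2 : / 2 * (1 - INR j / INR n) <= (INR n - INR j) / (2 * INR n - INR j).
  apply: (Rmult_le_reg_r (2 * INR n * (2 * INR n - INR j))); first by nra.
  have -> : / 2 * (1 - INR j / INR n) * (2 * INR n * (2 * INR n - INR j)) = (INR n - INR j) * (2 * INR n - INR j) by field; lra.
  have -> : (INR n - INR j) / (2 * INR n - INR j) * (2 * INR n * (2 * INR n - INR j)) = (INR n - INR j) * (2 * INR n) by field; lra.
  nra.
have p0 : 0 <= (/ 2) ^ j by apply: pow_le; lra.
rewrite -[(/ 2) ^ j.+1]/(/ 2 * (/ 2) ^ j) S_INR; split; last first.
  rewrite ZE Rmult_assoc; apply: Rle_trans (Rmult_le_compat_r _ _ _ Y0 f1) _.
  by apply: Rmult_le_compat_l => //; lra.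
set L := 1 - INR j ^ 2 / (2 * INR n) in lo.
have LE : 1 - (INR j + 1) ^ 2 / (2 * INR n) <= L * (1 - INR j / INR n) /\
   1 - (INR j + 1) ^ 2 / (2 * INR n) <= L.
  have -> : 1 - (INR j + 1) ^ 2 / (2 * INR n) = L - INR j / INR n - / (2 * INR n) by rewrite /L; field; lra.
  have -> : L * (1 - INR j / INR n) = L - INR j / INR n + INR j ^ 2 / (2 * INR n) * (INR j / INR n) by rewrite /L; field; lra.
  have i0 : 0 < / INR n by apply: Rinv_0_lt_compat.
  have i1 : 0 < / (2 * INR n) by apply: Rinv_0_lt_compat; lra.
  have q1 : 0 <= INR j / INR n by apply: Rmult_le_pos; lra.
  have q2 : 0 <= INR j ^ 2 / (2 * INR n) by apply: Rmult_le_pos; [apply: pow_le|]; lra.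
  have := Rmult_le_pos _ _ q2 q1; lra.
have pX : 0 <= / 2 * (/ 2) ^ j * X by apply: Rmult_le_pos => //; lra.
case: (Rle_dec 0 L) => L0.
  apply: (@Rle_trans _ (/ 2 * (/ 2) ^ j * (L * (1 - INR j / INR n)) * X)).
    by have := Rmult_le_compat_l _ _ _ pX (proj1 LE); lra.
  have w0 : 0 <= / 2 * (1 - INR j / INR n).
    have -> : / 2 * (1 - INR j / INR n) = (INR n - INR j) * / (2 * INR n) by field; lra.
    by apply: Rmult_le_pos; [lra|apply/Rlt_le/Rinv_0_lt_compat; lra].
  have h : / 2 * (1 - INR j / INR n) * ((/ 2) ^ j * L * X) <= (INR n - INR j) / (2 * INR n - INR j) * Y.
    apply: Rmult_le_compat => //; first by apply: Rmult_le_pos => //; apply: Rmult_le_pos.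
  by rewrite ZE; lra.
have h : (1 - (INR j + 1) ^ 2 / (2 * INR n)) * (/ 2 * (/ 2) ^ j * X) <= 0 * (/ 2 * (/ 2) ^ j * X).
  by apply: Rmult_le_compat_r => //; lra.
lra.
Qed.

(** By [tri_closed] the quotient is j / (2n - j) times a ratio of binomials, and both factors are
    known up to a relative error j^2 / n. For j > n the ballot number is 0 and the main term itself
    is below the error. *)
Lemma tri_approx n j : (0 < n)%nat ->
  Rabs (tri n j / An n - INR j * (/ 2) ^ j / (2 * INR n)) <= INR j ^ 3 * (/ 2) ^ j / (2 * INR n ^ 2).
Proof.
move=> n0; have N1 : 1 <= INR n by rewrite -[1]/(INR 1); apply/le_INR/leP.
have A0 := An_gt0 n; have p0 : 0 < (/ 2) ^ j by apply: pow_lt; lra.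
case: (posnP j) => [->|j0].
  rewrite tri0 [INR 0]/= (_ : (n == 0)%nat = false); last by case: (n) n0.
  by rewrite /= /Rdiv !Rmult_0_l Rminus_0_r Rabs_R0; lra.
have J1 : 1 <= INR j by rewrite -[1]/(INR 1); apply/le_INR/leP.
have K0 : 0 < INR j * (/ 2) ^ j / (2 * INR n).
  by apply: Rmult_lt_0_compat; [nra|apply: Rinv_0_lt_compat; lra].
have KE : INR j ^ 3 * (/ 2) ^ j / (2 * INR n ^ 2) = INR j * (/ 2) ^ j / (2 * INR n) * (INR j ^ 2 / INR n).
  by field; lra.
rewrite KE; set K := INR j * (/ 2) ^ j / (2 * INR n) in K0 *.
case: (leqP j n) => jn; last first.
  have jN : INR n + 1 <= INR j by rewrite -S_INR; apply/le_INR/leP.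
  rewrite tri_gt // /Rdiv Rmult_0_l Rminus_0_l Rabs_Ropp Rabs_pos_eq; last by lra.
  rewrite -[X in X <= _]Rmult_1_r; apply: Rmult_le_compat_l; first by lra.
  by apply: (Rmult_le_reg_r (INR n)); [lra|rewrite Rmult_assoc Rinv_l; nra].
have jR : INR j <= INR n by apply/le_INR/leP.
have [lo hi] := bin_ratio jn n0.
have c := tri_closed j0 jn; have C0 : 0 < INR 'C(2 * n, n).
  by apply/lt_0_INR/ltP; rewrite bin_gt0 mul2n -addnn leq_addr.
have p3 : 0 < 3 ^ n by apply: pow_lt; lra.
set Y := INR 'C(2 * n - j, n) in lo hi c; set X := INR 'C(2 * n, n) in lo hi C0.
have tE : tri n j / An n = INR j / (2 * INR n - INR j) * (Y / X).
  have -> : tri n j = 3 ^ n * INR j * Y / (2 * INR n - INR j) by rewrite -c; field; lra.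
  by rewrite /An -/X; field; lra.
have YX : (/ 2) ^ j * (1 - INR j ^ 2 / (2 * INR n)) <= Y / X <= (/ 2) ^ j.
  have YE : Y / X * X = Y by field; lra.
  by split; apply: (Rmult_le_reg_r X) => //; rewrite YE.
have Y0 : 0 <= Y / X by apply: Rmult_le_pos; [exact: pos_INR|apply/Rlt_le/Rinv_0_lt_compat].
have w1 : / (2 * INR n) <= / (2 * INR n - INR j) by apply: Rinv_le_contravar; lra.
have w2 : / (2 * INR n - INR j) <= / (2 * INR n) * (1 + INR j / INR n).
  apply: (Rmult_le_reg_r (2 * INR n * INR n * (2 * INR n - INR j))); first by nra.
  have -> : / (2 * INR n - INR j) * (2 * INR n * INR n * (2 * INR n - INR j)) = 2 * INR n * INR n by field; lra.
  have -> : / (2 * INR n) * (1 + INR j / INR n) * (2 * INR n * INR n * (2 * INR n - INR j)) =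
    (INR n + INR j) * (2 * INR n - INR j) by field; lra.
  nra.
have q : INR j / INR n <= INR j ^ 2 / INR n.
  by apply: Rmult_le_compat_r; [apply/Rlt_le/Rinv_0_lt_compat; lra|nra].
have q0 : 0 <= INR j ^ 2 / INR n by apply: Rmult_le_pos; [apply: pow_le; lra|apply/Rlt_le/Rinv_0_lt_compat; lra].
have i0 : 0 < / (2 * INR n) by apply: Rinv_0_lt_compat; lra.
have up : tri n j / An n <= K * (1 + INR j ^ 2 / INR n).
  rewrite tE; have -> : K * (1 + INR j ^ 2 / INR n) = INR j * (/ (2 * INR n) * (1 + INR j ^ 2 / INR n)) * (/ 2) ^ j.
    by rewrite /K; field; lra.
  apply: Rmult_le_compat => //; last by case: YX.
    by apply: Rmult_le_pos; [lra|apply/Rlt_le/Rinv_0_lt_compat; lra].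
  apply: Rmult_le_compat_l; first by lra.
  by apply: Rle_trans w2 _; apply: Rmult_le_compat_l; lra.
have low : K * (1 - INR j ^ 2 / INR n) <= tri n j / An n.
  have h1 : K * (1 - INR j ^ 2 / (2 * INR n)) <= INR j * / (2 * INR n) * (Y / X).
    have -> : K * (1 - INR j ^ 2 / (2 * INR n)) = INR j * / (2 * INR n) * ((/ 2) ^ j * (1 - INR j ^ 2 / (2 * INR n))).
      by rewrite /K; field; lra.
    by apply: Rmult_le_compat_l; [apply: Rmult_le_pos; lra|case: YX].
  have h2 : INR j * / (2 * INR n) * (Y / X) <= tri n j / An n.
    by rewrite tE; apply: Rmult_le_compat_r => //; apply: Rmult_le_compat_l => //; lra.
  have h3 : INR j ^ 2 / (2 * INR n) <= INR j ^ 2 / INR n.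
    have -> : INR j ^ 2 / (2 * INR n) = INR j ^ 2 / INR n * / 2 by field; lra.
    lra.
  have h4 : K * (1 - INR j ^ 2 / INR n) <= K * (1 - INR j ^ 2 / (2 * INR n)) by apply: Rmult_le_compat_l; lra.
  lra.
by apply: Rabs_le; lra.
Qed.

Lemma ex_tau3 : ex_series (fun j => tau j * (INR j ^ 3 * (/ 2) ^ j)).
Proof.
(* [tau j] is at most 5/2 (5/3)^j, which 2^(-j) turns into 5/2 (5/6)^j, and j^3 is at most 27000
   (31/30)^(3j); the product of the ratios stays below 1, and 67500 is 5/2 times 27000. *)
pose r := 5 / 6 * (31 / 30) ^ 3.
have r1 : 0 <= r < 1 by rewrite /r; lra.
apply: (ex_series_le (V := R_CompleteNormedModule) _ (fun j => 67500 * r ^ j)); last first.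
  by apply: (ex_series_scal (V := R_NormedModule)); apply: ex_series_geom; rewrite Rabs_pos_eq; lra.
move=> j; rewrite /norm /= /abs /=; have t0 := tau_ge0 j; have j0 := pos_INR j.
have p0 : 0 <= (/ 2) ^ j by apply: pow_le; lra.
rewrite Rabs_pos_eq; last by apply: Rmult_le_pos => //; apply: Rmult_le_pos => //; apply: (pow_le _ 3).
have b : 1 + INR j * / 30 <= (1 + / 30) ^ j by apply: bernoulli_pow; lra.
have b3 : INR j ^ 3 <= 27000 * ((1 + / 30) ^ j) ^ 3.
  have -> : INR j ^ 3 = 27000 * (INR j * / 30) ^ 3 by field.
  by apply: Rmult_le_compat_l; [lra|apply: pow_incr; lra].
have tl := tau_le j.
have -> : tau j * (INR j * (INR j * (INR j * 1)) * (/ 2) ^ j) = (tau j * (3 / 5) ^ j) * INR j ^ 3 * (5 / 6) ^ j.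
  have -> : (/ 2) ^ j = (3 / 5) ^ j * (5 / 6) ^ j by rewrite -Rpow_mult_distr; congr (_ ^ _); lra.
  by rewrite /=; ring.
have -> : 67500 * r ^ j = 5 / 2 * (27000 * ((1 + / 30) ^ j) ^ 3) * (5 / 6) ^ j.
  rewrite /r Rpow_mult_distr -!pow_mult Nat.mul_comm; have -> : 1 + / 30 = 31 / 30 by lra.
  by field.
apply: Rmult_le_compat_r; first by apply: pow_le; lra.
apply: Rmult_le_compat => //; last exact: pow_le.
by apply: Rmult_le_pos => //; apply: pow_le; lra.
Qed.

Lemma ex_tau1 : ex_series (fun j => tau j * (INR j * (/ 2) ^ j)).
Proof.
apply: (ex_series_le (V := R_CompleteNormedModule) _ _ _ ex_tau3) => j.
rewrite /norm /= /abs /=; have t0 := tau_ge0 j; have j0 := pos_INR j.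
have p0 : 0 <= (/ 2) ^ j by apply: pow_le; lra.
rewrite Rabs_pos_eq; last by apply: Rmult_le_pos => //; apply: Rmult_le_pos.
apply: Rmult_le_compat_l => //; apply: Rmult_le_compat_r => //.
case: (posnP j) => [->|jp]; first by rewrite /=; lra.
have J1 : 1 <= INR j by rewrite -[1]/(INR 1); apply/le_INR/leP.
by nra.
Qed.

(** The sum is x T'(x) at x = 1/2, found by differentiating the quadratic equation of T. There T^2 -
    5 T + 2 = 0, and T <= 2 selects (5 - sqrt 17) / 2. *)
Lemma tau_drift : Series (fun j => tau j * (INR j * (/ 2) ^ j)) = sqrt 17 - 3.
Proof.
have hd : 0 <= / 2 < 3 / 5 by lra.
have dt := disk_tau hd; pose t' := PSeries (PS_derive tau) (/ 2).
have -> : Series (fun j => tau j * (INR j * (/ 2) ^ j)) = / 2 * t'.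
  rewrite Series_incr_1; last exact: ex_tau1.
  rewrite tau0 Rmult_0_l Rplus_0_l /t' /PSeries -Series_scal_l; apply: Series_ext => n.
  by rewrite /PS_derive -[(/ 2) ^ n.+1]/(/ 2 * (/ 2) ^ n); ring.
have [t2 tE] := gf_tau hd; set t := PSeries tau (/ 2) in t2 tE.
have der : is_derive (PSeries tau) (/ 2) t' by exact: is_derive_PSeries.
pose F x := x * (1 - x) * PSeries tau x ^ 2 - (1 - x) * (3 - x) * PSeries tau x + x.
have dF : is_derive F (/ 2) (/ 2 * t * t' - 5 / 4 * t' + 3 * t + 1).
  have ex : ex_derive (PSeries tau) (/ 2) by exists t'.
  rewrite /F; auto_derive => //.
  by rewrite (is_derive_unique _ _ _ der) -/t; field.
have F0 : is_derive F (/ 2) 0.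
  apply: (is_derive_ext_loc (fun=> 0)); last exact: is_derive_const.
  have h : 0 < / 20 by lra.
  exists (mkposreal _ h) => y; rewrite /ball /= /AbsRing_ball /abs /= /minus /plus /opp /= => hy.
  have [h1 h2] := Rabs_def2 _ _ hy; have yd : 0 <= y < 3 / 5 by lra.
  by have [_ E] := gf_tau yd; rewrite /F E.
have E : / 2 * t * t' - 5 / 4 * t' + 3 * t + 1 = 0.
  by rewrite -(is_derive_unique _ _ _ dF) (is_derive_unique _ _ _ F0).
have s17 : sqrt 17 * sqrt 17 = 17 by apply: sqrt_sqrt; lra.
have s4 : 4 < sqrt 17 by rewrite -(sqrt_square 4); [apply: sqrt_lt_1; lra|lra].
have tv : t = (5 - sqrt 17) / 2.
  have : (t - (5 - sqrt 17) / 2) * (t - (5 + sqrt 17) / 2) = 0.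
    have -> : (t - (5 - sqrt 17) / 2) * (t - (5 + sqrt 17) / 2) = t ^ 2 - 5 * t + (25 - sqrt 17 * sqrt 17) / 4 by field.
    by rewrite s17; lra.
  by case/Rmult_integral; lra.
rewrite tv in E; apply: (Rmult_eq_reg_r (sqrt 17)); last by lra.
lra.
Qed.

(** * Concentration *)

Lemma Tn_approx : exists2 K, 0 <= K & forall n, (0 < n)%nat ->
  Rabs (Tn n / An n - (sqrt 17 - 3) / (2 * INR n)) <= K / INR n ^ 2.
Proof.
pose K := Series (fun j => tau j * (INR j ^ 3 * (/ 2) ^ j)).
have pos j : 0 <= tau j * (INR j ^ 3 * (/ 2) ^ j).
  apply: Rmult_le_pos; first exact: tau_ge0.
  by apply: Rmult_le_pos; apply: pow_le; [exact: pos_INR|lra].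
have KN N : sum_f_R0 (fun j => tau j * (INR j ^ 3 * (/ 2) ^ j)) N <= K.
  by apply: sum_incr => //; apply/is_series_Reals/Series_correct/ex_tau3.
have K0 : 0 <= K by apply: Rle_trans (pos 0%nat) (KN 0%nat).
exists K => // n n0; have N1 : 1 <= INR n by rewrite -[1]/(INR 1); apply/le_INR/leP.
have A0 := An_gt0 n.
pose u N := sum_f_R0 (fun j => tau j * (INR j * (/ 2) ^ j)) N.
(* Summing up to N + n leaves [Tn n] unchanged, since [tri] vanishes beyond n, while the main terms
   complete to the full series. *)
have ul : is_lim_seq (fun N => / (2 * INR n) * u (N + n)%nat) (/ (2 * INR n) * (sqrt 17 - 3)).
  apply: (is_lim_seq_scal_l _ _ (Finite (sqrt 17 - 3))); apply/(is_lim_seq_incr_n u n).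
  by rewrite -tau_drift; apply/is_series_lim/Series_correct/ex_tau1.
have TN N : sum_f_R0 (fun j => tau j * tri n j) (N + n) = Tn n.
  by elim: N => [|N IH] //; rewrite addSn /= IH tri_gt ?ltnS ?leq_addl //; ring.
have bd N : Rabs (Tn n / An n - / (2 * INR n) * u (N + n)%nat) <= K / INR n ^ 2.
  rewrite -(TN N) /u /Rdiv Rmult_comm !scal_sum -minus_sum.
  apply: Rle_trans (Rsum_abs _ _) _.
  apply: (@Rle_trans _ (sum_f_R0 (fun j => tau j * (INR j ^ 3 * (/ 2) ^ j) * / (2 * INR n ^ 2)) (N + n))).
    apply: sum_Rle => j _.
    have -> : tau j * tri n j * / An n - tau j * (INR j * (/ 2) ^ j) * / (2 * INR n) =
       tau j * (tri n j / An n - INR j * (/ 2) ^ j / (2 * INR n)) by field; lra.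
    rewrite Rabs_mult Rabs_pos_eq; last exact: tau_ge0.
    rewrite Rmult_assoc; apply: Rmult_le_compat_l; [exact: tau_ge0|exact: tri_approx].
  rewrite -scal_sum Rmult_comm; have i0 : 0 < / INR n ^ 2 by apply: Rinv_0_lt_compat; apply: pow_lt; lra.
  have -> : / (2 * INR n ^ 2) = / 2 * / INR n ^ 2 by field; lra.
  have := KN (N + n)%nat; set S := sum_f_R0 _ _ => SK.
  rewrite -Rmult_assoc; apply: Rmult_le_compat_r; [lra|].
  have : 0 <= S by exact: cond_pos_sum.
  lra.
have -> : (sqrt 17 - 3) / (2 * INR n) = / (2 * INR n) * (sqrt 17 - 3) by rewrite /Rdiv Rmult_comm.
have lim := is_lim_seq_abs _ _ (is_lim_seq_minus' _ _ _ _ (is_lim_seq_const (Tn n / An n)) ul).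
exact: (is_lim_seq_le _ _ _ _ bd lim (is_lim_seq_const _)).
Qed.

Definition c17 := (5 - sqrt 17) / 4.

(** Relative to [Mn], the three terms of [Pn1_formula] are (n + 2) / 2, 1 and (n + 1) (n + 2) / 2
    times [Tn n / An n]; the coefficient of n is 1/2 - D / 4. *)
Lemma mean_xo : exists2 K, 0 <= K & forall n, Rabs (Pn 1 n - c17 * INR n * Mn n) <= K * Mn n.
Proof.
have [K K0 hK] := Tn_approx; pose D := sqrt 17 - 3.
have D0 : 0 <= D <= 2.
  rewrite /D; have s17 : sqrt 17 * sqrt 17 = 17 by apply: sqrt_sqrt; lra.
  by have := sqrt_pos 17; nra.
exists (3 * K + 3) => [|n]; first by lra.
have M0 := Mn_gt0 n.
case: (posnP n) => [n0|n0].
  rewrite n0 Pn0 Rmult_0_r Rmult_0_l Rminus_0_r Rabs_R0; rewrite n0 in M0; apply: Rmult_le_pos; lra.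
have N1 : 1 <= INR n by rewrite -[1]/(INR 1); apply/le_INR/leP.
have A0 := An_gt0 n; set N := INR n in N1 *.
pose d := Tn n / An n - D / (2 * N).
have hd : Rabs d <= K / N ^ 2 := hK n n0.
have ME : Mn n = 2 * An n / ((N + 1) * (N + 2)).
  by rewrite Mn_An !S_INR -/N; congr (_ / (_ * _)); lra.
have E : Pn 1 n - c17 * N * Mn n = Mn n * (- (3 / 4) * D - D / (2 * N) - (N + 1) * (N + 2) / 2 * d).
  rewrite Pn1_formula tri1_An S_INR -/N.
  have -> : Tn n = An n * (D / (2 * N) + d) by rewrite /d; field; lra.
  by rewrite ME /c17 /D; field; lra.
rewrite E Rabs_mult Rabs_pos_eq; last by lra.
rewrite Rmult_comm; apply: Rmult_le_compat_r; first by lra.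
have i0 : 0 < / N ^ 2 by apply: Rinv_0_lt_compat; nra.
have h1 : Rabs ((N + 1) * (N + 2) / 2 * d) <= 3 * K.
  rewrite Rabs_mult Rabs_pos_eq; last by nra.
  apply: (@Rle_trans _ ((N + 1) * (N + 2) / 2 * (K / N ^ 2))); first by apply: Rmult_le_compat_l => //; nra.
  have -> : (N + 1) * (N + 2) / 2 * (K / N ^ 2) = K * ((N + 1) * (N + 2) / (2 * N ^ 2)) by field; lra.
  rewrite [3 * K]Rmult_comm; apply: Rmult_le_compat_l => //.
  apply: (Rmult_le_reg_r (2 * N ^ 2)); first by nra.
  have -> : (N + 1) * (N + 2) / (2 * N ^ 2) * (2 * N ^ 2) = (N + 1) * (N + 2) by field; lra.
  nra.
have h2 : 0 <= D / (2 * N) <= 1.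
  split; first by apply: Rmult_le_pos; [lra|apply/Rlt_le/Rinv_0_lt_compat; lra].
  apply: (Rmult_le_reg_r (2 * N)); first by lra.
  have -> : D / (2 * N) * (2 * N) = D by field; lra.
  lra.
have [h3 h4] := proj1 (Rabs_le_between _ _) h1.
by apply: Rabs_le; lra.
Qed.

(** * Sequences negligible against n times the number of maps *)

Lemma Mn_S_ge n : PS_mult Mn Mn n + Mn n <= Mn n.+1.
Proof.
have E m : Mn m = \rsum_(c <- codes m) 1 by rewrite rsum_const count_predT /Mn; ring.
rewrite [Mn n.+1]E rsum_codesS; apply: Rplus_le_compat.
  rewrite /PS_mult; apply: Req_le; apply: sum_eq => k _.
  by rewrite rsum_const count_predT rsum_const count_predT /Mn minusE; ring.
rewrite E; apply: rsum_le => c _; rewrite sum_cte Rmult_1_l S_INR.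
by have := pos_INR (deg c); lra.
Qed.

(** Together with [Mn_S_ge] it bounds the convolution of [Mn] with itself by 12 [Mn], so that
    convolution costs only a constant factor. *)
Lemma Mn_S_le n : Mn n.+1 <= 12 * Mn n.
Proof.
have n0 := pos_INR n; have A0 := An_gt0 n.
have E : INR n.+1 * INR 'C(2 * n.+1, n.+1) = 2 * (2 * INR n + 1) * INR 'C(2 * n, n).
  have e1 : (n.+1 * 'C(2 * n.+1, n.+1) = (2 * n).+2 * 'C((2 * n).+1, n))%nat.
    by rewrite mulnS add2n -(mul_bin_diag (2 * n).+2 n).
  have e2 : ((2 * n).+1 * 'C(2 * n, n) = n.+1 * 'C((2 * n).+1, n))%nat.
    by rewrite (mul_bin_down (2 * n).+1 n) subSn ?mul2n -addnn ?addnK ?leq_addr.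
  have := congr1 INR e1; have := congr1 INR e2; rewrite !mult_INR !S_INR !mult_INR [INR 2]/=.
  by move=> h1 h2; rewrite h2; lra.
have AE : An n.+1 = 6 * (2 * INR n + 1) / (INR n + 1) * An n.
  apply: (Rmult_eq_reg_l (INR n.+1)); last by rewrite S_INR; lra.
  rewrite /An -[3 ^ n.+1]/(3 * 3 ^ n).
  have -> : INR n.+1 * (3 * 3 ^ n * INR 'C(2 * n.+1, n.+1)) = 3 * 3 ^ n * (INR n.+1 * INR 'C(2 * n.+1, n.+1)) by ring.
  by rewrite E S_INR; field; lra.
rewrite !Mn_An AE !S_INR; set N := INR n in n0 *.
have -> : 2 * (6 * (2 * N + 1) / (N + 1) * An n) / ((N + 1 + 1) * (N + 1 + 1 + 1)) =
   (6 * (2 * N + 1) / (N + 3)) * (2 * An n / ((N + 1) * (N + 1 + 1))) by field; lra.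
apply: Rmult_le_compat_r.
  by apply: Rmult_le_pos; [lra|apply/Rlt_le/Rinv_0_lt_compat; nra].
apply: (Rmult_le_reg_r (N + 3)); first by lra.
by rewrite /Rdiv Rmult_assoc Rinv_l; lra.
Qed.

(** The constant [C] takes care of small n: a convolution runs through all indices, so the bound has
    to hold for each of them. *)
Definition small (d : nat -> R) := forall eps, 0 < eps -> exists C, forall n,
  Rabs (d n) <= (eps * INR n + C) * Mn n.

Lemma small_ext d e : (forall n, d n = e n) -> small e -> small d.
Proof. by move=> de se eps e0; have [C hC] := se eps e0; exists C => n; rewrite de. Qed.

Lemma small_bounded d K : (forall n, Rabs (d n) <= K * Mn n) -> small d.
Proof.
move=> dK eps e0; exists K => n; apply: Rle_trans (dK n) _.
apply: Rmult_le_compat_r; first exact: Mn_ge0.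
by have := Rmult_le_pos _ _ (Rlt_le _ _ e0) (pos_INR n); lra.
Qed.

Lemma smallD d e : small d -> small e -> small (fun n => d n + e n).
Proof.
move=> sd se eps e0; have e2 : 0 < eps / 2 by lra.
have [C hC] := sd _ e2; have [C' hC'] := se _ e2; exists (C + C') => n.
by apply: Rle_trans (Rabs_triang _ _) _; have := hC n; have := hC' n; lra.
Qed.

Lemma smallN d : small d -> small (fun n => - d n).
Proof. by move=> sd eps e0; have [C hC] := sd _ e0; exists C => n; rewrite Rabs_Ropp. Qed.

Lemma small_sum (F : nat -> nat -> R) p : (forall a, (a <= p)%nat -> small (F a)) ->
  small (fun n => sum_f_R0 (fun a => F a n) p).
Proof.
elim: p => [|p IH] h /=; first exact: h.
by apply: smallD; [apply: IH => a ap; apply: h; exact: leqW|exact: h].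
Qed.

Lemma small_shift d e : small e -> (forall n, d n.+1 = e n) -> small d.
Proof.
move=> se de eps e0; have [C hC] := se _ e0; exists (Rabs C + Rabs (d 0%nat)) => -[|n].
  rewrite /= {1}/Mn /= Rmult_0_r; have := Rabs_pos C; have := Rabs_pos (d 0%nat).
  by rewrite /Mn /=; lra.
rewrite de; apply: Rle_trans (hC n) _.
have M1 : Mn n <= Mn n.+1.
  by have := Mn_S_ge n; have := PS_mult_ge0 n Mn_ge0 Mn_ge0; lra.
have M0 := Mn_ge0 n; have n0 := pos_INR n; have c1 := Rle_abs C; have c0 := Rabs_pos C.
have en := Rmult_le_pos _ _ (Rlt_le _ _ e0) n0.
apply: (@Rle_trans _ ((eps * INR n + Rabs C) * Mn n)); first by apply: Rmult_le_compat_r; lra.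
apply: Rmult_le_compat => //; first by lra.
by rewrite S_INR; have := Rabs_pos (d 0%nat); lra.
Qed.

Lemma small_conv d w : small d -> (forall n, Rabs (w n) <= Mn n) -> small (PS_mult d w).
Proof.
move=> sd wM eps e0; have e12 : 0 < eps / 12 by lra.
have [C hC] := sd _ e12; exists (12 * Rabs C) => n.
apply: Rle_trans (Rsum_abs _ _) _.
have n0 := pos_INR n; have cp := Rabs_pos C; have M0 := Mn_ge0 n.
apply: (@Rle_trans _ ((eps / 12 * INR n + Rabs C) * PS_mult Mn Mn n)).
  rewrite scal_sum; apply: sum_Rle => k kn; rewrite Rabs_mult.
  have kR : INR k <= INR n by exact: le_INR.
  have h : Rabs (d k) <= (eps / 12 * INR n + Rabs C) * Mn k.
    apply: Rle_trans (hC k) _; apply: Rmult_le_compat_r; first exact: Mn_ge0.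
    by have := Rmult_le_compat_l _ _ _ (Rlt_le _ _ e12) kR; have := Rle_abs C; lra.
  have := Rmult_le_compat _ _ _ _ (Rabs_pos _) (Rabs_pos _) h (wM (n - k)%coq_nat).
  lra.
have h : PS_mult Mn Mn n <= 12 * Mn n.
  by have := Mn_S_ge n; have := Mn_S_le n; lra.
have en := Rmult_le_pos _ _ (Rlt_le _ _ e12) n0.
apply: Rle_trans (Rmult_le_compat_l _ _ _ _ h) _; first by lra.
apply: Req_le; field.
Qed.

Definition ind (b : bool) : R := if b then 1 else 0.

Lemma ind_andb a b : ind (a && b) = ind a * ind b.
Proof. by case: a; case: b; rewrite /ind /=; ring. Qed.

Lemma ind01 b : 0 <= ind b <= 1. Proof. by case: b; rewrite /ind; lra. Qed.

Lemma sum_ind p x : sum_f_R0 (fun a => ind (x == a)) p = ind (x <= p)%nat.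
Proof.
elim: p => [|p IH] /=; first by rewrite leqn0.
rewrite IH (leq_eqVlt x p.+1) ltnS; case: (eqVneq x p.+1) => [->|_].
  by rewrite ltnn /ind /=; ring.
by case: (x <= p)%nat; rewrite /ind /=; ring.
Qed.

(** * Deviations at a fixed root degree *)

Definition dev c := INR (xo c) - c17 * INR (csize c).

Lemma dev_ins c j e : valid c -> valid e -> (j <= deg c)%nat -> dev (ins c j e) = dev c + dev e.
Proof. by move=> vc ve jc; rewrite /dev xo_ins // csize_ins !plus_INR; ring. Qed.

Lemma rsum_codes_const n K : \rsum_(c <- codes n) K = K * Mn n.
Proof. by rewrite rsum_const count_predT; exact: Rmult_comm. Qed.

Lemma rsum_Mn n F : (forall c, 0 <= F c <= 1) -> Rabs (\rsum_(c <- codes n) F c) <= Mn n.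
Proof.
move=> F1; rewrite Rabs_pos_eq; last by apply: rsum_ge0 => c _; have := F1 c; lra.
have -> : Mn n = \rsum_(c <- codes n) 1 by rewrite rsum_const count_predT /Mn; ring.
by apply: rsum_le => c _; have := F1 c; lra.
Qed.

Definition Dn (p n : nat) := \rsum_(c <- codes n) (ind (deg c == p) * dev c).
Definition Nn (p n : nat) := \rsum_(c <- codes n) ind (deg c == p).

Lemma Nn_le p n : Rabs (Nn p n) <= Mn n.
Proof. by apply: rsum_Mn => c; exact: ind01. Qed.

(** The mean enters the induction on the root degree here; the induction transfers this one estimate
    to each fixed degree. *)
Lemma small_total : small (fun n => \rsum_(c <- codes n) dev c).
Proof.
have [K K0 hK] := mean_xo; apply: (@small_bounded _ K) => n.
have -> : \rsum_(c <- codes n) dev c = Pn 1 n - c17 * INR n * Mn n; last exact: hK.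
rewrite rsumB; congr (_ - _); first by apply: eq_bigr => c _; rewrite pow1 Rmult_1_r.
rewrite (eq_big_seq (fun=> c17 * INR n)) => [|c]; first by rewrite rsum_const count_predT; exact: Rmult_comm.
by rewrite mem_codes => /andP[_ /eqP->].
Qed.

Lemma small_scal a d : small d -> small (fun n => a * d n).
Proof.
move=> sd eps e0; have a1 : 0 < Rabs a + 1 by have := Rabs_pos a; lra.
have [C hC] := sd (eps / (Rabs a + 1)) (Rdiv_lt_0_compat _ _ e0 a1); exists (Rabs a * Rabs C) => n.
rewrite Rabs_mult; have a0 := Rabs_pos a; have M0 := Mn_ge0 n; have n0 := pos_INR n.
apply: Rle_trans (Rmult_le_compat_l _ _ _ a0 (hC n)) _; rewrite -Rmult_assoc; apply: Rmult_le_compat_r => //.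
have h : Rabs a * (eps / (Rabs a + 1)) <= eps.
  apply: (Rmult_le_reg_r (Rabs a + 1)) => //.
  have -> : Rabs a * (eps / (Rabs a + 1)) * (Rabs a + 1) = Rabs a * eps by field; lra.
  lra.
have := Rmult_le_compat_r _ _ _ n0 h; have := Rmult_le_compat_l _ _ _ a0 (Rle_abs C); lra.
Qed.

Lemma sum_ind2 p x y : sum_f_R0 (fun a => ind (x == a) * ind (y == p - a)%nat) p = ind (x + y == p)%nat.
Proof.
rewrite (sum_eq _ (fun a => ind (x == a) * ind (y == p - x)%nat)); last first.
  by move=> a _; case: eqP => [->//|_]; rewrite /ind; ring.
rewrite -scal_sum sum_ind -ind_andb; congr ind.
case: (leqP x p) => xp; last by rewrite andbF; apply/esym/negP => /eqP E; rewrite -E ltnNge leq_addr in xp.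
by rewrite andbT -(eqn_add2l x y) subnKC.
Qed.

Lemma sum_f_exchange (F : nat -> nat -> R) n p :
  sum_f_R0 (fun a => sum_f_R0 (F a) n) p = sum_f_R0 (fun k => sum_f_R0 (fun a => F a k) p) n.
Proof.
rewrite -!rsum_iota (eq_bigr (fun a => \rsum_(k <- iota 0 n.+1) F a k)); last by move=> a _; rewrite rsum_iota.
by rewrite exchange_big; apply: eq_bigr => k _; rewrite rsum_iota.
Qed.

(** [dev] is additive over the two sides of a loop up to the constant [c17], so the sum is a finite
    combination of convolutions. *)
Lemma small_loops p : (forall a, (a <= p)%nat -> small (Dn a)) ->
  small (fun n => sum_f_R0 (fun k => \rsum_(c1 <- codes k) \rsum_(c2 <- codes (n - k))
    (ind (deg (Loop c1 c2) == p.+2) * dev (Loop c1 c2))) n).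
Proof.
move=> sD.
refine (@small_ext _ (fun n => sum_f_R0 (fun a => PS_mult (Dn a) (Nn (p - a)) n +
   (PS_mult (Dn (p - a)) (Nn a) n + - c17 * PS_mult (Nn a) (Nn (p - a)) n)) p) _ _); last first.
  apply: small_sum => a ap; apply: smallD; first by apply: small_conv; [exact: sD|exact: Nn_le].
  apply: smallD; first by apply: small_conv; [apply: sD; exact: leq_subr|exact: Nn_le].
  apply: small_scal; apply: small_conv; last exact: Nn_le.
  by apply: (@small_bounded _ 1) => n; rewrite Rmult_1_l; exact: Nn_le.
move=> n.
pose g a (c1 c2 : code) := ind (deg c1 == a) * ind (deg c2 == p - a)%nat * (dev c1 + dev c2 - c17).
have E a : PS_mult (Dn a) (Nn (p - a)) n + (PS_mult (Dn (p - a)) (Nn a) n + - c17 * PS_mult (Nn a) (Nn (p - a)) n) =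
    sum_f_R0 (fun k => \rsum_(c1 <- codes k) \rsum_(c2 <- codes (n - k)) g a c1 c2) n.
  rewrite [PS_mult (Dn (p - a)) _ n]PS_mult_comm -!conv_rsum scal_sum -!plus_sum; apply: sum_eq => k _.
  rewrite -rsum_mulr -!rsumD; apply: eq_bigr => c1 _; rewrite -rsum_mulr -!rsumD; apply: eq_bigr => c2 _.
  by rewrite /g; ring.
rewrite (sum_eq _ _ p (fun a _ => E a)) sum_f_exchange; apply: sum_eq => k _.
rewrite sum_f_R0_rsum; apply: eq_bigr => c1 _; rewrite sum_f_R0_rsum; apply: eq_bigr => c2 _.
rewrite -[deg (Loop c1 c2) == p.+2]/(deg c1 + deg c2 == p)%nat -sum_ind2.
have -> : dev (Loop c1 c2) = dev c1 + dev c2 - c17.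
  by rewrite /dev -[xo (Loop c1 c2)]/(xo c1 + xo c2)%nat -[csize (Loop c1 c2)]/((csize c1 + csize c2).+1) S_INR !plus_INR; ring.
by rewrite Rmult_comm scal_sum.
Qed.

Lemma sum_ind_rev p d : sum_f_R0 (fun i => ind (d - i == p)%nat) d = ind (p <= d)%nat.
Proof.
rewrite -rsum_iota -[iota 0 d.+1]/(index_iota 0 d.+1) big_nat_rev big_nat.
rewrite (eq_bigr (fun i => ind (p == i))).
  by rewrite -big_nat [index_iota _ _]/(iota 0 d.+1) rsum_iota sum_ind.
by move=> i /= id_; rewrite add0n subSS subKn // eq_sym.
Qed.

(** Each [c] of degree at least p has exactly one expansion of degree p + 1. Their deviations sum to
    the total minus those of degrees below p, and the change in [dev] is bounded for each map. *)
Lemma small_expands p : (forall a, (a < p)%nat -> small (Dn a)) ->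
  small (fun n => \rsum_(c <- codes n) sum_f_R0 (fun i => ind (deg (Expand c i) == p.+1) * dev (Expand c i)) (deg c)).
Proof.
move=> sD; pose w c i := INR (~~ noblk c i) - c17.
have wle c i : Rabs (w c i) <= 1 + Rabs c17.
  apply: Rle_trans (Rabs_triang _ _) _; rewrite Rabs_Ropp; apply: Rplus_le_compat_r.
  by case: noblk; rewrite /= ?Rabs_R0 ?Rabs_R1; lra.
pose e1 n := \rsum_(c <- codes n) (ind (p <= deg c)%nat * dev c).
pose e2 n := \rsum_(c <- codes n) sum_f_R0 (fun i => ind (deg c - i == p)%nat * w c i) (deg c).
apply: (@small_ext _ (fun n => e1 n + e2 n)) => [n|].
  rewrite -rsumD; apply: eq_bigr => c _; rewrite -sum_ind_rev Rmult_comm scal_sum -plus_sum; apply: sum_eq => i _.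
  rewrite -[deg (Expand c i) == p.+1]/(deg c - i == p)%nat /w.
  rewrite /dev -[xo (Expand c i)]/(xo c + ~~ noblk c i)%nat -[csize (Expand c i)]/((csize c).+1) S_INR plus_INR; ring.
apply: smallD; last first.
  apply: (@small_bounded _ (1 + Rabs c17)) => n; apply: Rle_trans (rsum_abs _ _ _) _.
  rewrite -rsum_codes_const; apply: rsum_le => c _.
  apply: Rle_trans (Rsum_abs _ _) _.
  apply: (@Rle_trans _ (sum_f_R0 (fun i => ind (deg c - i == p)%nat * (1 + Rabs c17)) (deg c))).
    apply: sum_Rle => i _; rewrite Rabs_mult Rabs_pos_eq; last by have := ind01 (deg c - i == p)%nat; lra.
    by apply: Rmult_le_compat_l => //; have := ind01 (deg c - i == p)%nat; lra.
  rewrite -scal_sum sum_ind_rev; have := ind01 (p <= deg c)%nat; have := Rabs_pos c17.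
  by move=> h1 [h2 h3]; have := Rmult_le_compat_l (1 + Rabs c17) _ _ ltac:(lra) h3; lra.
case: p sD @e1 => [|p] sD e1 in e2 *.
  apply: small_ext small_total => n; rewrite /e1; apply: eq_bigr => c _; by rewrite /ind /=; ring.
apply: (@small_ext _ (fun n => \rsum_(c <- codes n) dev c + - sum_f_R0 (fun q => Dn q n) p)) => [n|].
  rewrite /Dn sum_f_R0_rsum -rsumN -rsumD; apply: eq_bigr => c _.
  have -> : sum_f_R0 (fun q => ind (deg c == q) * dev c) p = ind (deg c <= p)%nat * dev c.
    by rewrite -scal_sum sum_ind; ring.
  by rewrite ltnNge; case: (deg c <= p)%nat; rewrite /ind /=; ring.
by apply: smallD small_total _; apply/smallN/small_sum => q qp; exact: sD.
Qed.

Lemma small_Dn p : small (Dn p).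
Proof.
elim/ltn_ind: p => -[|p] IH.
  apply: (@small_bounded _ 0) => n; rewrite Rmult_0_l /Dn big1 ?Rabs_R0; first lra.
  move=> c _; rewrite deg0; case: eqP => [->|_]; rewrite /ind /dev /=; ring.
apply: (small_shift _ (fun n => rsum_codesS n _)).
apply: smallD; last by apply: small_expands => a ap; apply: IH; exact: ltnW.
case: p IH => [|p] IH; last by apply: small_loops => a ap; apply: IH; rewrite ltnS leqW.
apply: (@small_bounded _ 0) => n; rewrite Rmult_0_l (sum_eq _ (fun=> 0)); first by rewrite sum_cte Rmult_0_l Rabs_R0; lra.
by move=> k _; rewrite big1 // => c1 _; rewrite big1 // => c2 _; rewrite /ind /=; ring.
Qed.

(** * Deviations at open prefixes and at root cut vertices *)

Definition Gn (i m n : nat) := \rsum_(p <- open_prefixes n) (ind ((p.2 == i) && (deg p.1 == m)) * dev p.1).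
Definition Cn (i m n : nat) := \rsum_(p <- open_prefixes n) ind ((p.2 == i) && (deg p.1 == m)).

Lemma rsum_pre_at n i (F : code -> R) :
  \rsum_(p <- open_prefixes n) (ind (p.2 == i) * F p.1) =
  \rsum_(c <- codes n) (ind ((i <= deg c)%nat && noblk c i) * F c).
Proof.
rewrite (@rsum_pre n (fun c j => ind (j == i) * F c)); apply: eq_bigr => c _.
have -> : ind ((i <= deg c)%nat && noblk c i) * F c = sum_f_R0 (fun j => ind (i == j) * (ind (noblk c i) * F c)) (deg c).
  by rewrite -scal_sum sum_ind ind_andb; ring.
apply: sum_eq => j _; rewrite eq_sym; case: eqP => [->|_]; rewrite /ind /=; last by case: ifP => *; ring.
by case: noblk; ring.
Qed.

Lemma Cn_le i m n : Rabs (Cn i m n) <= Mn n.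
Proof.
have -> : Cn i m n = \rsum_(c <- codes n) (ind ((i <= deg c)%nat && noblk c i) * ind (deg c == m)).
  by rewrite -rsum_pre_at; apply: eq_bigr => p _; rewrite ind_andb.
by apply: rsum_Mn => c; rewrite -ind_andb; exact: ind01.
Qed.

Lemma GnE i m n : Gn i m n =
  \rsum_(c <- codes n) (ind ((i <= deg c)%nat && noblk c i) * (ind (deg c == m) * dev c)).
Proof. by rewrite -rsum_pre_at; apply: eq_bigr => p _; rewrite ind_andb; ring. Qed.

Lemma Gn_last k n : Gn k k.+1 n = \rsum_(e <- blocks n) (ind (deg e == k.+1) * dev e).
Proof.
rewrite GnE big_filter [RHS]big_mkcond; apply: eq_bigr => c _.
case: eqP => [dc|_]; last by rewrite [ind false]/ind; case: ifP => _; ring.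
have -> : k = (deg c).-1 by rewrite dc.
by rewrite noblk_pred dc //= leqnSn /=; case: noncut; rewrite /ind /=; ring.
Qed.

Lemma Cn_last k n : Cn k k.+1 n = \rsum_(e <- blocks n) ind (deg e == k.+1).
Proof.
have -> : Cn k k.+1 n = \rsum_(c <- codes n) (ind ((k <= deg c)%nat && noblk c k) * ind (deg c == k.+1)).
  by rewrite -rsum_pre_at; apply: eq_bigr => p _; rewrite ind_andb.
rewrite big_filter [RHS]big_mkcond; apply: eq_bigr => c _.
case: eqP => [dc|_]; last by rewrite [ind false]/ind; case: ifP => _; ring.
have -> : k = (deg c).-1 by rewrite dc.
by rewrite noblk_pred dc //= leqnSn /=; case: noncut; rewrite /ind /=; ring.
Qed.

(** [pre_step] for prefix length [i] and degree [m]: detaching a block of degree k + 1 leaves prefix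
    length i - k and degree m - k - 1, and [dev] is additive over the two parts. *)
Lemma Gn_step i m n : (i < m)%nat -> Gn i.+1 m n = Gn i m n + - sum_f_R0 (fun k =>
  PS_mult (Gn k k.+1) (Cn (i - k) (m - k.+1)) n + PS_mult (Gn (i - k) (m - k.+1)) (Cn k k.+1) n) i.
Proof.
move=> im; pose F (p : code * nat) := ind ((p.2 == i) && (deg p.1 == m)) * dev p.1.
have := perm_big _ (pre_step n) (x := 0) (op := Rplus) (P := predT) (F := F).
rewrite big_cat big_map !big_filter rsum_glued => E.
have E1 : \rsum_(p <- open_prefixes n | (p.2 < deg p.1)%nat) F p = Gn i m n.
  rewrite big_mkcond; apply: eq_bigr => p _; rewrite /F; case: ifP => // h.
  case: eqP => [pi|_] /=; last by rewrite /ind /=; ring.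
  case: eqP => [dm|_]; rewrite /ind /=; last by ring.
  by rewrite pi dm im in h.
have E2 : \rsum_(p <- open_prefixes n | (0 < p.2)%nat) F (p.1, p.2.-1) = Gn i.+1 m n.
  by rewrite big_mkcond; apply: eq_bigr => -[c [|j]] _; rewrite /F /= ?eqSS // /ind /=; ring.
rewrite E1 E2 in E.
have {}E : Gn i m n = Gn i.+1 m n + sum_f_R0 (fun a =>
  \rsum_(e <- blocks a) \rsum_(q <- open_prefixes (n - a)) F (glue_pre e q)) n := E.
rewrite E; suff -> : sum_f_R0 (fun k => PS_mult (Gn k k.+1) (Cn (i - k) (m - k.+1)) n +
     PS_mult (Gn (i - k) (m - k.+1)) (Cn k k.+1) n) i =
   sum_f_R0 (fun a => \rsum_(e <- blocks a) \rsum_(q <- open_prefixes (n - a)) F (glue_pre e q)) n by ring.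
pose g k (e : code) (q : code * nat) := ind (deg e == k.+1) *
  ind ((q.2 == i - k)%nat && (deg q.1 == m - k.+1)%nat) * (dev e + dev q.1).
have Ek k : PS_mult (Gn k k.+1) (Cn (i - k) (m - k.+1)) n + PS_mult (Gn (i - k) (m - k.+1)) (Cn k k.+1) n =
    sum_f_R0 (fun a => \rsum_(e <- blocks a) \rsum_(q <- open_prefixes (n - a)) g k e q) n.
  rewrite [PS_mult (Gn (i - k) _) _ n]PS_mult_comm.
  have -> : PS_mult (Gn k k.+1) (Cn (i - k) (m - k.+1)) n =
      PS_mult (fun a => \rsum_(e <- blocks a) (ind (deg e == k.+1) * dev e)) (Cn (i - k) (m - k.+1)) n.
    by apply: sum_eq => a _; rewrite Gn_last.
  have -> : PS_mult (Cn k k.+1) (Gn (i - k) (m - k.+1)) n =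
      PS_mult (fun a => \rsum_(e <- blocks a) ind (deg e == k.+1)) (Gn (i - k) (m - k.+1)) n.
    by apply: sum_eq => a _; rewrite Cn_last.
  rewrite -!conv_rsum -plus_sum; apply: sum_eq => a _.
  rewrite -rsumD; apply: eq_bigr => e _; rewrite -rsumD; apply: eq_bigr => q _.
  by rewrite /g; ring.
rewrite (sum_eq _ _ i (fun k _ => Ek k)) sum_f_exchange; apply: sum_eq => a _.
rewrite sum_f_R0_rsum big_seq [RHS]big_seq; apply: eq_bigr => e.
rewrite mem_filter mem_codes => /andP[/andP[nc e0] /andP[ve _]].
rewrite sum_f_R0_rsum big_seq [RHS]big_seq; apply: eq_bigr => -[c j].
rewrite mem_pre => /and4P[/= vc _ jd nb].
rewrite /F /glue_pre /= dev_ins // deg_ins //.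
case de : (deg e) e0 => [//|d] _ /=.
set V := ind _ * _.
have gk k : (k <= i)%nat -> g k e (c, j) = V * ind (d == k).
  move=> ki; rewrite /g de eqSS /=; case: eqP => [dk|_]; last by rewrite [ind false]/ind; ring.
  rewrite -dk in ki *; have dm : (d.+1 <= m)%nat by exact: leq_ltn_trans ki im.
  rewrite /V -(eqn_add2r d j) subnK // -(eqn_add2r d.+1 (deg c)) subnK // [ind true]/ind; ring.
rewrite (sum_eq _ (fun k => ind (d == k) * V)) => [|k /leP /gk ->]; last by ring.
rewrite -scal_sum sum_ind; case: (leqP d i) => di; first by rewrite [ind true]/ind; ring.
rewrite [ind false]/ind /V; case: eqP => [E2'|_]; last by rewrite /ind /=; ring.
by rewrite -E2' ltnNge leq_addl in di.
Qed.

(** Induction on the prefix length, which for 0 gives all maps of degree m. The inequality i < m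
    survives every detachment. *)
Lemma small_Gn i m : (i < m)%nat -> small (Gn i m).
Proof.
elim/ltn_ind: i m => -[|i] IH m im.
  apply: small_ext (small_Dn m) => n; rewrite GnE; apply: eq_bigr => c _.
  by rewrite /noblk take0 /= /ind; ring.
apply: small_ext (fun n => Gn_step n (ltnW im)) _.
apply: smallD; first by apply: IH => //; exact: ltnW.
apply/smallN/small_sum => k ki; apply: smallD; apply: small_conv.
- exact: IH.
- exact: Cn_le.
- apply: IH; first by rewrite ltnS leq_subr.
  by rewrite ltn_subRL addSn subnKC.
exact: Cn_le.
Qed.

(** The maps of degree k whose root is not a cut vertex are those with an open prefix of length k -
    1; their deviations are subtracted from all those of degree k. *)
Lemma small_cut k : (0 < k)%nat ->
  small (fun n => \rsum_(c <- codes n) (ind (deg c == k) * (ind (~~ noncut c) * dev c))).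
Proof.
case: k => // k _.
apply: (@small_ext _ (fun n => Dn k.+1 n + - Gn k k.+1 n)) => [n|]; last first.
  by apply: smallD; [exact: small_Dn|apply/smallN/small_Gn].
rewrite Gn_last /Dn big_filter [X in _ + - X]big_mkcond -rsumN -rsumD; apply: eq_bigr => c _.
case: eqP => [dc|_]; last by rewrite [ind false]/ind; case: ifP => _; ring.
by rewrite dc andbT; case: noncut; rewrite /ind /=; ring.
Qed.

Lemma INR_ind (b : bool) : INR b = ind b. Proof. by case: b. Qed.

Lemma c17_bounds : 0 <= c17 <= 1.
Proof.
have s17 : sqrt 17 * sqrt 17 = 17 by apply: sqrt_sqrt; lra.
by have := sqrt_pos 17; rewrite /c17; nra.
Qed.

(** * Second moment and Chebyshev's inequality *)

Definition S1 n := \rsum_(c <- codes n) INR (xc c).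
Definition S2 n := \rsum_(c <- codes n) (INR (xc c) * INR (xc c)).

Lemma mean_xc : exists2 K, 0 <= K & forall n, Rabs (S1 n - c17 * INR n * Mn n) <= K * Mn n.
Proof.
have [K K0 hK] := mean_xo; exists (K + 1) => [|n]; first lra.
have -> : S1 n = Pn 1 n + \rsum_(c <- codes n) ind (~~ noncut c).
  rewrite /Pn -rsumD; apply: eq_bigr => c _; rewrite pow1 -INR_ind /xc plus_INR; ring.
have h := @rsum_Mn n (fun c => ind (~~ noncut c)) (fun c => ind01 _).
have := hK n; move: (\rsum_(c <- _) _) h => B h h2.
have -> : Pn 1 n + B - c17 * INR n * Mn n = (Pn 1 n - c17 * INR n * Mn n) + B by ring.
by apply: Rle_trans (Rabs_triang _ _) _; lra.
Qed.

(** Degrees are cut off at D + 1. Below, X is c n + dev + 1, the 1 being the root vertex itself;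
    above, 1 / deg is at most 1 / (D + 1). *)
Lemma second_moment_pointwise n D c : csize c = n ->
  INR (xc c) * (INR (~~ noncut c) / INR (deg c)) <=
  c17 * INR n * (INR (~~ noncut c) / INR (deg c)) +
  (sum_f_R0 (fun k => / INR k.+1 * (ind (deg c == k.+1) * (ind (~~ noncut c) * (dev c + 1)))) D + INR (xc c) * / INR D.+1).
Proof.
move=> sc; have X0 := pos_INR (xc c); have D0 : 0 < / INR D.+1 by apply: Rinv_0_lt_compat; apply: lt_0_INR; lia.
have XD := Rmult_le_pos _ _ X0 (Rlt_le _ _ D0).
rewrite INR_ind; case nc: (noncut c).
  rewrite (_ : ind (~~ true) = 0) // (sum_eq _ (fun=> 0)); last by move=> k _; ring.
  by rewrite sum_cte /Rdiv; lra.
rewrite (_ : ind (~~ false) = 1) //; have dE : INR (xc c) = c17 * INR n + (dev c + 1).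
  by rewrite /xc nc plus_INR /dev sc /=; ring.
case dc: (deg c) => [|d].
  have cV : c = Vtx by apply/eqP; rewrite -deg0 dc.
  by move: nc; rewrite cV.
have d0 : 0 < / INR d.+1 by apply: Rinv_0_lt_compat; apply: lt_0_INR; lia.
have -> : sum_f_R0 (fun k => / INR k.+1 * (ind (d.+1 == k.+1) * (1 * (dev c + 1)))) D =
    ind (d <= D)%nat * (/ INR d.+1 * (dev c + 1)).
  rewrite -sum_ind [RHS]Rmult_comm scal_sum; apply: sum_eq => k _; rewrite eqSS.
  by case: eqP => [->|_]; rewrite /ind; ring.
case: (leqP d D) => dD; rewrite /ind /Rdiv; first by rewrite {1}dE; lra.
have lt : / INR d.+1 <= / INR D.+1.
  by apply: Rinv_le_contravar; [apply: lt_0_INR; lia|apply: le_INR; lia].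
have := Rmult_le_compat_l _ _ _ X0 lt.
have cn : 0 <= c17 * INR n * (1 * / INR d.+1).
  by have [c0 _] := c17_bounds; apply: Rmult_le_pos; [apply: Rmult_le_pos => //; exact: pos_INR|lra].
lra.
Qed.

(** Rerooting gives 2n times the sum of X / deg over the maps rooted at a cut vertex. With X
    replaced by c n, rerooting in reverse turns this into c n times the first moment; the rest
    consists of finitely many degrees and a tail of order n^2 / D. *)
Lemma second_moment eps : 0 < eps -> exists C, forall n, (0 < n)%nat ->
  S2 n <= (c17 ^ 2 * INR n ^ 2 + eps * INR n ^ 2 + C * INR n) * Mn n.
Proof.
move=> e0; have [K K0 hK] := mean_xc; have [c0 c1] := c17_bounds.
(* The tail contributes about 2 c n^2 / (D + 1), which is kept below half of the allowance, as c <=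
   1. *)
have [D hD] : exists D, 2 * / INR D.+1 <= eps / 2.
  have [D [hD D0]] := archimed_cor1 (eps / 4) ltac:(lra); exists D.
  have : / INR D.+1 <= / INR D by apply: Rinv_le_contravar; [apply: lt_0_INR|apply: le_INR]; lia.
  lra.
pose sm n := sum_f_R0 (fun k => / INR k.+1 * (\rsum_(c <- codes n) (ind (deg c == k.+1) * (ind (~~ noncut c) * dev c)) +
   \rsum_(c <- codes n) (ind (deg c == k.+1) * ind (~~ noncut c)))) D.
have ssm : small sm.
  apply: small_sum => k _; apply: small_scal; apply: smallD; first exact: small_cut.
  by apply: (@small_bounded _ 1) => n; rewrite Rmult_1_l; apply: rsum_Mn => c; rewrite -ind_andb; exact: ind01.
have [C hC] := ssm (eps / 4) ltac:(lra).
exists (c17 * K + 2 * C + 2 * K * / INR D.+1) => n n0.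
have N0 : 0 < INR n by apply: lt_0_INR; lia.
have M0 := Mn_ge0 n; have D0 : 0 < / INR D.+1 by apply: Rinv_0_lt_compat; apply: lt_0_INR; lia.
have R1 : S1 n = INR (2 * n) * \rsum_(c <- codes n) (INR (~~ noncut c) / INR (deg c)).
  have := rerooting (fun=> 1) n0; rewrite rsum_mull Rmult_1_l => E; rewrite /S1 E; congr (_ * _).
  by apply: eq_bigr => c _; ring.
have N2 : INR (2 * n) = 2 * INR n by rewrite mult_INR.
have up : \rsum_(c <- codes n) (INR (xc c) * (INR (~~ noncut c) / INR (deg c))) <=
    c17 * INR n * (\rsum_(c <- codes n) (INR (~~ noncut c) / INR (deg c))) + (sm n + S1 n * / INR D.+1).
  have -> : sm n = \rsum_(c <- codes n) sum_f_R0 (fun k => / INR k.+1 * (ind (deg c == k.+1) * (ind (~~ noncut c) * (dev c + 1)))) D.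
    rewrite -sum_f_R0_rsum; apply: sum_eq => k _; rewrite rsum_mull -rsumD; congr (_ * _).
    by apply: eq_bigr => c _; ring.
  rewrite -rsum_mull /S1 -rsum_mulr -!rsumD big_seq [X in _ <= X]big_seq; apply: rsum_le => c.
  by rewrite mem_codes => /andP[_ /eqP sc]; exact: second_moment_pointwise.
have -> : S2 n = INR (2 * n) * \rsum_(c <- codes n) (INR (xc c) * (INR (~~ noncut c) / INR (deg c))).
  exact: rerooting.
rewrite N2 in R1 *; set R := \rsum_(c <- codes n) (INR (~~ noncut c) / INR (deg c)) in R1 up.
have [_ hS] := proj1 (Rabs_le_between _ _) (hK n).
have hm : sm n <= (eps / 4 * INR n + C) * Mn n by apply: Rle_trans (Rle_abs _) (hC n).
have S1le : S1 n <= (c17 * INR n + K) * Mn n by lra.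
have h1 : 2 * INR n * (c17 * INR n * R + (sm n + S1 n * / INR D.+1)) =
   (c17 * INR n + 2 * INR n * / INR D.+1) * S1 n + 2 * INR n * sm n by rewrite R1; ring.
have h2 := Rmult_le_compat_l (2 * INR n) _ _ ltac:(lra) up; rewrite h1 in h2.
apply: Rle_trans h2 _.
have h3 : (c17 * INR n + 2 * INR n * / INR D.+1) * S1 n <=
    (c17 * INR n + 2 * INR n * / INR D.+1) * ((c17 * INR n + K) * Mn n).
  apply: Rmult_le_compat_l => //; have := Rmult_le_pos _ _ c0 (Rlt_le _ _ N0); have := Rmult_lt_0_compat _ _ N0 D0; lra.
have h4 := Rmult_le_compat_l (2 * INR n) _ _ ltac:(lra) hm.
have h5 : 2 * / INR D.+1 * (c17 * (INR n ^ 2 * Mn n)) <= eps / 2 * (1 * (INR n ^ 2 * Mn n)).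
  have p : 0 <= INR n ^ 2 * Mn n by apply: Rmult_le_pos => //; apply: pow_le; lra.
  apply: Rmult_le_compat => //; [lra|exact: Rmult_le_pos|exact: Rmult_le_compat_r].
lra.
Qed.

(** After expanding the square, the upper bound for [S2] and the lower bound for [S1] leave only the
    error terms. *)
Lemma variance eps : 0 < eps -> exists C, forall n, (0 < n)%nat ->
  \rsum_(c <- codes n) (INR (xc c) - c17 * INR n) ^ 2 <= (eps * INR n ^ 2 + C * INR n) * Mn n.
Proof.
move=> e0; have [C hC] := second_moment e0; have [K K0 hK] := mean_xc; have [c0 c1] := c17_bounds.
exists (C + 2 * c17 * K) => n n0.
have -> : \rsum_(c <- codes n) (INR (xc c) - c17 * INR n) ^ 2 =
    S2 n + (- (2 * c17 * INR n) * S1 n + c17 ^ 2 * INR n ^ 2 * Mn n).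
  rewrite -rsum_codes_const -rsum_mull -!rsumD; apply: eq_bigr => c _; ring.
have [hS _] := proj1 (Rabs_le_between _ _) (hK n); have n1 := pos_INR n.
have h : 2 * c17 * INR n * ((c17 * INR n - K) * Mn n) <= 2 * c17 * INR n * S1 n.
  by apply: Rmult_le_compat_l; [apply: Rmult_le_pos; lra|lra].
have := hC n n0; lra.
Qed.

Lemma prob_dev_le n eps : (0 < n)%nat -> 0 < eps ->
  prob_dev n c17 eps * (eps ^ 2 * INR n ^ 2) * Mn n <= \rsum_(c <- codes n) (INR (xc c) - c17 * INR n) ^ 2.
Proof.
move=> n0 e0; have N0 : 0 < INR n by apply: lt_0_INR; lia.
pose P k : bool := Rgt_dec (Rabs (INR k / INR n - c17)) eps.
have M0 := Mn_gt0 n.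
have -> : prob_dev n c17 eps = INR (count (fun c => P (xc c)) (codes n)) / Mn n.
  by rewrite /prob_dev (card_classes_pred P n0) card_classes.
have -> : INR (count (fun c => P (xc c)) (codes n)) / Mn n * (eps ^ 2 * INR n ^ 2) * Mn n =
    INR (count (fun c => P (xc c)) (codes n)) * (eps ^ 2 * INR n ^ 2) by field; lra.
rewrite -rsum_const big_mkcond; apply: rsum_le => c _; rewrite /P.
case: Rgt_dec => h; last exact: pow2_ge_0.
change (eps ^ 2 * INR n ^ 2 <= (INR (xc c) - c17 * INR n) ^ 2).
have -> : INR (xc c) - c17 * INR n = (INR (xc c) / INR n - c17) * INR n by field; lra.
rewrite Rpow_mult_distr; apply: Rmult_le_compat_r; first by apply: pow_le; lra.
by rewrite -(pow2_abs (_ - _)); apply: pow_incr; lra.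
Qed.

Theorem theorem1 :
  let c := (5 - sqrt 17) / 4 in
  (forall eps delta : R, 0 < eps -> 0 < delta ->
     exists N : nat, forall n : nat, (N <= n)%nat -> (1 <= n)%nat ->
       prob_dev n c eps < delta)
  /\
  (exists K : R, forall n : nat, (1 <= n)%nat ->
     Rabs (expect_cut n - c * INR n) <= K).
Proof.
rewrite -/c17 /=; split.
  move=> eps delta e0 d0; have ed : 0 < eps ^ 2 * delta / 2.
    by apply: Rmult_lt_0_compat; [apply: Rmult_lt_0_compat => //; apply: pow_lt|lra].
  (* The variance is granted half of eps^2 delta n^2; beyond N the linear term C n stays below the
     other half. *)
  have [C hC] := variance ed; have [N hN] := INR_unbounded (Rabs C / (eps ^ 2 * delta / 2)).
  exists N => n Nn n0; have n1 : 0 < INR n by apply: lt_0_INR; lia.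
  have M0 := Mn_gt0 n; have e2 : 0 < eps ^ 2 by apply: pow_lt.
  have h := Rle_trans _ _ _ (prob_dev_le n0 e0) (hC n n0).
  have h2 := Rmult_le_reg_r _ _ _ M0 h.
  have Cn : C < eps ^ 2 * delta / 2 * INR n.
    apply: Rle_lt_trans (Rle_abs _) _.
    have nN : INR N <= INR n by apply: le_INR; lia.
    apply: (Rmult_lt_reg_r (/ (eps ^ 2 * delta / 2))); first exact: Rinv_0_lt_compat.
    have -> : eps ^ 2 * delta / 2 * INR n * / (eps ^ 2 * delta / 2) = INR n by field; lra.
    by apply: Rlt_le_trans nN.
  apply: (Rmult_lt_reg_r (eps ^ 2 * INR n ^ 2)); first by apply: Rmult_lt_0_compat => //; apply: pow_lt.
  by apply: Rle_lt_trans h2 _; have := Rmult_lt_compat_r _ _ _ n1 Cn; lra.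
have [K K0 hK] := mean_xc; exists K => n n0; have M0 := Mn_gt0 n.
have -> : expect_cut n = S1 n / Mn n by rewrite /expect_cut sum_classes // card_classes // INR_sum.
have -> : S1 n / Mn n - c17 * INR n = (S1 n - c17 * INR n * Mn n) * / Mn n by field; lra.
rewrite Rabs_mult [Rabs (/ _)]Rabs_pos_eq; last by apply/Rlt_le/Rinv_0_lt_compat.
apply: (Rmult_le_reg_r (Mn n)) => //; rewrite Rmult_assoc Rinv_l; last by lra.
by rewrite Rmult_1_r.
Qed.
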